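(* For every integer $N \geq 0$, let $D_{N,2}:=\dim_{\mathbb Q}\mathrm{gr}^{\mathcal{L}}_2\mathcal{EZ}^A_N$. Then (i) $D_{N,2}=0$ if $N$ is even, and $D_{N,2}=\left\lfloor \frac N3 \right\rfloor+1$ if $N$ is odd; (ii) every $\mathbb Q$-linear relation between elliptic double zeta values (A-elliptic multiple zeta values $I^A(m,n;\tau)$ of length two) is a consequence of the Fay and shuffle relations, where for $m,n\ge 0$ these are shuffle: $I^A(m,n;\tau)+I^A(n,m;\tau)=I^A(m)I^A(n)$; Fay: $I^A(m,n;\tau)=-\delta_{m,1}\delta_{n,1}3\zeta(2)-(-1)^nI^A(0,m+n;\tau)+\sum_{r=0}^n(-1)^{n-r}\binom{m-1+r}{m-1}I^A(m+r,n-r;\tau)+\sum_{r=0}^m(-1)^{n+r}\binom{n-1+r}{n-1}I^A(n+r,m-r;\tau)$.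
   Context: Fix $\tau$ in the upper half-plane $\mathbb H$, $q=e^{2\pi i\tau}$. Let $\theta_\tau(\xi)=\sum_{n\in\mathbb Z}(-1)^nq^{\frac12(n+\frac12)^2}e^{(n+\frac12)2\pi i\xi}$ and $F_\tau(\xi,\alpha)=\frac{\theta_\tau'(0)\theta_\tau(\xi+\alpha)}{\theta_\tau(\xi)\theta_\tau(\alpha)}$. Write $\xi=s+r\tau$ with $r,s\in\mathbb R$ and define real-analytic one-forms $\omega^{(k)}=f^{(k)}(\xi)\,\mathrm d\xi$ ($k\ge0$) on $E_\tau^\times=\mathbb C/(\mathbb Z+\mathbb Z\tau)\setminus\{0\}$ by $e^{2\pi i r\alpha}F_\tau(\xi,\alpha)\mathrm d\xi=\sum_{k\ge0}\omega^{(k)}\alpha^{k-1}$. For a path $\gamma$ and forms with pullbacks $f_i(t)\mathrm dt$, $\int_\gamma\omega_1\cdots\omega_r=\int_{0<t_1<\dots<t_r<1}f_1(t_1)\cdots f_r(t_r)\,\mathrm dt_1\cdots\mathrm dt_r$. Let $x,y$ be non-commuting variables and $J=\sum_{k\ge0}\omega^{(k)}\mathrm{ad}^k(x)(y)$. For integers $n_1,\dots,n_r\ge0$ the A-elliptic multiple zeta value $I^A(n_1,\dots,n_r;\tau)$ is the coefficient of $\mathrm{ad}^{n_1}(x)(y)\cdots\mathrm{ad}^{n_r}(x)(y)$ in $\lim_{t\to0}(-2\pi i t)^{\mathrm{ad}(x)(y)}\big(1+\sum_{k\ge1}\int_{[t,1-t]}J\cdots J\big)(-2\pi i t)^{-\mathrm{ad}(x)(y)}$,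 the iterated integrals ($k$ factors $J$) taken along the straight path from $t$ to $1-t$ (regularization at the puncture via tangential base points $\mp(2\pi i)^{-1}\partial/\partial\xi$ at the start/end). If $n_1,n_r\ne1$ this is simply $\int_{0<t_1<\dots<t_r<1}f^{(n_1)}(t_1)\cdots f^{(n_r)}(t_r)\,\mathrm dt$. It has length $r$ and weight $n_1+\dots+n_r$; $I^A(n)$ denotes the length-one value (a constant in $\tau$). $\mathcal{EZ}^A_N\subset\mathcal O(\mathbb H)$ is the $\mathbb Q$-span of all $I^A(n_1,\dots,n_r;\tau)$ of weight $N$; $\mathcal L_l\mathcal{EZ}^A_N$ is the span of those of length $\le l$; $\mathrm{gr}^{\mathcal L}_l\mathcal{EZ}^A_N=\mathcal L_l\mathcal{EZ}^A_N/\mathcal L_{l-1}\mathcal{EZ}^A_N$. *)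

(* Defs.v *)
(* MathComp-Analysis; complex numbers are R[i] (mathcomp-real-closed) over an
   abstract realType R.  R[i] carries its topology through the alias R[i]^o. *)
From HB Require Import structures.
From mathcomp Require Import all_boot all_order all_algebra.
From mathcomp Require Import complex.
From mathcomp Require Import all_classical all_reals all_analysis.
Set Implicit Arguments.
Unset Strict Implicit.
Unset Printing Implicit Defensive.
Import Order.TTheory GRing.Theory Num.Theory.
Import numFieldNormedType.Exports.
Local Open Scope classical_set_scope.
Local Open Scope ring_scope.
Local Open Scope complex_scope.

Definition UHP (R : realType) := {tau : R[i] | 0 < complex.Im tau}.

Definition cexp {R : realType} (z : R[i]) : R[i] :=
  (expR (complex.Re z) * cos (complex.Im z))
    +i* (expR (complex.Re z) * sin (complex.Im z)).

(* Principal branch; only used at nonzero arguments. *)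
Definition clog {R : realType} (z : R[i]) : R[i] :=
  xget 0 [set w : R[i] | cexp w = z /\ - pi < complex.Im w <= pi].

Definition two_pi_i (R : realType) : R[i] := 0 +i* (2 * pi).

Definition cseries {R : realType} (u : nat -> R[i]) : R[i] :=
  limn (series (u : nat -> R[i]^o)).

Definition csumZ {R : realType} (u : int -> R[i]) : R[i] :=
  cseries (fun n : nat => u (Posz n)) + cseries (fun n : nat => u (Negz n)).

(* The fractional power of q = exp(2 pi i tau) means exp(2 pi i tau * _). *)
Definition theta {R : realType} (tau xi : R[i]) : R[i] :=
  csumZ (fun n : int =>
    let h : R[i] := n%:~R + 2^-1 in
    (-1) ^ n * cexp (two_pi_i R * tau * (2^-1 * h ^+ 2))
             * cexp (h * two_pi_i R * xi)).

Definition theta'0 {R : realType} (tau : R[i]) : R[i] :=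
  derive1 (theta tau : R[i]^o -> R[i]^o) 0.

Definition kroneckerF {R : realType} (tau xi alpha : R[i]) : R[i] :=
  theta'0 tau * theta tau (xi + alpha) / (theta tau xi * theta tau alpha).

(* The real number r in xi = s + r tau. *)
Definition tau_coord {R : realType} (tau xi : R[i]) : R :=
  complex.Im xi / complex.Im tau.

Definition laurent_expansion {R : realType} (tau xi : R[i])
    (c : nat -> R[i]) : Prop :=
  \forall alpha \near ((0 : R[i]^o)^'),
    series (fun k : nat => c k * alpha ^ (k%:Z - 1) : R[i]^o) @ \oo -->
      (cexp (two_pi_i R * (tau_coord tau xi)%:C * alpha)
         * kroneckerF tau xi alpha : R[i]^o).

(* f^(k)(xi); the sequence of Laurent coefficients is unique when it exists. *)
Definition fker {R : realType} (tau : R[i]) (k : nat) (xi : R[i]) : R[i] :=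
  xget (fun _ : nat => 0 : R[i]) [set c | laurent_expansion tau xi c] k.

Definition cint {R : realType} (a b : R) (g : R -> R[i]) : R[i] :=
  (\int[@lebesgue_measure R]_(t in `]a, b[) complex.Re (g t))
    +i* (\int[@lebesgue_measure R]_(t in `]a, b[) complex.Im (g t)).

(* Integral of g_1(t_1)...g_r(t_r) over a < t_1 < ... < t_r < 1. *)
Fixpoint simplex_int {R : realType} (gs : seq (R -> R[i])) (a : R) : R[i] :=
  if gs is g :: gs' then cint a 1 (fun t => g t * simplex_int gs' t) else 1.

(* Pullback of omega^(k) along u |-> a + u (b - a), as a function of u. *)
Definition pullback {R : realType} (tau a b : R[i]) (k : nat) (u : R) : R[i] :=
  fker tau k (a + u%:C * (b - a)) * (b - a).

Definition iterated_int {R : realType} (tau a b : R[i]) (w : seq nat) : R[i] :=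
  simplex_int [seq pullback tau a b k | k <- w] 0.

(* Formal series in a_k := ad^k(x)(y), k >= 0.  These elements freely generate
   their closed subalgebra of C<<x,y>>, so such a series is the function giving
   the coefficient of a_{n_1} ... a_{n_r} at the word [:: n_1; ...; n_r]. *)
Definition ncseries (R : realType) := seq nat -> R[i].

Definition ncmul {R : realType} (A B : ncseries R) : ncseries R :=
  fun w => \sum_(i < (size w).+1) A (take i w) * B (drop i w).

(* exp (l a_1) *)
Definition ncexp1 {R : realType} (l : R[i]) : ncseries R :=
  fun w => if all (pred1 1%N) w then l ^+ size w / (size w)`!%:R else 0.

(* 1 + \sum_(k >= 1) int_[t, 1-t] J ... J, where J = \sum_k omega^(k) a_k *)
Definition Jseries {R : realType} (tau : R[i]) (t : R) : ncseries R :=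
  fun w => iterated_int tau t%:C (1 - t)%:C w.

Definition Aseries_t {R : realType} (tau : R[i]) (t : R) : ncseries R :=
  let l := clog (- two_pi_i R * t%:C) in
  ncmul (ncmul (ncexp1 l) (Jseries tau t)) (ncexp1 (- l)).

(* I^A(n_1, ..., n_r; tau) *)
Definition IA {R : realType} (w : seq nat) (tau : UHP R) : R[i] :=
  lim ((Aseries_t (val tau) t w : R[i]^o) @[t --> (0 : R)^'+]).

Definition Qspan {R : realType} {T : Type} (S : set (T -> R[i])) :
    set (T -> R[i]) :=
  [set f | exists (n : nat) (c : 'I_n -> rat) (g : 'I_n -> T -> R[i]),
     (forall i, S (g i)) /\ forall x, f x = \sum_(i < n) ratr (c i) * g i x].

(* dim_Q (V / U) = d, for Q-subspaces U of V: the classes of the b_i form a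
   basis of V / U. *)
Definition Qdim_quotient {R : realType} {T : Type} (V U : set (T -> R[i]))
    (d : nat) : Prop :=
  exists b : 'I_d -> T -> R[i],
    [/\ forall i, V (b i),
        forall c : 'I_d -> rat,
          U (fun x => \sum_(i < d) ratr (c i) * b i x) -> forall i, c i = 0
      & forall f, V f -> exists c : 'I_d -> rat,
          U (fun x => f x - \sum_(i < d) ratr (c i) * b i x)].

(* L_l EZ^A_N *)
Definition LEZ (R : realType) (l N : nat) : set (UHP R -> R[i]) :=
  Qspan [set f | exists w : seq nat,
                   [/\ (size w <= l)%N, sumn w = N & f = IA w]].

(* dim_Q gr^L_l EZ^A_N = d, for l >= 1 *)
Definition gr_dim (R : realType) (l N d : nat) : Prop :=
  Qdim_quotient (@LEZ R l N) (@LEZ R l.-1 N) d.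

Definition zeta (R : realType) (k : nat) : R :=
  limn (series (fun n : nat => (n.+1%:R ^+ k)^-1 : R)).

(* A pair (c, rhs) stands for the formal Q-linear relation
   \sum_(m, n) c (m, n) I^A(m, n; tau) = rhs tau. *)
Definition relation2 (R : realType) :=
  ((nat * nat -> rat) * (UHP R -> R[i]))%type.

Definition sym2 (m n : nat) : nat * nat -> rat := fun p => (p == (m, n))%:R.

Definition shuffle_rel (R : realType) (m n : nat) : relation2 R :=
  (fun p => sym2 m n p + sym2 n m p,
   fun tau => IA [:: m] tau * IA [:: n] tau).

(* binom(m - 1 + r, m - 1), the coefficient of X^r in (1 - X)^(-m); for m = 0
   it is 1 if r = 0 and 0 otherwise. *)
Definition fay_binom (m r : nat) : nat := 'C((m + r).-1, r).

(* Sign pitfall: here I^A(1,1) = 0 and I^A(0,2) = I^A(2,0) = -zeta(2), so at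
   m = n = 1 the numerical identity holds with +3 zeta(2).  The constant is kept
   as stated by the theorem; fay_rel 1 1 is not needed to derive any relation
   with right-hand side 0. *)
Definition fay_rel (R : realType) (m n : nat) : relation2 R :=
  (fun p =>
     sym2 m n p
     - (- (-1) ^+ n * sym2 0 (m + n) p
        + \sum_(r < n.+1)
            (-1) ^+ (n - r) * (fay_binom m r)%:R * sym2 (m + r) (n - r) p
        + \sum_(r < m.+1)
            (-1) ^+ (n + r) * (fay_binom n r)%:R * sym2 (n + r) (m - r) p),
   fun=> - (((m == 1%N) && (n == 1%N))%:R * 3 * (zeta R 2)%:C)).

Definition fay_or_shuffle {R : realType} (rho : relation2 R) : Prop :=
  exists m n : nat, rho = shuffle_rel R m n \/ rho = fay_rel R m n.

(* rho is a finite Q-linear combination of Fay and shuffle relations, both in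
   its length-two coefficients and in its right-hand side. *)
Definition fay_shuffle_consequence {R : realType} (rho : relation2 R) : Prop :=
  exists (n : nat) (a : 'I_n -> rat) (g : 'I_n -> relation2 R),
    [/\ forall i, fay_or_shuffle (g i),
        forall p, rho.1 p = \sum_(i < n) a i * (g i).1 p
      & forall tau, rho.2 tau = \sum_(i < n) ratr (a i) * (g i).2 tau].

(* Main.v *)
(** Proof idea.  The Fourier expansion of the Kronecker function on the segment
    (0,1) makes every length-two value computable.  With X = 2 pi i,
    b_k = B_k / k! and E_k = sum_m 1/m sum_s s^k q^(ms), in even weight
    I(m,n) = I(m) I(n) / 2 is a rational multiple of X^(m+n), while in odd weight
    N the value I(m,n) is X^(N-1) times a rational combination, with coefficients
    b_(N-1-k) / k! times [tvec N k m], of the E_k, k even.  The E_k and 1 are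
    linearly independent over C, as the lowest term of the q-expansion shows, and
    b_k is nonzero for even k, so the relations in odd weight are exactly the
    kernel of the rational matrix [Tmx N].  Encoding a weight-N vector as a
    polynomial, the Fay and shuffle relations become functional equations for the
    group of order six generated by x -> 1/x and x -> -1-x; comparing with its
    invariants and alternants gives both the rank N/3 + 1 of [Tmx N] and the fact
    that the Fay and shuffle vectors span its kernel.  Relations mixing different
    weights split into homogeneous ones because 2 pi i is transcendental. *)
Require Import Defs.
From mathcomp Require Import all_boot all_order all_algebra all_fingroup.
Set Implicit Arguments.
Unset Strict Implicit.
Unset Printing Implicit Defensive.
Import Order.TTheory GRing.Theory Num.Theory.
Local Open Scope ring_scope.

(** Two analytic obstacles shape the argument. The kernels are defined through theta, so their
    Fourier expansion needs theta to be nonzero on (0,1) and needs the value of theta'(0). Both come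
    from one identity, theta(z) S(z,w) = c(w) theta(zw) with S symmetric in z and w: it makes c(w)
    theta(w) constant near w = 1, which fixes theta'(0), and it spreads a zero of theta along the
    whole unit circle. The second obstacle is the regularisation when an entry is 1: the divergence
    of the cotangent integral is cancelled by the logarithm of -2 pi i t, leaving a constant
    [kappa]. It occurs only together with E_0, so it moves E_0 by a constant, which is harmless
    because the E_k are independent together with 1. That b_k is nonzero for even k is a 2-adic
    fact: for even k > 0, 2 B_k is a quotient of odd integers. The kernel statement is a squeeze:
    with n = (N+1)/2 and m = floor((N+1)/6), test vectors give the relations rank at least n + m,
    [Tmx] has rank at least n - m, the relation rows lie in its kernel, and the two bounds add up to
    N+1. *)

Module SymmetricIntegers.
From mathcomp Require Import mpoly.

(** * Integrality of symmetric functions of algebraic integers *)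

Section SymmetricIntegrality.
Variables (K : fieldType) (n : nat) (th : 'I_n -> K).

Definition isZ (L : nzRingType) (x : L) := exists z : int, x = z%:~R.

Lemma isZ_add (L : nzRingType) (x y : L) : isZ x -> isZ y -> isZ (x + y).
Proof. by move=> [a ->] [b ->]; exists (a + b); rewrite intrD. Qed.
Lemma isZ_mul (L : nzRingType) (x y : L) : isZ x -> isZ y -> isZ (x * y).
Proof. by move=> [a ->] [b ->]; exists (a * b); rewrite intrM. Qed.
Lemma isZ_int (L : nzRingType) (z : int) : isZ (z%:~R : L). Proof. by exists z. Qed.
Lemma isZ_sum (L : nzRingType) (I : Type) (r : seq I) (P : pred I) (F : I -> L) :
  (forall i, P i -> isZ (F i)) -> isZ (\sum_(i <- r | P i) F i).
Proof.
by move=> h; elim/big_rec: _ => [|i x Pi hx]; [exists 0|apply: isZ_add; [exact: h|]].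
Qed.
Lemma isZ_prod (L : nzRingType) (I : Type) (r : seq I) (P : pred I) (F : I -> L) :
  (forall i, P i -> isZ (F i)) -> isZ (\prod_(i <- r | P i) F i).
Proof.
by move=> h; elim/big_rec: _ => [|i x Pi hx]; [exists 1|apply: isZ_mul; [exact: h|]].
Qed.
Lemma isZ_exp (L : nzRingType) (x : L) k : isZ x -> isZ (x ^+ k).
Proof. by move=> [a ->]; exists (a ^+ k); rewrite rmorphXn. Qed.

Hypothesis thZ : forall i, isZ (\prod_(i < n) ('X - (th i)%:P))`_i.

Let ev : {mpoly int[n]} -> K := mmap intr th.

(** Vieta: up to sign the elementary symmetric functions are the coefficients assumed integral in
    [thZ]. *)
Lemma ev_mesym k : (k <= n)%N -> isZ (ev (mesym n int k)).
Proof.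
move=> le; pose cs := [tuple th i | i < n].
have hk : (k < n.+1)%N by [].
have := mroots_coeff cs (Ordinal hk); rewrite /=.
have -> : \prod_(c <- cs) ('X - c%:P) = \prod_(i < n) ('X - (th i)%:P).
  by rewrite big_tuple; apply: eq_bigr => i _; rewrite tnth_mktuple.
have -> : (mesym n K k).@[tnth cs] = ev (mesym n int k).
  rewrite !mesymE raddf_sum /ev /= [RHS]raddf_sum; apply: eq_bigr => h _.
  rewrite mevalX /= mmapX /mmap1; apply: eq_bigr => i _.
  by rewrite tnth_mktuple.
move=> e; have -> : ev (mesym n int k) = (-1) ^+ k * (\prod_(i < n) ('X - (th i)%:P))`_(n - k).
  by rewrite e signrMK.
by apply: isZ_mul => //; apply: isZ_exp; exists (-1).
Qed.

(** The fundamental theorem of symmetric polynomials, applied over [int], makes [f] an integer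
    polynomial in the elementary symmetric ones. *)
Lemma ev_sym (f : {mpoly int[n]}) : f \is symmetric -> isZ (ev f).
Proof.
move=> /sym_fundamental[t [<- _]].
rewrite comp_mpolyE /ev rmorph_sum; apply: isZ_sum => m _ /=.
rewrite mmapZ; apply: isZ_mul; first exact: isZ_int.
rewrite rmorph_prod; apply: isZ_prod => i _ /=.
by rewrite rmorphXn; apply: isZ_exp; rewrite tnth_mktuple; exact: ev_mesym.
Qed.

Definition subsum (S : {set 'I_n}) : K := \sum_(i in S) th i.
Let xs (S : {set 'I_n}) : {mpoly int[n]} := \sum_(i in S) 'X_i.

Lemma ev_xs S : ev (xs S) = subsum S.
Proof.
rewrite /ev /xs rmorph_sum; apply: eq_bigr => i _ /=.
by rewrite mmapX mmap1U.
Qed.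

Lemma msym_xs (s : {perm 'I_n}) S : msym s (xs S) = xs (s @: S).
Proof.
rewrite /xs raddf_sum /= big_imset /=; last by move=> i j _ _; exact: perm_inj.
by apply: eq_bigr => i _; rewrite /msym mmapX mmap1U.
Qed.

(** A permutation of the variables only permutes the subsets, so an expression running over all
    subsets is symmetric although the individual subset sums need not be. This and the next lemma
    feed the transcendence proof, where subset sums appear as exponents. *)
Lemma isZ_sum_subsum (g : {poly int}) :
  isZ (\sum_(S : {set 'I_n}) (map_poly intr g).[subsum S]).
Proof.
pose f := \sum_(S : {set 'I_n}) \sum_(i < size g) g`_i *: xs S ^+ i.
have -> : \sum_(S : {set 'I_n}) (map_poly intr g).[subsum S] = ev f.
  rewrite /f /ev raddf_sum; apply: eq_bigr => S _.
  rewrite raddf_sum /= horner_poly; apply: eq_bigr => i _.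
  by rewrite mmapZ rmorphXn /= -/ev ev_xs.
apply: ev_sym; apply/issymP => s; rewrite /f raddf_sum /=.
rewrite [RHS](reindex_inj (imset_inj (@perm_inj _ s))) /=.
apply: eq_bigr => S _; rewrite raddf_sum /=; apply: eq_bigr => i _.
by rewrite msymZ rmorphXn /= msym_xs.
Qed.

Lemma isZ_prod_subsum k : isZ (\prod_(S : {set 'I_n}) ('X - (subsum S)%:P))`_k.
Proof.
pose f := \prod_(S : {set 'I_n}) ('X - (xs S)%:P).
have -> : \prod_(S : {set 'I_n}) ('X - (subsum S)%:P) = map_poly ev f.
  rewrite /f rmorph_prod; apply: eq_bigr => S _ /=.
  by rewrite rmorphB /= map_polyX map_polyC /= -/(ev _) ev_xs.
rewrite coef_map; apply: ev_sym; apply/issymP => s.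
suff hf : map_poly (msym s) f = f by rewrite -[in RHS]hf coef_map.
rewrite /f rmorph_prod /= [RHS](reindex_inj (imset_inj (@perm_inj _ s))) /=.
by apply: eq_bigr => S _; rewrite rmorphB /= map_polyX map_polyC /= msym_xs.
Qed.
End SymmetricIntegrality.
End SymmetricIntegers.
Import SymmetricIntegers.

From mathcomp Require Import complex.
From mathcomp Require Import all_classical all_reals all_analysis.
From mathcomp Require Import ring lra zify.
Import Order.TTheory GRing.Theory Num.Theory.
Import numFieldNormedType.Exports.
Local Open Scope classical_set_scope.
Local Open Scope ring_scope.
Local Open Scope complex_scope.

(** * Complex series: absolute convergence, dominated limits, exchange of sums *)

Module ComplexSeries.
Section ComplexNorm.
Context {R : realType}.
Local Notation C := R[i].
Implicit Types (z w : C).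

(** The norm of [R[i]] takes values in [R[i]]; its real part carries the same information and allows
    estimates in the ordered field [R]. *)
Definition nc (z : C) : R := complex.Re `|z|.

Lemma ncE z : `|z| = (nc z)%:C.
Proof. by rewrite /nc normc_def. Qed.
Lemma nc_ge0 z : 0 <= nc z.
Proof. by rewrite /nc normc_def /= sqrtr_ge0. Qed.
Lemma ncM z w : nc (z * w) = nc z * nc w.
Proof. by apply: complexI; rewrite rmorphM -!ncE normrM. Qed.
Lemma ncD z w : nc (z + w) <= nc z + nc w.
Proof. by rewrite -lecR rmorphD -!ncE ler_normD. Qed.
Lemma ncN z : nc (- z) = nc z.
Proof. by rewrite /nc normrN. Qed.
Lemma ncB z w : nc (z - w) <= nc z + nc w.
Proof. by rewrite -(ncN w) ncD. Qed.
Lemma nc_distC z w : nc (z - w) = nc (w - z).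
Proof. by rewrite /nc distrC. Qed.
Lemma nc0 : nc 0 = 0. Proof. by rewrite /nc normr0. Qed.
Lemma nc1 : nc 1 = 1. Proof. by rewrite /nc normr1. Qed.
Lemma ncX z n : nc (z ^+ n) = nc z ^+ n.
Proof. by apply: complexI; rewrite rmorphXn -!ncE normrX. Qed.
Lemma ncV z : nc z^-1 = (nc z)^-1.
Proof. by apply: complexI; rewrite fmorphV -!ncE normfV. Qed.
Lemma nc_div z w : nc (z / w) = nc z / nc w.
Proof. by rewrite ncM ncV. Qed.
Lemma nc_eq0 z : (nc z == 0) = (z == 0).
Proof. by rewrite -(normr_eq0 z) ncE -(inj_eq (@complexI _)). Qed.
Lemma nc_gt0 z : (0 < nc z) = (z != 0).
Proof. by rewrite lt_neqAle nc_ge0 andbT eq_sym nc_eq0. Qed.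
Lemma nc_real (x : R) : nc x%:C = `|x|.
Proof. by rewrite /nc normc_def /= expr0n addr0 sqrtr_sqr. Qed.
Lemma nc_nat n : nc n%:R = n%:R.
Proof. by rewrite /nc normr_nat -(rmorph_nat (real_complex R)). Qed.
Lemma nc_sum (I : Type) (r : seq I) (P : pred I) (u : I -> C) :
  nc (\sum_(i <- r | P i) u i) <= \sum_(i <- r | P i) nc (u i).
Proof.
elim/big_rec2: _ => [|i x y _ le]; first by rewrite nc0.
by apply: le_trans (ncD _ _) _; rewrite lerD2l.
Qed.
Lemma nc_triB z w : nc z - nc w <= nc (z - w).
Proof. by rewrite lerBlDr; have := ncD (z - w) w; rewrite subrK. Qed.
Lemma nc_Re z : `|complex.Re z| <= nc z.
Proof.
rewrite /nc normc_def /= -(ger0_norm (sqrtr_ge0 _)) -ler_sqr ?nnegrE //.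
by rewrite !real_normK ?num_real // sqr_sqrtr ?addr_ge0 ?sqr_ge0 // lerDl sqr_ge0.
Qed.
Lemma nc_Im z : `|complex.Im z| <= nc z.
Proof.
rewrite /nc normc_def /= -(ger0_norm (sqrtr_ge0 _)) -ler_sqr ?nnegrE //.
by rewrite !real_normK ?num_real // sqr_sqrtr ?addr_ge0 ?sqr_ge0 // lerDr sqr_ge0.
Qed.
Lemma nc_ReIm z : nc z <= `|complex.Re z| + `|complex.Im z|.
Proof.
rewrite [in leLHS](complexE z); apply: le_trans (ncD _ _) _.
rewrite ncM !nc_real; have -> : nc 'i%C = 1; last by rewrite mul1r.
by rewrite /nc normc_def /= expr0n /= add0r expr1n sqrtr1.
Qed.

Lemma ReD z w : complex.Re (z + w) = complex.Re z + complex.Re w.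
Proof. by case: z; case: w. Qed.
Lemma ImD z w : complex.Im (z + w) = complex.Im z + complex.Im w.
Proof. by case: z; case: w. Qed.
Lemma ReN z : complex.Re (- z) = - complex.Re z. Proof. by case: z. Qed.
Lemma ImN z : complex.Im (- z) = - complex.Im z. Proof. by case: z. Qed.
Lemma Re_sum (I : Type) (r : seq I) (P : pred I) (u : I -> C) :
  complex.Re (\sum_(i <- r | P i) u i) = \sum_(i <- r | P i) complex.Re (u i).
Proof. by elim/big_rec2: _ => //= i x y _ <-; rewrite ReD. Qed.
Lemma Im_sum (I : Type) (r : seq I) (P : pred I) (u : I -> C) :
  complex.Im (\sum_(i <- r | P i) u i) = \sum_(i <- r | P i) complex.Im (u i).
Proof. by elim/big_rec2: _ => //= i x y _ <-; rewrite ImD. Qed.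
Lemma complex_ext z w : complex.Re z = complex.Re w ->
  complex.Im z = complex.Im w -> z = w.
Proof. by case: z => a b; case: w => c d /= -> ->. Qed.

(** Balls of [R[i]^o] have complex radii, but a positive radius has imaginary part 0, so every limit
    reduces to a real one. *)
Lemma cvgCP (T : Type) (F : set_system T) (FF : Filter F) (u : T -> C) (l : C) :
  ((u x : C^o) @[x --> F] --> (l : C^o)) <-> (nc (u x - l) @[x --> F] --> (0 : R)).
Proof.
split=> [/cvgrPdistC_lt h|/cvgrPdistC_lt h].
  apply/cvgrPdistC_lt => e e0; have := h e%:C.
  rewrite ltcR => /(_ e0); apply: filterS => x.
  by rewrite ncE ltcR subr0 ger0_norm // nc_ge0.
apply/cvgrPdistC_lt => e; rewrite ltcE /= => /andP[/eqP Ie Re0].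
have := h _ Re0; apply: filterS => x; rewrite subr0 ger0_norm ?nc_ge0 // ncE.
by rewrite ltcE /= Ie eqxx.
Qed.

Lemma cvgC_ReIm (T : Type) (F : set_system T) (FF : Filter F) (u : T -> C) (l : C) :
  (complex.Re (u x) @[x --> F] --> complex.Re l) ->
  (complex.Im (u x) @[x --> F] --> complex.Im l) ->
  ((u x : C^o) @[x --> F] --> (l : C^o)).
Proof.
move=> hr hi; apply/cvgCP.
have h : (`|complex.Re (u x) - complex.Re l| + `|complex.Im (u x) - complex.Im l|)
   @[x --> F] --> (0 : R).
  rewrite -[X in _ --> X](addr0 (0 : R)); apply: cvgD.
    rewrite -[X in _ --> X](@normr0 _ R); apply: cvg_norm.
    by rewrite -(subrr (complex.Re l)); apply: cvgB => //; exact: cvg_cst.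
  rewrite -[X in _ --> X](@normr0 _ R); apply: cvg_norm.
  by rewrite -(subrr (complex.Im l)); apply: cvgB => //; exact: cvg_cst.
apply: squeeze_cvgr h; last exact: (cvg_cst (0 : R)).
apply: nearW => x /=; rewrite nc_ge0 /=.
by rewrite -!ReN -!ImN -ReD -ImD nc_ReIm.
Qed.

Lemma cvgC_Re (T : Type) (F : set_system T) (FF : Filter F) (u : T -> C) (l : C) :
  ((u x : C^o) @[x --> F] --> (l : C^o)) -> complex.Re (u x) @[x --> F] --> complex.Re l.
Proof.
move/cvgCP => /cvgrPdistC_lt h; apply/cvgrPdistC_lt => e /h; apply: filterS => x.
by rewrite subr0 ger0_norm ?nc_ge0 //; apply: le_lt_trans; rewrite -ReN -ReD nc_Re.
Qed.

Lemma cvgC_Im (T : Type) (F : set_system T) (FF : Filter F) (u : T -> C) (l : C) :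
  ((u x : C^o) @[x --> F] --> (l : C^o)) -> complex.Im (u x) @[x --> F] --> complex.Im l.
Proof.
move/cvgCP => /cvgrPdistC_lt h; apply/cvgrPdistC_lt => e /h; apply: filterS => x.
by rewrite subr0 ger0_norm ?nc_ge0 //; apply: le_lt_trans; rewrite -ImN -ImD nc_Im.
Qed.

Lemma limC (T : Type) (F : set_system T) (FF : ProperFilter F) (u : T -> C) (l : C) :
  ((u x : C^o) @[x --> F] --> (l : C^o)) -> lim ((u x : C^o) @[x --> F]) = l.
Proof. exact: cvg_lim. Qed.

Lemma cvgC_squeeze (T : Type) (F : set_system T) (FF : Filter F) (f : T -> C) (a : C)
    (h : T -> R) :
  (\forall x \near F, nc (f x - a) <= h x) -> h x @[x --> F] --> (0 : R) ->
  (f x : C^o) @[x --> F] --> (a : C^o).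
Proof.
move=> le h0; apply/cvgCP; apply: squeeze_cvgr h0; last exact: (cvg_cst (0 : R)).
by apply: filterS le => x ->; rewrite nc_ge0.
Qed.

Section Limits.
Variables (T : Type) (F : set_system T) (FF : Filter F) (f g : T -> C) (a b : C).
Hypothesis fa : (f x : C^o) @[x --> F] --> (a : C^o).
Lemma cvgC_norm : nc (f x) @[x --> F] --> nc a.
Proof.
have /cvgCP/cvgrPdistC_lt h := fa; apply/cvgrPdistC_lt => e /h; apply: filterS => x.
rewrite subr0 ger0_norm ?nc_ge0 // => lt; rewrite ltr_norml.
have := nc_triB (f x) a; have := nc_triB a (f x); rewrite nc_distC; lra.
Qed.
Lemma cvgCZ (c : C) : (c * f x : C^o) @[x --> F] --> (c * a : C^o).
Proof.
apply: (cvgC_squeeze FF (h := fun x => nc c * nc (f x - a))).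
  by apply: nearW => x; rewrite -mulrBr ncM.
rewrite -(mulr0 (nc c)); apply: cvgM; first exact: cvg_cst.
by apply/cvgCP.
Qed.
Lemma cvgCN : (- f x : C^o) @[x --> F] --> (- a : C^o).
Proof. by have := @cvgCZ (-1); rewrite mulN1r; under eq_cvg do rewrite mulN1r. Qed.
Lemma cvgCV : a != 0 -> ((f x)^-1 : C^o) @[x --> F] --> (a^-1 : C^o).
Proof.
move=> a0; have na : 0 < nc a by rewrite nc_gt0.
have hn := cvgC_norm.
apply: (cvgC_squeeze FF (h := fun x => nc (f x - a) * (nc (f x) * nc a)^-1)).
  have /cvgrPdistC_lt/(_ _ na) h := hn; apply: filterS h => x hx.
  have fx : f x != 0.
    by rewrite -nc_gt0; move: hx; rewrite ltr_norml => /andP[h1 _]; rewrite ltrBDr addrC subrr in h1.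
  by rewrite -nc_distC -ncM -ncV -ncM le_eqVlt; apply/orP; left; apply/eqP; congr nc;
    field; rewrite fx a0.
rewrite -(mul0r (nc a * nc a)^-1); apply: cvgM; first by apply/cvgCP.
apply: cvgV; first by rewrite mulf_neq0 ?gt_eqF.
by apply: cvgM => //; exact: cvg_cst.
Qed.
Hypothesis gb : (g x : C^o) @[x --> F] --> (b : C^o).
Lemma cvgCD : (f x + g x : C^o) @[x --> F] --> (a + b : C^o).
Proof.
apply: (cvgC_squeeze FF (h := fun x => nc (f x - a) + nc (g x - b))).
  by apply: nearW => x; rewrite opprD addrACA ncD.
by rewrite -(addr0 (0 : R)); apply: cvgD; apply/cvgCP.
Qed.
Lemma cvgCM : (f x * g x : C^o) @[x --> F] --> (a * b : C^o).
Proof.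
apply: (cvgC_squeeze FF (h := fun x => nc (f x) * nc (g x - b) + nc b * nc (f x - a))).
  apply: nearW => x; rewrite -!ncM; apply: le_trans (ncD _ _).
  by rewrite le_eqVlt; apply/orP; left; apply/eqP; congr nc; ring.
rewrite -(addr0 (0 : R)); apply: cvgD.
  by rewrite -(mulr0 (nc a)); apply: cvgM; [exact: cvgC_norm|apply/cvgCP].
by rewrite -(mulr0 (nc b)); apply: cvgM; [exact: cvg_cst|apply/cvgCP].
Qed.
End Limits.

Lemma cvgCB (T : Type) (F : set_system T) (FF : Filter F) (f g : T -> C) (a b : C) :
  (f x : C^o) @[x --> F] --> (a : C^o) -> (g x : C^o) @[x --> F] --> (b : C^o) ->
  (f x - g x : C^o) @[x --> F] --> (a - b : C^o).
Proof. by move=> fa gb; apply: (cvgCD FF fa); exact: cvgCN. Qed.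

Lemma cvgC_cst (T : Type) (F : set_system T) (FF : Filter F) (c : C) :
  (c : C^o) @[x --> F] --> (c : C^o).
Proof. exact: cvg_cst. Qed.

Lemma cvgC_sum (T : Type) (F : set_system T) (FF : Filter F) (I : Type) (r : seq I)
    (f : I -> T -> C) (a : I -> C) :
  (forall i, (f i x : C^o) @[x --> F] --> (a i : C^o)) ->
  (\sum_(i <- r) f i x : C^o) @[x --> F] --> (\sum_(i <- r) a i : C^o).
Proof.
move=> h; elim: r => [|i r IH].
  by rewrite big_nil; under eq_cvg do rewrite big_nil; exact: cvgC_cst.
rewrite big_cons; under eq_cvg do rewrite big_cons.
exact: (cvgCD FF (h i) IH).
Qed.

End ComplexNorm.

Section Summation.
Context {R : realType}.
Local Notation C := R[i].
Implicit Types (u v : nat -> C) (s : nat -> R).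

(** For nonnegative terms, bounded partial sums amount to convergence; keeping only the bound turns
    comparison tests into plain inequalities. *)
Definition rsum s := exists M, forall n, \sum_(i < n) s i <= M.
Definition asum u := rsum (fun n => nc (u n)).

Lemma rsum_le s s' : (forall n, s n <= s' n) -> rsum s' -> rsum s.
Proof. by move=> h [M hM]; exists M => n; apply: le_trans (hM n); apply: ler_sum. Qed.
Lemma rsumD s s' : rsum s -> rsum s' -> rsum (fun n => s n + s' n).
Proof. by move=> [M hM] [N hN]; exists (M + N) => n; rewrite big_split lerD. Qed.
Lemma rsumZ a s : 0 <= a -> rsum s -> rsum (fun n => a * s n).
Proof. by move=> a0 [M hM]; exists (a * M) => n; rewrite -mulr_sumr ler_wpM2l. Qed.
Lemma rsum_shift s : (forall n, 0 <= s n) -> rsum s -> rsum (fun n => s n.+1).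
Proof.
move=> s0 [M hM]; exists M => n; apply: le_trans (hM n.+1).
by rewrite big_ord_recl lerDr s0.
Qed.
Lemma rsum_unshift s : rsum (fun n => s n.+1) -> rsum s.
Proof.
move=> [M hM]; exists (Num.max 0 (s 0%N + M)) => -[|n].
  by rewrite big_ord0 le_max lexx.
by rewrite big_ord_recl le_max lerD2l hM orbT.
Qed.

Lemma asum_le u s : (forall n, nc (u n) <= s n) -> rsum s -> asum u.
Proof. exact: rsum_le. Qed.
Lemma asumD u v : asum u -> asum v -> asum (fun n => u n + v n).
Proof. by move=> hu hv; apply: asum_le (rsumD hu hv) => n; exact: ncD. Qed.
Lemma asumZ a u : asum u -> asum (fun n => a * u n).
Proof. by move=> hu; apply: asum_le (rsumZ (nc_ge0 a) hu) => n; rewrite ncM. Qed.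
Lemma asumN u : asum u -> asum (fun n => - u n).
Proof. by apply: rsum_le => n; rewrite ncN. Qed.
Lemma asum_shift u : asum u -> asum (fun n => u n.+1).
Proof. by apply: (@rsum_shift (fun n => nc (u n))) => n; exact: nc_ge0. Qed.

Lemma rsum_cvg s : (forall n, 0 <= s n) -> rsum s -> cvgn (series s).
Proof.
move=> s0 [M hM]; apply: nondecreasing_is_cvgn.
  by apply/nondecreasing_series => n _ _; exact: s0.
by exists M => _ [n _ <-]; rewrite seriesEord /= hM.
Qed.

Lemma Re_series u n : complex.Re (series (u : nat -> C^o) n) =
  series (fun k => complex.Re (u k)) n.
Proof. by rewrite !seriesEord /= Re_sum. Qed.
Lemma Im_series u n : complex.Im (series (u : nat -> C^o) n) =
  series (fun k => complex.Im (u k)) n.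
Proof. by rewrite !seriesEord /= Im_sum. Qed.

Lemma asum_cvg u : asum u -> series (u : nat -> C^o) @ \oo --> (cseries u : C^o).
Proof.
move=> hu.
have cr : cvgn (series (fun n => complex.Re (u n))).
  apply: normed_cvg; apply: rsum_cvg => [n|]; first exact: normr_ge0.
  by apply: rsum_le hu => n; exact: nc_Re.
have ci : cvgn (series (fun n => complex.Im (u n))).
  apply: normed_cvg; apply: rsum_cvg => [n|]; first exact: normr_ge0.
  by apply: rsum_le hu => n; exact: nc_Im.
set l : C := limn (series (fun n => complex.Re (u n)))
      +i* limn (series (fun n => complex.Im (u n))).
have h : series (u : nat -> C^o) @ \oo --> (l : C^o).
  apply: (@cvgC_ReIm _ _ _ _ (fun n => series (u : nat -> C^o) n : C)) => /=.
    by under eq_cvg do rewrite Re_series.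
  by under eq_cvg do rewrite Im_series.
by rewrite /cseries; rewrite (cvg_lim _ h).
Qed.

Lemma cseriesP u (l : C) : series (u : nat -> C^o) @ \oo --> (l : C^o) -> cseries u = l.
Proof. exact: cvg_lim. Qed.

Lemma cseries_ext u v : u =1 v -> cseries u = cseries v.
Proof. by move=> /funext ->. Qed.

Lemma cseriesD u v : asum u -> asum v ->
  cseries (fun n => u n + v n) = cseries u + cseries v.
Proof.
move=> hu hv; apply: cseriesP.
rewrite (_ : series _ = (series (u : nat -> C^o) \+ series (v : nat -> C^o))).
  by apply: cvgD; apply: asum_cvg.
by apply/funext => n /=; rewrite !seriesEnat /= big_split.
Qed.
Lemma cseriesZ a u : asum u -> cseries (fun n => a * u n) = a * cseries u.
Proof.
move=> hu; apply: cseriesP.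
rewrite (_ : series _ = (fun n => (a : C^o) * series (u : nat -> C^o) n)).
  by apply: cvgM; [exact: cvg_cst|exact: asum_cvg].
by apply/funext => n /=; rewrite !seriesEnat /= mulr_sumr.
Qed.
Lemma cseriesN u : asum u -> cseries (fun n => - u n) = - cseries u.
Proof.
by move=> hu; rewrite -mulN1r -cseriesZ //; apply: cseries_ext => n; rewrite mulN1r.
Qed.
Lemma cseriesB u v : asum u -> asum v ->
  cseries (fun n => u n - v n) = cseries u - cseries v.
Proof. by move=> hu hv; rewrite cseriesD ?cseriesN//; exact: asumN. Qed.

Lemma cseries_sum (I : Type) (r : seq I) (f : I -> nat -> C) :
  (forall i, asum (f i)) ->
  cseries (fun n => \sum_(i <- r) f i n) = \sum_(i <- r) cseries (f i)
  /\ asum (fun n => \sum_(i <- r) f i n).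
Proof.
move=> h; elim: r => [|i r [IH1 IH2]].
  have a0 : asum (fun n => \sum_(i <- [::]) f i n).
    by exists 0 => n; rewrite big1 // => k _; rewrite big_nil nc0.
  split=> //; rewrite big_nil; apply: cseriesP.
  rewrite (_ : series _ = cst 0); first exact: cvg_cst.
  by apply/funext => n; rewrite seriesEord /= big1 // => k _; rewrite big_nil.
have e : (fun n => \sum_(j <- i :: r) f j n) = (fun n => f i n + \sum_(j <- r) f j n).
  by apply/funext => n; rewrite big_cons.
by rewrite e big_cons cseriesD // IH1; split => //; exact: asumD.
Qed.

Lemma cseries_fin u N : (forall n, (N <= n)%N -> u n = 0) ->
  cseries u = \sum_(i < N) u i.
Proof.
move=> h; apply: cseriesP; apply: (@cvg_near_cst _ _ _ _ (\oo : set_system nat) _).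
exists N => // n /= le; rewrite seriesEord /=; apply/eqP.
by rewrite -(subnKC le) big_split_ord /= [X in _ + X]big1 ?addr0 // => i _; rewrite h ?leq_addr.
Qed.

Lemma cseries_shift u : asum u -> cseries u = u 0%N + cseries (fun n => u n.+1).
Proof.
move=> hu; apply: cseriesP; rewrite -cvg_shiftS /=.
rewrite (_ : (fun n => _) = (fun n => (u 0%N : C^o) + series (fun n => u n.+1 : C^o) n)).
  by apply: cvgD; [exact: cvg_cst|exact: asum_cvg (asum_shift hu)].
by apply/funext => n; rewrite !seriesEord /= big_ord_recl.
Qed.

Lemma nc_cseries_le u M : (forall n, \sum_(i < n) nc (u i) <= M) ->
  nc (cseries u) <= M.
Proof.
move=> hM; have hu : asum u by exists M.
have := asum_cvg hu => /cvgCP h.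
apply/ler_addgt0Pr => e e0.
have [n] : exists n, nc (series (u : nat -> C^o) n - cseries u) < e.
  move/cvgrPdistC_lt : h => /(_ e e0)[n _ hn]; exists n.
  by have := hn n (leqnn n); rewrite /= subr0 ger0_norm ?nc_ge0.
move=> hn; rewrite -lerBlDr; apply: le_trans (hM n).
apply: le_trans (nc_sum _ _ _); rewrite lerBlDr.
have := nc_triB (cseries u) (series (u : nat -> C^o) n).
rewrite nc_distC seriesEord /= => h2.
rewrite addrC -lerBlDr; apply: le_trans h2 _.
by move: hn; rewrite seriesEord => /ltW.
Qed.

(** Dominated convergence for series: beyond one index [N] the tails are at most e/3 for all [t]
    near the limit, and the finite head converges term by term. *)
Lemma tannery (T : Type) (F : set_system T) (FF : ProperFilter F)
    (v : T -> nat -> C) (v0 : nat -> C) s :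
  rsum s ->
  (\forall t \near F, forall n, nc (v t n) <= s n) ->
  (forall n, (v t n : C^o) @[t --> F] --> (v0 n : C^o)) ->
  asum v0 /\ ((cseries (v t) : C^o) @[t --> F] --> (cseries v0 : C^o)).
Proof.
move=> rs dom lim.
have [t0 ht0] := filter_ex dom.
have s0 n : 0 <= s n by apply: le_trans (ht0 n); exact: nc_ge0.
have v0s n : nc (v0 n) <= s n.
  apply/ler_addgt0Pr => e e0.
  have /cvgCP/cvgrPdistC_lt/(_ e e0) h := lim n.
  have [t [h1 h2]] := filter_ex (filterI dom h).
  move: h2; rewrite subr0 ger0_norm ?nc_ge0 // => h2.
  have := nc_triB (v0 n) (v t n); rewrite nc_distC => h3.
  by have := h1 n; lra.
have av0 : asum v0 by apply: asum_le rs.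
split=> //; apply/cvgCP/cvgrPdistC_lt => e e0.
have cs := rsum_cvg s0 rs.
have e3 : 0 < e / 3 by lra.
have [N hN] : exists N, forall n, \sum_(i < n) s (N + i)%N <= e / 3.
  have /cvgrPdistC_lt/(_ _ e3)[N _ hN] := cs; exists N => n.
  have := hN N (leqnn N); have inc : nondecreasing_seq (series s).
    by apply/nondecreasing_series => k _ _; exact: s0.
  have := @nondecreasing_cvgn_le _ _ inc cs (N + n)%N.
  rewrite !seriesEord /= big_split_ord /= => h1.
  have := @nondecreasing_cvgn_le _ _ inc cs N; rewrite seriesEord /= => h2.
  by rewrite ler0_norm; [lra | rewrite subr_le0].
have tail (w : nat -> C) : (forall n, nc (w n) <= s n) ->
    nc (cseries w - \sum_(i < N) w i) <= e / 3.
  move=> hw; have aw : asum w by apply: asum_le rs.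
  have : cseries w = \sum_(i < N) w i + cseries (fun n => w (N + n)%N).
    elim: (N) => [|M IH]; first by rewrite big_ord0 add0r.
    rewrite big_ord_recr /= IH -addrA; congr (_ + _).
    have aM : asum (fun n => w (M + n)%N).
      clear IH; elim: (M) => [//|M' IH]; have := asum_shift IH.
      by apply: rsum_le => n; rewrite addnS addSn.
    rewrite (cseries_shift aM) addn0; congr (_ + _).
    by apply: cseries_ext => n; rewrite addnS addSn.
  move=> ->; rewrite addrAC subrr add0r; apply: nc_cseries_le => n.
  by apply: le_trans (hN n); apply: ler_sum.
have fin : (nc (\sum_(i < N) v t i - \sum_(i < N) v0 i)) @[t --> F] --> (0 : R).
  apply/(@cvgCP _ _ _ _ (fun t => \sum_(i < N) v t i)).
  by apply: (cvgC_sum _ (f := fun (i : 'I_N) t => v t i)) => i; exact: lim.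
move/cvgrPdistC_lt : fin => /(_ _ e3) fin.
near=> t.
rewrite subr0 ger0_norm ?nc_ge0 //.
have h1 : nc (cseries (v t) - \sum_(i < N) v t i) <= e / 3.
  by apply: tail; near: t.
have h2 := tail _ v0s.
have h3 : nc (\sum_(i < N) v t i - \sum_(i < N) v0 i) < e / 3.
  by have : `|nc (\sum_(i < N) v t i - \sum_(i < N) v0 i) - 0| < e / 3;
    [near: t | rewrite subr0 ger0_norm ?nc_ge0].
have -> : cseries (v t) - cseries v0 = (cseries (v t) - \sum_(i < N) v t i)
   + ((\sum_(i < N) v t i - \sum_(i < N) v0 i) - (cseries v0 - \sum_(i < N) v0 i)).
  by ring.
have := ncD (cseries (v t) - \sum_(i < N) v t i)
   ((\sum_(i < N) v t i - \sum_(i < N) v0 i) - (cseries v0 - \sum_(i < N) v0 i)).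
have := ncB (\sum_(i < N) v t i - \sum_(i < N) v0 i) (cseries v0 - \sum_(i < N) v0 i).
lra.
Unshelve. all: by end_near.
Qed.

(** Finitely many columns are added first, as series of norms over the rows, so the estimate
    involves only one infinite summation. *)
Lemma exchange_bound (u : nat -> nat -> C) s M :
  (forall m n, \sum_(j < n) nc (u m j) <= s m) -> (forall n, \sum_(i < n) s i <= M) ->
  forall n, \sum_(j < n) nc (cseries (u^~ j)) <= M.
Proof.
move=> hs hM n; have rs : rsum s by exists M.
have le m k : nc (u m k) <= s m.
  by apply: le_trans (hs m k.+1); rewrite big_ord_recr lerDr sumr_ge0 // => i _; exact: nc_ge0.
have a2 k : asum (u^~ k) by apply: asum_le rs => m.
have cu (j : nat) : rsum (fun m => nc (u m j)) by exact: a2.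
pose g (j m : nat) : C := (nc (u m j))%:C.
have ag j : asum (g j) by apply: asum_le (cu j) => m; rewrite nc_real ger0_norm ?nc_ge0.
have gle j : nc (cseries (u^~ j)) <= complex.Re (cseries (g j)).
  have cg := rsum_cvg (fun m => nc_ge0 (u m j)) (cu j).
  have -> : cseries (g j) = (limn (series (fun m => nc (u m j))))%:C.
    apply: cseriesP; apply: (@cvgC_ReIm _ _ _ _ (fun n => series (g j : nat -> C^o) n : C)) => /=.
      by under eq_cvg do rewrite Re_series.
    under eq_cvg do rewrite Im_series seriesEord /= big1 //.
    exact: cvg_cst.
  apply: nc_cseries_le => k.
  have inc : nondecreasing_seq (series (fun m => nc (u m j))).
    by apply/nondecreasing_series => l _ _; exact: nc_ge0.
  by have := @nondecreasing_cvgn_le _ _ inc cg k; rewrite seriesEord.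
apply: le_trans (ler_sum _ (fun (i : 'I_n) _ => gle i)) _.
rewrite -Re_sum -(cseries_sum (index_enum 'I_n) (fun i : 'I_n => ag i)).1.
apply: le_trans (ler_norm _) _; apply: le_trans (nc_Re _) _.
apply: nc_cseries_le => k; apply: le_trans (hM k); apply: ler_sum => i _.
rewrite -rmorph_sum nc_real ger0_norm ?hs //.
by apply: sumr_ge0 => j _; exact: nc_ge0.
Qed.

(** Fubini for double series. The partial sums over [n] of the column sums are series over [m]
    dominated by [s], and [tannery] passes to the limit in [n]. *)
Lemma exchange_cseries (u : nat -> nat -> C) s :
  (forall m n, \sum_(j < n) nc (u m j) <= s m) -> rsum s ->
  [/\ forall m, asum (u m), forall n, asum (u^~ n),
      asum (fun m => cseries (u m)), asum (fun n => cseries (u^~ n)) &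
      cseries (fun m => cseries (u m)) = cseries (fun n => cseries (u^~ n))].
Proof.
move=> hs rs.
have a1 m : asum (u m) by exists (s m) => n.
have le m n : nc (u m n) <= s m.
  by apply: le_trans (hs m n.+1); rewrite big_ord_recr lerDr sumr_ge0 // => i _; exact: nc_ge0.
have a2 n : asum (u^~ n) by apply: asum_le rs => m.
have a3 : asum (fun m => cseries (u m)).
  by apply: asum_le rs => m; apply: nc_cseries_le.
have a4 : asum (fun n => cseries (u^~ n)).
  by have [M hM] := rs; exists M => n; exact: (exchange_bound hs hM).
split=> //.
have [||_ h] := @tannery nat \oo _ (fun n m => \sum_(j < n) u m j) (fun m => cseries (u m)) s rs.
- by apply: nearW => n m; apply: le_trans (nc_sum _ _ _) _; exact: hs.
- by move=> m; have := asum_cvg (a1 m); under eq_cvg do rewrite seriesEord.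
apply/esym/cseriesP; rewrite (_ : series _ = (fun n => cseries (fun m => \sum_(j < n) u m j))) //.
apply/funext => n; rewrite seriesEord /=.
by rewrite (cseries_sum (index_enum 'I_n) (fun i : 'I_n => a2 i)).1.
Qed.

(** Fubini for the sheared array [w]: its rows sum to [u i * cseries v] and its columns are the
    finite convolutions. *)
Lemma cauchy_product u v : asum u -> asum v ->
  asum (fun n => \sum_(i < n.+1) u i * v (n - i)%N) /\
  cseries u * cseries v = cseries (fun n => \sum_(i < n.+1) u i * v (n - i)%N).
Proof.
move=> hu [M hM].
have M0 : 0 <= M by have := hM 0%N; rewrite big_ord0.
pose w (i n : nat) : C := if (i <= n)%N then u i * v (n - i)%N else 0.
have hv : asum v by exists M.
have ew i n : \sum_(j < n) nc (w i j) <= nc (u i) * M.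
  case: (leqP i n) => le; last first.
    rewrite big1 ?mulr_ge0 ?nc_ge0 // => j _; rewrite /w leqNgt.
    by rewrite (ltn_trans (ltn_ord j) le) nc0.
  have -> : \sum_(j < n) nc (w i j) = \sum_(j < i + (n - i)) nc (w i j).
    by rewrite subnKC.
  rewrite big_split_ord /= [X in X + _]big1 ?add0r; last first.
    by move=> j _; rewrite /w leqNgt ltn_ord nc0.
  apply: le_trans (_ : nc (u i) * (\sum_(j < n - i) nc (v j)) <= _); last first.
    by rewrite ler_wpM2l ?nc_ge0.
  rewrite mulr_sumr; apply: ler_sum => j _.
  by rewrite /w leq_addr addKn ncM.
have rs : rsum (fun i => nc (u i) * M).
  by under [X in rsum X]funext do rewrite mulrC; apply: rsumZ.
have [a1 a2 a3 a4 e] := exchange_cseries ew rs.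
have eq1 i : cseries (w i) = u i * cseries v.
  rewrite -cseriesZ //.
  have : forall k, cseries (w i) = cseries (fun n => w i (k + n)%N) + \sum_(j < k) w i j.
    elim=> [|k IH]; first by rewrite big_ord0 addr0.
    rewrite IH big_ord_recr /= cseries_shift; last first.
      clear IH; elim: k => [|k IH]; first exact: a1.
      by have := asum_shift IH; apply: rsum_le => n; rewrite addnS addSn.
    rewrite addn0 (_ : cseries (fun n => w i (k + n.+1)%N) = cseries (fun n => w i (k.+1 + n)%N)).
      by ring.
    by apply: cseries_ext => n; rewrite addSn addnS.
  move/(_ i) => ->; rewrite [X in _ + X]big1 ?addr0; last first.
    by move=> j _; rewrite /w leqNgt ltn_ord.
  by apply: cseries_ext => n; rewrite /w leq_addr addKn.
have eq2 n : cseries (w^~ n) = \sum_(i < n.+1) u i * v (n - i)%N.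
  rewrite (@cseries_fin _ n.+1) => [|k]; last by rewrite /w => nk; rewrite leqNgt nk.
  by apply: eq_bigr => i _; rewrite /w leq_ord.
split.
  by under [X in asum X]funext do rewrite -eq2.
rewrite -(cseries_ext eq2) -e (cseries_ext eq1).
rewrite mulrC -cseriesZ //.
by apply: cseries_ext => i; rewrite mulrC.
Qed.

End Summation.

Section Geometric.
Context {R : realType}.
Local Notation C := R[i].

Lemma rsum_geo (x : R) : 0 <= x < 1 -> rsum (fun n => x ^+ n).
Proof.
move=> /andP[x0 x1]; exists (1 - x)^-1 => n.
have d : 0 < 1 - x by lra.
rewrite -[leRHS]mul1r ler_pdivlMr //.
have e : (\sum_(i < n) x ^+ i) * (1 - x) = 1 - x ^+ n.
  elim: n => [|n IH]; first by rewrite big_ord0 mul0r expr0 subrr.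
  by rewrite big_ord_recr /= mulrDl IH exprS; ring.
by rewrite e lerBlDr lerDl exprn_ge0.
Qed.

Lemma asum_geo (z : C) : nc z < 1 -> asum (fun n => z ^+ n).
Proof.
move=> z1; apply: asum_le (rsum_geo (x := nc z) _) => [n|]; first by rewrite ncX.
by rewrite nc_ge0.
Qed.

Lemma cseries_geo (z : C) : nc z < 1 -> cseries (fun n => z ^+ n) = (1 - z)^-1.
Proof.
move=> z1; have a := asum_geo z1.
have zn : 1 - z != 0.
  by rewrite subr_eq0; apply: contraTneq z1 => <-; rewrite nc1 ltxx.
apply: (mulfI zn); rewrite divff // mulrBl mul1r -cseriesZ //.
rewrite {1}(cseries_shift a) expr0.
under [X in _ - X]cseries_ext do rewrite -exprS.
by rewrite addrK.
Qed.

(** With x <= z^(k+1) and z < 1, the term n^k x^n is at most (n z^n)^k z^n; the first factor is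
    bounded because n z^n <= 1/(1-z). *)
Lemma rsum_polygeo (k : nat) (x : R) : 0 <= x < 1 -> rsum (fun n => n%:R ^+ k * x ^+ n).
Proof.
move=> /andP[x0 x1].
have [z z0 zz] : exists2 z, 0 <= z < 1 & x <= z ^+ k.+1.
  (* Bernoulli's inequality (1-d)^(k+1) >= 1 - (k+1) d = x dictates this choice of [d]. *)
  pose d : R := (1 - x) / k.+1%:R.
  have kp : (0 : R) < k.+1%:R by rewrite ltr0n.
  have d0 : 0 < d by rewrite divr_gt0 // subr_gt0.
  have k1 : (1 : R) <= k.+1%:R by rewrite ler1n.
  have d1 : d <= 1 by rewrite ler_pdivrMr // mul1r; lra.
  exists (1 - d); first by lra.
  have : 1 - k.+1%:R * d <= (1 - d) ^+ k.+1.
    elim: (k.+1) => [|n IH]; first by rewrite mul0r subr0 expr0.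
    rewrite exprS -natr1 mulrDl mul1r.
    apply: le_trans (ler_wpM2l _ IH); last by lra.
    have n0 : 0 <= n%:R * d * d by apply: mulr_ge0; [apply: mulr_ge0; [exact: ler0n|exact: ltW]|exact: ltW].
    by rewrite (_ : (1 - d) * _ = 1 - (n%:R * d + d) + n%:R * d * d); [lra|ring].
  rewrite /d mulrC divfK ?gt_eqF //; lra.
have z1 : 0 < 1 - z by lra.
have bound n : n%:R * z ^+ n <= (1 - z)^-1.
  rewrite -[leRHS]mul1r ler_pdivlMr //.
  suff h : n%:R * z ^+ n * (1 - z) <= 1 - z ^+ n.
    by apply: le_trans h _; rewrite lerBlDr lerDl exprn_ge0; lra.
  elim: n => [|n IH]; first by rewrite !mul0r expr0 subrr.
  have zn : 0 <= z ^+ n <= 1 by rewrite exprn_ge0 ?exprn_ile1; lra.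
  have : z ^+ n.+1 <= z ^+ n by rewrite exprS ler_piMl; lra.
  have -> : n.+1%:R * z ^+ n.+1 * (1 - z) = z * (n%:R * z ^+ n * (1 - z)) + z ^+ n.+1 * (1 - z).
    by rewrite -natr1 exprS; ring.
  have : z * (n%:R * z ^+ n * (1 - z)) <= z * (1 - z ^+ n) by rewrite ler_wpM2l; lra.
  rewrite exprS; nra.
apply: rsum_le (rsumZ (a := (1 - z)^-1 ^+ k) _ (rsum_geo z0)) => [n|]; last first.
  by rewrite exprn_ge0 // invr_ge0 ltW.
apply: le_trans (_ : n%:R ^+ k * (z ^+ k.+1) ^+ n <= _).
  by rewrite ler_wpM2l ?exprn_ge0 // lerXn2r // ?nnegrE ?exprn_ge0; lra.
rewrite -exprM mulnC exprM exprSr mulrA -exprMn ler_wpM2r ?exprn_ge0 //; first by lra.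
by rewrite lerXn2r // nnegrE ?mulr_ge0 ?exprn_ge0 ?invr_ge0 ?ler0n //; lra.
Qed.

Lemma exp_partial_le (x : R) n : 0 <= x -> \sum_(i < n) x ^+ i / i`!%:R <= expR x.
Proof.
move=> x0; rewrite /expR.
have cv := is_cvg_series_exp_coeff x.
have inc : nondecreasing_seq (series (exp_coeff x)).
  by apply/nondecreasing_series => l _ _; exact: exp_coeff_ge0.
by have := @nondecreasing_cvgn_le _ _ inc cv n; rewrite seriesEord.
Qed.

Lemma rsum_exp (x : R) : 0 <= x -> rsum (fun n => x ^+ n / n`!%:R).
Proof. by move=> x0; exists (expR x) => n; exact: exp_partial_le. Qed.

Lemma asum_cexp (z : C) : asum (fun n => z ^+ n / n`!%:R).
Proof.
by apply: asum_le (rsum_exp (nc_ge0 z)) => n; rewrite nc_div ncX nc_nat.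
Qed.

Lemma cexp0 : cexp (0 : C) = 1.
Proof. by rewrite /cexp /= expR0 cos0 sin0 mulr1 mulr0. Qed.

Lemma cexpD (z w : C) : cexp (z + w) = cexp z * cexp w.
Proof.
case: z => a b; case: w => c d; rewrite /cexp /= expRD cosD sinD.
by apply: complex_ext => /=; ring.
Qed.

Lemma cexpN (z : C) : cexp (- z) * cexp z = 1.
Proof. by rewrite -cexpD addNr cexp0. Qed.

Lemma cexp_neq0 (z : C) : cexp z != 0.
Proof.
by apply/eqP => h; have := cexpN z; rewrite h mulr0 => /eqP; rewrite eq_sym oner_eq0.
Qed.

Lemma cexpNV (z : C) : cexp (- z) = (cexp z)^-1.
Proof. by apply: (mulIf (cexp_neq0 z)); rewrite cexpN mulVf ?cexp_neq0. Qed.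

Lemma cexpMn (z : C) n : cexp (z *+ n) = cexp z ^+ n.
Proof. by elim: n => [|n IH]; rewrite ?mulr0n ?cexp0 // mulrS cexpD IH exprS. Qed.

Lemma cexpMz (z : C) (n : int) : cexp (z *~ n) = cexp z ^ n.
Proof.
by case: n => n; rewrite ?NegzE ?mulrNz ?cexpNV -pmulrn cexpMn // -exprnN.
Qed.

Lemma nc_cexp (z : C) : nc (cexp z) = expR (complex.Re z).
Proof.
rewrite /nc normc_def /= !exprMn -mulrDr cos2Dsin2 mulr1 sqrtr_sqr ger0_norm //.
Qed.

Lemma cexp_two_pi_i : cexp (two_pi_i R) = 1.
Proof.
rewrite /cexp /two_pi_i /= expR0 !mul1r; have -> : 2 * pi = pi *+ 2 :> R by rewrite mulr_natl.
by rewrite cos2pi sin2pi.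
Qed.

Lemma cexp_real_series (x : R) : cexp x%:C = cseries (fun n => x%:C ^+ n / n`!%:R).
Proof.
rewrite /cexp /= cos0 sin0 mulr1 mulr0; apply/esym/cseriesP.
apply: (@cvgC_ReIm _ _ _ _ (fun n => series ((fun n => x%:C ^+ n / n`!%:R) : nat -> C^o) n : C)) => /=.
  under eq_cvg do rewrite Re_series.
  have := is_cvg_series_exp_coeff x.
  rewrite (_ : (fun k => complex.Re _) = exp_coeff x) //; apply/funext => n.
  by rewrite -rmorphXn -(rmorph_nat (real_complex R)) -fmorphV -rmorphM.
rewrite (_ : (fun k => _) = cst 0); first exact: cvg_cst.
apply/funext => n; rewrite Im_series seriesEord /= big1 // => i _.
by rewrite -rmorphXn -(rmorph_nat (real_complex R)) -fmorphV -rmorphM.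
Qed.

Lemma cexp_imag_series (y : R) : cexp (0 +i* y) = cseries (fun n => (0 +i* y) ^+ n / n`!%:R).
Proof.
rewrite /cexp /= expR0 !mul1r; apply/esym/cseriesP.
have ey n : (0 +i* y) ^+ n = if odd n then 0 +i* ((-1) ^+ n./2 * y ^+ n)
     else ((-1) ^+ n./2 * y ^+ n) +i* 0 :> C.
  elim: n => [|n IH]; first by rewrite /= !expr0 mulr1.
  rewrite exprS IH /= uphalf_half; case: (odd n) => /=.
    by apply: complex_ext; rewrite add1n /= ?[_ ^+ _.+1]exprS ?[(-1) ^+ _.+1]exprS; ring.
  by apply: complex_ext; rewrite add0n /= ?[_ ^+ _.+1]exprS; ring.
have nV n : (n`!%:R : C)^-1 = (n`!%:R^-1)%:C.
  by rewrite fmorphV rmorph_nat.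
apply: (@cvgC_ReIm _ _ _ _ (fun n => series ((fun n => (0 +i* y) ^+ n / n`!%:R) : nat -> C^o) n : C)) => /=.
  under eq_cvg do rewrite Re_series.
  have := (@is_cvg_series_cos_coeff R y).
  suff -> : (fun k => complex.Re ((0 +i* y) ^+ k / k`!%:R)) = cos_coeff y.
    by rewrite unlock.
  apply/funext => n; rewrite ey nV /cos_coeff /=; case: (odd n) => /=; first by rewrite ?(mul0r,mulr0,subr0,oppr0,addr0,mul1r).
  by rewrite ?(mul0r,mulr0,subr0,oppr0,addr0,mul1r).
under eq_cvg do rewrite Im_series.
have := (@is_cvg_series_sin_coeff R y).
suff -> : (fun k => complex.Im ((0 +i* y) ^+ k / k`!%:R)) = sin_coeff y.
  by rewrite unlock.
apply/funext => n; rewrite ey nV /sin_coeff /=; case: (boolP (odd n)) => on /=; last by rewrite ?(mul0r,mulr0,addr0).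
rewrite ?(mul0r,mulr0,add0r,addr0,mul1r); case: n on => //= n on.
by rewrite uphalf_half (negbTE on) add0n.
Qed.

Lemma cexp_series (z : C) : cexp z = cseries (fun n => z ^+ n / n`!%:R).
Proof.
have -> : z = (complex.Re z)%:C + (0 +i* complex.Im z).
  by case: z => a b; apply: complex_ext; rewrite /= ?addr0 ?add0r.
rewrite cexpD cexp_real_series cexp_imag_series.
rewrite (cauchy_product (asum_cexp _) (asum_cexp _)).2.
apply: cseries_ext => n; rewrite addrC exprDn mulr_suml; apply: eq_bigr => i _.
have f0 m : m`!%:R != 0 :> C by rewrite pnatr_eq0 -lt0n fact_gt0.
have le : (i <= n)%N by rewrite -ltnS.
have -> : n`!%:R = 'C(n, i)%:R * (i`!%:R * (n - i)`!%:R) :> C.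
  by rewrite -!natrM bin_fact.
by rewrite -mulr_natr; field; rewrite !f0 pnatr_eq0 -lt0n bin_gt0 le.
Qed.

End Geometric.
End ComplexSeries.
Import ComplexSeries.

(** * The theta series and Kronecker's bilateral sum *)

Module ThetaSeries.
Section BilateralSums.
Context {R : realType}.
Local Notation C := R[i].
Implicit Types (u v : int -> C).

Definition zasum u := asum (fun n : nat => u (Posz n)) /\ asum (fun n : nat => u (Negz n)).

Lemma zasum_le u (s : int -> R) : (forall n, nc (u n) <= s n) ->
  rsum (fun n : nat => s (Posz n)) -> rsum (fun n : nat => s (Negz n)) -> zasum u.
Proof. by move=> h s1 s2; split; [apply: asum_le s1|apply: asum_le s2]. Qed.
Lemma zsum_ext u v : u =1 v -> csumZ u = csumZ v.
Proof. by move=> /funext ->. Qed.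
Lemma zasumD u v : zasum u -> zasum v -> zasum (fun n => u n + v n).
Proof. by move=> [? ?] [? ?]; split; apply: asumD. Qed.
Lemma zasumZ a u : zasum u -> zasum (fun n => a * u n).
Proof. by move=> [? ?]; split; apply: asumZ. Qed.
Lemma zasumN u : zasum u -> zasum (fun n => - u n).
Proof. by move=> [h1 h2]; split; [exact: (asumN h1)|exact: (asumN h2)]. Qed.
Lemma zsumD u v : zasum u -> zasum v -> csumZ (fun n => u n + v n) = csumZ u + csumZ v.
Proof. by move=> [? ?] [? ?]; rewrite /csumZ !cseriesD // addrACA. Qed.
Lemma zsumZ a u : zasum u -> csumZ (fun n => a * u n) = a * csumZ u.
Proof. by move=> [? ?]; rewrite /csumZ !cseriesZ // mulrDr. Qed.
Lemma zsumN u : zasum u -> csumZ (fun n => - u n) = - csumZ u.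
Proof. by move=> h; rewrite -mulN1r -zsumZ //; apply: zsum_ext => n; rewrite mulN1r. Qed.
Lemma zsumB u v : zasum u -> zasum v -> csumZ (fun n => u n - v n) = csumZ u - csumZ v.
Proof. by move=> hu hv; rewrite zsumD ?zsumN//; exact: zasumN. Qed.

Lemma csumZE u : csumZ u = cseries (fun n => u (Posz n)) + cseries (fun n => u (Negz n)).
Proof. by []. Qed.

Lemma zasum_ext u v : u =1 v -> zasum u -> zasum v.
Proof. by move=> /funext ->. Qed.

Lemma asum_unshift (f : nat -> C) : asum (fun n => f n.+1) -> asum f.
Proof. exact: (@rsum_unshift R (fun n => nc (f n))). Qed.

Lemma NegzS n : Negz n.+1 + 1 = Negz n :> int.
Proof. by rewrite !NegzE -[n.+2]addn1 PoszD opprD subrK. Qed.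

Lemma zshiftS u : zasum u -> zasum (fun n => u (n + 1)) /\ csumZ (fun n => u (n + 1)) = csumZ u.
Proof.
move=> [h1 h2].
have e1 n : u (Posz n + 1) = u (Posz n.+1) by rewrite -PoszD addn1.
have e2 n : u (Negz n.+1 + 1) = u (Negz n) by rewrite NegzS.
have a1 : asum (fun n => u (Posz n + 1)).
  by rewrite (_ : (fun n => _) = (fun n => u (Posz n.+1))); [exact: asum_shift h1|exact/funext].
have a2 : asum (fun n => u (Negz n + 1)).
  apply: asum_unshift.
  by rewrite (_ : (fun n => _) = (fun n => u (Negz n))) //; exact/funext.
split=> //; rewrite /csumZ (cseries_shift h1) (cseries_shift a2).
by rewrite (cseries_ext e1) (cseries_ext e2) -!addrA addrCA.
Qed.

Lemma zshift u (k : int) : zasum u ->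
  zasum (fun n => u (n + k)) /\ csumZ (fun n => u (n + k)) = csumZ u.
Proof.
move=> hu.
have pos (v : int -> C) (m : nat) : zasum v -> zasum (fun n => v (n + m%:Z)) /\
    csumZ (fun n => v (n + m%:Z)) = csumZ v.
  move=> hv; elim: m => [|m [IH1 IH2]].
    by split; [apply: zasum_ext hv|apply: zsum_ext] => n; rewrite addr0.
  have [s1 s2] := zshiftS IH1; rewrite -IH2 -s2; split.
    by apply: zasum_ext s1 => n /=; rewrite -addrA -PoszD addnC addn1.
  by apply: zsum_ext => n /=; rewrite -addrA -PoszD addnC addn1.
have zs1 (v : int -> C) : zasum (fun n => v (n + 1)) -> zasum v.
  move=> [h1 h2]; split.
    by apply: asum_unshift; apply: rsum_le h1 => n; rewrite -PoszD addn1.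
  by have := asum_shift h2; apply: rsum_le => n; rewrite NegzS.
have zsm (m : nat) (v : int -> C) : zasum (fun n => v (n + m%:Z)) -> zasum v.
  elim: m v => [|m IH] v h; first by apply: zasum_ext h => n; rewrite addr0.
  apply: IH; apply: zs1; apply: zasum_ext h => n /=.
  by rewrite -addrA -PoszD addnC addn1.
case: k => [m|m]; first exact: pos.
have e n : u (n + m.+1%:Z + Negz m) = u n by rewrite NegzE addrK.
have hv : zasum (fun n => u (n + Negz m)).
  by apply: (zsm m.+1); apply: zasum_ext hu => n; rewrite e.
split=> //; rewrite -(pos _ m.+1 hv).2.
by apply: zsum_ext => n; rewrite e.
Qed.

(** A bilateral double sum splits into four quadrants, each handled by [exchange_cseries] with a
    product majorant. *)
Lemma zexchange (u : int -> int -> C) (s s' : int -> R) :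
  (forall m n, nc (u m n) <= s m * s' n) -> (forall n, 0 <= s n) -> (forall n, 0 <= s' n) ->
  rsum (fun n : nat => s (Posz n)) -> rsum (fun n : nat => s (Negz n)) ->
  rsum (fun n : nat => s' (Posz n)) -> rsum (fun n : nat => s' (Negz n)) ->
  csumZ (fun m => csumZ (u m)) = csumZ (fun n => csumZ (u^~ n)).
Proof.
move=> h s0 s'0 s1 s2 s'1 s'2.
have ex (f g : nat -> int) : rsum (fun n => s (f n)) -> rsum (fun n => s' (g n)) ->
    [/\ forall m, asum (fun n => u (f m) (g n)), forall n, asum (fun m => u (f m) (g n)),
      asum (fun m => cseries (fun n => u (f m) (g n))),
      asum (fun n => cseries (fun m => u (f m) (g n))) &
      cseries (fun m => cseries (fun n => u (f m) (g n))) =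
      cseries (fun n => cseries (fun m => u (f m) (g n)))].
  move=> hf [M hM]; have M0 : 0 <= M by have := hM 0%N; rewrite big_ord0.
  apply: (@exchange_cseries _ (fun m n => u (f m) (g n)) (fun m => M * s (f m))).
    move=> m n; apply: le_trans (_ : s (f m) * (\sum_(j < n) s' (g j)) <= _); last first.
      by rewrite mulrC ler_wpM2r.
    by rewrite mulr_sumr; apply: ler_sum => i _.
  exact: rsumZ.
have [a1 a2 a3 a4 e1] := ex _ _ s1 s'1.
have [b1 b2 b3 b4 e2] := ex _ _ s1 s'2.
have [c1 c2 c3 c4 e3] := ex _ _ s2 s'1.
have [d1 d2 d3 d4 e4] := ex _ _ s2 s'2.
by rewrite /csumZ !cseriesD // e1 e2 e3 e4 addrACA.
Qed.

End BilateralSums.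

Section Theta.
Context {R : realType}.
Local Notation C := R[i].

Lemma nc_exprz (z : C) (n : int) : nc (z ^ n) = nc z ^ n.
Proof. by case: n => n; rewrite ?NegzE -?exprnN -?exprnP ?ncV ncX. Qed.

Lemma rsum_ratio (s : nat -> R) (n0 : nat) :
  (forall n, 0 <= s n) -> (forall n, (n0 <= n)%N -> s n.+1 <= s n / 2) -> rsum s.
Proof.
move=> s0 h.
have : rsum (fun n => s (n0 + n)%N).
  have g : rsum (fun n => s n0 * (2^-1 : R) ^+ n).
    by apply: rsumZ => //; apply: rsum_geo; lra.
  apply: rsum_le g => n; elim: n => [|n IH]; first by rewrite addn0 expr0 mulr1.
  rewrite addnS; apply: le_trans (h _ _) _; first by rewrite leq_addr.
  by rewrite exprSr mulrA ler_pM2r ?invr_gt0.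
elim: n0 {h} => [//|n0 IH] h; apply: IH; apply: rsum_unshift.
by apply: rsum_le h => n; rewrite addSn addnS.
Qed.

Lemma expr_small (x r : R) : 0 <= x < 1 -> 0 <= r -> exists n0, forall n, (n0 <= n)%N -> r * x ^+ n <= 2^-1.
Proof.
move=> /andP[x0 x1] r0.
have := @cvg_expr R x; rewrite ger0_norm // => /(_ x1) /cvgrPdistC_lt.
have e0 : 0 < (2 * (r + 1))^-1 by rewrite invr_gt0; lra.
move=> /(_ _ e0)[n0 _ hn]; exists n0 => n le; have := hn n le.
rewrite /= subr0 ger0_norm ?exprn_ge0 // => lt.
apply: le_trans (_ : (r + 1) * x ^+ n <= _).
  by rewrite ler_wpM2r ?exprn_ge0 // lerDl.
have r1 : 0 < r + 1 by lra.
have : (r + 1) * x ^+ n <= (r + 1) * (2 * (r + 1))^-1 by rewrite ler_pM2l // ltW.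
by move=> /le_trans -> //; rewrite invfM mulrCA divff ?mulr1 ?gt_eqF.
Qed.

Lemma rsum_theta (x r : R) : 0 <= x < 1 -> 0 <= r -> rsum (fun n => x ^+ 'C(n.+1, 2) * r ^+ n).
Proof.
move=> x01 r0; have [n0 hn] := expr_small x01 r0; have /andP[x0 x1] := x01.
apply: (@rsum_ratio _ n0) => [n|n le]; first by rewrite mulr_ge0 ?exprn_ge0.
rewrite binS bin1 exprD [r ^+ _]exprSr; have h := hn n.+1 (leqW le).
have ac : 0 <= x ^+ 'C(n.+1, 2) * r ^+ n by rewrite mulr_ge0 ?exprn_ge0.
have := ler_wpM2l ac h.
by rewrite (_ : _ * (r * x ^+ n.+1) = x ^+ 'C(n.+1, 2) * x ^+ n.+1 * (r ^+ n * r)) //; ring.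
Qed.

Variable q : C.
Hypotheses (q0 : q != 0) (q1 : nc q < 1).

Let nq0 : 0 < nc q. Proof. by rewrite nc_gt0. Qed.
Let nq01 : 0 <= nc q < 1. Proof. by rewrite nc_ge0. Qed.

(** The coefficient is (-1)^n q^(n(n+1)/2). The exponent is unchanged by n -> -1-n while the sign
    flips, hence the same binomial and the extra minus on the [Negz] branch. *)
Definition tcoef (n : int) : C :=
  match n with
  | Posz n => (-1) ^+ n * q ^+ 'C(n.+1, 2)
  | Negz n => - ((-1) ^+ n * q ^+ 'C(n.+1, 2))
  end.

Lemma tcoefS (n : int) : tcoef (n + 1) = - q ^ (n + 1) * tcoef n.
Proof.
case: n => n.
  rewrite -PoszD addn1 /= [in LHS]binS bin1 exprD -exprnP exprS; ring.
case: n => [|n]; first by rewrite /= NegzE addNr expr0z !expr0; ring.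
rewrite NegzS /tcoef (binS n.+1) bin1 exprD NegzE (exprS _ n) -exprnN.
by field; rewrite expf_neq0.
Qed.

Definition thetat (z : C) : C := csumZ (fun n => tcoef n * z ^ n).

Lemma thetatE z : thetat z = csumZ (fun n => tcoef n * z ^ n).
Proof. by []. Qed.

Lemma nc_tcoef_pos n : nc (tcoef (Posz n)) = nc q ^+ 'C(n.+1, 2).
Proof. by rewrite /= ncM !ncX ncN nc1 expr1n mul1r. Qed.
Lemma nc_tcoef_neg n : nc (tcoef (Negz n)) = nc q ^+ 'C(n.+1, 2).
Proof. by rewrite /= ncN ncM !ncX ncN nc1 expr1n mul1r. Qed.

Lemma rsum_tcoef_pos (r : R) : 0 <= r -> rsum (fun n : nat => nc (tcoef (Posz n)) * r ^+ n).
Proof. by move=> r0; apply: rsum_le (rsum_theta nq01 r0) => n; rewrite nc_tcoef_pos. Qed.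
Lemma rsum_tcoef_neg (r : R) : 0 <= r -> rsum (fun n : nat => nc (tcoef (Negz n)) * r ^+ n.+1).
Proof.
move=> r0; apply: rsum_le (rsumZ r0 (rsum_theta nq01 r0)) => n.
by rewrite nc_tcoef_neg exprSr mulrA mulrC.
Qed.

Definition zabs (z : C) : R := Num.max (nc z) (nc z)^-1.

Lemma zabs_ge0 z : 0 <= zabs z. Proof. by rewrite le_max nc_ge0. Qed.
Lemma nc_exprz_le z (n : int) : nc (z ^ n) <= zabs z ^+ `|n|%N.
Proof.
rewrite nc_exprz; case: n => n /=.
  by rewrite -exprnP lerXn2r ?nnegrE ?nc_ge0 ?zabs_ge0 // le_max lexx.
rewrite NegzE -exprnN -exprVn /= lerXn2r ?nnegrE ?invr_ge0 ?nc_ge0 ?zabs_ge0 //.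
by rewrite le_max lexx orbT.
Qed.

Lemma zasum_theta_bounded (a : int -> C) (K : R) (z : C) : (forall n, nc (a n) <= K) ->
  zasum (fun n => tcoef n * a n * z ^ n).
Proof.
move=> ha; have K0 : 0 <= K by apply: le_trans (ha 0); exact: nc_ge0.
apply: (@zasum_le _ _ (fun n => K * (nc (tcoef n) * zabs z ^+ `|n|%N))).
- move=> n; rewrite !ncM [nc (tcoef n) * _]mulrC -mulrA ler_pM ?mulr_ge0 ?nc_ge0 //.
  by rewrite ler_wpM2l ?nc_ge0 // nc_exprz_le.
- by apply: rsumZ => //; apply: rsum_tcoef_pos; exact: zabs_ge0.
- by apply: rsumZ => //; apply: rsum_tcoef_neg; exact: zabs_ge0.
Qed.

Lemma zasum_thetat z : zasum (fun n => tcoef n * z ^ n).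
Proof.
have := @zasum_theta_bounded (fun=> 1) 1 z; rewrite nc1 => /(_ (fun=> lexx _)).
by apply: zasum_ext => n; rewrite mulr1.
Qed.

Lemma thetat_nat z : thetat z =
  cseries (fun n => (-1) ^+ n * q ^+ 'C(n.+1, 2) * (z ^ Posz n - z ^ Negz n)).
Proof.
have [h1 h2] := zasum_thetat z; rewrite /thetat /csumZ -cseriesD //.
by apply: cseries_ext => n /=; ring.
Qed.

(** At z = 1 the terms of index n and -1-n cancel. *)
Lemma thetat1 : thetat 1 = 0.
Proof.
rewrite thetat_nat (@cseries_fin _ _ 0) ?big_ord0 // => n _.
by rewrite !exp1rz subrr mulr0.
Qed.

Section Kronecker.
Variable w : C.
Hypotheses (w1 : w != 1) (wq : nc q < nc w) (wq' : nc w * nc q < 1).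

Let nw0 : 0 < nc w. Proof. exact: lt_trans wq. Qed.
Let w0 : w != 0. Proof. by rewrite -nc_gt0. Qed.

Definition acoef (m : int) : C := (1 - w * q ^ m)^-1.
Definition pos1 (m : int) : C := if m is Posz n.+1 then 1 else 0.
(** [acoef m] tends to 1 for m -> +oo and to 0 for m -> -oo; removing [pos1] leaves geometric decay
    in both directions, so that the sum against z^m converges also on the unit circle. *)
Definition ecoef (m : int) : C := acoef m - pos1 m.

Lemma pos1B m : pos1 m - pos1 (m - 1) = (m == 1)%:R.
Proof.
case: m => [[|[|n]]|n]; rewrite ?subrr //=; first by rewrite subr0.
Qed.

Lemma acoef_neq0 (m : int) : 1 - w * q ^ m != 0.
Proof.
rewrite subr_eq0; case: m => [[|m]|m].
- by rewrite expr0z mulr1 eq_sym.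
- apply: contraTneq wq' => e; rewrite -leNgt.
  have : nc (1 : C) = nc w * nc q * nc q ^+ m by rewrite {1}e ncM -exprnP ncX exprS mulrA.
  rewrite nc1 => ->; rewrite -[leRHS]mulr1 ler_wpM2l ?mulr_ge0 ?nc_ge0 //.
  by rewrite exprn_ile1 ?nc_ge0 // ltW.
- apply: contraTneq wq => e; rewrite -leNgt.
  have : nc w = nc q ^+ m.+1.
    have := congr1 (fun x => nc (x * q ^+ m.+1)) e.
    by rewrite /= mul1r NegzE -exprnN mulfVK ?expf_neq0 // ncX => ->.
  by move=> ->; rewrite exprS -[leRHS]mulr1 ler_wpM2l ?nc_ge0 // exprn_ile1 ?nc_ge0 // ltW.
Qed.

Lemma acoefE (m : int) : acoef m = 1 + w * q ^ m * acoef m.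
Proof. by rewrite /acoef; field; exact: acoef_neq0. Qed.

Lemma ecoef_bound : exists2 K : R, 0 <= K & forall m, nc (ecoef m) <= K * nc q ^+ `|m|%N.
Proof.
pose x := nc w * nc q; pose y := nc q / nc w.
have x1 : 0 <= x < 1 by rewrite mulr_ge0 ?nc_ge0.
have y1 : 0 <= y < 1 by rewrite divr_ge0 ?nc_ge0 // ltr_pdivrMr // mul1r.
pose K1 := nc w * (1 - x)^-1; pose K2 := (nc w)^-1 * (1 - y)^-1.
have K10 : 0 <= K1 by rewrite mulr_ge0 ?nc_ge0 // invr_ge0; lra.
have K20 : 0 <= K2 by rewrite mulr_ge0 ?invr_ge0 ?nc_ge0 //; lra.
exists (nc (acoef 0) + K1 + K2); first by rewrite !addr_ge0 ?nc_ge0.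
have a0 := nc_ge0 (acoef 0).
case=> [[|m]|m].
- by rewrite /ecoef subr0 expr0 mulr1; lra.
- have -> : ecoef (Posz m.+1) = w * q ^ m.+1%:Z * acoef m.+1.
    by rewrite /ecoef {1}acoefE addrAC subrr add0r.
  apply: le_trans (_ : K1 * nc q ^+ m.+1 <= _); last first.
    by rewrite ler_wpM2r ?exprn_ge0 ?nc_ge0 //; lra.
  rewrite !ncM -exprnP ncX /K1 mulrAC ler_wpM2r ?exprn_ge0 ?nc_ge0 //.
  rewrite ler_wpM2l ?nc_ge0 // /acoef ncV lef_pV2 ?posrE ?nc_gt0 ?acoef_neq0 //; last by lra.
  have := nc_triB 1 (w * q ^ m.+1%:Z); rewrite nc1; apply: le_trans.
  rewrite lerB // ncM -exprnP ncX exprS mulrA -[leRHS]mulr1 ler_wpM2l ?mulr_ge0 ?nc_ge0 //.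
  by rewrite exprn_ile1 ?nc_ge0 // ltW.
- have -> : ecoef (Negz m) = acoef (Negz m) by rewrite /ecoef subr0.
  apply: le_trans (_ : K2 * nc q ^+ m.+1 <= _); last first.
    by rewrite ler_wpM2r ?exprn_ge0 ?nc_ge0 //; lra.
  have qm0 : q ^+ m.+1 != 0 by rewrite expf_neq0.
  have -> : acoef (Negz m) = - (w^-1 * q ^+ m.+1 * (1 - w^-1 * q ^+ m.+1)^-1).
    have := acoef_neq0 (Negz m); rewrite /acoef NegzE -exprnN => n0.
    have n1 : q ^+ m.+1 - w != 0.
      by move: n0; apply: contraNneq => e; rewrite -(subrK w (q ^+ m.+1)) e add0r divff ?subrr.
    by field; rewrite n1 qm0 w0 /= -opprB oppr_eq0 n1.
  rewrite ncN !ncM ncV ncX /K2 mulrAC ler_wpM2r ?exprn_ge0 ?nc_ge0 //.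
  rewrite ler_wpM2l ?invr_ge0 ?nc_ge0 //.
  have le : nc (w^-1 * q ^+ m.+1) <= y.
    rewrite ncM ncV ncX mulrC exprS mulrAC -[leRHS]mulr1 ler_wpM2l //; first by case/andP: y1.
    by rewrite exprn_ile1 ?nc_ge0 // ltW.
  have := nc_triB 1 (w^-1 * q ^+ m.+1); rewrite nc1 => h.
  rewrite ncV lef_pV2 ?posrE //; lra.
Qed.

Lemma acoef_bound : exists K : R, forall m, nc (acoef m) <= K.
Proof.
have [K K0 hK] := ecoef_bound; exists (K + 1) => m.
have -> : acoef m = ecoef m + pos1 m by rewrite subrK.
apply: le_trans (ncD _ _) _; apply: lerD.
  by apply: le_trans (hK m) _; rewrite -[leRHS]mulr1 ler_wpM2l // exprn_ile1 ?nc_ge0 // ltW.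
by case: m => [[|m]|m]; rewrite /= ?nc1 ?nc0.
Qed.

(** Formally the coefficient of z^N in the product of the theta series with the sum of [acoef m]
    z^m. *)
Definition ccoef (N : int) : C := csumZ (fun n => tcoef n * acoef (N - n)).

Lemma ccoefZ N : ccoef N = csumZ (fun n => tcoef n * acoef (N - n)).
Proof. by []. Qed.

Lemma zasum_ccoef N : zasum (fun n => tcoef n * acoef (N - n)).
Proof.
have [K hK] := acoef_bound.
have := @zasum_theta_bounded (fun n => acoef (N - n)) K 1 (fun n => hK _).
by apply: zasum_ext => n; rewrite exp1rz mulr1.
Qed.

(** Inserting [acoefE] splits each term in two: the constant 1 contributes [thetat 1] = 0, and the
    rest is the previous coefficient up to a factor, by the recurrence for [tcoef]. *)
Lemma ccoefS N : ccoef (N + 1) = - (w * q ^ (N + 1)) * ccoef N.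
Proof.
have z1 := zasum_ccoef (N + 1); have z0 := zasum_ccoef N.
have [_ e] := zshiftS z1.
have [t1 e1] := zshiftS (zasum_thetat 1).
rewrite /ccoef -[LHS]e.
have -> : - (w * q ^ (N + 1)) * csumZ (fun n => tcoef n * acoef (N - n)) =
   csumZ (fun n => tcoef (n + 1) * 1 ^ (n + 1)) +
   csumZ (fun n => - (w * q ^ (N + 1)) * (tcoef n * acoef (N - n))).
  by rewrite e1 -/(thetat 1) thetat1 add0r zsumZ.
rewrite -zsumD //; last exact: zasumZ.
apply: zsum_ext => n.
rewrite exp1rz mulr1 tcoefS.
have -> : N + 1 - (n + 1) = N - n by rewrite opprD addrACA subrr addr0.
rewrite {1}acoefE.
have -> : q ^ (N + 1) = q ^ (n + 1) * q ^ (N - n).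
  by rewrite -expfzDr //; congr (q ^ _); ring.
ring.
Qed.

(** Both sides obey the same first-order recurrence with nonzero factor and agree at 0, hence also
    at negative indices. *)
Lemma ccoefE N : ccoef N = tcoef N * w ^ N * ccoef 0.
Proof.
pose r (N : int) : C := ccoef N - tcoef N * w ^ N * ccoef 0.
have rS M : r (M + 1) = - (w * q ^ (M + 1)) * r M.
  have e : w ^ (M + 1) = w ^ M * w by rewrite expfzDr // expr1z.
  rewrite /r e ccoefS tcoefS; ring.
have nz M : - (w * q ^ (M + 1)) != 0 by rewrite oppr_eq0 mulf_neq0 // expfz_neq0.
suff : r N = 0 by move/eqP; rewrite subr_eq0 => /eqP.
have r0 : r 0 = 0 by rewrite /r /= expr0z !expr0 !mul1r subrr.
case: N => N; elim: N => [//|N IH].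
- by rewrite -addn1 PoszD rS IH mulr0.
- by apply: (mulfI (nz (Negz 0))); rewrite -rS mulr0 NegzE addNr.
- by apply: (mulfI (nz (Negz N.+1))); rewrite -rS mulr0 NegzS.
Qed.

Variable z : C.
Hypotheses (z1 : z != 1) (zq : nc q < nc z) (zq' : nc z * nc q < 1).
Let nz0 : 0 < nc z. Proof. exact: lt_trans zq. Qed.
Let z0 : z != 0. Proof. by rewrite -nc_gt0. Qed.

Let rho : R := zabs z * nc q.
Let rho0 : 0 < rho. Proof. by rewrite mulr_gt0 // lt_max nz0. Qed.
Let rho1 : rho < 1.
Proof.
have [|] : zabs z = nc z \/ zabs z = (nc z)^-1 by rewrite /zabs; case: leP; auto.
  by rewrite /rho => ->.
by rewrite /rho => ->; rewrite mulrC ltr_pdivrMr // mul1r.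
Qed.

Lemma ecoef_boundz : exists2 K : R, 0 <= K & forall m, nc (ecoef m * z ^ m) <= K * rho ^+ `|m|%N.
Proof.
have [K K0 hK] := ecoef_bound; exists K => // m.
rewrite ncM /rho exprMn [zabs _ ^+ _ * _]mulrC mulrA.
by rewrite ler_pM ?nc_ge0 ?nc_exprz_le.
Qed.

Lemma rsum_rho_pos : rsum (fun n : nat => rho ^+ `|Posz n|%N).
Proof. by apply: rsum_geo; rewrite ltW ?rho1. Qed.
Lemma rsum_rho_neg : rsum (fun n : nat => rho ^+ `|Negz n|%N).
Proof.
have := rsumZ (ltW rho0) rsum_rho_pos; apply: rsum_le => n /=.
by rewrite exprS.
Qed.

Lemma zasum_rho (u : int -> C) (K : R) : 0 <= K ->
  (forall m, nc (u m) <= K * rho ^+ `|m|%N) -> zasum u.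
Proof.
by move=> K0 /zasum_le; apply; apply: rsumZ => //; [exact: rsum_rho_pos|exact: rsum_rho_neg].
Qed.

Definition Esum : C := csumZ (fun m => ecoef m * z ^ m).
(** Differences of [acoef] decay on both sides; they are the coefficients of (1-z) times the formal
    sum of [acoef m] z^m. *)
Definition dcoef (m : int) : C := acoef m - acoef (m - 1).

Lemma dcoef_boundz : exists2 K : R, 0 <= K & forall m, nc (dcoef m * z ^ m) <= K * rho ^+ `|m|%N.
Proof.
have [K K0 hK] := ecoef_boundz.
exists (K + nc z * K * rho^-1 + nc z * rho^-1).
  by rewrite !addr_ge0 ?mulr_ge0 ?nc_ge0 // invr_ge0 ltW.
move=> m.
have e : dcoef m = ecoef m - ecoef (m - 1) + (m == 1)%:R.
  by rewrite -pos1B /dcoef /ecoef; ring.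
have zm : z ^ m = z * z ^ (m - 1) by rewrite -{2}(expr1z z) -expfzDr // addrC subrK.
have -> : dcoef m * z ^ m = ecoef m * z ^ m - z * (ecoef (m - 1) * z ^ (m - 1)) + (m == 1)%:R * z ^ m.
  by rewrite e [in z * _]mulrCA -zm; ring.
apply: le_trans (ncD _ _) _; rewrite [leRHS]mulrDl; apply: lerD.
  apply: le_trans (ncB _ _) _; rewrite [leRHS]mulrDl; apply: lerD => //.
  rewrite ncM -!mulrA; apply: ler_wpM2l; first exact: nc_ge0.
  apply: le_trans (hK _) _; apply: ler_wpM2l => //.
  rewrite -(ler_pM2l rho0) mulrA divff ?gt_eqF // mul1r -exprS.
  apply: ler_wiXn2l; [exact: ltW|exact: ltW|].
  by have := leqD_dist m (m - 1) 0; rewrite !subr0 subKr.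
case: (m =P 1) => [->|_]; last by rewrite mul0r nc0 mulr_ge0 ?mulr_ge0 ?nc_ge0 ?exprn_ge0 ?invr_ge0 ?ltW.
by rewrite mul1r expr1z -mulrA mulVf ?gt_eqF // mulr1.
Qed.

(** The isolated summand [z] is the jump of [pos1] at index 1. *)
Lemma dsum_Esum : csumZ (fun m => dcoef m * z ^ m) = (1 - z) * Esum + z.
Proof.
have [K K0 hK] := ecoef_boundz; have ze := zasum_rho K0 hK.
have [ze' e'] := zshift (-1) ze.
have ez : csumZ (fun m : int => (m == 1)%:R * z) = z.
  rewrite /csumZ (@cseries_fin _ _ 2) ?(@cseries_fin _ _ 0) //.
  - by rewrite !big_ord_recl !big_ord0 /= !mul0r mul1r add0r !addr0.
  - by move=> n _; rewrite mul0r.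
  - by move=> [|[|n]] // _; rewrite mul0r.
have z3 : zasum (fun m : int => (m == 1)%:R * z).
  apply: (@zasum_rho _ (nc z / rho)); first by rewrite divr_ge0 ?nc_ge0 ?ltW.
  move=> m; case: (m =P 1) => [->|_]; last by rewrite mul0r nc0 mulr_ge0 ?divr_ge0 ?nc_ge0 ?exprn_ge0 ?ltW.
  by rewrite mul1r divfK ?gt_eqF.
have ze2 := zasumZ z ze'.
have ze3 := zasumD ze (zasumN ze2).
transitivity (csumZ (fun m => ecoef m * z ^ m - z * (ecoef (m - 1) * z ^ (m - 1)) + (m == 1)%:R * z)).
  apply: zsum_ext => m.
  have zm : z ^ m = z * z ^ (m - 1) by rewrite -{2}(expr1z z) -expfzDr // addrC subrK.
  have -> : (m == 1)%:R * z = (m == 1)%:R * z ^ m.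
    by case: (m =P 1) => [->|]; rewrite ?expr1z ?mul0r.
  have -> : z * (ecoef (m - 1) * z ^ (m - 1)) = ecoef (m - 1) * z ^ m by rewrite zm mulrCA.
  by rewrite -pos1B /dcoef /ecoef; ring.
rewrite (zsumD ze3 z3) (zsumB ze ze2) (zsumZ z ze') e' ez /Esum; ring.
Qed.

(** Multiply theta by the series of differences and collect powers of z: the coefficient of z^N is
    [ccoef N - ccoef (N - 1)], which [ccoefE] turns into the coefficients of theta at zw, with the
    factor 1-z. *)
Lemma theta_Esum : thetat z * ((1 - z) * Esum + z) = (1 - z) * ccoef 0 * thetat (z * w).
Proof.
have [K K0 hK] := dcoef_boundz; have zd := zasum_rho K0 hK.
rewrite -dsum_Esum mulrC -[in LHS]/(thetat z) {1}/thetat -zsumZ; last exact: zasum_thetat.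
pose u (n N : int) : C := tcoef n * dcoef (N - n) * z ^ N.
have s1 n : csumZ (fun m => dcoef m * z ^ m) * (tcoef n * z ^ n) = csumZ (u n).
  have [_ e] := zshift (- n) zd; rewrite -e mulrC -zsumZ; last by have [] := zshift (- n) zd.
  apply: zsum_ext => N; rewrite /u.
  have -> : z ^ N = z ^ n * z ^ (N - n) by rewrite -expfzDr // addrC subrK.
  ring.
rewrite (zsum_ext s1).
have rV1 : 1 <= rho^-1 by rewrite invf_ge1 // ltW.
(* Since |N-n| >= |N| - |n|, the decay rho^|N-n| is at most rho^|N| rho^(-|n|); the loss rho^(-|n|)
   is absorbed by the theta coefficients, which decay faster than any geometric sequence. *)
pose zr := zabs z / rho.
have zr0 : 0 <= zr by rewrite divr_ge0 ?zabs_ge0 ?ltW.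
rewrite (@zexchange _ u (fun n => K * (nc (tcoef n) * zr ^+ `|n|%N)) (fun N => rho ^+ `|N|%N)).
- transitivity (csumZ (fun N => ccoef 0 * (tcoef N * (z * w) ^ N) - z * (ccoef 0 * (tcoef (N - 1) * (z * w) ^ (N - 1))))).
    apply: zsum_ext => N.
    have -> : csumZ (u^~ N) = z ^ N * (ccoef N - ccoef (N - 1)).
      have h1 := zasum_ccoef N; have h2 := zasum_ccoef (N - 1).
      rewrite /ccoef -zsumB // -zsumZ; last by apply: zasumD => //; exact: zasumN.
      apply: zsum_ext => n; rewrite /u /dcoef addrAC; ring.
    rewrite !(ccoefE N) (ccoefE (N - 1)) !expfzMl.
    have -> : z ^ N = z * z ^ (N - 1) by rewrite -{2}(expr1z z) -expfzDr // addrC subrK.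
    ring.
  have zt := zasum_thetat (z * w); have [zt' et] := zshift (-1) zt.
  rewrite zsumB; [|exact: zasumZ|by apply: zasumZ; exact: zasumZ].
  rewrite !zsumZ //; last exact: zasumZ.
  by rewrite et -/(thetat _); ring.
- move=> n N; rewrite /u.
  have -> : tcoef n * dcoef (N - n) * z ^ N = (tcoef n * z ^ n) * (dcoef (N - n) * z ^ (N - n)).
    have -> : z ^ N = z ^ n * z ^ (N - n) by rewrite -expfzDr // addrC subrK.
    ring.
  rewrite ncM [leRHS](_ : _ = (nc (tcoef n) * zabs z ^+ `|n|%N) * (K * (rho^-1 ^+ `|n|%N * rho ^+ `|N|%N))); last first.
    by rewrite /zr exprMn; ring.
  apply: ler_pM; rewrite ?nc_ge0 //.
    by rewrite ncM ler_wpM2l ?nc_ge0 ?nc_exprz_le.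
  apply: le_trans (hK _) _; apply: ler_wpM2l => //.
  rewrite exprVn ler_pdivlMl ?exprn_gt0 // -exprD.
  apply: ler_wiXn2l; [exact: ltW|exact: ltW|].
  by have := leqD_dist N n 0; rewrite !subr0 addnC.
- by move=> n; rewrite !mulr_ge0 ?nc_ge0 ?exprn_ge0.
- by move=> n; rewrite exprn_ge0 // ltW.
- by apply: rsumZ => //; exact: rsum_tcoef_pos.
- by apply: rsumZ => //; exact: rsum_tcoef_neg.
- exact: rsum_rho_pos.
- exact: rsum_rho_neg.
Qed.
End Kronecker.
End Theta.
End ThetaSeries.
Import ThetaSeries.

(** * Kronecker's formula, and the nonvanishing of theta on the unit circle *)

Module KroneckerTheta.
#[local] Opaque cseries csumZ thetat ccoef.

Section KroneckerFunction.
Context {R : realType}.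
Local Notation C := R[i].
Variable q : C.
Hypotheses (q0 : q != 0) (q1 : nc q < 1).
Let nq0 : 0 < nc q. Proof. by rewrite nc_gt0. Qed.

Definition Gsum (z w : C) : C :=
  cseries (fun m => cseries (fun n => z ^+ m.+1 * w ^+ n.+1 * q ^+ (m.+1 * n.+1)%N)).

Lemma Gsum_inner (z w : C) m : nc w * nc q < 1 ->
  cseries (fun n => z ^+ m.+1 * w ^+ n.+1 * q ^+ (m.+1 * n.+1)%N) =
  z ^+ m.+1 * (w * q ^+ m.+1 / (1 - w * q ^+ m.+1)).
Proof.
move=> wq.
have le : nc (w * q ^+ m.+1) < 1.
  apply: le_lt_trans wq; rewrite ncM ncX ler_wpM2l ?nc_ge0 // exprS.
  by rewrite ler_piMr ?nc_ge0 // exprn_ile1 ?nc_ge0 // ltW.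
rewrite -(cseries_geo le) [RHS]mulrA -cseriesZ; last exact: asum_geo.
by apply: cseries_ext => n; rewrite exprMn -exprM mulnS exprD (exprS w); ring.
Qed.

Lemma Gsum_sym (z w : C) : nc z * nc q < 1 -> nc w * nc q < 1 -> Gsum z w = Gsum w z.
Proof.
move=> zq wq; rewrite /Gsum.
have [||_ _ _ _ ->] := @exchange_cseries _ (fun m n => z ^+ m.+1 * w ^+ n.+1 * q ^+ (m.+1 * n.+1)%N)
   (fun m => nc w * (1 - nc w * nc q)^-1 * (nc z * nc q) ^+ m.+1).
- move=> m n; rewrite (eq_bigr (fun j : 'I_n => (nc z * nc q) ^+ m.+1 * nc w * (nc w * nc q ^+ m.+1) ^+ j)).
    rewrite -mulr_sumr mulrAC [leRHS]mulrC -mulrA; apply: ler_wpM2l.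
      by rewrite exprn_ge0 // mulr_ge0 ?nc_ge0.
    rewrite mulrC; apply: ler_wpM2l; first exact: nc_ge0.
    apply: le_trans (_ : \sum_(j < n) (nc w * nc q) ^+ j <= _).
      apply: ler_sum => j _; rewrite lerXn2r ?nnegrE ?mulr_ge0 ?exprn_ge0 ?nc_ge0 //.
      rewrite ler_wpM2l ?nc_ge0 // exprS ler_piMr ?nc_ge0 // exprn_ile1 ?nc_ge0 //; exact: ltW.
    have d : 0 < 1 - nc w * nc q by lra.
    rewrite -[leRHS]mul1r ler_pdivlMr //.
    have -> : (\sum_(j < n) (nc w * nc q) ^+ j) * (1 - nc w * nc q) = 1 - (nc w * nc q) ^+ n.
      elim: n => [|n IH]; first by rewrite big_ord0 mul0r expr0 subrr.
      by rewrite big_ord_recr /= mulrDl IH exprS; ring.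
    by rewrite lerBlDr lerDl exprn_ge0 // mulr_ge0 ?nc_ge0.
  by move=> j _; rewrite !ncM !ncX !exprMn mulnS exprD (exprS (nc w)) exprM; ring.
- apply: rsumZ.
    by rewrite mulr_ge0 ?nc_ge0 // invr_ge0; lra.
  have : rsum (fun n => (nc z * nc q) * (nc z * nc q) ^+ n).
    by apply: rsumZ; rewrite ?mulr_ge0 ?nc_ge0 //; apply: rsum_geo; rewrite mulr_ge0 ?nc_ge0.
  by apply: rsum_le => n; rewrite exprS.
apply: cseries_ext => n; apply: cseries_ext => m.
by rewrite mulnC [z ^+ _ * _]mulrC.
Qed.

Definition annulus (z : C) := (nc q < nc z) && (nc z * nc q < 1).

Lemma annulusV z : annulus z -> nc z^-1 * nc q < 1.
Proof.
move=> /andP[z1 z2]; rewrite ncV mulrC ltr_pdivrMr ?mul1r //; exact: lt_trans z1.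
Qed.

Lemma annulus_neq0 z : annulus z -> z != 0.
Proof. by move=> /andP[z1 z2]; rewrite -nc_gt0; exact: lt_trans z1. Qed.

(** Each [acoef m] is expanded as a geometric series, in powers of w for m > 0 and of 1/w for m <
    0. *)
Lemma Esum_Gsum z w : w != 1 -> annulus z -> annulus w ->
  Esum q w z = (1 - w)^-1 + Gsum z w - Gsum z^-1 w^-1.
Proof.
move=> w1 az aw; have /andP[wq wq'] := aw; have /andP[zq zq'] := az.
have z0 := annulus_neq0 az; have w0 := annulus_neq0 aw.
have [K K0 hK] := @ecoef_boundz _ q q0 q1 w w1 wq wq' z.
have [h1 h2] := zasum_rho q0 zq zq' K0 hK.
rewrite /Esum csumZE (cseries_shift h1); congr (_ + _).
  rewrite /ecoef /= subr0 /acoef !expr0z !mulr1; congr (_ + _).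
  apply: cseries_ext => m; rewrite (Gsum_inner _ _ wq') -exprnP mulrC; congr (_ * _).
  have n0 := acoef_neq0 q0 q1 w1 wq wq' (Posz m.+1).
  by rewrite /acoef -exprnP in n0 *; field.
rewrite -cseriesN; last first.
  have [] := (h1, h2) => _; apply: rsum_le => m.
  rewrite (Gsum_inner _ _ (annulusV aw)) /ecoef subr0 NegzE -exprnN.
  have n0 := acoef_neq0 q0 q1 w1 wq wq' (Negz m).
  rewrite /acoef NegzE -exprnN in n0 *.
  have n1 : w - q ^+ m.+1 != 0.
    move: n0; apply: contraNneq => /eqP; rewrite subr_eq0 => /eqP ->.
    by rewrite divff ?subrr // expf_neq0.
  have qm0 : q ^+ m.+1 != 0 by rewrite expf_neq0.
  rewrite le_eqVlt; apply/orP; left; apply/eqP; rewrite -ncN; congr nc.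
  by rewrite exprVn; field; rewrite expf_neq0 // w0 qm0 n1 /= -opprB oppr_eq0 n1.
apply: cseries_ext => m.
rewrite (Gsum_inner _ _ (annulusV aw)) /ecoef subr0 NegzE -exprnN.
have n0 := acoef_neq0 q0 q1 w1 wq wq' (Negz m).
rewrite /acoef NegzE -exprnN in n0 *.
have n1 : w - q ^+ m.+1 != 0.
  move: n0; apply: contraNneq => /eqP; rewrite subr_eq0 => /eqP ->.
  by rewrite divff ?subrr // expf_neq0.
have qm0 : q ^+ m.+1 != 0 by rewrite expf_neq0.
by rewrite exprVn; field; rewrite expf_neq0 // w0 qm0 n1 /= -opprB oppr_eq0 n1.
Qed.

(** Kronecker's expansion of F(xi, alpha) divided by -2 pi i, with z = exp(2 pi i xi) and w = exp(2
    pi i alpha). *)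
Definition Ssum z w := z / (1 - z) + (1 - w)^-1 + Gsum z w - Gsum z^-1 w^-1.

Lemma Ssum_sym z w : z != 1 -> w != 1 -> annulus z -> annulus w -> Ssum z w = Ssum w z.
Proof.
move=> z1 w1 az aw; have /andP[wq wq'] := aw; have /andP[zq zq'] := az.
rewrite /Ssum (Gsum_sym zq' wq') (Gsum_sym (annulusV az) (annulusV aw)).
congr (_ + _ - _); field.
by rewrite !subr_eq0 ![1 == _]eq_sym z1 w1.
Qed.

Lemma theta_Ssum z w : z != 1 -> w != 1 -> annulus z -> annulus w ->
  thetat q z * Ssum z w = ccoef q w 0 * thetat q (z * w).
Proof.
move=> z1 w1 az aw; have /andP[wq wq'] := aw; have /andP[zq zq'] := az.
have z1' : 1 - z != 0 by rewrite subr_eq0 eq_sym.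
have := @theta_Esum _ q q0 q1 w w1 wq wq' z zq zq'.
rewrite (Esum_Gsum w1 az aw) => h.
apply: (mulfI z1'); rewrite [RHS]mulrA -h mulrCA; congr (_ * _).
by rewrite /Ssum; move: (Gsum z w) (Gsum _ _) ((1 - w)^-1) => a b c; field.
Qed.

Definition ktheta w := ccoef q w 0 * thetat q w.

(** By symmetry of [Ssum], the formula for (z,w) times theta(w) equals the one for (w,z) times
    theta(z). This constancy takes the place of a product formula for theta. *)
Lemma ktheta_eq z w : z != 1 -> w != 1 -> annulus z -> annulus w ->
  thetat q (z * w) != 0 -> ktheta z = ktheta w.
Proof.
move=> z1 w1 az aw t0.
have h1 := theta_Ssum z1 w1 az aw; have h2 := theta_Ssum w1 z1 aw az.
rewrite -(Ssum_sym z1 w1 az aw) in h2.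
apply: (mulIf t0); rewrite /ktheta [in LHS]mulrAC [RHS]mulrAC -h1 [z * w]mulrC -h2.
by move: (thetat q z) (thetat q w) (Ssum z w) => a b c; ring.
Qed.

Lemma rsum_tc_pos : rsum (fun n : nat => nc (tcoef q (Posz n))).
Proof.
have := rsum_tcoef_pos q1 (@ler01 R); apply: rsum_le => n; by rewrite expr1n mulr1.
Qed.
Lemma rsum_tc_neg : rsum (fun n : nat => nc (tcoef q (Negz n))).
Proof.
have := rsum_tcoef_neg q1 (@ler01 R); apply: rsum_le => n; by rewrite expr1n mulr1.
Qed.

Let kap : R := (1 - nc q) / 2.
Let kap0 : 0 < kap. Proof. by rewrite /kap; have := q1; lra. Qed.

Lemma near1_annulus w : nc (w - 1) < kap -> annulus w.
Proof.
move=> h; have := nc_triB w 1; have := nc_triB 1 w; rewrite nc_distC nc1 => h1 h2.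
rewrite /kap in h; apply/andP; split; first by have := q1; lra.
have := nc_ge0 w; have := q1; have := nq0; nra.
Qed.

Lemma near1_acoef w (m : int) : nc (w - 1) < kap -> m != 0 -> nc (acoef q w m) <= kap^-1.
Proof.
move=> h; have := nc_triB w 1; have := nc_triB 1 w; rewrite nc_distC nc1 => h1 h2.
have w0 := nc_ge0 w.
suff h3 : m != 0 -> kap <= nc (1 - w * q ^ m).
  by move=> /h3 h4; rewrite /acoef ncV lef_pV2 ?posrE //; exact: lt_le_trans h4.
have hk : kap = (1 - nc q) / 2 by [].
have qX n : nc q ^+ n.+1 <= nc q by rewrite exprS ler_piMr ?nc_ge0 // exprn_ile1 ?nc_ge0 // ltW.
case: m => [[|m]|m] // _.
  have := nc_triB 1 (w * q ^ m.+1%:Z); rewrite nc1 ncM -exprnP ncX => h3.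
  have := qX m => h4; apply: le_trans h3.
  have : nc w * nc q ^+ m.+1 <= nc w * nc q by rewrite ler_wpM2l.
  have := nq0; have := q1; nra.
have qm0 : q ^+ m.+1 != 0 by rewrite expf_neq0.
have qp : 0 < nc q ^+ m.+1 by rewrite exprn_gt0.
have -> : 1 - w * q ^ Negz m = (q ^+ m.+1 - w) / q ^+ m.+1.
  by rewrite NegzE -exprnN; field.
rewrite nc_div ncX ler_pdivlMr //.
have := nc_triB w (q ^+ m.+1); rewrite nc_distC ncX => h3; apply: le_trans h3.
have h4 := qX m; have : kap * nc q ^+ m.+1 <= kap * nc q by rewrite ler_wpM2l // ltW.
have := nq0; have := q1; nra.
Qed.

(** Only the summand with [acoef] of index 0 has a pole at w = 1; for every other index |1 - w q^m|
    stays above [kap]. *)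
Lemma ccoef_near1 : exists2 K : R, 0 <= K &
  forall w, nc (w - 1) < kap -> w != 1 -> nc (ccoef q w 0 - (1 - w)^-1) <= K.
Proof.
have [M1 hM1] := rsum_tc_pos; have [M2 hM2] := rsum_tc_neg.
have M10 : 0 <= M1 by have := hM1 0%N; rewrite big_ord0.
have M20 : 0 <= M2 by have := hM2 0%N; rewrite big_ord0.
exists (kap^-1 * (M1 + M2)); first by rewrite mulr_ge0 ?addr_ge0 // invr_ge0 ltW.
move=> w h w1; have aw := near1_annulus h; have /andP[wq wq'] := aw.
have [h1 h2] := zasum_ccoef q0 q1 w1 wq wq' 0.
rewrite ccoefZ csumZE (cseries_shift h1).
have -> : tcoef q 0 * acoef q w (0 - 0) = (1 - w)^-1.
  by rewrite subrr /acoef /= expr0z !expr0 !mulr1 mul1r.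
have e3 (a b c : C) : a + b + c - a = b + c by ring.
rewrite e3 mulrDr; apply: le_trans (ncD _ _) _; apply: lerD.
  apply: nc_cseries_le => n.
  apply: le_trans (_ : kap^-1 * (\sum_(i < n.+1) nc (tcoef q (Posz i))) <= _); last first.
    by rewrite ler_wpM2l // invr_ge0 ltW.
  rewrite big_ord_recl mulrDr -[leLHS]add0r; apply: lerD.
    by rewrite mulr_ge0 ?nc_ge0 // invr_ge0 ltW.
  rewrite mulr_sumr; apply: ler_sum => i _; rewrite ncM mulrC.
  by rewrite ler_wpM2r ?nc_ge0 // near1_acoef // sub0r oppr_eq0.
apply: nc_cseries_le => n.
apply: le_trans (_ : kap^-1 * (\sum_(i < n) nc (tcoef q (Negz i))) <= _); last first.
  by rewrite ler_wpM2l // invr_ge0 ltW.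
rewrite mulr_sumr; apply: ler_sum => i _; rewrite ncM mulrC.
by rewrite ler_wpM2r ?nc_ge0 // near1_acoef // sub0r oppr_eq0.
Qed.

Lemma ccoef_neq0_near1 : exists2 d : R, 0 < d &
  forall w, nc (w - 1) < d -> w != 1 -> annulus w /\ ccoef q w 0 != 0.
Proof.
have [K K0 hK] := ccoef_near1.
exists (Num.min kap (K + 1)^-1); first by rewrite lt_min kap0 invr_gt0; lra.
move=> w; rewrite lt_min => /andP[h1 h2] w1; split; first exact: near1_annulus.
have w1' : w - 1 != 0 by rewrite subr_eq0.
have n0 : 0 < nc (w - 1) by rewrite nc_gt0.
apply: contraTneq (hK w h1 w1) => ->; rewrite sub0r ncN -ltNge ncV nc_distC.
have : K + 1 < (nc (w - 1))^-1 by rewrite -[ltLHS]invrK ltf_pV2 ?posrE ?invr_gt0 //; lra.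
lra.
Qed.

Lemma ccoef_lim : ((1 - w) * ccoef q w 0 : C^o) @[w --> (1 : C^o)^'] --> (1 : C^o).
Proof.
have [K K0 hK] := ccoef_near1.
have id1 : (w : C^o) @[w --> (1 : C^o)^'] --> (1 : C^o) by exact: cvg_within.
have nw : nc (w - 1) @[w --> (1 : C^o)^'] --> (0 : R) by apply/(@cvgCP _ _ _ _ id).
apply: (@cvgC_squeeze _ _ _ _ _ _ (fun w => K * nc (w - 1))); last first.
  by rewrite -(mulr0 K); apply: cvgM => //; exact: cvg_cst.
near=> w.
have w1 : w != 1 by near: w; exact: (@nbhs_dnbhs_neq C^o).
have wk : nc (w - 1) < kap.
  have : `|nc (w - 1) - 0| < kap by near: w; move/cvgrPdistC_lt : nw; apply.
  by rewrite subr0 ger0_norm ?nc_ge0.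
have w1' : 1 - w != 0 by rewrite subr_eq0 eq_sym.
have -> : (1 - w) * ccoef q w 0 - 1 = (1 - w) * (ccoef q w 0 - (1 - w)^-1).
  by rewrite mulrBr divff.
by rewrite ncM nc_distC mulrC ler_wpM2r ?nc_ge0 // hK.
Unshelve. all: by end_near.
Qed.

Lemma thetat_cvg (T : Type) (F : set_system T) (FF : ProperFilter F) (f : T -> C) (z : C) :
  z != 0 -> (f x : C^o) @[x --> F] --> (z : C^o) ->
  (thetat q (f x) : C^o) @[x --> F] --> (thetat q z : C^o).
Proof.
move=> z0 fz.
have fn := cvgC_norm FF fz.
have nz0 : 0 < nc z by rewrite nc_gt0.
pose r : R := Num.max (nc z + 1) (nc z / 2)^-1.
have r0 : 0 <= r by rewrite le_max; apply/orP; left; have := nc_ge0 z; lra.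
have zr : \forall x \near F, zabs (f x) <= r.
  have h1 : \forall x \near F, nc (f x) < nc z + 1.
    by apply: (cvgr_lt (nc z)) => //; lra.
  have h2 : \forall x \near F, nc z / 2 < nc (f x).
    by apply: (cvgr_gt (nc z)) => //; lra.
  near=> x; rewrite /zabs ge_max; apply/andP; split.
    by rewrite le_max; apply/orP; left; apply: ltW; near: x.
  rewrite le_max; apply/orP; right.
  have h : nc z / 2 < nc (f x) by near: x.
  by rewrite lef_pV2 ?posrE; [exact: ltW|lra|lra].
have fzn (n : int) : (f x ^ n : C^o) @[x --> F] --> (z ^ n : C^o).
  have pw k : (f x ^+ k : C^o) @[x --> F] --> (z ^+ k : C^o).
    elim: k => [|k IH]; first by under eq_cvg do rewrite expr0; exact: cvgC_cst.
    by under eq_cvg do rewrite exprS; rewrite exprS; exact: (cvgCM FF fz IH).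
  case: n => n; first by under eq_cvg do rewrite -exprnP; exact: pw.
  under eq_cvg do rewrite NegzE -exprnN; rewrite NegzE -exprnN.
  exact: (cvgCV FF (pw _) (expf_neq0 _ z0)).
rewrite thetatE csumZE; under eq_cvg do rewrite thetatE csumZE; apply: (cvgCD FF).
  have [||_ h] := @tannery _ _ F _ (fun x n => tcoef q (Posz n) * f x ^ Posz n)
    (fun n => tcoef q (Posz n) * z ^ Posz n) _ (rsum_tcoef_pos q1 r0).
  - near=> x => n; rewrite ncM ler_wpM2l ?nc_ge0 //.
    apply: le_trans (nc_exprz_le _ _) _; rewrite lerXn2r ?nnegrE ?zabs_ge0 //.
    by near: x.
  - by move=> n; exact: (cvgCZ FF (fzn _)).
  exact: h.
have [||_ h] := @tannery _ _ F _ (fun x n => tcoef q (Negz n) * f x ^ Negz n)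
    (fun n => tcoef q (Negz n) * z ^ Negz n) _ (rsum_tcoef_neg q1 r0).
- near=> x => n; rewrite ncM ler_wpM2l ?nc_ge0 //.
  apply: le_trans (nc_exprz_le _ _) _; rewrite lerXn2r ?nnegrE ?zabs_ge0 //.
  by near: x.
- by move=> n; exact: (cvgCZ FF (fzn _)).
exact: h.
Unshelve. all: by end_near.
Qed.

Definition ee (x : R) : C := cexp (two_pi_i R * x%:C).

Lemma eeE x : ee x = cos (2 * pi * x) +i* sin (2 * pi * x).
Proof.
rewrite /ee /cexp /two_pi_i; simpc.
by rewrite ?(mul0r,subr0,mulr0,add0r,oppr0,addr0) expR0 !mul1r.
Qed.
Lemma nc_ee x : nc (ee x) = 1.
Proof. by rewrite /ee nc_cexp /two_pi_i; simpc; rewrite ?(mul0r,subr0,mulr0,add0r,oppr0) expR0. Qed.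
Lemma eeD x y : ee (x + y) = ee x * ee y.
Proof. by rewrite /ee rmorphD mulrDr cexpD. Qed.
Lemma ee0 : ee 0 = 1. Proof. by rewrite /ee mulr0 cexp0. Qed.
Lemma ee1 : ee 1 = 1. Proof. by rewrite /ee mulr1 cexp_two_pi_i. Qed.
Lemma eeN x : ee (- x) = (ee x)^-1.
Proof. by rewrite /ee rmorphN mulrN cexpNV. Qed.
Lemma eeMn x n : ee (n%:R * x) = ee x ^+ n.
Proof. by rewrite /ee -cexpMn rmorphM rmorph_nat mulrCA mulr_natl. Qed.

Lemma ee_neq1 (x : R) : 0 < x < 1 -> ee x != 1.
Proof.
move=> /andP[x0 x1]; rewrite eeE; apply/eqP => -[+ _].
have s : 0 < sin (pi * x).
  by apply: sin_gt0_pi; rewrite mulr_gt0 ?pi_gt0 //= -[ltRHS]mulr1 ltr_pM2l ?pi_gt0.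
have -> : 2 * pi * x = (pi * x) *+ 2 by ring.
rewrite cos_mulr2n cos2sin2 => h.
have : sin (pi * x) ^+ 2 = 0 by move: h; rewrite -mulr_natl; lra.
by move/eqP; rewrite expf_eq0 /= gt_eqF.
Qed.

Lemma ee_annulus x : annulus (ee x).
Proof. by rewrite /annulus nc_ee q1 mul1r. Qed.

Lemma ee_cvg0 : (ee x : C^o) @[x --> (0 : R)] --> (1 : C^o).
Proof.
apply: (@cvgC_ReIm _ _ _ _ ee).
  have -> : complex.Re (1 : C) = cos (2 * pi * 0) by rewrite mulr0 cos0.
  under eq_cvg do rewrite eeE.
  apply: (@continuous_comp _ _ _ (fun x => 2 * pi * x) (@cos R) 0); last exact: continuous_cos.
  exact: mulrl_continuous.
have -> : complex.Im (1 : C) = sin (2 * pi * 0) by rewrite mulr0 sin0.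
under eq_cvg do rewrite eeE.
apply: (@continuous_comp _ _ _ (fun x => 2 * pi * x) (@sin R) 0); last exact: continuous_sin.
exact: mulrl_continuous.
Qed.

Lemma ee_near1 (d : R) : 0 < d -> exists2 eta : R, 0 < eta < 1 &
  forall y, `|y| < eta -> nc (ee y - 1) < d.
Proof.
move=> d0; have /cvgCP/cvgrPdistC_lt/(_ d d0) := ee_cvg0.
move=> /nbhs_ballP[e /= e0 h].
exists (Num.min e (2^-1)); first by rewrite lt_min gt_min e0 /=; lra.
move=> y; rewrite lt_min => /andP[ye _].
have := h y; rewrite /ball /= sub0r normrN => /(_ ye).
by rewrite subr0 ger0_norm ?nc_ge0.
Qed.

(** If theta vanishes at z, then [theta_Ssum] gives c(w) theta(zw) = 0, and c(w) is nonzero for w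
    near 1. So zeros spread by steps of a fixed size [eta], and finitely many steps join x to y. *)
Lemma thetat_zero_propagates (x : R) : 0 < x < 1 -> thetat q (ee x) = 0 ->
  forall y : R, 0 < y < 1 -> thetat q (ee y) = 0.
Proof.
move=> x01 tx y y01.
have [d d0 hd] := ccoef_neq0_near1; have [eta eta0 heta] := ee_near1 d0.
have step (u v : R) : 0 < u < 1 -> `|v - u| < eta -> thetat q (ee u) = 0 -> thetat q (ee v) = 0.
  move=> u01 vu tu; have [->//|vneq] := eqVneq v u.
  have w1 : ee (v - u) != 1.
    have [lt|gt|e] := ltgtP u v.
    - by apply: ee_neq1; move: vu; rewrite ger0_norm ?subr_ge0 ?(ltW lt)//; lra.
    - rewrite -(inj_eq (@invr_inj _)) invr1 -eeN opprB.
      by apply: ee_neq1; move: vu; rewrite distrC ger0_norm ?subr_ge0 ?(ltW gt)//; lra.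
    - by rewrite e eqxx in vneq.
  have [aw c0] := hd _ (heta _ vu) w1.
  have := theta_Ssum (ee_neq1 u01) w1 (ee_annulus u) aw.
  rewrite tu mul0r -eeD [u + _]addrC subrK => /esym/eqP.
  by rewrite mulf_eq0 (negbTE c0) /= => /eqP.
have [n hn] : exists n : nat, `|y - x| < eta * n.+1%:R.
  exists (Num.truncn (`|y - x| / eta)); rewrite mulrC -ltr_pdivrMr; last by lra.
  exact: truncnS_gt.
have np : (0 : R) < n.+1%:R by rewrite ltr0n.
pose pt (k : nat) := x + k%:R / n.+1%:R * (y - x).
have pt01 k : (k <= n.+1)%N -> 0 < pt k < 1.
  move=> le; have l0 : 0 <= (k%:R / n.+1%:R : R) by rewrite divr_ge0.
  have l1 : (k%:R / n.+1%:R : R) <= 1 by rewrite ler_pdivrMr // mul1r ler_nat.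
  rewrite /pt; move: (k%:R / n.+1%:R) l0 l1 => l l0 l1.
  have [xy|yx] := leP x y.
    have : 0 <= l * (y - x) by rewrite mulr_ge0 // subr_ge0.
    have : 0 <= (1 - l) * (y - x) by rewrite mulr_ge0 // subr_ge0.
    lra.
  have : 0 <= l * (x - y) by rewrite mulr_ge0 // subr_ge0 ltW.
  have : 0 <= (1 - l) * (x - y) by rewrite mulr_ge0 ?subr_ge0 // ltW.
  lra.
have e : pt n.+1 = y by rewrite /pt divff ?gt_eqF // mul1r addrC subrK.
have hp : forall k, (k <= n.+1)%N -> thetat q (ee (pt k)) = 0.
  elim=> [|k IH] le; first by rewrite /pt mul0r mul0r addr0.
  apply: (step (pt k)); [by apply: pt01; exact: ltnW| |by apply: IH; exact: ltnW].
  have -> : pt k.+1 - pt k = (y - x) / n.+1%:R by rewrite /pt -natr1; field; rewrite gt_eqF.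
  by rewrite normrM normfV (ger0_norm (ltW np)) ltr_pdivrMr.
rewrite -e; exact: (hp _ (leqnn _)).
Qed.

(** One zero would make theta vanish on the whole unit circle and kill all its Fourier coefficients,
    whereas the constant coefficient is 1. *)
Lemma thetat_ee_neq0 (x : R) : 0 < x < 1 -> thetat q (ee x) != 0.
Proof.
move=> x01; apply/eqP => tx.
have all0 := thetat_zero_propagates x01 tx.
(* The mean of z^n over the roots of unity of order P+1 replaces an integral over the circle: it is
   1 for n = 0 and vanishes as soon as P >= |n| > 0. *)
pose av (P : nat) (n : int) : C := P.+1%:R^-1 * \sum_(a < P.+1) ee (a%:R / P.+1%:R) ^ n.
have Pp P : (0 : R) < P.+1%:R by rewrite ltr0n.
have PC P : (P.+1%:R : C) != 0 by rewrite pnatr_eq0.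
have avle P n : nc (av P n) <= 1.
  rewrite /av ncM ncV nc_nat ler_pdivrMl // mulr1.
  apply: le_trans (nc_sum _ _ _) _.
  rewrite (eq_bigr (fun=> 1)) ?sumr_const ?card_ord // => a _.
  by rewrite nc_exprz nc_ee exp1rz.
have s0 P : csumZ (fun n => tcoef q n * av P n) = 0.
  have hz a : zasum (fun n => tcoef q n * ee a ^ n) by exact: zasum_thetat.
  have -> : csumZ (fun n => tcoef q n * av P n) =
    P.+1%:R^-1 * \sum_(a < P.+1) thetat q (ee (a%:R / P.+1%:R)).
    rewrite csumZE; under [in RHS]eq_bigr do rewrite thetatE csumZE.
    rewrite big_split /= -!(cseries_sum _ _).1; last 2 first.
    - by move=> a; case: (hz (a%:R / P.+1%:R)).
    - by move=> a; case: (hz (a%:R / P.+1%:R)).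
    rewrite mulrDr -!cseriesZ; last 2 first.
    - by apply: (cseries_sum _ _).2 => a; case: (hz (a%:R / P.+1%:R)).
    - by apply: (cseries_sum _ _).2 => a; case: (hz (a%:R / P.+1%:R)).
    by congr (_ + _); apply: cseries_ext => n; rewrite /av mulrCA mulr_sumr.
  have hb (a : 'I_P.+1) : thetat q (ee (a%:R / P.+1%:R)) = 0.
    case: (posnP a) => [->|a0]; first by rewrite mul0r ee0; exact: thetat1.
    by apply: all0; rewrite divr_gt0 ?ltr0n //= ltr_pdivrMr // mul1r ltr_nat.
  by rewrite (eq_bigr _ (fun a _ => hb a)) sumr_const mul0rn mulr0.
have avlim (n : int) : n != 0 -> \forall P \near \oo, av P n = 0.
  move=> n0; exists `|n|%N => // P /= le; rewrite /av.
  set w := ee (P.+1%:R^-1).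
  have ew (a : 'I_P.+1) : ee (a%:R / P.+1%:R) ^ n = (w ^ n) ^+ a.
    by rewrite eeMn -/w !exprnP exprzAC.
  rewrite (eq_bigr _ (fun a _ => ew a)).
  have wP : w ^+ P.+1 = 1 by rewrite -eeMn divff ?gt_eqF // ee1.
  have wn1 : w ^ n != 1.
    have hm (m : nat) : (0 < m <= P)%N -> w ^+ m != 1.
      move=> /andP[m0 mP]; rewrite -eeMn; apply: ee_neq1.
      by rewrite divr_gt0 ?ltr0n //= ltr_pdivrMr // mul1r ltr_nat ltnS.
    case: n n0 le {ew} => n n0 le; first by rewrite -exprnP hm // lt0n n0.
    by rewrite NegzE -exprnN -(inj_eq (@invr_inj _)) invrK invr1 hm.
  apply/eqP; rewrite mulf_eq0; apply/orP; right.
  have := subrX1 (w ^ n) P.+1.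
  have -> : (w ^ n) ^+ P.+1 = 1 by rewrite exprnP exprzAC -exprnP wP exp1rz.
  rewrite subrr => /esym/eqP; rewrite mulf_eq0 subr_eq0 (negbTE wn1) /=.
  by [].
have lim1 : (csumZ (fun n => tcoef q n * av P n) : C^o) @[P --> \oo] --> (1 : C^o).
  under eq_cvg do rewrite csumZE; have -> : (1 : C) = 1 + 0 by rewrite addr0.
  apply: (cvgCD _).
    have [||_ h] := @tannery _ _ \oo _ (fun P n => tcoef q (Posz n) * av P (Posz n))
      (fun n => (n == 0%N)%:R) _ rsum_tc_pos.
    - by near=> P => n; rewrite ncM ler_piMr ?nc_ge0.
    - case=> [|n] /=.
        rewrite (_ : (fun P => _) = cst 1); first exact: cvgC_cst.
        apply/funext => P; rewrite !expr0 !mul1r /av.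
        under eq_bigr do rewrite expr0z.
        by rewrite sumr_const card_ord mulVf.
      apply: cvg_near_cst; apply: filterS (avlim (Posz n.+1) isT) => P ->.
      by rewrite mulr0.
    move: h; rewrite (@cseries_fin _ (fun n => (n == 0%N)%:R) 1) ?big_ord1 //.
    by case.
  have [||_ h] := @tannery _ _ \oo _ (fun P n => tcoef q (Negz n) * av P (Negz n))
      (fun n => 0) _ rsum_tc_neg.
  - by near=> P => n; rewrite ncM ler_piMr ?nc_ge0.
  - move=> n; apply: cvg_near_cst; apply: filterS (avlim (Negz n) isT) => P ->.
    by rewrite mulr0.
  by move: h; rewrite (@cseries_fin _ (fun n => 0) 0) ?big_ord0.
have : (csumZ (fun n => tcoef q n * av P n) : C^o) @[P --> \oo] --> (0 : C^o).
  by under eq_cvg do rewrite s0; exact: cvgC_cst.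
move/limC; rewrite (limC _ lim1) => /eqP; by rewrite oner_eq0.
Unshelve. all: by end_near.
Qed.

(** The reference point [ee (2^-1)] is z = -1, where theta is known to be nonzero. *)
Definition Kth : C := ktheta (ee (2^-1)).

Let h01 : 0 < (2^-1 : R) < 1. Proof. by rewrite invr_gt0; lra. Qed.

(** By continuity theta(-w) stays nonzero for w near 1, so [ktheta_eq] compares w with -1. *)
Lemma ktheta_near1 : \forall w \near (1 : C^o)^',
  [/\ w != 1, annulus w & ktheta w = Kth].
Proof.
have zneq := ee_neq1 h01; have za := ee_annulus 2^-1; have tz := thetat_ee_neq0 h01.
have id1 : (w : C^o) @[w --> (1 : C^o)^'] --> (1 : C^o) by exact: cvg_within.
have z0 : ee 2^-1 != 0 by exact: annulus_neq0 za.
have FF1 : ProperFilter (1 : C^o)^' by typeclasses eauto.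
have nw : nc (w - 1) @[w --> (1 : C^o)^'] --> (0 : R).
  exact: (iffLR (@cvgCP R C _ FF1 (fun w => w) 1) id1).
have mz : (ee 2^-1 * w : C^o) @[w --> (1 : C^o)^'] --> (ee 2^-1 : C^o).
  by rewrite -{2}(mulr1 (ee 2^-1)); exact: (@cvgCZ R C _ FF1 (fun w => w) 1 id1).
have nt := @cvgC_norm R C _ FF1 _ _ (thetat_cvg FF1 z0 mz).
have t0 : 0 < nc (thetat q (ee 2^-1)) by rewrite nc_gt0.
near=> w.
have w1 : w != 1 by near: w; exact: (@nbhs_dnbhs_neq C^o).
have wk : nc (w - 1) < kap.
  have : `|nc (w - 1) - 0| < kap by near: w; move/cvgrPdistC_lt : nw; apply.
  by rewrite subr0 ger0_norm ?nc_ge0.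
have aw := near1_annulus wk.
split; [exact: w1|exact: aw|apply/esym; apply: (ktheta_eq zneq w1 za aw)].
rewrite -nc_gt0; near: w.
exact: (cvgr_gt _ nt _ t0).
Unshelve. all: by end_near.
Qed.

(** Evaluate the constant at a point of the unit circle close to 1, where both [ccoef] and theta are
    nonzero. *)
Lemma Kth_neq0 : Kth != 0.
Proof.
have /nbhs_ballP[e /= e0 h] := ktheta_near1.
have [d d0 hd] := ccoef_neq0_near1.
move: e0; rewrite ltcE /= => /andP[/eqP Ie Re0].
have [eta /andP[eta0 eta1] heta] : exists2 eta : R, 0 < eta < 1 &
    forall y, `|y| < eta -> nc (ee y - 1) < Num.min d (complex.Re e).
  by apply: ee_near1; rewrite lt_min d0.
have y01 : 0 < eta / 2 < 1 by lra.
have yw := ee_neq1 y01.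
have : nc (ee (eta / 2) - 1) < Num.min d (complex.Re e).
  by apply: heta; rewrite ger0_norm; lra.
rewrite lt_min => /andP[h1 h2].
have [|//|_ aw <-] := h (ee (eta / 2)).
  by rewrite /ball /= distrC ncE ltcE /= Ie eqxx.
have [_ c0] := hd _ h1 yw.
by rewrite /ktheta mulf_neq0 // thetat_ee_neq0.
Qed.

End KroneckerFunction.
End KroneckerTheta.
Import KroneckerTheta.

(** * Laurent coefficients of the Kronecker function on the real segment *)

Module FourierKernels.
Lemma two_pi_i_neq0 (R : realType) : two_pi_i R != 0.
Proof.
by rewrite /two_pi_i eq_complex /= negb_and mulf_neq0 ?orbT // gt_eqF ?pi_gt0.
Qed.

Lemma nc_qtau_lt1 (R : realType) (tau : R[i]) : 0 < complex.Im tau ->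
  nc (cexp (two_pi_i R * tau)) < 1.
Proof.
rewrite nc_cexp -expR0 ltr_expR /two_pi_i; case: tau => a b /= b0.
by rewrite mul0r sub0r oppr_lt0 !mulr_gt0 ?pi_gt0.
Qed.

#[local] Opaque cseries csumZ thetat ccoef cexp two_pi_i.

Section Bernoulli.

(** Course-of-values recursion: the list of earlier values is carried along. The recursion states
    that the generating series of [bern] is inverse to (e^x - 1)/x. *)
Fixpoint bern_seq (n : nat) : seq rat :=
  if n is n'.+1 then
    let s := bern_seq n' in
    rcons s ((n' == 0%N)%:R - \sum_(i < n') s`_i / (n'.+1 - i)`!%:R)
  else [::].

(* The Bernoulli number B_n divided by n!. *)
Definition bern (n : nat) : rat := (bern_seq n.+1)`_n.

Lemma size_bern_seq n : size (bern_seq n) = n.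
Proof. by elim: n => //= n IH; rewrite size_rcons IH. Qed.

Lemma nth_bern_seq n i : (i < n)%N -> (bern_seq n)`_i = bern i.
Proof.
elim: n => // n IH lt; rewrite /= nth_rcons size_bern_seq.
have [ltn|gtn|->] := ltngtP i n; first exact: IH.
  by move: lt; rewrite ltnS leqNgt gtn.
by rewrite /bern /= nth_rcons size_bern_seq ltnn eqxx.
Qed.

Lemma bernE n : bern n = (n == 0%N)%:R - \sum_(i < n) bern i / (n.+1 - i)`!%:R.
Proof.
rewrite {1}/bern /= nth_rcons size_bern_seq ltnn eqxx.
by congr (_ - _); apply: eq_bigr => i _; rewrite nth_bern_seq.
Qed.

Lemma bern_rec n : \sum_(i < n.+1) bern i / (n.+1 - i)`!%:R = (n == 0%N)%:R.
Proof. by rewrite big_ord_recr /= subSnn (_ : 1`! = 1%N) // divr1 [X in _ + X]bernE addrC subrK. Qed.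

Lemma bern0 : bern 0 = 1. Proof. by rewrite bernE big_ord0 subr0. Qed.
Lemma bern1 : bern 1 = - 2^-1.
Proof. by rewrite bernE big_ord_recl big_ord0 /= bern0 addr0 sub0r mul1r. Qed.

Lemma fact_ge2X n : (2 ^ n <= n.+1`!)%N.
Proof.
elim: n => // n IH; rewrite expnS factS; apply: leq_mul => //.
Qed.

(** A crude bound, enough for convergence when |x| < 1: as 2^n <= (n+1)!, the recursion dominates
    |b_n| by a sum of 2^(-j) over j >= 1. *)
Lemma bern_le1 n : `|bern n| <= 1.
Proof.
elim/ltn_ind: n => -[|n] IH; first by rewrite bern0 normr1.
rewrite bernE sub0r normrN.
apply: le_trans (ler_norm_sum _ _ _) _.
apply: le_trans (_ : \sum_(i < n.+1) (2^-1 : rat) ^+ (n.+1 - i) <= _).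
  apply: ler_sum => i _; rewrite normrM normfV normr_nat.
  apply: le_trans (_ : (n.+2 - i)`!%:R^-1 <= _).
    by rewrite ler_piMl ?invr_ge0 // IH.
  rewrite exprVn lef_pV2 ?posrE ?exprn_gt0 ?ltr0n ?fact_gt0 //.
  by rewrite -natrX ler_nat (subSn (ltnW (ltn_ord i))) fact_ge2X.
rewrite (reindex_inj rev_ord_inj) /=.
have -> : \sum_(i < n.+1) (2^-1 : rat) ^+ (n.+1 - (n.+1 - i.+1)) = 1 - 2^-1 ^+ n.+1.
  have e (i : 'I_n.+1) : (n.+1 - (n.+1 - i.+1) = i.+1)%N by rewrite subKn.
  under eq_bigr do rewrite e.
  elim: (n.+1) => [|m IHm]; first by rewrite big_ord0 expr0 subrr.
  by rewrite big_ord_recr /= IHm [2^-1 ^+ m.+1]exprS; field.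
by rewrite lerBlDr lerDl exprn_ge0.
Qed.

End Bernoulli.

Section Expansions.
Context {R : realType}.
Local Notation C := R[i].
Local Notation X := (two_pi_i R).

(** The entire function (e^x - 1)/x, which keeps divisions by x out of the limits at 0. *)
Definition phiexp (x : C) : C := cseries (fun n => x ^+ n / n.+1`!%:R).

Lemma asum_phiexp (x : C) : asum (fun n => x ^+ n / n.+1`!%:R).
Proof.
apply: asum_le (rsum_exp (nc_ge0 x)) => n; rewrite nc_div ncX nc_nat.
rewrite ler_wpM2l ?exprn_ge0 ?nc_ge0 // lef_pV2 ?posrE ?ltr0n ?fact_gt0 // ler_nat.
by rewrite factS leq_pmull.
Qed.

Lemma cexp_phi (x : C) : cexp x = 1 + x * phiexp x.
Proof.
rewrite cexp_series (cseries_shift (asum_cexp x)) expr0 fact0 divr1; congr (_ + _).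
rewrite /phiexp -(cseriesZ _ (asum_phiexp x)); apply: cseries_ext => n.
by rewrite exprS mulrA.
Qed.

Lemma phiexp0 : phiexp 0 = 1.
Proof.
rewrite /phiexp (@cseries_fin _ _ 1) ?big_ord1 ?expr0 ?divr1 // => -[|n] // _.
by rewrite exprS mul0r mul0r.
Qed.

Lemma phiexp_cvg (T : Type) (F : set_system T) (FF : ProperFilter F) (f : T -> C) :
  (f x : C^o) @[x --> F] --> (0 : C^o) -> (phiexp (f x) : C^o) @[x --> F] --> (1 : C^o).
Proof.
move=> f0; rewrite -phiexp0 /phiexp.
have nf := cvgC_norm FF f0; rewrite nc0 in nf.
have [||_ h] := @tannery _ _ F _ (fun x n => f x ^+ n / n.+1`!%:R)
   (fun n => 0 ^+ n / n.+1`!%:R) (fun n => 1 ^+ n / n`!%:R) (rsum_exp ler01).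
- have n1 : \forall x \near F, nc (f x) < 1 by exact: (cvgr_lt _ nf _ ltr01).
  apply: filterS n1 => x n1 n; rewrite nc_div ncX nc_nat.
  apply: ler_pM; rewrite ?exprn_ge0 ?nc_ge0 ?invr_ge0 //.
    by rewrite lerXn2r ?nnegrE ?nc_ge0 ?ler01 // ltW.
  by rewrite lef_pV2 ?posrE ?ltr0n ?fact_gt0 // ler_nat factS leq_pmull.
- move=> n.
  have pw : (f x ^+ n : C^o) @[x --> F] --> (0 ^+ n : C^o).
    elim: n => [|n IH]; first by under eq_cvg do rewrite expr0; exact: cvgC_cst.
    by under eq_cvg do rewrite exprS; rewrite exprS; exact: (cvgCM FF f0 IH).
  exact: (cvgCM FF pw (@cvgC_cst R T F FF (n.+1`!%:R^-1))).
exact: h.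
Qed.

Lemma asum_bern (x : C) : nc x < 1 -> asum (fun n => ratr (bern n) * x ^+ n).
Proof.
move=> x1; apply: asum_le (rsum_geo (x := nc x) _) => [n|]; last by rewrite nc_ge0.
rewrite ncM ncX ler_piMl ?exprn_ge0 ?nc_ge0 //.
rewrite -(fmorph_rat (real_complex R)) nc_real -ratr_norm.
by rewrite -[leRHS](rmorph1 (@ratr R)) ler_rat bern_le1.
Qed.

Lemma bern_series (x : C) : nc x < 1 ->
  cseries (fun n => ratr (bern n) * x ^+ n) * phiexp x = 1.
Proof.
move=> x1; rewrite /phiexp (cauchy_product (asum_bern x1) (asum_phiexp x)).2.
rewrite (@cseries_fin _ _ 1) ?big_ord1 //=; last first.
  move=> [|n] // _; rewrite (eq_bigr (fun i : 'I_n.+2 => x ^+ n.+1 * ratr (bern i / (n.+2 - i)`!%:R))).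
    by rewrite -mulr_sumr -rmorph_sum bern_rec rmorph0 mulr0.
  move=> i _; have hi : (i <= n.+1)%N := ltn_ord i.
  have -> : ratr (bern i / (n.+2 - i)`!%:R) = ratr (bern i) / (n.+1 - i).+1`!%:R :> C.
    by rewrite fmorph_div rmorph_nat (subSn hi).
  have -> : x ^+ n.+1 = x ^+ i * x ^+ (n.+1 - i) by rewrite -exprD subnKC.
  by move: (x ^+ i) (x ^+ (n.+1 - i)) (ratr (bern i)) (_^-1) => a b c d; ring.
by rewrite bern0 rmorph1 subnn !expr0 (_ : 1`! = 1%N) // divr1 !mul1r.
Qed.

Variable q : C.
Hypotheses (q0 : q != 0) (q1 : nc q < 1).

(** [lam k Q] is the coefficient of x^k in the sum of (e^x Q)^n over n >= 1, and [gcoef k z] is the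
    one of [Gsum q z (cexp x)]. *)
Definition lam (k : nat) (Q : C) : C := cseries (fun n => n.+1%:R ^+ k * Q ^+ n.+1 / k`!%:R).
Definition gcoef (k : nat) (z : C) : C := cseries (fun m => z ^+ m.+1 * lam k (q ^+ m.+1)).

Lemma sum_geo_le (r : R) n : 0 <= r < 1 -> \sum_(i < n) r ^+ i.+1 <= r / (1 - r).
Proof.
move=> /andP[r0 r1]; have d : 0 < 1 - r by lra.
rewrite ler_pdivlMr //.
have -> : (\sum_(i < n) r ^+ i.+1) * (1 - r) = r * (1 - r ^+ n).
  elim: n => [|n IH]; first by rewrite big_ord0 mul0r expr0 subrr mulr0.
  by rewrite big_ord_recr /= mulrDl IH !exprS; ring.
by rewrite -[leRHS]mulr1 ler_wpM2l // lerBlDr lerDl exprn_ge0.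
Qed.

Lemma asum_lam k (Q : C) : nc Q < 1 -> asum (fun n => n.+1%:R ^+ k * Q ^+ n.+1 / k`!%:R).
Proof.
move=> Q1; have Q01 : 0 <= nc Q < 1 by rewrite nc_ge0.
have h := rsum_shift (fun n => mulr_ge0 (exprn_ge0 k (ler0n R n)) (exprn_ge0 n (nc_ge0 Q)))
  (rsum_polygeo k Q01).
apply: asum_le h => n; rewrite nc_div ncM !ncX !nc_nat ler_piMr //.
  by rewrite mulr_ge0 ?exprn_ge0 ?nc_ge0.
by rewrite invf_le1 ?ltr0n ?fact_gt0 // ler1n fact_gt0.
Qed.

Lemma lam_bound k : exists2 K : R, 0 <= K & forall Q, nc Q <= nc q -> nc (lam k Q) <= K * nc Q.
Proof.
have Q01 : 0 <= nc q < 1 by rewrite nc_ge0.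
have h := rsum_shift (fun n => mulr_ge0 (exprn_ge0 k (ler0n R n)) (exprn_ge0 n (nc_ge0 q)))
  (rsum_polygeo k Q01).
have [M hM] := h; have M0 : 0 <= M by have := hM 0%N; rewrite big_ord0.
have nq0 : 0 < nc q by rewrite nc_gt0.
exists (M / nc q) => [|Q le]; first by rewrite divr_ge0 ?nc_ge0.
rewrite /lam; apply: nc_cseries_le => n.
apply: le_trans (_ : (\sum_(i < n) i.+1%:R ^+ k * nc q ^+ i.+1) / nc q * nc Q <= _); last first.
  by rewrite ler_wpM2r ?nc_ge0 // ler_wpM2r ?invr_ge0 ?nc_ge0.
rewrite !mulr_suml; apply: ler_sum => i _.
rewrite nc_div ncM !ncX !nc_nat.
apply: le_trans (_ : i.+1%:R ^+ k * nc Q ^+ i.+1 <= _).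
  rewrite ler_piMr //; first by rewrite mulr_ge0 ?exprn_ge0 ?nc_ge0.
  by rewrite invf_le1 ?ltr0n ?fact_gt0 // ler1n fact_gt0.
rewrite -!mulrA ler_wpM2l ?exprn_ge0 // exprSr mulrA exprSr mulfK ?gt_eqF //.
by rewrite ler_wpM2r ?nc_ge0 // lerXn2r ?nnegrE ?nc_ge0.
Qed.

Lemma lam_expand (Q x : C) : nc Q * expR (nc x) < 1 ->
  cseries (fun n => cexp x ^+ n.+1 * Q ^+ n.+1) = cseries (fun k => x ^+ k * lam k Q) /\
  forall n, \sum_(k < n) nc (x ^+ k * lam k Q) <=
     nc Q * expR (nc x) / (1 - nc Q * expR (nc x)).
Proof.
set r := nc Q * expR (nc x) => r1.
have r0 : 0 <= r by rewrite mulr_ge0 ?nc_ge0 ?expR_ge0.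
pose u (n k : nat) : C := Q ^+ n.+1 * (n.+1%:R * x) ^+ k / k`!%:R.
have hs n k : \sum_(j < k) nc (u n j) <= r ^+ n.+1.
  apply: le_trans (_ : nc Q ^+ n.+1 * (\sum_(j < k) (n.+1%:R * nc x) ^+ j / j`!%:R) <= _).
    rewrite mulr_sumr; apply: ler_sum => j _.
    by rewrite /u nc_div ncM !ncX ncM !nc_nat mulrA.
  rewrite /r exprMn ler_wpM2l ?exprn_ge0 ?nc_ge0 //.
  rewrite -expRM_natl.
  have x0 : 0 <= n.+1%:R * nc x by rewrite mulr_ge0 ?nc_ge0.
  exact: exp_partial_le.
have hM n : \sum_(i < n) r ^+ i.+1 <= r / (1 - r) by apply: sum_geo_le; rewrite r0.
have rs : rsum (fun n => r ^+ n.+1) by exists (r / (1 - r)).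
have e2 k : cseries (u^~ k) = x ^+ k * lam k Q.
  have [_ a2 _ _ _] := exchange_cseries hs rs.
  have Q1 : nc Q < 1.
    by apply: le_lt_trans r1; rewrite /r ler_peMr ?nc_ge0 // -expR0 ler_expR nc_ge0.
  rewrite /lam -(cseriesZ _ (asum_lam k Q1)).
  by apply: cseries_ext => n; rewrite /u exprMn; ring.
split.
  have [_ _ _ _ e] := exchange_cseries hs rs.
  rewrite -(cseries_ext e2) -e; apply: cseries_ext => n.
  have -> : cseries (u n) = Q ^+ n.+1 * cseries (fun k => (n.+1%:R * x) ^+ k / k`!%:R).
    by rewrite -(cseriesZ _ (asum_cexp _)); apply: cseries_ext => k; rewrite mulrA.
  by rewrite -cexp_series mulrC -cexpMn mulr_natl.
by move=> n; under eq_bigr do rewrite -e2; exact: (exchange_bound hs hM).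
Qed.

Lemma nc_qX m : nc (q ^+ m.+1) <= nc q.
Proof. by rewrite ncX exprS ler_piMr ?nc_ge0 // exprn_ile1 ?nc_ge0 // ltW. Qed.

Lemma asum_gcoef k (z : C) : nc z = 1 -> asum (fun m => z ^+ m.+1 * lam k (q ^+ m.+1)).
Proof.
move=> z1; have [K K0 hK] := lam_bound k.
have : rsum (fun n => K * nc q ^+ n).
  by apply: rsumZ => //; apply: rsum_geo; rewrite nc_ge0.
apply: asum_le => m; rewrite ncM ncX z1 expr1n mul1r.
apply: le_trans (hK _ (nc_qX m)) _; rewrite ler_wpM2l // ncX exprSr ler_piMr ?exprn_ge0 ?nc_ge0 //.
exact: ltW.
Qed.

Lemma Gsum_expand (z x : C) : nc z = 1 -> nc q * expR (nc x) < 1 ->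
  asum (fun k => x ^+ k * gcoef k z) /\
  Gsum q z (cexp x) = cseries (fun k => x ^+ k * gcoef k z).
Proof.
move=> z1; set r := nc q * expR (nc x) => r1.
have r0 : 0 <= r by rewrite mulr_ge0 ?nc_ge0 ?expR_ge0.
have qm m : nc (q ^+ m.+1) * expR (nc x) = nc q ^+ m * r.
  by rewrite ncX exprSr /r mulrA.
have qmr m : nc (q ^+ m.+1) * expR (nc x) <= r.
  by rewrite /r ler_wpM2r ?expR_ge0 // nc_qX.
have L m := lam_expand (le_lt_trans (qmr m) r1).
pose u (m k : nat) : C := z ^+ m.+1 * (x ^+ k * lam k (q ^+ m.+1)).
have hs m n : \sum_(k < n) nc (u m k) <= r / (1 - r) * nc q ^+ m.
  apply: le_trans (_ : \sum_(k < n) nc (x ^+ k * lam k (q ^+ m.+1)) <= _).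
    by apply: ler_sum => k _; rewrite /u ncM ncX z1 expr1n mul1r.
  apply: le_trans ((L m).2 n) _; rewrite qm -[_ * r / _]mulrA [leRHS]mulrC.
  rewrite ler_wpM2l ?exprn_ge0 ?nc_ge0 // ler_wpM2l //.
  have d : 0 < 1 - r by lra.
  have : nc q ^+ m * r <= r by rewrite ler_piMl // exprn_ile1 ?nc_ge0 // ltW.
  by move=> h; rewrite lef_pV2 ?posrE; lra.
have rs : rsum (fun m => r / (1 - r) * nc q ^+ m).
  apply: rsumZ; first by rewrite divr_ge0 //; lra.
  by apply: rsum_geo; rewrite nc_ge0.
have [a1 a2 a3 a4 e] := exchange_cseries hs rs.
have e2 k : cseries (u^~ k) = x ^+ k * gcoef k z.
  rewrite /gcoef -(cseriesZ _ (asum_gcoef k z1)).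
  by apply: cseries_ext => m; rewrite /u mulrCA.
split.
  have -> : (fun k => x ^+ k * gcoef k z) = (fun k => cseries (u^~ k)).
    by apply/funext => k; rewrite e2.
  exact: a4.
rewrite -(cseries_ext e2) -e /Gsum; apply: cseries_ext => m.
rewrite /u (cseriesZ _ (_ : asum (fun k => x ^+ k * lam k (q ^+ m.+1)))); last first.
  by exists (nc (q ^+ m.+1) * expR (nc x) / (1 - nc (q ^+ m.+1) * expR (nc x))); exact: (L m).2.
rewrite -(L m).1 -cseriesZ; last first.
  have r01 : 0 <= nc (q ^+ m.+1) * expR (nc x) < 1.
    by rewrite (le_lt_trans (qmr m) r1) andbT mulr_ge0 ?nc_ge0 ?expR_ge0.
  apply: asum_le (_ : rsum (fun n => (nc (q ^+ m.+1) * expR (nc x)) ^+ n.+1)) => [n|]; last first.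
    by eexists => n; exact: sum_geo_le.
  rewrite ncM ncX [nc (_ ^+ n.+1 )]ncX nc_cexp mulrC exprMn.
  apply: (ler_wpM2l (exprn_ge0 _ (nc_ge0 _))).
  apply: (lerXn2r _ (expR_ge0 _) (expR_ge0 _)); rewrite ler_expR.
  exact: le_trans (ler_norm _) (nc_Re _).
by apply: cseries_ext => n; rewrite -mulrA -exprM.
Qed.

End Expansions.

#[local] Opaque Gsum Kth gcoef lam phiexp.

Section FourierKernel.
Context {R : realType}.
Local Notation C := R[i].
Local Notation X := (two_pi_i R).
Variable tau : C.
Hypothesis tau0 : 0 < complex.Im tau.

Definition qtau : C := cexp (X * tau).
Local Notation q := qtau.

Lemma qtau_neq0 : q != 0. Proof. exact: cexp_neq0. Qed.
Lemma qtau_lt1 : nc q < 1. Proof. exact: nc_qtau_lt1. Qed.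
Let q0 := qtau_neq0.
Let q1 := qtau_lt1.
Let X_neq0 := two_pi_i_neq0 R.

(** The factor q^(1/8) left over from (n + 1/2)^2 / 2 = n(n+1)/2 + 1/8. *)
Definition q8 : C := cexp (X * tau / 8).

Lemma tri_natr n : 'C(n.+1, 2)%:R * 2 = n%:R * (n%:R + 1) :> C.
Proof.
elim: n => [|n IH]; first by rewrite !mul0r.
by rewrite binS bin1 natrD mulrDl IH -natr1; ring.
Qed.

Lemma theta_exponent_pos n : X * tau * (2^-1 * ((Posz n)%:~R + 2^-1) ^+ 2) =
  (X * tau) *+ 'C(n.+1, 2) + X * tau / 8.
Proof.
rewrite -pmulrn -[_ *+ 'C(_, _)]mulr_natr.
have -> : 'C(n.+1, 2)%:R = n%:R * (n%:R + 1) / 2 :> C by rewrite -tri_natr mulfK // pnatr_eq0.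
by field.
Qed.

Lemma theta_exponent_neg n : X * tau * (2^-1 * ((Negz n)%:~R + 2^-1) ^+ 2) =
  (X * tau) *+ 'C(n.+1, 2) + X * tau / 8.
Proof.
rewrite NegzE mulrNz -pmulrn -[_ *+ 'C(_, _)]mulr_natr.
have -> : 'C(n.+1, 2)%:R = n%:R * (n%:R + 1) / 2 :> C by rewrite -tri_natr mulfK // pnatr_eq0.
by rewrite -natr1; field.
Qed.

Lemma theta_factor (n : int) :
  (-1) ^ n * cexp (X * tau * (2^-1 * (n%:~R + 2^-1) ^+ 2)) = q8 * tcoef q n.
Proof.
case: n => n.
  by rewrite theta_exponent_pos cexpD cexpMn -exprnP /tcoef /q8 /qtau; ring.
have -> : (-1) ^ Negz n = - (-1) ^+ n :> C by rewrite NegzE -exprnN -exprVn invrN1 exprS mulN1r.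
rewrite theta_exponent_neg cexpD cexpMn /tcoef /q8 /qtau.
by ring.
Qed.

Lemma theta_term (n : int) (xi : C) :
  (-1) ^ n * cexp (X * tau * (2^-1 * (n%:~R + 2^-1) ^+ 2)) * cexp ((n%:~R + 2^-1) * X * xi) =
  q8 * cexp (X * xi / 2) * (tcoef q n * cexp (X * xi) ^ n).
Proof.
have e : cexp ((n%:~R + 2^-1) * X * xi) = cexp (X * xi) ^ n * cexp (X * xi / 2).
  rewrite -cexpMz -cexpD; congr cexp; rewrite -mulrzr; ring.
transitivity (q8 * tcoef q n * (cexp (X * xi) ^ n * cexp (X * xi / 2))).
  by congr (_ * _); [exact: theta_factor|exact: e].
by move: (cexp (X * xi / 2)) (cexp (X * xi) ^ n) (tcoef q n) q8 => a b c d; ring.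
Qed.

Lemma theta_thetat (xi : C) : theta tau xi = q8 * cexp (X * xi / 2) * thetat q (cexp (X * xi)).
Proof.
rewrite /theta thetatE -(zsumZ _ (zasum_thetat q1 _)).
by apply: zsum_ext => n; rewrite theta_term.
Qed.

Lemma id_dnbhs0 : (a : C^o) @[a --> (0 : C^o)^'] --> (0 : C^o).
Proof. exact: cvg_within. Qed.

Let FF0 : ProperFilter (0 : C^o)^'. Proof. by typeclasses eauto. Qed.

Lemma Xa_cvg : (X * a : C^o) @[a --> (0 : C^o)^'] --> (0 : C^o).
Proof.
by rewrite -{2}(mulr0 X); exact: (@cvgCZ R C _ FF0 (fun w => w) 0 id_dnbhs0).
Qed.

Lemma phi_cvg : (phiexp (X * a) : C^o) @[a --> (0 : C^o)^'] --> (1 : C^o).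
Proof. exact: (phiexp_cvg FF0 Xa_cvg). Qed.

Lemma cexpX_cvg : (cexp (X * a) : C^o) @[a --> (0 : C^o)^'] --> (1 : C^o).
Proof.
under eq_cvg do rewrite cexp_phi.
have h := cvgCD FF0 (@cvgC_cst R C _ FF0 1) (cvgCM FF0 Xa_cvg phi_cvg).
by rewrite mul0r addr0 in h; exact: h.
Qed.

Lemma near_neq0 : \forall a \near (0 : C^o)^', a != 0.
Proof. exact: (@nbhs_dnbhs_neq C^o). Qed.

Lemma near_phi_neq0 : \forall a \near (0 : C^o)^', phiexp (X * a) != 0.
Proof.
have nt := cvgC_norm FF0 phi_cvg.
have t0 : 0 < nc (1 : C) by rewrite nc1.
have h := @cvgr_gt _ _ _ FF0 _ _ nt _ t0.
by near=> a; rewrite -nc_gt0; near: a.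
Unshelve. all: by end_near.
Qed.

Lemma cexpX_dnbhs (P : set C) : (\forall w \near (1 : C^o)^', P w) ->
  \forall a \near (0 : C^o)^', P (cexp (X * a)).
Proof.
move=> /nbhs_ballP[e /= e0 h].
have /cvgrPdist_lt/(_ e e0) h2 := cexpX_cvg.
have h3 := near_neq0; have h4 := near_phi_neq0.
apply: filterS3 h2 h3 h4 => a d a0 p0.
apply: h; first exact: d.
rewrite cexp_phi -subr_eq0 addrC addKr.
by rewrite !mulf_neq0 // X_neq0.
Qed.

Lemma kron_near : \forall a \near (0 : C^o)^',
  [/\ cexp (X * a) != 1, annulus q (cexp (X * a)), ccoef q (cexp (X * a)) 0 != 0 &
   thetat q (cexp (X * a)) = Kth q / ccoef q (cexp (X * a)) 0].
Proof.
have K0 := Kth_neq0 q0 q1.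
have := cexpX_dnbhs (ktheta_near1 q0 q1); apply: filterS => a [w1 aw k].
have c0 : ccoef q (cexp (X * a)) 0 != 0.
  by apply: contraNneq K0 => c0; rewrite -k /ktheta c0 mul0r.
split; [exact: w1|exact: aw|exact: c0|].
move: k c0; rewrite /ktheta; move: (thetat q _) (ccoef q _ 0) (Kth q) => u v r <- v0.
by rewrite mulrAC divff // mul1r.
Qed.

(** Near 0 theta is q^(1/8) e^(Xh/2) [Kth] / c(w) with w = e^(Xh). Since (1-w) c(w) -> 1 and 1-w =
    -Xh [phiexp] (Xh), the difference quotient has the stated limit. *)
Lemma theta'0E : theta'0 tau = - (q8 * X * Kth q).
Proof.
have thE (h : C) : theta tau h = q8 * cexp (X * h / 2) * thetat q (cexp (X * h)) by exact: theta_thetat.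
have th0 : theta tau 0 = 0.
  by rewrite (thE 0) mulr0 mul0r cexp0 (thetat1 q1) mulr0.
have c2 : (cexp (X * h / 2) : C^o) @[h --> (0 : C^o)^'] --> (1 : C^o).
  have x2 : (2^-1 * (X * a) : C^o) @[a --> (0 : C^o)^'] --> (0 : C^o).
    by rewrite -{2}(mulr0 (2^-1 : C)); exact: (cvgCZ FF0 Xa_cvg).
  have h := cvgCD FF0 (@cvgC_cst R C _ FF0 1) (cvgCM FF0 x2 (phiexp_cvg FF0 x2)).
  rewrite mul0r addr0 in h.
  by under eq_cvg do rewrite mulrC cexp_phi; exact: h.
have cl : ((1 - cexp (X * a)) * ccoef q (cexp (X * a)) 0 : C^o) @[a --> (0 : C^o)^'] --> (1 : C^o).
  apply/cvgrPdist_lt => e e0.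
  have /cvgrPdist_lt/(_ e e0) h := ccoef_lim q0 q1.
  exact: (cexpX_dnbhs h).
have lim : (q8 * Kth q * - X * (cexp (X * h / 2) * phiexp (X * h) *
   ((1 - cexp (X * h)) * ccoef q (cexp (X * h)) 0)^-1) : C^o) @[h --> (0 : C^o)^'] -->
   (- (q8 * X * Kth q) : C^o).
  have h := @cvgCZ R C _ FF0 _ _ (cvgCM FF0 (cvgCM FF0 c2 phi_cvg) (cvgCV FF0 cl (oner_neq0 _)))
     (q8 * Kth q * - X).
  have e : q8 * Kth q * - X * (1 * 1 * 1^-1) = - (q8 * X * Kth q).
    by rewrite invr1; move: (Kth q) q8 X => a b c; ring.
  by rewrite e in h; exact: h.
rewrite /theta'0 /derive1; apply: (cvg_lim (@norm_hausdorff _ C^o)).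
apply: cvg_trans lim; apply: near_eq_cvg.
have h1 := kron_near; have h2 := near_neq0; have h3 := near_phi_neq0.
apply: filterS3 h1 h2 h3 => h [w1 aw c0 tk] h0 p0.
rewrite th0 subr0 addr0 thE tk.
have -> : 1 - cexp (X * h) = - (X * h * phiexp (X * h)).
  by rewrite [in LHS]cexp_phi opprD addrA subrr sub0r.
have X0 := X_neq0.
rewrite [RHS]/GRing.scale /=.
move: (ccoef q (cexp (X * h)) 0) c0 (cexp (X * h / 2)) (phiexp (X * h)) p0 {w1 aw tk}.
move: (Kth q) q8 X X0 => d e f X0 c c0 a b p0.
by field; rewrite h0 c0 p0 X0.
Qed.

(** The unknown constant [Kth] enters through theta'(0) and through theta(alpha), and cancels. *)
Lemma kroneckerF_Ssum (x : R) : 0 < x < 1 -> \forall a \near (0 : C^o)^',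
  kroneckerF tau x%:C a = - X * Ssum q (ee x) (cexp (X * a)).
Proof.
move=> x01; have h1 := kron_near; have h2 := near_neq0.
have tx := thetat_ee_neq0 q0 q1 x01; have K0 := Kth_neq0 q0 q1; have X0 := X_neq0.
have Q0 : q8 != 0 by exact: cexp_neq0.
apply: filterS2 h1 h2 => a [w1 aw c0 tk] a0.
have := theta_Ssum q0 q1 (ee_neq1 x01) w1 (ee_annulus q1 x) aw => tS.
rewrite /kroneckerF theta'0E !theta_thetat tk.
have -> : cexp (X * x%:C) = ee x by [].
have -> : cexp (X * (x%:C + a)) = ee x * cexp (X * a) by rewrite mulrDr cexpD.
have -> : cexp (X * (x%:C + a) / 2) = cexp (X * x%:C / 2) * cexp (X * a / 2).
  by rewrite -cexpD; congr cexp; ring.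
have e1 : cexp (X * x%:C / 2) != 0 by exact: cexp_neq0.
have e2 : cexp (X * a / 2) != 0 by exact: cexp_neq0.
have -> : thetat q (ee x * cexp (X * a)) = thetat q (ee x) * Ssum q (ee x) (cexp (X * a)) /
   ccoef q (cexp (X * a)) 0.
  by rewrite tS mulrAC divff // mul1r.
move: (cexp (X * x%:C / 2)) (cexp (X * a / 2)) e1 e2 => e1 e2 e10 e20.
move: (thetat q (ee x)) (ccoef q (cexp (X * a)) 0) (Kth q) q8 X (Ssum _ _ _) tx c0 K0 Q0 X0 {tS tk}.
move=> t c k p f S tx c0 K0 Q0 X0.
by field; rewrite e10 e20 tx c0 K0 Q0.
Qed.

(** Coefficient of alpha^(k-1) in -X [Ssum] z e^(X alpha): the summand 1/(1-w) gives the Bernoulli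
    term, z/(1-z) contributes only to k = 1, and the two double series enter with index shifted by
    one. *)
Definition fcoef (k : nat) (z : C) : C :=
  X ^+ k * ratr (bern k) + (if k == 1%N then - (X * (z / (1 - z))) else 0)
  - (if k is k'.+1 then X ^+ k * (gcoef q k' z - (-1) ^+ k' * gcoef q k' z^-1) else 0).

Lemma near_small (e : R) : 0 < e -> \forall a \near (0 : C^o)^', nc (X * a) < e.
Proof.
move=> e0; have nt := cvgC_norm FF0 Xa_cvg; rewrite nc0 in nt.
exact: (@cvgr_lt _ _ _ FF0 _ _ nt _ e0).
Qed.

Lemma small_exp : exists2 e : R, 0 < e & forall y, 0 <= y < e -> nc q * expR y < 1.
Proof.
have nq0 : 0 < nc q by rewrite nc_gt0.
exists (- ln (nc q)) => [|y /andP[y0 ye]]; first by rewrite oppr_gt0 ln_lt0 // nq0.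
rewrite -(lnK (x := nc q)) ?posrE // -expRD -expR0 ltr_expR; lra.
Qed.

Lemma fcoef_expand (x : R) : 0 < x < 1 -> laurent_expansion tau x%:C (fcoef^~ (ee x)).
Proof.
move=> x01; rewrite /laurent_expansion.
have [e e0 he] := small_exp.
have zn : nc (ee x) = 1 by exact: nc_ee.
have znV : nc (ee x)^-1 = 1 by rewrite ncV zn invr1.
have h1 := kroneckerF_Ssum x01; have h2 := near_neq0.
have h3 := near_small e0; have h4 := near_small ltr01; have h5 := kron_near.
have h34 : \forall a \near (0 : C^o)^', nc (X * a) < e /\ nc (X * a) < 1 by exact: (filterI h3 h4).
apply: filterS2 (filterI h1 h34) (filterI h2 h5) => a [kF [a1 a2]] [a0 [w1 _ _ _]].
(* On the real segment r = 0, so the exponential correction factor is 1. *)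
have -> : tau_coord tau x%:C = 0 by rewrite /tau_coord /= mul0r.
rewrite mulr0 mul0r cexp0 mul1r kF.
set y := X * a.
have y0 : y != 0 by rewrite mulf_neq0 // X_neq0.
have r1 : nc q * expR (nc y) < 1 by apply: he; rewrite nc_ge0.
have r1' : nc q * expR (nc (- y)) < 1 by rewrite ncN.
have [g1 e1] := Gsum_expand q0 q1 zn r1.
have [g2 e2] := Gsum_expand q0 q1 znV r1'.
rewrite cexpNV in e2.
pose G k := y ^+ k * gcoef q k (ee x) - (- y) ^+ k * gcoef q k (ee x)^-1.
have aG : asum G by apply: asumD => //; exact: asumN.
have sG : cseries G = Gsum q (ee x) (cexp y) - Gsum q (ee x)^-1 (cexp y)^-1.
  transitivity (cseries (fun k => y ^+ k * gcoef q k (ee x)) -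
     cseries (fun k => (- y) ^+ k * gcoef q k (ee x)^-1)); first exact: (cseriesB g1 g2).
  by congr (_ - _); [exact: (esym e1)|exact: (esym e2)].
pose H (k : nat) : C := if k is k'.+1 then y * G k' else 0.
have aH : asum H by apply: asum_unshift; exact: asumZ.
have sH : cseries H = y * cseries G by rewrite (cseries_shift aH) add0r /= cseriesZ.
pose D (k : nat) : C := if k == 1%N then - (y * (ee x / (1 - ee x))) else 0.
have aD : asum D.
  by do 2![apply: asum_unshift]; exists 0 => n; rewrite big1 // => i _; rewrite /D /= nc0.
have sD : cseries D = - (y * (ee x / (1 - ee x))).
  rewrite (@cseries_fin _ _ 2) => [|[|[|n]]] //.
  by rewrite !big_ord_recl big_ord0 /D /= add0r addr0.
have aB := asum_bern a2.
have eT k : fcoef k (ee x) * a ^+ k = ratr (bern k) * y ^+ k + D k - H k.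
  rewrite /fcoef /D /H /G; case: k => [|k].
    by rewrite !expr0 /= !subr0 !addr0 mulr1 mul1r mulr1.
  have ya : y ^+ k.+1 = X ^+ k.+1 * a ^+ k.+1 by rewrite exprMn.
  rewrite mulrBl mulrDl; congr (_ + _ - _).
  - by rewrite ya; move: (X ^+ _) (a ^+ _) (ratr _) => u v r; ring.
  - by case: k {ya} => [|k] /=; rewrite ?mul0r // expr1 /y; move: X (ee x / _) => u v; ring.
  - rewrite (exprNn y); move: (gcoef q k (ee x)) (gcoef q k (ee x)^-1) ((-1) ^+ k) => u v s.
    transitivity (y ^+ k.+1 * (u - s * v)); first by rewrite ya mulrAC.
    by rewrite exprS; move: (y ^+ k) => m; ring.
have aT : asum (fun k => fcoef k (ee x) * a ^+ k).
  have : asum (fun k => ratr (bern k) * y ^+ k + D k - H k).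
    by apply: asumD; [exact: asumD|exact: asumN].
  by apply: rsum_le => k; rewrite eT.
have sT : cseries (fun k => fcoef k (ee x) * a ^+ k) = a * (- X * Ssum q (ee x) (cexp y)).
  rewrite (cseries_ext eT) cseriesB //; last exact: asumD.
  rewrite cseriesD // sD sH sG.
  have bs := bern_series a2; rewrite -/y in bs.
  have wy := cexp_phi y.
  have p0 : phiexp y != 0.
    by apply/eqP => p0; move: bs; rewrite p0 mulr0 => /eqP; rewrite eq_sym oner_eq0.
  have -> : cseries (fun n => ratr (bern n) * y ^+ n) = (phiexp y)^-1.
    by apply: (mulIf p0); rewrite bs mulVf.
  have w1' : 1 - cexp y != 0 by rewrite subr_eq0 eq_sym.
  have pe : (phiexp y)^-1 = - y * (1 - cexp y)^-1.
    have -> : 1 - cexp y = - (y * phiexp y) by rewrite wy opprD addrA subrr sub0r.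
    by rewrite invrN mulrNN invfM mulrA divff // mul1r.
  rewrite pe /Ssum.
  move: (Gsum q (ee x) (cexp y)) (Gsum q (ee x)^-1 (cexp y)^-1) ((1 - cexp y)^-1) (ee x / (1 - ee x)) => u v r s.
  by rewrite /y; move: X => f; ring.
have eaW (W : C) : a^-1 * (a * W) = W by rewrite mulrA mulVf ?mul1r.
have hT := asum_cvg aT; rewrite sT in hT.
have FFo : Filter (\oo : set_system nat) by typeclasses eauto.
have hZ := @cvgCZ R nat \oo FFo (fun n => series (fun k => fcoef k (ee x) * a ^+ k : C^o) n) _ hT a^-1.
rewrite eaW in hZ.
have eS n : series (fun k : nat => fcoef k (ee x) * a ^ (k%:Z - 1) : C^o) n =
   a^-1 * series (fun k => fcoef k (ee x) * a ^+ k : C^o) n; last first.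
  by under eq_cvg do rewrite eS; exact: hZ.
rewrite !seriesEord /= mulr_sumr; apply: eq_bigr => k _.
by rewrite expfzDr // -exprnP exprN1; move: (fcoef _ _) (a ^+ _) (a^-1) => u v r; ring.
Qed.

End FourierKernel.

Section Uniqueness.
Context {R : realType}.
Local Notation C := R[i].

(** If all earlier coefficients vanish, evaluating at t = s r bounds |d_k| r^k by 2 B s for all
    small s > 0, hence by 0. Positive real arguments suffice. *)
Lemma power_series_zero (d : nat -> C) (r : R) : 0 < r ->
  (forall t : R, 0 < t <= r ->
    series (fun k : nat => d k * t%:C ^ (k%:Z - 1) : C^o) @ \oo --> (0 : C^o)) ->
  forall k, d k = 0.
Proof.
move=> r0 h.
(* The terms of the series convergent at t = r tend to 0 and are therefore bounded. *)
have [B B0 hB] : exists2 B : R, 0 <= B & forall k, nc (d k) * r ^+ k <= B.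
  have rr : 0 < r <= r by rewrite r0 lexx.
  have := h _ rr => h0.
  have c0 : cvgn (series (fun k : nat => complex.Re (d k * r%:C ^ (k%:Z - 1)))).
    apply/cvg_ex; exists 0.
    have := cvgC_Re _ (u := fun n => series (fun k : nat => d k * r%:C ^ (k%:Z - 1) : C^o) n) h0.
    by under eq_cvg do rewrite Re_series; exact.
  have c1 : cvgn (series (fun k : nat => complex.Im (d k * r%:C ^ (k%:Z - 1)))).
    apply/cvg_ex; exists 0.
    have := cvgC_Im _ (u := fun n => series (fun k : nat => d k * r%:C ^ (k%:Z - 1) : C^o) n) h0.
    by under eq_cvg do rewrite Im_series; exact.
  have b0 := cvg_series_cvg_0 c0; have b1 := cvg_series_cvg_0 c1.
  have [B1 [_ hB1]] := cvg_seq_bounded (cvgP _ b0).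
  have [B2 [_ hB2]] := cvg_seq_bounded (cvgP _ b1).
  have H1 k : `|complex.Re (d k * r%:C ^ (k%:Z - 1))| <= `|B1| + 1.
    by apply: (hB1 (`|B1| + 1)) => //; apply: le_lt_trans (ler_norm _) _; rewrite ltrDl.
  have H2 k : `|complex.Im (d k * r%:C ^ (k%:Z - 1))| <= `|B2| + 1.
    by apply: (hB2 (`|B2| + 1)) => //; apply: le_lt_trans (ler_norm _) _; rewrite ltrDl.
  exists (r * (`|B1| + 1 + (`|B2| + 1))); first by rewrite mulr_ge0 ?addr_ge0 // ltW.
  move=> k; have hle := nc_ReIm (d k * r%:C ^ (k%:Z - 1)).
  have rn0 : r%:C != 0 :> C by rewrite -nc_gt0 nc_real ger0_norm //; exact: ltW.
  have hle2 : nc (d k * r%:C ^ (k%:Z - 1)) <= `|B1| + 1 + (`|B2| + 1).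
    by apply: le_trans hle _; apply: lerD; [exact: H1|exact: H2].
  have e : nc (d k * r%:C ^ (k%:Z - 1)) = nc (d k) * r ^+ k / r.
    rewrite ncM expfzDr // ncM exprN1 ncV -exprnP ncX nc_real ger0_norm; last exact: ltW.
    by rewrite mulrA.
  by move: hle2; rewrite e ler_pdivrMr // [leRHS]mulrC.
move=> k; elim/ltn_ind: k => k IH.
have bound (s : R) : 0 < s <= 2^-1 -> nc (d k) * r ^+ k <= 2 * B * s.
  move=> /andP[s0 s1].
  have s01 : 0 <= s < 1 by lra.
  have tr : 0 < s * r <= r by rewrite mulr_gt0 //= ler_piMl; lra.
  have t0 : (s * r)%:C != 0 :> C by rewrite -nc_gt0 nc_real ger0_norm; [case/andP: tr|apply: ltW; case/andP: tr].
  have au : asum (fun j => d j * (s * r)%:C ^+ j).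
    apply: asum_le (rsumZ B0 (rsum_geo s01)) => j.
    rewrite ncM ncX nc_real ger0_norm; last by apply: ltW; case/andP: tr.
    rewrite exprMn mulrCA [B * _]mulrC.
    by apply: ler_wpM2l; [apply: exprn_ge0; lra|exact: hB].
  have z0 : cseries (fun j => d j * (s * r)%:C ^+ j) = 0.
    apply: cseriesP; have := h _ tr => h0.
    have FFo : Filter (\oo : set_system nat) by typeclasses eauto.
    have h1 := @cvgCZ R nat \oo FFo (fun n => series (fun k : nat => d k * (s * r)%:C ^ (k%:Z - 1) : C^o) n) _ h0 (s * r)%:C.
    rewrite mulr0 in h1.
    have e2 n : series (fun j => d j * (s * r)%:C ^+ j : C^o) n =
       (s * r)%:C * series (fun k : nat => d k * (s * r)%:C ^ (k%:Z - 1) : C^o) n; last first.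
      by under eq_cvg do rewrite e2; exact: h1.
    apply/esym; rewrite !seriesEord /= mulr_sumr; apply: eq_bigr => j _.
    rewrite expfzDr // -exprnP exprN1 mulrCA; congr (_ * _).
    by rewrite mulrCA divff // mulr1.
  have : d k * (s * r)%:C ^+ k + cseries (fun j => d (k.+1 + j)%N * (s * r)%:C ^+ (k.+1 + j)) = 0.
    rewrite -z0.
    have sp : forall m, cseries (fun j => d j * (s * r)%:C ^+ j) =
       \sum_(j < m) d j * (s * r)%:C ^+ j + cseries (fun j => d (m + j)%N * (s * r)%:C ^+ (m + j)).
      elim=> [|m IHm]; first by rewrite big_ord0 add0r.
      rewrite IHm big_ord_recr /= -addrA; congr (_ + _).
      rewrite cseries_shift ?addn0; last first.
        elim: m {IHm} => [//|m IHm]; have := asum_shift IHm.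
        by apply: rsum_le => j; rewrite addnS addSn.
      by congr (_ + _); apply: cseries_ext => j; rewrite addnS addSn.
    rewrite (sp k.+1) big_ord_recr /= big1 ?add0r // => j _.
    by rewrite IH // mul0r.
  move=> /eqP; rewrite addr_eq0 => /eqP e.
  have : nc (d k * (s * r)%:C ^+ k) <= 2 * B * s * s ^+ k.
    rewrite e ncN; apply: nc_cseries_le => n.
    apply: le_trans (_ : B * s ^+ k * (\sum_(i < n) s ^+ i.+1) <= _).
      rewrite mulr_sumr; apply: ler_sum => i _.
      rewrite ncM ncX nc_real ger0_norm; last by apply: ltW; case/andP: tr.
      rewrite exprMn mulrCA -[leRHS]mulrA -exprD addnS -addSn [B * _]mulrC.
      by apply: ler_wpM2l; [apply: exprn_ge0; lra|exact: hB].
    apply: le_trans (_ : B * s ^+ k * (s / (1 - s)) <= _).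
      by rewrite ler_wpM2l ?sum_geo_le // mulr_ge0 ?exprn_ge0 //; lra.
    rewrite (_ : 2 * B * s * s ^+ k = B * s ^+ k * (2 * s)); last by ring.
    rewrite ler_wpM2l ?mulr_ge0 ?exprn_ge0 //; first by lra.
    have d1 : 0 < 1 - s by lra.
    by rewrite ler_pdivrMr //; nra.
  rewrite ncM ncX nc_real ger0_norm; last by apply: ltW; case/andP: tr.
  rewrite exprMn mulrCA mulrC ler_pM2r ?exprn_gt0 //.
have : nc (d k) * r ^+ k <= 0.
  apply/ler_addgt0Pr => e e0; rewrite add0r.
  pose s := Num.min 2^-1 (e / (2 * B + 1)).
  have B1 : 0 < 2 * B + 1 by lra.
  have s0 : 0 < s by rewrite lt_min divr_gt0 // invr_gt0; lra.
  have := bound s; rewrite s0 ge_min lexx /= => /(_ isT) /le_trans; apply.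
  apply: le_trans (_ : (2 * B + 1) * s <= _); first by rewrite ler_wpM2r ?(ltW s0); lra.
  by rewrite mulrC -ler_pdivlMr // ge_min lexx orbT.
rewrite pmulr_lle0 ?exprn_gt0 // => le0; apply/eqP; rewrite -nc_eq0.
by rewrite eq_le le0 nc_ge0.
Qed.

Lemma laurent_unique (tau xi : C) (c c' : nat -> C) :
  laurent_expansion tau xi c -> laurent_expansion tau xi c' -> c = c'.
Proof.
move=> h1 h2.
have h12 : nbhs (0 : C^o)^' (fun a : C =>
   (series (fun k : nat => c k * a ^ (k%:Z - 1) : C^o) @ \oo -->
      (cexp (two_pi_i R * (tau_coord tau xi)%:C * a) * kroneckerF tau xi a : C^o)) /\
   (series (fun k : nat => c' k * a ^ (k%:Z - 1) : C^o) @ \oo -->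
      (cexp (two_pi_i R * (tau_coord tau xi)%:C * a) * kroneckerF tau xi a : C^o))).
  exact: (filterI h1 h2).
have /nbhs_ballP[e /= e0 h] := h12.
move: (e0); rewrite ltcE /= => /andP[/eqP Ie Re0].
apply/funext => k; apply/eqP; rewrite -subr_eq0; apply/eqP.
have r0 : 0 < complex.Re e / 2 by lra.
apply: (@power_series_zero (fun k => c k - c' k) _ r0) => t /andP[t0 tr].
have [|  |l1 l2] := h t%:C.
- rewrite /ball /= sub0r normrN ncE ltcE /= Ie eqxx nc_real ger0_norm; lra.
- by rewrite -nc_gt0 nc_real ger0_norm; lra.
have FFo : Filter (\oo : set_system nat) by typeclasses eauto.
have h0 := @cvgCB R nat \oo FFo _ _ _ _ l1 l2; rewrite subrr in h0.
have e2 n : series (fun k => (c k - c' k) * t%:C ^ (k%:Z - 1) : C^o) n =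
   series (fun k => c k * t%:C ^ (k%:Z - 1) : C^o) n - series (fun k => c' k * t%:C ^ (k%:Z - 1) : C^o) n.
  rewrite !seriesEord /= -sumrB; apply: eq_bigr => j _; by rewrite mulrBl.
by under eq_cvg do rewrite e2; exact: h0.
Qed.

(** By uniqueness of Laurent coefficients, the choice operator in [fker] must return the expansion
    already found. *)
Lemma fkerE (tau : C) (k : nat) (x : R) : 0 < complex.Im tau -> 0 < x < 1 ->
  fker tau k x%:C = fcoef tau k (ee x).
Proof.
move=> t0 x01; have h := fcoef_expand t0 x01; rewrite /fker.
have := @xgetI _ (fun _ : nat => 0 : C) [set c | laurent_expansion tau x%:C c] _ h.
by move=> /(laurent_unique h) <-.
Qed.

End Uniqueness.
End FourierKernels.
Import FourierKernels.

(** * Transcendence of 2 pi i, by the Hermite-Niven method *)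

Module Transcendence.
Lemma cexp_pi_i (R : realType) : cexp (two_pi_i R / 2) = - 1.
Proof.
have -> : two_pi_i R / 2 = 0 +i* pi.
  have -> : two_pi_i R = (0 +i* pi) * 2.
    by apply: complex_ext; rewrite /= /two_pi_i /=; simpc; rewrite /=; ring.
  by rewrite mulfK // pnatr_eq0.
by rewrite /cexp /= expR0 cospi sinpi mulr0 mul1r; apply: complex_ext => /=; rewrite ?oppr0.
Qed.

#[local] Opaque cexp two_pi_i.

Lemma isZ_poly (L : idomainType) (g : {poly L}) : (forall i, isZ g`_i) ->
  exists2 gz : {poly int}, g = map_poly intr gz & size gz = size g.
Proof.
move=> h; have /choice[f hf] : forall i, exists z : int, g`_i = z%:~R /\ (g`_i = 0 -> z = 0).
  move=> i; have [e|e] := eqVneq g`_i 0; first by exists 0; rewrite e.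
  by have [z ez] := h i; exists z; split=> // e'; rewrite e' eqxx in e.
have e : g = map_poly intr (\poly_(i < size g) f i).
  apply/polyP => i; rewrite coef_map coef_poly /=; case: ltnP => hi; first by have [->] := hf i.
  by rewrite nth_default.
exists (\poly_(i < size g) f i) => //.
case: (posnP (size g)) => [->|s0]; first by apply/eqP; rewrite -leqn0 size_poly.
apply: size_poly_eq; apply/eqP => f0.
have /eqP : g`_(size g).-1 = 0 by rewrite (hf _).1 f0.
by rewrite -[_ `_ _]/(lead_coef g) lead_coef_eq0 -size_poly_eq0 -leqn0 leqNgt s0.
Qed.

Lemma derivn_root (K : fieldType) (q : {poly K}) (c : K) (p i : nat) :
  (('X - c%:P) ^+ p %| q)%R -> (('X - c%:P) ^+ (p - i) %| q^`(i))%R.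
Proof.
elim: i => [|i IH] h; first by rewrite subn0 derivn0.
have := IH h; rewrite derivnS; case: (ltnP i p) => hi; last first.
  by move=> _; have -> : (p - i.+1 = 0)%N; [apply/eqP; rewrite subn_eq0 leqW|rewrite expr0 dvd1p].
have -> : (p - i = (p - i.+1).+1)%N by rewrite subnSK.
move: (q^`(i)) (p - i.+1)%N => r k /dvdpP[u ->].
rewrite derivM exprS !mulrA dvdp_add //; first by rewrite -mulrA !dvdp_mull.
by rewrite -exprS deriv_exp /= dvdp_mull // -mulr_natr dvdp_mulr // dvdp_mull.
Qed.

Lemma nderivn_root (K : numFieldType) (q : {poly K}) (c : K) (p i : nat) : (i < p)%N ->
  (('X - c%:P) ^+ p %| q)%R -> q^`N(i).[c] = 0.
Proof.
move=> hi /(@derivn_root _ _ _ _ i).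
have -> : (p - i = (p - i).-1.+1)%N by rewrite prednK // subn_gt0.
rewrite nderivn_def => /dvdpP[u]; move/(congr1 (fun r => r.[c])).
rewrite hornerM horner_exp !hornerE subrr expr0n mulr0 hornerMn => /eqP.
by rewrite mulrn_eq0 gtn_eqF ?fact_gt0 //= => /eqP.
Qed.

Section Niven.
Context {R : realType}.
Local Notation C := R[i].

Lemma exp_lt_fact (E D : R) : exists n0 : nat, forall n, (n0 <= n)%N -> E * D ^+ n < n`!%:R.
Proof.
have := cvg_series_cvg_0 (is_cvg_series_exp_coeff D).
move=> /cvgrPdist_lt /(_ (1 + `|E|)^-1); rewrite invr_gt0 ltr_wpDr // => /(_ isT)[n0 _ h].
exists n0 => n hn; have := h n hn; rewrite /exp_coeff /= sub0r normrN => h1.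
have f0 : 0 < n`!%:R :> R by rewrite ltr0n fact_gt0.
apply: le_lt_trans (ler_norm _) _; rewrite normrM.
have : `|D ^+ n| / n`!%:R < (1 + `|E|)^-1 by apply: le_lt_trans h1; rewrite normrM normfV normr_nat.
rewrite ltr_pdivrMr // mulrC ltr_pdivlMr ?ltr_wpDr // mulrDr mulr1 mulrC.
by apply: le_lt_trans; rewrite lerDr.
Qed.

Lemma cexp_tail (x : C) m :
  nc (cexp x - \sum_(j < m) x ^+ j / j`!%:R) <= nc x ^+ m / m`!%:R * expR (nc x).
Proof.
have -> : cexp x - \sum_(j < m) x ^+ j / j`!%:R = cseries (fun n => x ^+ (n + m) / (n + m)`!%:R).
  rewrite cexp_series.
  suff [_ e] : asum (fun n => x ^+ (n + m) / (n + m)`!%:R) /\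
     cseries (fun n => x ^+ n / n`!%:R) =
     \sum_(j < m) x ^+ j / j`!%:R + cseries (fun n => x ^+ (n + m) / (n + m)`!%:R).
    by rewrite e addrC addKr.
  elim: m => [|m [a IH]].
    rewrite big_ord0 add0r; under [X in asum X]eq_fun do rewrite addn0.
    by split; [exact: asum_cexp|apply: cseries_ext => n; rewrite addn0].
  split; first by have := asum_shift a; under eq_fun do rewrite addSnnS.
  rewrite IH (cseries_shift a) big_ord_recr /= add0n -addrA; congr (_ + (_ + _)).
  by apply: cseries_ext => n; rewrite addSnnS.
apply: nc_cseries_le => n.
apply: le_trans (ler_wpM2l _ (exp_partial_le n (nc_ge0 x))); last first.
  by rewrite divr_ge0 ?exprn_ge0 ?nc_ge0.
rewrite mulr_sumr; apply: ler_sum => i _; rewrite nc_div ncX nc_nat exprD.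
rewrite mulrACA -invfM mulrC [leRHS]mulrC; apply: ler_pM.
- by rewrite invr_ge0.
- by rewrite mulr_ge0 ?exprn_ge0 ?nc_ge0.
- rewrite lef_pV2 ?posrE -?natrM ?ltr0n ?muln_gt0 ?fact_gt0 // ler_nat addnC.
  rewrite -(bin_fact (leq_addr i m)) addKn leq_pmull // bin_gt0 leq_addr //.
- by rewrite mulrC.
Qed.

(** Coefficientwise majorants are compatible with products and bound the coefficients of X^(p-1) g^p
    by those of a real polynomial. *)
Definition pdom (p : {poly C}) (P : {poly R}) := forall i, nc p`_i <= P`_i.

Lemma pdomM p p' P P' : pdom p P -> pdom p' P' -> pdom (p * p') (P * P').
Proof.
move=> h h' i; rewrite !coefM; apply: le_trans (nc_sum _ _ _) _; apply: ler_sum => j _.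
by rewrite ncM ler_pM ?nc_ge0.
Qed.

Lemma pdomX p P n : pdom p P -> pdom (p ^+ n) (P ^+ n).
Proof.
move=> h; elim: n => [|n IH]; last by rewrite !exprS; exact: pdomM.
by move=> i; rewrite !expr0 !coef1 nc_nat.
Qed.

Lemma pdom_nc p : pdom p (map_poly nc p).
Proof. by move=> i; rewrite coef_map_id0 //; apply/eqP; rewrite nc_eq0. Qed.

Lemma pdom_horner p P (r : R) n : 0 <= r -> pdom p P ->
  \sum_(i < n) nc p`_i * r ^+ i <= P.[r].
Proof.
move=> r0 h; rewrite (@horner_coef_wide _ (maxn n (size P))) ?leq_maxr //.
apply: le_trans (_ : \sum_(i < maxn n (size P)) nc p`_i * r ^+ i <= _); last first.
  by apply: ler_sum => i _; rewrite ler_wpM2r ?exprn_ge0.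
rewrite (big_ord_widen (maxn n (size P)) (fun i => nc p`_i * r ^+ i)) ?leq_maxl //.
rewrite big_mkcond; apply: ler_sum => i _; case: ifP => // _.
by rewrite mulr_ge0 ?nc_ge0 ?exprn_ge0.
Qed.

Section Core.
Variables (A : int) (I : finType) (y : I -> C) (S0 : I).
Hypothesis A0 : A != 0.
Hypothesis yS0 : y S0 = 0.
Hypothesis H1 : forall G : {poly int}, isZ (\sum_S (map_poly intr G).[y S]).
Hypothesis H2 : forall i, isZ (\prod_S ('X - (y S)%:P))`_i.
Hypothesis H3 : \sum_S cexp (y S / A%:~R) = 0.

Let A0C : A%:~R != 0 :> C. Proof. by rewrite intr_eq0. Qed.

(** Hermite's sum of all derivatives of x -> q(Ax), taken at x = w/A. The divided derivatives keep
    integer coefficients, so the divisibility by i! is explicit. *)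
Definition niv (q : {poly C}) (w : C) :=
  \sum_(i < size q) A%:~R ^+ i * i`!%:R * q^`N(i).[w].

Lemma nderivn_horner (q : {poly C}) (i : nat) (w : C) :
  q^`N(i).[w] = \sum_(m < size q) q`_m * (w ^+ (m - i) *+ 'C(m, i)).
Proof.
rewrite -{1}[q]coefK poly_def raddf_sum /= horner_sum; apply: eq_bigr => m _.
by rewrite nderivnZ nderivnXn hornerZ hornerMn hornerXn.
Qed.

Lemma nivE q w : niv q w = \sum_(m < size q) q`_m *
  \sum_(i < size q) A%:~R ^+ i * i`!%:R * (w ^+ (m - i) *+ 'C(m, i)).
Proof.
rewrite /niv; under [RHS]eq_bigr do rewrite mulr_sumr.
rewrite exchange_big /=; apply: eq_bigr => i _.
rewrite nderivn_horner.
by rewrite mulr_sumr; apply: eq_bigr => m _; rewrite mulrCA.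
Qed.

(** On the monomial X^m Hermite's sum is A^m m! times the truncated exponential series; hence e^x
    [niv] q 0 - [niv] q (Ax) only sees tails of the exponential. *)
Lemma niv_mono (x : C) m n : (m < n)%N ->
  \sum_(i < n) A%:~R ^+ i * i`!%:R * ((A%:~R * x) ^+ (m - i) *+ 'C(m, i)) =
  A%:~R ^+ m * m`!%:R * \sum_(j < m.+1) x ^+ j / j`!%:R.
Proof.
move=> lt; rewrite -(subnKC lt) big_split_ord /= [X in _ + X]big1 ?addr0; last first.
  by move=> i _; rewrite bin_small ?mulr0n ?mulr0 // addSn ltnS leq_addr.
rewrite mulr_sumr [RHS](reindex_inj rev_ord_inj) /=; apply: eq_bigr => i _.
have hi : (i <= m)%N by rewrite -ltnS.
have eA : (A%:~R : C) ^+ m = A%:~R ^+ i * A%:~R ^+ (m - i) by rewrite -exprD subnKC.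
rewrite subSS eA exprMn -[_ *+ 'C(m, i)]mulr_natr -(bin_fact hi) !natrM.
have f0 : (m - i)`!%:R != 0 :> C by rewrite pnatr_eq0 -lt0n fact_gt0.
move: (A%:~R ^+ i) (A%:~R ^+ (m - i)) (i`!%:R) ('C(m, i)%:R) (x ^+ _) => a b c e f.
by field.
Qed.

Lemma niv_bound q (x : C) :
  nc (cexp x * niv q 0 - niv q (A%:~R * x)) <=
  expR (nc x) * nc x * \sum_(m < size q) nc q`_m * nc (A%:~R * x) ^+ m.
Proof.
have e0 : niv q 0 = \sum_(m < size q) q`_m * (A%:~R ^+ m * m`!%:R).
  rewrite nivE; apply: eq_bigr => m _; have := niv_mono 0 (ltn_ord m).
  rewrite mulr0 => ->; rewrite big_ord_recl expr0 divr1 big1 ?addr0 ?mulr1 //.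
  by move=> i _; rewrite expr0n /= mul0r.
rewrite e0 nivE mulr_sumr -sumrB.
apply: le_trans (nc_sum _ _ _) _; rewrite mulr_sumr; apply: ler_sum => m _.
rewrite niv_mono //; move: (\sum_(j < m.+1) _) (cexp_tail x m.+1) => s hs.
have -> : cexp x * (q`_m * (A%:~R ^+ m * m`!%:R)) - q`_m * (A%:~R ^+ m * m`!%:R * s) =
    q`_m * (A%:~R ^+ m * m`!%:R * (cexp x - s)).
  by move: (cexp x) (q`_m) (A%:~R ^+ m) => u v w; ring.
rewrite ncM mulrCA; apply: ler_wpM2l; first exact: nc_ge0.
rewrite !ncM !ncX nc_nat exprMn.
have -> : expR (nc x) * nc x * (nc (A%:~R : C) ^+ m * nc x ^+ m) =
   nc (A%:~R : C) ^+ m * (nc x ^+ m.+1 * expR (nc x)) by rewrite exprS; ring.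
rewrite -mulrA; apply: ler_wpM2l; first by rewrite exprn_ge0 ?nc_ge0.
apply: le_trans (ler_wpM2l _ hs) _ => //.
rewrite mulrA; apply: ler_wpM2r; first exact: expR_ge0.
rewrite mulrCA ler_piMr ?exprn_ge0 ?nc_ge0 // ler_pdivrMr ?ltr0n ?fact_gt0 //.
by rewrite mul1r ler_nat factS leq_pmull.
Qed.

(** For q = X^(p-1) g^p, with g the product over the nonzero [y S], the sum of all [niv q (y S)] is
    (p-1)! times an integer that is nonzero modulo p, hence at least (p-1)! in norm. By [H3] the
    same sum is minus a sum of exponential tails, which grows only geometrically in p. *)
Lemma niven : False.
Proof.
pose g := \prod_(S | y S != 0) ('X - (y S)%:P) : {poly C}.
pose k := #|[pred S | y S == 0]|.
have k0 : (0 < k)%N by apply/card_gt0P; exists S0; rewrite inE yS0.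
have Wg : \prod_S ('X - (y S)%:P) = 'X^k * g.
  rewrite (bigID (fun S => y S == 0)) /=; congr (_ * _).
  rewrite /k -sum1_card expr_sum; apply: eq_big => // S.
  by move=> /eqP ->; rewrite subr0 expr1.
have gZ i : isZ g`_i.
  have := H2 (i + k); rewrite Wg mulrC coefMXn ltnNge leq_addl /= addnK; exact.
have [gz eg _] := isZ_poly gZ.
have g00 : gz`_0 != 0.
  have : g.[0] != 0.
    rewrite /g horner_prod; apply/prodf_neq0 => S hS.
    by rewrite hornerXsubC sub0r oppr_eq0.
  by rewrite horner_coef0 eg coef_map /= intr_eq0.
pose rho := \sum_S nc (y S).
have rhoP S : nc (y S) <= rho.
  by rewrite /rho (bigD1 S) //= lerDl sumr_ge0 // => *; exact: nc_ge0.
have rho0 : 0 <= rho by apply: sumr_ge0 => *; exact: nc_ge0.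
pose G := (map_poly nc g).[rho].
pose E := \sum_S expR (nc (y S / A%:~R)) * nc (y S / A%:~R).
have [n0 hn0] := exp_lt_fact (E * G) (rho * G).
(* The prime must divide none of A, k and the constant coefficient of [gz], and be large enough for
   the factorial to win. *)
have [p hp pp] := prime_above (maxn n0 (maxn `|A| (maxn k `|gz`_0|))).
move: hp; rewrite !gtn_max => /and4P[hp1 hp2 hp3 hp4].
pose qz : {poly int} := 'X^(p.-1) * gz ^+ p.
pose q : {poly C} := 'X^(p.-1) * g ^+ p.
have p0 : (0 < p)%N by exact: prime_gt0.
have eq : q = map_poly intr qz.
  by rewrite /q /qz rmorphM rmorphXn /= rmorphXn /= map_polyX -eg.
(* q vanishes to order p-1 at 0 and to order p at the other [y S]. *)
have vanish S i : (i < p.-1 + (y S != 0)%R)%N -> q^`N(i).[y S] = 0.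
  move=> hi; have [e|e] := eqVneq (y S) 0.
    rewrite e eqxx addn0 in hi *; apply: nderivn_root hi _.
    by rewrite subr0 /q dvdp_mulIl.
  rewrite e addn1 prednK // in hi; apply: nderivn_root hi _.
  by rewrite /q dvdp_mull // dvdp_exp2r // /g (bigD1 S) //= dvdp_mulIl.
have qN i : isZ (\sum_S q^`N(i).[y S]) by rewrite eq; under eq_bigr do rewrite nderivn_map; exact: H1.
have /choice[c hc] : forall i, exists z : int, \sum_S q^`N(i).[y S] = z%:~R by [].
have cp : c p.-1 = k%:Z * gz`_0 ^+ p.
  apply/eqP; rewrite -(eqr_int C) -hc intrM.
  rewrite (bigID (fun S => y S == 0)) /= [X in _ + X]big1 ?addr0; last first.
    by move=> S hS; apply: vanish; rewrite hS addn1 prednK.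
  rewrite (eq_bigr (fun _ => (gz`_0 ^+ p)%:~R)); last first.
    move=> S /eqP ->; rewrite horner_coef0 coef_nderivn addn0 binn mulr1n eq coef_map /=.
    by rewrite /qz mulrC coefMXn ltnn subnn -horner_coef0 horner_exp horner_coef0.
  by rewrite sumr_const -[#|_|]/k mulr_natl.
have ec i : (i < p.-1)%N -> c i = 0.
  move=> hi; apply/eqP; rewrite -(intr_eq0 C) -hc big1 // => S _; apply: vanish.
  exact: leq_trans hi (leq_addr _ _).
have sumE : \sum_S niv q (y S) = (\sum_(i < size q) A ^+ i * i`!%:R * c i)%:~R.
  rewrite /niv exchange_big rmorph_sum; apply: eq_bigr => i _ /=.
  by rewrite -mulr_sumr hc !rmorphM rmorphXn /= mulrz_nat.
have sz : (p.-1 < size q)%N.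
  rewrite ltnNge; apply/negP => h.
  have /eqP : q`_p.-1 = 0 by rewrite nth_default.
  rewrite eq coef_map /= /qz mulrC coefMXn ltnn subnn -horner_coef0 horner_exp horner_coef0.
  by rewrite intr_eq0 expf_eq0 (negPf g00) andbF.
(* Only i >= p-1 survives: i = p-1 gives the term prime to p, and for i >= p the factor i! is
   divisible by p! = p (p-1)!. *)
have [M eM] : exists M : int, \sum_(i < size q) A ^+ i * i`!%:R * c i =
   p.-1`!%:R * (A ^+ p.-1 * (k%:Z * gz`_0 ^+ p) + p%:Z * M).
  rewrite prednK // in sz; move: (size q) sz => s /subnKC <-.
  exists (\sum_(i < s - p) A ^+ (p + i) * ((p + i)`! %/ p`!)%:R * c (p + i)%N).
  rewrite big_split_ord /= mulrDr; congr (_ + _).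
    have lp : (p.-1 < p)%N by rewrite prednK.
    rewrite (bigD1 (Ordinal lp)) //= big1 ?addr0 => [|i hi]; last first.
      rewrite -val_eqE /= in hi; rewrite ec ?mulr0 // ltn_neqAle hi /=.
      by rewrite -ltnS prednK.
    by rewrite cp; move: (A ^+ _) (_ `_ 0 ^+ p) => a b; ring.
  rewrite !mulr_sumr; apply: eq_bigr => i _.
  have -> : (p + i)`!%:R = p.-1`!%:R * (p%:Z * ((p + i)`! %/ p`!)%:R) :> int.
    have fp : (p * (p.-1)`! = p`!)%N by case: (p) p0 => // n _; rewrite factS.
    rewrite mulrA -[p%:Z]natz -natrM mulnC fp -natrM.
    congr (_%:R); rewrite mulnC divnK //.
    by rewrite -(bin_fact (leq_addr i p)) addKn mulnCA dvdn_mulr.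
  by move: (A ^+ _) (c _) (_%:R) (p.-1`!%:R) => a b d e; ring.
pose Z := A ^+ p.-1 * (k%:Z * gz`_0 ^+ p) + p%:Z * M.
have Z0 : Z != 0.
  apply/eqP => Z0.
  have : (p%:Z %| A ^+ p.-1 * (k%:Z * gz`_0 ^+ p))%Z.
    have -> : A ^+ p.-1 * (k%:Z * gz`_0 ^+ p) = p%:Z * (- M).
      by rewrite mulrN; apply/eqP; rewrite -addr_eq0; apply/eqP.
    exact: dvdz_mulr.
  rewrite dvdzE !abszM !abszX !absz_nat !Euclid_dvdM // !Euclid_dvdX //.
  by rewrite (gtnNdvd _ hp2) ?absz_gt0 // (gtnNdvd k0 hp3) (gtnNdvd _ hp4) ?absz_gt0.
have low : (p.-1)`!%:R <= nc (\sum_S niv q (y S)).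
  rewrite sumE eM rmorphM /= mulrz_nat ncM nc_nat ler_peMr // -/Z.
  have -> : nc (Z%:~R : C) = `|Z|%N%:R.
    by rewrite -(nc_nat (R := R)) /nc -[in LHS]intr_norm -natr_absz normr_nat.
  by rewrite ler1n absz_gt0.
have up : nc (\sum_S niv q (y S)) <= E * G * (rho * G) ^+ p.-1.
  (* Summed over S, the multiple of [niv q 0] vanishes by [H3]. *)
  have -> : \sum_S niv q (y S) = - \sum_S (cexp (y S / A%:~R) * niv q 0 - niv q (y S)).
    by rewrite sumrB -mulr_suml H3 mul0r sub0r opprK.
  rewrite ncN; apply: le_trans (nc_sum _ _ _) _; rewrite /E -mulrA mulr_suml.
  apply: ler_sum => S _; have eS : y S = A%:~R * (y S / A%:~R) by rewrite mulrC divfK.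
  rewrite {2}eS; apply: le_trans (niv_bound _ _) _; rewrite -eS.
  apply: ler_wpM2l; first by rewrite mulr_ge0 ?expR_ge0 ?nc_ge0.
  apply: le_trans (_ : \sum_(m < size q) nc q`_m * rho ^+ m <= _).
    apply: ler_sum => m _; rewrite ler_wpM2l ?nc_ge0 // lerXn2r ?nnegrE ?nc_ge0 //.
  have d : pdom q ('X^(p.-1) * map_poly nc g ^+ p).
    by apply: pdomM; [move=> i; rewrite !coefXn nc_nat|exact/pdomX/pdom_nc].
  apply: le_trans (pdom_horner _ rho0 d) _.
  have eG : G ^+ p = G * G ^+ p.-1 by rewrite -exprS prednK.
  by rewrite hornerM hornerXn horner_exp -/G eG exprMn mulrCA.
have := hn0 p.-1; rewrite -ltnS prednK // => /(_ hp1); rewrite ltNge => /negP; apply.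
exact: le_trans low up.
Qed.
End Core.
End Niven.

Lemma prod_XsubC_scale (K : comNzRingType) (a : K) n (th : 'I_n -> K) (i : nat) :
  a ^+ i * (\prod_(j < n) ('X - (a * th j)%:P))`_i =
  a ^+ n * (\prod_(j < n) ('X - (th j)%:P))`_i.
Proof.
set U := \prod_(j < n) ('X - (a * th j)%:P).
have -> : a ^+ i * U`_i = (U \Po (a *: 'X))`_i.
  rewrite comp_polyE coef_sum.
  rewrite (eq_bigr (fun j : 'I_(size U) => U`_j * a ^+ j * (i == j)%:R)); last first.
    by move=> j _; rewrite exprZn !coefZ coefXn mulrA.
  have [lt|ge] := ltnP i (size U).
    rewrite (bigD1 (Ordinal lt)) //= eqxx mulr1 big1 ?addr0 1?mulrC // => j hj.
    by rewrite eq_sym -val_eqE /= in hj; rewrite (negPf hj) mulr0.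
  rewrite nth_default // mulr0 big1 // => j _.
  by rewrite gtn_eqF ?mulr0 // (leq_trans (ltn_ord j)).
rewrite /U rmorph_prod /= -coefZ.
suff -> : \prod_(j < n) (('X - (a * th j)%:P) \Po (a *: 'X)) =
  a ^+ n *: \prod_(j < n) ('X - (th j)%:P) by [].
rewrite -[RHS]mul_polyC rmorphXn /=.
have -> : a%:P ^+ n = \prod_(j < n) a%:P by rewrite prodr_const card_ord.
rewrite -big_split /=.
apply: eq_bigr => j _.
by rewrite rmorphB /= comp_polyX comp_polyC mulrBr mul_polyC rmorphM.
Qed.

(** If 2 pi i were a root, the product of 1 + e^(r/2) over all roots r would vanish; expanded, it is
    a sum of exponentials of half subset sums. Multiplying the roots by the leading coefficient a
    makes them algebraic integers, so A = 2a restores the exponents. *)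
Theorem two_pi_i_transcendental (R : realType) (P : {poly int}) : P != 0 ->
  (map_poly intr P).[two_pi_i R] != 0.
Proof.
move=> P0; apply/eqP => root.
pose Pc : {poly R[i]} := map_poly intr P.
have sPc : size Pc = size P by rewrite size_map_inj_poly // => a b /eqP; rewrite eqr_int => /eqP.
have lPc : lead_coef Pc = (lead_coef P)%:~R.
  by rewrite lead_coef_map_inj // => a b /eqP; rewrite eqr_int => /eqP.
have [r er] := closed_field_poly_normal Pc.
pose a := lead_coef P.
have a0 : a != 0 by rewrite lead_coef_eq0.
have aC : a%:~R != 0 :> R[i] by rewrite intr_eq0.
pose n := size r; pose th (i : 'I_n) : R[i] := a%:~R * r`_i.
have er' : Pc = a%:~R *: \prod_(i < n) ('X - (r`_i)%:P).
  by rewrite {1}er lPc (big_nth 0) big_mkord.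
have coefPc i : Pc`_i = a%:~R * (\prod_(i < n) ('X - (r`_i)%:P))`_i by rewrite {1}er' coefZ.
have thZ i : isZ (\prod_(i < n) ('X - (th i)%:P))`_i.
  have sz : size (\prod_(i < n) ('X - (th i)%:P)) = n.+1.
    by rewrite size_prod_XsubC -sum1_size sum_nat_const card_ord muln1.
  have [lt|ge] := ltnP i n; last first.
    rewrite leq_eqVlt in ge; case/orP: ge => [/eqP <-|lt].
      exists 1; have /monicP := monic_prod_XsubC (index_enum 'I_n) xpredT th.
      by rewrite lead_coefE sz.
    by exists 0; rewrite nth_default // sz.
  (* These are the coefficients of the monic polynomial a^(n-1) P(X/a). *)
  exists (a ^+ (n.-1 - i) * P`_i).
  have := prod_XsubC_scale (a%:~R : R[i]) (fun i : 'I_n => r`_i) i; rewrite -/th => e.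
  have ai : (a%:~R : R[i]) ^+ i != 0 by rewrite expf_neq0.
  apply: (mulfI ai); rewrite e rmorphM rmorphXn /=.
  have -> : (P`_i)%:~R = Pc`_i by rewrite /Pc coef_map.
  rewrite coefPc.
  rewrite mulrA -exprD mulrA -exprSr; congr (_ ^+ _ * _).
  have n0 : (0 < n)%N by exact: leq_ltn_trans lt.
  by rewrite subnKC ?prednK // -ltnS prednK.
have hA : (2 * a)%R != 0 by rewrite mulf_neq0.
apply: (@niven R (2 * a) _ (subsum th) finset.set0 hA).
- by rewrite /subsum big_set0.
- exact: isZ_sum_subsum thZ.
- exact: isZ_prod_subsum thZ.
have e S : cexp (subsum th S / (2 * a)%:~R) = \prod_i (if i \in S then cexp (r`_i / 2) else 1).
  rewrite /subsum mulr_suml (big_morph _ (@cexpD R) (@cexp0 R)) big_mkcond /=.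
  apply: eq_bigr => i _; case: ifP => // _; congr cexp; rewrite /th intrM.
  by move: aC (r`_i) => /= aC u; field.
rewrite (eq_bigr _ (fun S _ => e S)).
have := @bigA_distr R[i] 0 1 *%R +%R 'I_n (fun i => cexp (r`_i / 2)) (fun=> 1).
move=> /= <-.
move/eqP: root; rewrite -/Pc er' hornerZ mulf_eq0 (negPf aC) /= horner_prod.
move=> /prodf_eq0[i _]; rewrite !hornerE subr_eq0 => /eqP ei.
by rewrite (bigD1 i) //= -ei cexp_pi_i addNr mul0r.
Qed.
End Transcendence.
Import Transcendence.

(** * Fay and shuffle relations in odd weight as functional equations *)

Module FayAlgebra.
Section PolyTools.

Lemma poly_natr_eq0 (p : {poly rat}) : (forall n : nat, p.[n.+1%:R] = 0) -> p = 0.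
Proof.
move=> h; apply/eqP; apply/negP => /negP p0.
pose rs := [seq n.+1%:R : rat | n <- iota 0 (size p)].
have a : all (root p) rs by apply/allP => _ /mapP[n _ ->]; rewrite /root h.
have u : uniq rs.
  by rewrite map_inj_uniq ?iota_uniq // => a' b /eqP; rewrite eqr_nat eqSS => /eqP.
by have := max_poly_roots p0 a u; rewrite size_map size_iota ltnn.
Qed.

(** Testing only at positive rationals avoids the zeros of x and x+1 in the denominators of the
    substitutions. *)
Lemma poly_pos_eq (p q : {poly rat}) : (forall x : rat, 0 < x -> p.[x] = q.[x]) -> p = q.
Proof.
move=> h; apply/eqP; rewrite -subr_eq0; apply/eqP/poly_natr_eq0 => n.
by rewrite hornerD hornerN h ?subrr // ltr0Sn.
Qed.

(** Value at (u, v) of the homogenisation of [f] in degree [d]. *)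
Definition hev (d : nat) (f : {poly rat}) (u v : rat) := \sum_(i < d.+1) f`_i * u ^+ i * v ^+ (d - i).

Lemma hevE d (f : {poly rat}) (u v : rat) : (size f <= d.+1)%N -> v != 0 ->
  hev d f u v = v ^+ d * f.[u / v].
Proof.
move=> sf v0; rewrite (horner_coef_wide _ sf) mulr_sumr; apply: eq_bigr => i _.
have hi : (i <= d)%N by rewrite -ltnS.
have ev : v ^+ d = v ^+ (d - i) * v ^+ i by rewrite -exprD subnK.
have vi : v ^+ i != 0 by rewrite expf_neq0.
rewrite ev exprMn exprVn; move: (v ^+ i) (v ^+ (d - i)) (u ^+ i) (f`_i) vi => a b g e a0.
by field.
Qed.

Lemma coef_reciprocal d (f : {poly rat}) c : (size f <= d.+1)%N ->
  (forall x : rat, 0 < x -> x ^+ d * f.[x^-1] = c * f.[x]) ->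
  forall i, (i <= d)%N -> f`_(d - i) = c * f`_i.
Proof.
move=> sf h i hi; pose g : {poly rat} := \poly_(i < d.+1) f`_(d - i).
have eg : g = c *: f.
  apply: poly_pos_eq => x x0; rewrite hornerZ -h // -[x^-1]mul1r -hevE ?gt_eqF //.
  rewrite horner_poly /hev (reindex_inj rev_ord_inj) /=; apply: eq_bigr => j _.
  by rewrite expr1n mulr1 subSS subKn // -ltnS.
by move/(congr1 (fun p : {poly rat} => p`_i)): eg; rewrite coef_poly ltnS hi coefZ.
Qed.

End PolyTools.

Section Pairing.
Variable R : realType.

(** Evaluates the weight-N part of a relation after replacing I(i, N-i) by [t i]. *)
Definition pairing (N : nat) (c : nat * nat -> rat) (t : nat -> rat) :=
  \sum_(i < N.+1) c (i : nat, (N - i)%N) * t i.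

Lemma pairing_sym2 N a b t : (a + b = N)%N -> pairing N (sym2 a b) t = t a.
Proof.
move=> e; have lt : (a < N.+1)%N by rewrite ltnS -e leq_addr.
rewrite /pairing (bigD1 (Ordinal lt)) //= big1 => [|i].
  by rewrite addr0 /sym2 xpair_eqE eqxx -e addKn eqxx mul1r.
rewrite -val_eqE /= => ne; by rewrite /sym2 xpair_eqE (negPf ne) mul0r.
Qed.

Lemma pairing_shuffle N m n t : (m + n = N)%N ->
  pairing N (shuffle_rel R m n).1 t = t m + t n.
Proof.
move=> e; rewrite -(pairing_sym2 t e) -(@pairing_sym2 N n m t) 1?addnC //.
by rewrite /pairing -big_split /=; apply: eq_bigr => i _; rewrite mulrDl.
Qed.

Lemma pairing_fay N m n t : (m + n = N)%N ->
  pairing N (fay_rel R m n).1 t =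
  t m - (- (-1) ^+ n * t 0%N
   + \sum_(r < n.+1) (-1) ^+ (n - r) * (fay_binom m r)%:R * t (m + r)%N
   + \sum_(r < m.+1) (-1) ^+ (n + r) * (fay_binom n r)%:R * t (n + r)%N).
Proof.
move=> e; rewrite /pairing /fay_rel /=.
rewrite -(pairing_sym2 t e) -(@pairing_sym2 N 0 (m + n) t) //.
rewrite (eq_bigr (fun r : 'I_n.+1 => (-1) ^+ (n - r) * (fay_binom m r)%:R *
    pairing N (sym2 (m + r) (n - r)) t)); last first.
  by move=> r _; have := ltn_ord r => hr; rewrite pairing_sym2 //; lia.
rewrite [X in _ - (_ + _ + X)](eq_bigr (fun r : 'I_m.+1 => (-1) ^+ (n + r) * (fay_binom n r)%:R *
    pairing N (sym2 (n + r) (m - r)) t)); last first.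
  by move=> r _; have := ltn_ord r => hr; rewrite pairing_sym2 //; lia.
rewrite /pairing mulr_sumr.
under [X in _ - (_ + X + _)]eq_bigr do rewrite mulr_sumr.
under [X in _ - (_ + _ + X)]eq_bigr do rewrite mulr_sumr.
rewrite [X in _ - (_ + X + _)]exchange_big [X in _ - (_ + _ + X)]exchange_big /=.
rewrite -!big_split /= -sumrB; apply: eq_bigr => i _.
rewrite mulrBl !mulrDl !mulr_suml; congr (_ - (_ + _ + _)); first by rewrite mulrA.
  by apply: eq_bigr => r _; rewrite mulrA.
by apply: eq_bigr => r _; rewrite mulrA.
Qed.

(* The generating polynomial of the Fay relation at a homogeneous f(x, y) of degree m + n - 2
   is f(x, y) + f(x + y, -y) - f(x + y, -x), here dehomogenised at y = 1. *)
Lemma pairing_fay_poly N m n (f : {poly rat}) c : odd N -> (m + n = N)%N -> (size f <= N.-1)%N ->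
  (forall x : rat, 0 < x ->
     f.[x] + hev (N - 2) f (x + 1) (-1) - hev (N - 2) f (x + 1) (- x) = c * f.[x]) ->
  pairing N (fay_rel R m n).1 (fun i => ('X * f)`_i) = c * ('X * f)`_m.
Proof.
move=> oN e sf h; rewrite pairing_fay //.
have t0 : ('X * f)`_0 = 0 by rewrite coefXM.
have tN : ('X * f)`_N = 0.
  by rewrite coefXM; case: eqP => // _; rewrite nth_default.
rewrite t0 mulr0 add0r.
(* The cases m = 0 and n = 0 lie outside the polynomial identity. They hold because the vector
   vanishes at both ends and [fay_binom 0 r] = 0 for r > 0. *)
case: m e => [|m] e.
  rewrite add0n in e; rewrite t0 mulr0 big_ord_recl /= addn0 t0 mulr0 add0r big1; last first.
    by move=> i _; rewrite /fay_binom /bump /= add1n add0n bin_small ?mulr0 ?mul0r // /= prednK.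
  by rewrite big_ord_recl big_ord0 addr0 /= addn0 e tN mulr0 add0r subrr.
case: n e => [|n] e.
  rewrite addn0 in e; rewrite e tN mulr0 big_ord_recl big_ord0 /= addn0 tN mulr0 addr0 add0r.
  rewrite big_ord_recl /= addn0 t0 mulr0 add0r big1 ?subrr ?oppr0 // => i _.
  by rewrite /fay_binom /bump /= add1n add0n bin_small ?mulr0 ?mul0r // /= prednK.
pose d := (m + n)%N.
have eN : N = d.+2 by rewrite -e /d; lia.
have {sf} sf : (size f <= d.+1)%N by rewrite eN in sf.
have ed : (N - 2 = d)%N by rewrite eN; lia.
rewrite ed in h.
(* [F2] and [F3] are f(x+1, -1) and f(x+1, -x) expanded as polynomials, so that coefficients can be
   compared. *)
pose F2 : {poly rat} := \sum_(i < d.+1) (f`_i * (-1) ^+ (d - i)) *: ('X + 1) ^+ i.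
pose F3 : {poly rat} := \sum_(i < d.+1) (f`_i * (-1) ^+ (d - i)) *: ('X^(d - i) * ('X + 1) ^+ i).
have eP : f + F2 - F3 = c *: f.
  apply: poly_pos_eq => x x0; rewrite hornerZ -h // !hornerD hornerN; congr (_ + _ - _).
    rewrite /F2 horner_sum; apply: eq_bigr => i _.
    by rewrite hornerZ horner_exp !hornerE mulrAC.
  rewrite /F3 horner_sum; apply: eq_bigr => i _.
  rewrite hornerZ hornerM hornerXn horner_exp !hornerE [(- x) ^+ _]exprNn /=.
  by move: ((-1) ^+ _) (_ ^+ i) (x ^+ _) => a b g; ring.
have coefXD1 i k : (('X + 1 : {poly rat}) ^+ i)`_k = 'C(i, k)%:R.
  rewrite exprDn coef_sum.
  have [lt|ge] := ltnP k i.+1; last first.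
    rewrite bin_small // big1 // => j _; rewrite expr1n mulr1 coefMn coefXn.
    by rewrite (_ : k == _ = false) ?mul0rn //; apply/negbTE; lia.
  have lt' : (i - k < i.+1)%N by lia.
  rewrite (bigD1 (Ordinal lt')) //= big1 => [|j].
    by rewrite addr0 expr1n mulr1 coefMn coefXn subKn // eqxx bin_sub.
  rewrite -val_eqE /= => ne; rewrite expr1n mulr1 coefMn coefXn.
  by rewrite (_ : k == _ = false) ?mul0rn //; apply/negbTE; have := ltn_ord j; lia.
have tS i : ('X * f)`_i.+1 = f`_i by rewrite coefXM.
have -> : c * ('X * f)`_m.+1 = (c *: f)`_m by rewrite coefZ tS.
rewrite -eP coefB coefD tS opprD addrA; congr (_ + _ + _); last congr (- _).
- rewrite big_ord_recr /= [X in _ + X](_ : _ = 0) ?addr0; last first.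
    by rewrite (_ : (m.+1 + n.+1)%N = N) // tN mulr0.
  rewrite -sumrN /F2 coef_sum.
  have -> : d.+1 = (m + n.+1)%N by rewrite addnS.
  rewrite [RHS]big_split_ord /= [X in _ = X + _]big1 ?add0r; last first.
    by move=> i _; rewrite coefZ coefXD1 bin_small ?mulr0.
  apply: eq_bigr => r _; rewrite coefZ coefXD1 addSn tS /fay_binom addSn /=.
  rewrite -[in LHS](@bin_sub (m + r) r) ?leq_addl // addnK.
  have -> : (d - (m + r) = n - r)%N by rewrite /d; lia.
  have -> : (n.+1 - r = (n - r).+1)%N by have := ltn_ord r; lia.
  by rewrite exprS; move: ((-1) ^+ _) (_%:R) => a b; ring.
- rewrite big_ord_recr /= [X in _ + X](_ : _ = 0) ?addr0; last first.
    by rewrite (_ : (n.+1 + m.+1)%N = N) 1?addnC // tN mulr0.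
  rewrite /F3 coef_sum.
  have -> : d.+1 = (n + m.+1)%N by rewrite /d; lia.
  rewrite [RHS]big_split_ord /= [X in _ = X + _]big1 ?add0r; last first.
    move=> i _; rewrite coefZ coefXnM ifT ?mulr0 //.
    by have := ltn_ord i; rewrite /d; lia.
  apply: eq_bigr => r _; have hr := ltn_ord r.
  rewrite coefZ coefXnM ifF; last by apply/negbTE; rewrite /d; lia.
  rewrite coefXD1 addSn tS /fay_binom addSn /=.
  have -> : (m - (d - (n + r)) = r)%N by rewrite /d; lia.
  have -> : (d - (n + r) = m - r)%N by rewrite /d; lia.
  (* The sign in [fay_rel] and the one produced by f(x+1, -x) agree because the weight is odd. *)
  rewrite -signr_odd -[in RHS]signr_odd.
  have -> : odd (n.+1 + r) = odd (m - r).
    by move: oN; rewrite -e !oddD /= oddB 1?oddD //; case: (odd m) (odd n) (odd r) => [] [] [].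
  by move: ((-1) ^+ _) (_%:R) => a b; ring.
Qed.

End Pairing.

Section OddWeight.
Variables (R : realType) (N : nat).
Hypothesis oN : odd N.
Let d := (N - 2)%N.

(** Homogeneously, with w = -x-y and p = d-k: x^k (y^p + w^p) - y^k (x^p + w^p). *)
Definition fpoly (k : nat) : {poly rat} :=
  'X^k * (1 + (- 1 - 'X) ^+ (d - k)) - ('X^(d - k) + (- 1 - 'X) ^+ (d - k)).

(** The top index k = N-1 is separate because the exponent d-k would be -1; its vector stems from
    the geometric sum 1 + X + ... + X^(N-2). *)
Definition tvec (k i : nat) : rat :=
  if k == N.-1 then (-1) ^+ (N - i) else ('X * fpoly k)`_i.

Lemma size_m1X n : (size ((- 1 - 'X : {poly rat}) ^+ n) <= n.+1)%N.
Proof.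
apply: leq_trans (size_poly_exp_leq _ _) _.
have -> : (- 1 - 'X : {poly rat}) = - ('X + 1%:P) by rewrite opprD addrC.
by rewrite size_polyN size_XaddC mul1n.
Qed.

Lemma size_fpoly k : (k <= d)%N -> (size (fpoly k) <= d.+1)%N.
Proof.
move=> kd; apply: leq_trans (size_polyD _ _) _; rewrite size_polyN geq_max; apply/andP; split.
  apply: leq_trans (size_polyMleq _ _) _; rewrite size_polyXn /=.
  have h : (size (1 + (- 1 - 'X : {poly rat}) ^+ (d - k))%R <= (d - k).+1)%N.
    by apply: leq_trans (size_polyD _ _) _; rewrite geq_max size_poly1 size_m1X.
  by move: h; move: (size _) => s; lia.
apply: leq_trans (size_polyD _ _) _; rewrite geq_max size_polyXn (leq_trans (size_m1X _)) ?andbT; lia.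
Qed.

Lemma horner_fpoly k (x : rat) : (fpoly k).[x] =
  x ^+ k * (1 + (- 1 - x) ^+ (d - k)) - (x ^+ (d - k) + (- 1 - x) ^+ (d - k)).
Proof.
by rewrite /fpoly hornerD hornerN hornerM !hornerD hornerXn horner_exp !hornerE.
Qed.

Lemma hev_fpoly k (u v : rat) : (k <= d)%N -> v != 0 -> hev d (fpoly k) u v =
  u ^+ k * (v ^+ (d - k) + (- v - u) ^+ (d - k)) - v ^+ k * (u ^+ (d - k) + (- v - u) ^+ (d - k)).
Proof.
move=> kd v0; rewrite hevE ?size_fpoly // horner_fpoly.
have ev : v ^+ d = v ^+ k * v ^+ (d - k) by rewrite -exprD subnKC.
have -> : - 1 - u / v = (- v - u) / v by field.
rewrite ev !exprMn !exprVn.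
have vk : v ^+ k != 0 by rewrite expf_neq0.
have vp : v ^+ (d - k) != 0 by rewrite expf_neq0.
move: (v ^+ k) (v ^+ (d - k)) (u ^+ k) (u ^+ (d - k)) ((- v - u) ^+ _) vk vp => a b e f g a0 b0.
by field; rewrite a0 b0.
Qed.

Lemma exprN_odd (x : rat) n : odd n -> (- x) ^+ n = - x ^+ n.
Proof. by move=> o; rewrite exprNn -signr_odd o expr1 mulN1r. Qed.
Lemma exprN_even (x : rat) n : ~~ odd n -> (- x) ^+ n = x ^+ n.
Proof. by move=> o; rewrite exprNn -signr_odd (negPf o) expr0 mul1r. Qed.

(** Put w = -x-y and let A_x = x^k (y^p + w^p), similarly A_y, A_w. For k even and p odd the three
    terms of the Fay operator are A_x - A_y, A_y - A_w and A_w - A_x. *)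
Lemma fpoly_fay m n k : (m + n = N)%N -> (k <= d)%N -> ~~ odd k -> (1 < N)%N ->
  pairing N (fay_rel R m n).1 (fun i => ('X * fpoly k)`_i) = 0.
Proof.
move=> e kd ok N1; have op : odd (d - k) by rewrite oddB // /d oddB // oN (negPf ok).
rewrite (@pairing_fay_poly R N m n (fpoly k) 0) ?mul0r //.
  by apply: leq_trans (size_fpoly kd) _; rewrite /d; lia.
move=> x x0; have x0' : x != 0 by rewrite gt_eqF.
rewrite -/d !hev_fpoly ?oppr_eq0 ?oner_eq0 // horner_fpoly mul0r.
have -> : - -1 - (x + 1) = - x :> rat by ring.
have -> : - - x - (x + 1) = - 1 :> rat by ring.
have -> : - 1 - x = - (x + 1) :> rat by ring.
rewrite !(exprN_odd _ op) !(exprN_even _ ok) !expr1n.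
by move: (x ^+ k) (x ^+ (d - k)) ((x + 1) ^+ k) ((x + 1) ^+ (d - k)) => a b f g; ring.
Qed.

Lemma fpoly_antisym k i : (k <= d)%N -> odd (d - k) -> (i <= d)%N ->
  (fpoly k)`_(d - i) = - (fpoly k)`_i.
Proof.
move=> kd op hi; rewrite (@coef_reciprocal d (fpoly k) (-1)) ?size_fpoly ?mulN1r // => x x0.
have x0' : x != 0 by rewrite gt_eqF.
have := hev_fpoly 1 kd x0'; rewrite hevE ?size_fpoly // mul1r => ->.
rewrite horner_fpoly !expr1n; have -> : - x - 1 = - 1 - x by ring.
by move: (x ^+ k) (x ^+ (d - k)) ((- 1 - x) ^+ _) => a b g; ring.
Qed.

Lemma coefX_antisym (f : {poly rat}) : (1 < N)%N -> (size f <= d.+1)%N ->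
  (forall i, (i <= d)%N -> f`_(d - i) = - f`_i) ->
  forall i, (i <= N)%N -> ('X * f)`_(N - i) = - ('X * f)`_i.
Proof.
move=> N1 sf h i hi; rewrite !coefXM.
have [->|i0] := eqVneq i 0%N.
  by rewrite subn0 oppr0; case: eqP => // _; rewrite nth_default // (leq_trans sf) // /d; lia.
have [->|iN] := eqVneq i N.
  by rewrite subnn eqxx nth_default ?oppr0 // (leq_trans sf) // /d; lia.
rewrite ifF; last by lia.
by rewrite -h; [congr (_ `_ _); rewrite /d|rewrite /d]; lia.
Qed.

Lemma hockey a b : (\sum_(r < b.+1) fay_binom a r = 'C(a + b, b))%N.
Proof.
elim: b => [|b IH]; first by rewrite big_ord_recl big_ord0 /fay_binom /= !bin0.
by rewrite big_ord_recr /= IH /fay_binom addnS /= binS addnC.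
Qed.

(** Both sums collapse by the hockey-stick identity to the same binomial coefficient, with opposite
    signs as N is odd. *)
Lemma sign_fay m n : (m + n = N)%N ->
  pairing N (fay_rel R m n).1 (fun i => (-1) ^+ (N - i)) = 0.
Proof.
move=> e; rewrite pairing_fay // subn0.
have s1 : \sum_(r < n.+1) (-1) ^+ (n - r) * (fay_binom m r)%:R * (-1) ^+ (N - (m + r))
   = ('C(m + n, n))%:R :> rat.
  rewrite -hockey natr_sum; apply: eq_bigr => r _.
  have -> : (N - (m + r) = n - r)%N by lia.
  by rewrite mulrAC -exprMn mulrNN mulr1 expr1n mul1r.
have s2 : \sum_(r < m.+1) (-1) ^+ (n + r) * (fay_binom n r)%:R * (-1) ^+ (N - (n + r))
   = - ('C(n + m, m))%:R :> rat.
  rewrite -hockey natr_sum -sumrN; apply: eq_bigr => r _; have hr := ltn_ord r.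
  by rewrite mulrAC -exprD subnKC ?[(n + r)%N]addnC; [rewrite -signr_odd oN expr1 mulN1r|lia].
rewrite s1 s2; have -> : 'C(m + n, n) = 'C(n + m, m) by rewrite -bin_sub ?leq_addl // addnK addnC.
have -> : (N - m = n)%N by lia.
by rewrite -[in (-1) ^+ N]signr_odd oN expr1; move: ((-1) ^+ n) (_%:R) => a b; ring.
Qed.

(** Homogeneously: the invariants xy(x+y) and x^2+xy+y^2 of the group of order six, times the
    alternant (x-y)(x+2y)(2x+y), in total degree d. As d is odd, xy(x+y) needs an even exponent 2b;
    the bound b < floor((N+1)/6) says that the remaining exponent is nonnegative. *)
Definition altpoly (b : nat) : {poly rat} :=
  'X^(b.*2) * ('X + 1) ^+ b.*2 * ('X^2 + 'X + 1) ^+ (((d - 3) - 6 * b)./2) *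
  (('X - 1) * ('X + 2%:P) * (2%:P * 'X + 1)).

Let m0 := (N.+1 %/ 6)%N.

Lemma size_altpoly b : (b < m0)%N -> (size (altpoly b) <= d.+1)%N.
Proof.
move=> hb; rewrite /altpoly.
have s1 : (size ('X^(b.*2) : {poly rat}) <= b.*2.+1)%N by rewrite size_polyXn.
have s2 : (size (('X + 1 : {poly rat}) ^+ b.*2) <= b.*2.+1)%N.
  by apply: leq_trans (size_poly_exp_leq _ _) _; rewrite size_XaddC mul1n.
have s3 n : (size (('X^2 + 'X + 1 : {poly rat}) ^+ n) <= n.*2.+1)%N.
  apply: leq_trans (size_poly_exp_leq _ _) _; rewrite ltnS -mul2n leq_mul2r.
  apply/orP; right; have : (size ('X^2 + 'X + 1 : {poly rat})%R <= 3)%N; last by case: (size _).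
  apply: leq_trans (size_polyD _ _) _; rewrite geq_max size_poly1 andbT.
  by apply: leq_trans (size_polyD _ _) _; rewrite geq_max size_polyXn size_polyX.
have s4 : (size (('X - 1) * ('X + 2%:P) * (2%:P * 'X + 1) : {poly rat})%R <= 4)%N.
  apply: leq_trans (size_polyMleq _ _) _; have h1 := size_polyMleq ('X - 1 : {poly rat}) ('X + 2%:P).
  rewrite -[X in 'X - X]polyC1 size_XsubC size_XaddC in h1.
  have h2 : (size (2%:P * 'X + 1 : {poly rat})%R <= 2)%N.
    apply: leq_trans (size_polyD _ _) _; rewrite geq_max size_poly1 andbT.
    by apply: leq_trans (size_polyMleq _ _) _; rewrite size_polyX size_polyC.
  by move: h1 h2; rewrite polyC1; move: (size _) (size _) => u v; lia.
move: s1 s2 (s3 (((d - 3) - 6 * b)./2)) s4.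
move: ('X^(b.*2) : {poly rat}) (('X + 1) ^+ b.*2 : {poly rat}) => p1 p2.
move: (('X^2 + 'X + 1) ^+ _ : {poly rat}) (('X - 1) * ('X + 2%:P) * (2%:P * 'X + 1) : {poly rat}) => p3 p4 s1 s2 s4 s5.
have := size_polyMleq p1 p2; have := size_polyMleq (p1 * p2) p3.
have := size_polyMleq (p1 * p2 * p3) p4.
move: (size (p1 * p2)) (size (p1 * p2 * p3)) (size (p1 * p2 * p3 * p4)) => u v w.
by move: hb oN; rewrite /m0 /d; lia.
Qed.

Lemma horner_altpoly b (x : rat) : (altpoly b).[x] =
  x ^+ b.*2 * (x + 1) ^+ b.*2 * (x ^+ 2 + x + 1) ^+ (((d - 3) - 6 * b)./2) *
  ((x - 1) * (x + 2) * (2 * x + 1)).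
Proof. by rewrite /altpoly !hornerM !horner_exp !hornerE. Qed.

Lemma hev_altpoly b (u v : rat) : (b < m0)%N -> v != 0 -> hev d (altpoly b) u v =
  (u * v * (u + v)) ^+ b.*2 * (u ^+ 2 + u * v + v ^+ 2) ^+ (((d - 3) - 6 * b)./2) *
  ((u - v) * (u + 2 * v) * (2 * u + v)).
Proof.
move=> hb v0; rewrite hevE ?size_altpoly // horner_altpoly.
set a := (_./2).
have ev : v ^+ d = v ^+ b.*2 * v ^+ b.*2 * v ^+ b.*2 * (v ^+ 2) ^+ a * v ^+ 3.
  rewrite -exprM -!exprD; congr (_ ^+ _); rewrite /a.
  by move: hb oN; rewrite /m0 /d; lia.
have -> : u / v + 1 = (u + v) / v by field.
have -> : (u / v) ^+ 2 + u / v + 1 = (u ^+ 2 + u * v + v ^+ 2) / v ^+ 2 by field.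
rewrite ev [(u / v) ^+ b.*2]exprMn [((u + v) / v) ^+ b.*2]exprMn [(_ / v ^+ 2) ^+ a]exprMn.
rewrite [(u * v * (u + v)) ^+ b.*2]exprMn [(u * v) ^+ b.*2]exprMn !exprVn.
have vk : v ^+ b.*2 != 0 by rewrite expf_neq0.
have vp : (v ^+ 2) ^+ a != 0 by rewrite !expf_neq0.
move: (v ^+ b.*2) ((v ^+ 2) ^+ a) (u ^+ b.*2) ((u + v) ^+ b.*2) vk vp => e f g h e0 f0.
move: ((u ^+ 2 + u * v + v ^+ 2) ^+ a) => w.
by field; rewrite v0 e0 f0.
Qed.

(** For an alternant of odd degree f(x+y, -y) = f and f(x+y, -x) = -f, so the Fay operator acts as
    multiplication by 3. *)
Lemma altpoly_fay m n b : (m + n = N)%N -> (b < m0)%N ->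
  pairing N (fay_rel R m n).1 (fun i => ('X * altpoly b)`_i) = 3 * ('X * altpoly b)`_m.
Proof.
move=> e hb; apply: pairing_fay_poly => //.
  by apply: leq_trans (size_altpoly hb) _; move: hb; rewrite /m0 /d; lia.
move=> x x0; have x0' : x != 0 by rewrite gt_eqF.
have ev : ~~ odd b.*2 by rewrite odd_double.
rewrite -/d !hev_altpoly ?oppr_eq0 ?oner_eq0 // horner_altpoly.
have -> : (x + 1) * -1 * (x + 1 + -1) = - (x * (x + 1)) by ring.
have -> : (x + 1) * - x * (x + 1 + - x) = - (x * (x + 1)) by ring.
have -> : (x + 1) ^+ 2 + (x + 1) * -1 + (-1) ^+ 2 = x ^+ 2 + x + 1 by ring.
have -> : (x + 1) ^+ 2 + (x + 1) * - x + (- x) ^+ 2 = x ^+ 2 + x + 1 by ring.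
rewrite !(exprN_even _ ev) exprMn.
by move: (x ^+ b.*2) ((x + 1) ^+ b.*2) (_ ^+ _./2) => a f g; ring.
Qed.

Lemma altpoly_antisym b i : (b < m0)%N -> (i <= d)%N -> (altpoly b)`_(d - i) = - (altpoly b)`_i.
Proof.
move=> hb hi; rewrite (@coef_reciprocal d (altpoly b) (-1)) ?size_altpoly ?mulN1r // => x x0.
have x0' : x != 0 by rewrite gt_eqF.
have := hev_altpoly 1 hb x0'; rewrite hevE ?size_altpoly // mul1r => ->.
rewrite horner_altpoly; have -> : 1 * x * (1 + x) = x * (x + 1) by ring.
have -> : 1 ^+ 2 + 1 * x + x ^+ 2 = x ^+ 2 + x + 1 by ring.
rewrite exprMn.
by move: (x ^+ b.*2) ((x + 1) ^+ b.*2) (_ ^+ _./2) => a f g; ring.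
Qed.

(** The orders of vanishing at 0 are exactly 2b, hence distinct, and the coefficients can be read
    off one after the other. *)
Lemma altpoly_free (w : 'I_m0 -> rat) : \sum_b w b *: altpoly b = 0 -> forall b, w b = 0.
Proof.
move=> h b; elim/ltn_ind: {b}(b : nat) {-2}b (erefl (b : nat)) => n IH b eb.
pose g (b : nat) := ('X + 1 : {poly rat}) ^+ b.*2 * ('X^2 + 'X + 1) ^+ (((d - 3) - 6 * b)./2) *
  (('X - 1) * ('X + 2%:P) * (2%:P * 'X + 1)).
have eg c : altpoly c = g c * 'X^(c.*2) by rewrite /altpoly /g -!mulrA mulrC -!mulrA.
have := congr1 (fun p : {poly rat} => p`_(b.*2)) h.
rewrite coef_sum coef0 (bigD1 b) //= big1 ?addr0 => [|c ne].
  rewrite coefZ eg coefMXn ltnn subnn -horner_coef0 /g !hornerM !horner_exp !hornerE.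
  rewrite /= !expr1n !mulr1 => /eqP.
  by rewrite !mulf_eq0 oppr_eq0 oner_eq0 /= !orbF => /eqP.
have [lt|ge] := ltnP c b.
  have lt' : (c < n)%N by rewrite -eb.
  by rewrite (IH c lt' c erefl) scale0r coef0.
rewrite coefZ eg coefMXn ifT ?mulr0 //.
by move: ne ge; rewrite -val_eqE /=; lia.
Qed.

Let nn := N.+1./2.

Definition Tmx : 'M[rat]_(nn, N.+1) := \matrix_(j, i) tvec j.*2 i.
Definition Relmx : 'M[rat]_(N.+1 + N.+1, N.+1) :=
  col_mx (\matrix_(m, i) (shuffle_rel R m (N - m)).1 (i : nat, (N - i)%N))
         (\matrix_(m, i) (fay_rel R m (N - m)).1 (i : nat, (N - i)%N)).

Lemma tvec_antisym k i : ~~ odd k -> (k < N)%N -> (i <= N)%N -> tvec k (N - i) = - tvec k i.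
Proof.
move=> ok kN hi; rewrite /tvec; case: eqP => [_|/eqP ne].
  rewrite subKn // -[LHS]signr_odd -[in RHS]signr_odd oddB // oN.
  by case: (odd i); rewrite ?expr0 ?expr1 ?opprK.
have kd : (k <= d)%N by move: oN; rewrite /d; lia.
have N1 : (1 < N)%N by move: oN; lia.
apply: coefX_antisym => //; first exact: size_fpoly.
move=> j hj; apply: fpoly_antisym => //.
by rewrite oddB // /d oddB // oN (negPf ok).
Qed.

Lemma tvec_fay m n k : ~~ odd k -> (k < N)%N -> (m + n = N)%N ->
  pairing N (fay_rel R m n).1 (tvec k) = 0.
Proof.
move=> ok kN e; rewrite /tvec; case: (eqVneq k N.-1) => [_|ne]; first exact: sign_fay.
by apply: fpoly_fay => //; move: oN; rewrite /d; lia.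
Qed.

Lemma Rel_T : Relmx *m Tmx^T = 0.
Proof.
rewrite /Relmx mul_col_mx; apply/eqP; rewrite col_mx_eq0; apply/andP; split; apply/eqP/matrixP => m j.
  rewrite !mxE -[RHS](_ : pairing N (shuffle_rel R m (N - m)).1 (tvec j.*2) = 0).
    by apply: eq_bigr => i _; rewrite !mxE.
  have hm : (m <= N)%N by rewrite -ltnS.
  rewrite pairing_shuffle ?subnKC // tvec_antisym ?odd_double ?subrr //.
  by have := ltn_ord j; rewrite /nn; lia.
rewrite !mxE -[RHS](@tvec_fay m (N - m) j.*2) ?odd_double //.
- by apply: eq_bigr => i _; rewrite !mxE.
- by have := ltn_ord j; rewrite /nn; lia.
- by rewrite subnKC // -ltnS.
Qed.

(** Symmetric vectors e_j + e_(N-j), on which shuffle acts as multiplication by 2, next to the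
    alternants, which shuffle kills and Fay multiplies by 3. *)
Definition testmx : 'M[rat]_(N.+1, nn + m0) :=
  row_mx (\matrix_(i, j) ((i == j :> nat)%:R + (i == N - j :> nat)%N%:R))
         (\matrix_(i, b) ('X * altpoly b)`_i).

(** The product of [Relmx] and [testmx] has independent columns: in a vanishing combination the
    shuffle rows remove the symmetric part [s], and the Fay rows then return 3 times the alternating
    part [tt]. *)
Lemma rank_Rel : (nn + m0 <= \rank Relmx)%N.
Proof.
apply: leq_trans (mxrankM_maxl Relmx testmx).
rewrite -mxrank_tr; suff /eqP -> : row_free (Relmx *m testmx)^T by [].
apply: inj_row_free => v hv.
pose s (i : nat) := \sum_(j < nn) v 0 (lshift _ j) * ((i == j)%:R + (i == N - j)%N%:R).
pose tt (i : nat) := \sum_(b < m0) v 0 (rshift _ b) * ('X * altpoly b)`_i.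
have ht i : (i <= N)%N -> tt (N - i)%N = - tt i.
  move=> hi; rewrite /tt -sumrN; apply: eq_bigr => b _; rewrite -mulrN; congr (_ * _).
  apply: coefX_antisym => //; first by have := ltn_ord b; rewrite /m0; lia.
    exact: size_altpoly.
  by move=> j hj; apply: altpoly_antisym.
have hs i : (i <= N)%N -> s (N - i)%N = s i.
  move=> hi; apply: eq_bigr => j _; have := ltn_ord j; rewrite /nn => hj; congr (_ * _).
  rewrite addrC; congr (_%:R + _%:R); apply/eqP/eqP; lia.
have hu (c : nat * nat -> rat) : pairing N c (fun i => s i + tt i) =
   \sum_k v 0 k * pairing N c (fun i => if insub i is Some i' then testmx i' k else 0).
  under [RHS]eq_bigr do rewrite /pairing mulr_sumr.
  rewrite exchange_big /=; apply: eq_bigr => i _.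
  under eq_bigr do rewrite mulrCA.
  rewrite -mulr_sumr valK big_split_ord /=; congr (_ * (_ + _)).
    by apply: eq_bigr => j _; rewrite /testmx row_mxEl !mxE.
  by apply: eq_bigr => j _; rewrite /testmx row_mxEr !mxE.
have hu' (r : 'I_(N.+1 + N.+1)) (c : nat * nat -> rat) :
    (forall i : 'I_N.+1, Relmx r i = c (i : nat, (N - i)%N)) ->
    pairing N c (fun i => s i + tt i) = 0.
  move=> hc; rewrite hu; have := congr1 (fun M : 'rV_ _ => M 0 r) hv; rewrite !mxE => e0; rewrite -[RHS]e0.
  apply: eq_bigr => k _; congr (_ * _); rewrite !mxE; apply: eq_bigr => i _.
  by rewrite hc valK.
have sh m : (m <= N)%N -> s m = 0.
  move=> hm; have hm' : (m < N.+1)%N by [].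
  have : pairing N (shuffle_rel R m (N - m)).1 (fun i => s i + tt i) = 0.
    by apply: (hu' (lshift _ (Ordinal hm'))) => i; rewrite /Relmx col_mxEu mxE.
  rewrite pairing_shuffle ?subnKC // ht // hs //.
  move/eqP; rewrite addrACA subrr addr0 -mulr2n mulrn_eq0 /= => /eqP //.
have v1 j : v 0 (lshift m0 j) = 0.
  have hj := ltn_ord j; have := sh j; rewrite /s (bigD1 j) //= big1 => [|k ne].
    rewrite eqxx (_ : ((j : nat) == (N - j)%N) = false) ?addr0 ?mulr1; last first.
      by apply/negbTE; move: oN hj; rewrite /nn; lia.
    by apply; move: hj; rewrite /nn; lia.
  have hk := ltn_ord k; move: ne; rewrite -val_eqE /= => ne.
  rewrite eq_sym (negPf ne) (_ : ((j : nat) == (N - k)%N) = false) ?addr0 ?mulr0 //.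
  by apply/negbTE; move: oN hj hk; rewrite /nn; lia.
have tz m : (m <= N)%N -> tt m = 0.
  move=> hm; have hm' : (m < N.+1)%N by [].
  have : pairing N (fay_rel R m (N - m)).1 (fun i => s i + tt i) = 0.
    by apply: (hu' (rshift _ (Ordinal hm'))) => i; rewrite /Relmx col_mxEd mxE.
  have -> : pairing N (fay_rel R m (N - m)).1 (fun i => s i + tt i) = 3 * tt m.
    rewrite /pairing (eq_bigr (fun i : 'I_N.+1 => \sum_(b < m0) v 0 (rshift nn b) *
      ((fay_rel R m (N - m)).1 (i : nat, (N - i)%N) * ('X * altpoly b)`_i))); last first.
      move=> i _; rewrite sh ?add0r -1?ltnS // /tt mulr_sumr; apply: eq_bigr => b _.
      by rewrite mulrCA.
    rewrite exchange_big /= /tt mulr_sumr; apply: eq_bigr => b _.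
    rewrite -mulr_sumr [RHS]mulrCA; congr (_ * _).
    by apply: altpoly_fay; rewrite ?subnKC.
  by move/eqP; rewrite mulf_eq0 /= => /eqP.
have v2 : forall b, v 0 (rshift nn b) = 0.
  apply: (@altpoly_free (fun b => v 0 (rshift nn b))); apply/polyP => i; rewrite coef0.
  have -> : (\sum_(b < m0) v 0 (rshift nn b) *: altpoly b)`_i = tt i.+1.
    rewrite coef_sum; apply: eq_bigr => b _; by rewrite coefZ coefXM.
  have [hi|hi] := leqP i.+1 N; first exact: tz.
  rewrite /tt big1 // => b _; rewrite coefXM /= nth_default ?mulr0 //.
  by apply: leq_trans (size_altpoly (ltn_ord b)) _; move: hi; rewrite /d; lia.
apply/rowP => k; rewrite mxE -(splitK k); case: (fintype.split k) => j /=.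
  exact: v1.
exact: v2.
Qed.

(* For a in the left kernel of Tmx, h(x) = alpha(x) + alpha(-1-x) is invariant under
   x -> -1-x and x^d h(1/x) = h(x), and its order at 0 is odd. *)
Section LeftKernel.
Variable h : {poly rat}.
Hypothesis sh : (size h <= d.+1)%N.
Hypothesis od : odd d.
Hypothesis h1 : forall x : rat, h.[-1 - x] = h.[x].
Hypothesis h2 : forall x : rat, x != 0 -> x ^+ d * h.[x^-1] = h.[x].

(** Composing the two symmetries gives x -> -x/(x+1), which fixes 0 and multiplies h by -1 up to the
    factor (x+1)^d; comparing leading coefficients at 0 gives (-1)^e = -1. *)
Lemma order_odd (g : {poly rat}) e : h = 'X^e * g -> g.[0] != 0 -> odd e.
Proof.
move=> eh g0; have gn0 : g != 0 by apply: contraNneq g0 => ->; rewrite horner0.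
have sg : (size g + e <= d.+1)%N.
  by move: sh; rewrite eh (size_mul (monic_neq0 (monicXn rat e)) gn0) size_polyXn addSn /= addnC.
have sg0 : (0 < size g)%N by rewrite size_poly_gt0.
pose G : {poly rat} := \sum_(i < (d - e).+1) g`_i *: ((- 'X) ^+ i * ('X + 1) ^+ (d - e - i)).
have hG x : G.[x] = hev (d - e) g (- x) (x + 1).
  rewrite /G horner_sum; apply: eq_bigr => i _.
  by rewrite hornerZ hornerM !horner_exp !hornerE.
have eG : g = (- (-1) ^+ e) *: G.
  apply: poly_pos_eq => x x0; have x0' : x != 0 by rewrite gt_eqF.
  have x1 : x + 1 != 0 by rewrite gt_eqF // addr_gt0.
  rewrite hornerZ hG hevE //; last by lia.
  have E : (x + 1) ^+ d * h.[- x / (x + 1)] = - h.[x].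
    have -> : - x / (x + 1) = - 1 - (- (x + 1))^-1 by rewrite invrN opprK; field.
    have E2 : - ((x + 1) ^+ d * h.[(- (x + 1))^-1]) = h.[x].
      by rewrite -mulNr -exprN_odd // h2 ?oppr_eq0 // (_ : - (x + 1) = - 1 - x) ?h1 //; ring.
    by rewrite h1 -E2 opprK.
  have xe : x ^+ e != 0 by rewrite expf_neq0.
  apply: (mulfI xe); move: E; rewrite eh !hornerM !hornerXn.
  have -> : (x + 1) ^+ d = (x + 1) ^+ (d - e) * (x + 1) ^+ e by rewrite -exprD subnK //; lia.
  have -> : (- x / (x + 1)) ^+ e = (-1) ^+ e * x ^+ e / (x + 1) ^+ e.
    by rewrite exprMn exprVn [(- x) ^+ e]exprNn.
  have xe1 : (x + 1) ^+ e != 0 by rewrite expf_neq0.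
  move: ((x + 1) ^+ e) ((x + 1) ^+ (d - e)) (x ^+ e) ((-1) ^+ e) (g.[x]) (g.[_]) xe1 => a b f s u w a0 E.
  by apply: oppr_inj; rewrite -E; field.
have := congr1 (fun p : {poly rat} => p.[0]) eG.
rewrite hornerZ hG oppr0 add0r hevE ?oner_eq0 //; last by lia.
rewrite expr1n mul1r mul0r -signr_odd; case: (odd e) => //.
rewrite expr0 mulN1r => /eqP; rewrite -addr_eq0 -mulr2n mulrn_eq0 /= => /eqP g00.
by rewrite g00 eqxx in g0.
Qed.

(** The vanishing coefficients and the odd order push the order at 0 to at least 2m+1. The
    symmetries carry 0 to -1 and to infinity, so a nonzero h would have total order at least 3(2m+1)
    > d. *)
Lemma h_eq0 m : (d < 3 * m.*2.+1)%N -> (forall l, (l < m)%N -> h`_(l.*2.+1) = 0) -> h = 0.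
Proof.
move=> hm hl; apply/eqP; apply/negP => /negP h0.
have [e [g g0 eh]] := multiplicity_XsubC h 0.
rewrite h0 /= in g0; rewrite subr0 mulrC in eh.
have g00 : g.[0] != 0 by [].
have oe := order_odd eh g00.
have gn0 : g != 0 by apply: contraNneq g00 => ->; rewrite horner0.
have em : (m.*2.+1 <= e)%N.
  rewrite leqNgt; apply/negP => lt.
  have := hl e./2; have -> : (e./2).*2.+1 = e by have := odd_double_half e; rewrite oe; lia.
  rewrite eh coefXnM ltnn subnn -horner_coef0 => h00.
  by move/eqP: g00; apply; apply: h00; lia.
have hc i : (i <= d)%N -> h`_(d - i) = h`_i.
  move=> hi; rewrite (@coef_reciprocal d h 1) ?mul1r // => x x0.
  by rewrite mul1r h2 // gt_eqF.
have ed : (e <= d)%N.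
  rewrite leqNgt; apply/negP => lt; move: sh; rewrite eh (size_mul (monic_neq0 (monicXn rat e)) gn0) size_polyXn.
  by move: gn0; rewrite -size_poly_gt0; lia.
have sh' : (size h <= d - e + 1)%N.
  apply/leq_sizeP => j hj; have [jd|jd] := leqP j d; last first.
    by rewrite nth_default // (leq_trans sh).
  by rewrite -(subKn jd) hc ?leq_subr // eh coefXnM ifT //; lia.
have ex : 'X + 1 = 'X - (-1)%:P :> {poly rat} by rewrite polyCN opprK.
have dv : (('X + 1) ^+ e %| g)%R.
  have cp : coprimep (('X + 1) ^+ e) ('X^e : {poly rat}).
    apply: coprimep_expl; apply: coprimep_expr.
    have cp1 : coprimep ('X - (-1)%:P) ('X - 0%:P : {poly rat}).
      by apply: coprimep_XsubC2; rewrite sub0r opprK.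
    by rewrite ex; rewrite polyC0 subr0 in cp1.
  rewrite -(Gauss_dvdpr _ cp) -eh.
  have -> : h = h \Po (- 1 - 'X).
    by apply: poly_pos_eq => x _; rewrite horner_comp !hornerE /= h1.
  rewrite eh rmorphM rmorphXn /= comp_polyX dvdp_mulr //.
  have -> : - 1 - 'X = - ('X + 1) :> {poly rat} by rewrite opprD addrC.
  by rewrite exprNn -signr_odd oe expr1 mulN1r dvdpNr.
have := dvdp_leq gn0 dv; rewrite ex size_exp_XsubC.
move: sh'; rewrite eh (size_mul (monic_neq0 (monicXn rat e)) gn0) size_polyXn.
by move: (size g) gn0 em hm ed => u; lia.
Qed.
End LeftKernel.

(** Adjoining to [Tmx] the m0 columns [F], which record the low odd coefficients of h, makes the
    rows independent; so [Tmx] itself lacks at most m0 in rank. *)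
Lemma rank_T : (nn <= \rank Tmx + m0)%N.
Proof.
pose F : 'M[rat]_(nn, m0) :=
  \matrix_(j, l) ('X^(d - j.*2) + (- 1 - 'X) ^+ (d - j.*2))`_(l.*2.+1).
have free : row_free (row_mx Tmx F).
  apply: inj_row_free => a /eqP; rewrite mul_mx_row row_mx_eq0 => /andP[/eqP aT /eqP aF].
  have nn0 : (0 < nn)%N by rewrite /nn; move: oN; lia.
  have jb (j : 'I_nn) : (j.*2 < N)%N by have := ltn_ord j; move: oN; rewrite /nn; lia.
  have aTi (i : nat) : (i <= N)%N -> \sum_j a 0 j * tvec j.*2 i = 0.
    move=> hi; have hi' : (i < N.+1)%N by [].
    have := congr1 (fun M : 'rV_ _ => M 0 (Ordinal hi')) aT; rewrite !mxE => e; rewrite -[RHS]e.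
    by apply: eq_bigr => j _; rewrite !mxE.
  have ln : (nn.-1 < nn)%N by rewrite prednK.
  pose jn := Ordinal ln.
  have ejn (j : 'I_nn) : (j.*2 == N.-1) = (j == jn).
    by rewrite -val_eqE /= /nn; have := ltn_ord j; move: oN; rewrite /nn; lia.
  (* In column 0 only the vector of index k = N-1 has a nonzero entry. *)
  have an : a 0 jn = 0.
    have := aTi 0%N (leq0n _); rewrite (bigD1 jn) //= big1 => [|j ne].
      rewrite /tvec (ejn jn) eqxx subn0 -signr_odd oN expr1 addr0 mulrN1 => /eqP.
      by rewrite oppr_eq0 => /eqP.
    by rewrite /tvec ejn (negPf ne) coefXM mulr0.
  have [N1|N1] := ltnP 1 N; last first.
    apply/rowP => j; rewrite mxE; suff -> : j = jn by [].
    by apply/eqP; rewrite -val_eqE /= /nn; have := ltn_ord j; rewrite /nn; move: oN; lia.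
  have od : odd d by rewrite /d oddB // oN.
  pose al : {poly rat} := \sum_(j | j != jn) a 0 j *: 'X^(d - j.*2).
  have jd (j : 'I_nn) : j != jn -> (j.*2 <= d)%N.
    by rewrite -ejn; have := jb j; move: oN; rewrite /d; lia.
  have hal x : al.[x] = \sum_(j | j != jn) a 0 j * x ^+ (d - j.*2).
    by rewrite /al horner_sum; apply: eq_bigr => j _; rewrite hornerZ hornerXn.
  have alN x : al.[- x] = - al.[x].
    rewrite !hal -sumrN; apply: eq_bigr => j ne; rewrite exprN_odd ?mulrN //.
    by rewrite oddB ?jd // od odd_double.
  have F0 : \sum_(j | j != jn) a 0 j *: fpoly j.*2 = 0.
    apply/polyP => i; rewrite coef0 coef_sum.
    have [hi|hi] := leqP i.+1 N; last first.
      rewrite big1 // => j ne; rewrite coefZ nth_default ?mulr0 //.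
      by apply: leq_trans (size_fpoly (jd j ne)) _; move: hi; rewrite /d; lia.
    rewrite -[RHS](aTi i.+1 hi) [RHS](bigD1 jn) //= an mul0r add0r; apply: eq_bigr => j ne.
    by rewrite coefZ /tvec ejn (negPf ne) coefXM.
  pose h := al + (al \Po (- 1 - 'X)).
  have hh x : h.[x] = al.[x] + al.[- 1 - x] by rewrite /h hornerD horner_comp !hornerE.
  have sal : (size al <= d.+1)%N.
    apply: leq_trans (size_sum _ _ _) _; apply/bigmax_leqP => j ne.
    by apply: leq_trans (size_scale_leq _ _) _; rewrite size_polyXn ltnS leq_subr.
  have sh : (size h <= d.+1)%N.
    apply: leq_trans (size_polyD _ _) _; rewrite geq_max sal /=.
    rewrite /al rmorph_sum /=; apply: leq_trans (size_sum _ _ _) _; apply/bigmax_leqP => j ne.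
    rewrite comp_polyZ rmorphXn /= comp_polyX; apply: leq_trans (size_scale_leq _ _) _.
    by apply: leq_trans (size_m1X _) _; rewrite ltnS leq_subr.
  have h1 (x : rat) : h.[-1 - x] = h.[x].
    by rewrite !hh addrC (_ : - 1 - (- 1 - x) = x) //; ring.
  have h2 (x : rat) : x != 0 -> x ^+ d * h.[x^-1] = h.[x].
    move=> x0; rewrite !hh !hal mulrDr !mulr_sumr -!big_split /=; apply/eqP.
    rewrite -subr_eq0 -sumrB -[X in _ == X](horner0 x) -F0 horner_sum; apply/eqP.
    apply: eq_bigr => j ne; rewrite hornerZ horner_fpoly.
    have -> : x ^+ d = x ^+ j.*2 * x ^+ (d - j.*2) by rewrite -exprD subnKC // jd.
    have -> : - 1 - x^-1 = (- 1 - x) / x by field.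
    rewrite exprMn !exprVn; have : x ^+ (d - j.*2) != 0 by rewrite expf_neq0.
    move: (x ^+ j.*2) (x ^+ (d - j.*2)) ((- 1 - x) ^+ _) (a 0 j) => u v w c v0.
    by field.
  have h0 : h = 0.
    apply: (@h_eq0 h sh od h1 h2 m0); first by move: oN; rewrite /d /m0; lia.
    move=> l hl; have := congr1 (fun M : 'rV_ _ => M 0 (Ordinal hl)) aF; rewrite !mxE => e.
    rewrite -[RHS]e (bigD1 jn) //= an mul0r add0r /h /al rmorph_sum -big_split coef_sum /=.
    apply: eq_bigr => j ne.
    by rewrite comp_polyZ rmorphXn /= comp_polyX -scalerDr coefZ mxE.
  (* h = 0 and the oddness of [al] make it 1-periodic, hence constant as a polynomial, hence 0. *)
  have alS x : al.[x + 1] = al.[x].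
    have := hh x; rewrite h0 horner0 (_ : - 1 - x = - (x + 1)) ?alN; last by ring.
    by move/eqP; rewrite eq_sym subr_eq0 => /eqP.
  have al0 : al = 0.
    apply: poly_natr_eq0 => n; have -> : al.[n.+1%:R] = al.[0].
      by elim: n => [|n IH]; [rewrite -[RHS]alS add0r|rewrite -natr1 alS].
    have := alN 0; rewrite oppr0 => /eqP; rewrite -addr_eq0 -mulr2n mulrn_eq0 /= => /eqP.
    exact.
  apply/rowP => j; rewrite mxE; have [->//|ne] := eqVneq j jn.
  have := congr1 (fun p : {poly rat} => p`_(d - j.*2)) al0; rewrite coef0 coef_sum (bigD1 j) //=.
  rewrite coefZ coefXn eqxx mulr1 big1 ?addr0 // => k /andP[kn kj].
  rewrite coefZ coefXn (_ : _ == _ = false) ?mulr0 //; apply/negbTE.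
  by have := jd j ne; have := jd k kn; move: kj; rewrite -val_eqE /=; lia.
have : (\rank (row_mx Tmx F) <= \rank Tmx + m0)%N.
  rewrite -mxrank_tr tr_row_mx; rewrite -addsmxE.
  apply: leq_trans (mxrank_adds_leqif _ _) _; rewrite !mxrank_tr leq_add2l.
  by rewrite rank_leq_col.
by move/eqP: free => ->.
Qed.

(** The two rank bounds meet: (nn + m0) + (nn - m0) = N+1 and nn - m0 = N/3 + 1, so [Relmx] fills
    the whole kernel. *)
Lemma rank_T_Rel : \rank Tmx = (N %/ 3 + 1)%N /\ forall c : 'rV_(N.+1), c *m Tmx^T = 0 -> (c <= Relmx)%MS.
Proof.
have le : (Relmx <= kermx Tmx^T)%MS by apply/sub_kermxP; exact: Rel_T.
have k1 := mxrankS le; rewrite mxrank_ker mxrank_tr in k1.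
have k2 := rank_Rel; have k3 := rank_T.
have e3 : (nn = N %/ 3 + 1 + m0)%N by rewrite /nn /m0; move: oN; lia.
have e4 : (nn + nn = N.+1)%N by rewrite /nn; move: oN; lia.
have k4 : (\rank Tmx <= N.+1)%N by rewrite rank_leq_col.
split; first by lia.
move=> c hc; have ck : (c <= kermx Tmx^T)%MS by apply/sub_kermxP.
apply: submx_trans ck _; rewrite -(geq_leqif (mxrank_leqif_sup le)) mxrank_ker mxrank_tr.
by lia.
Qed.
End OddWeight.
End FayAlgebra.
Import FayAlgebra.

(** * Bernoulli numbers, and divisor-type convolutions evaluated by Faulhaber's formula *)

Module BernoulliConvolution.
#[local] Opaque cseries cexp phiexp bern.

(** For S(x) = x/(e^x - 1) one has S(-x) = S(x) + x; comparing coefficients leaves only index 1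
    among the odd ones. *)
Lemma bern_odd (R : realType) k : bern k.*2.+3 = 0.
Proof.
pose d (n : nat) : R[i] := ((-1) ^+ n - 1) * ratr (bern n) - (n == 1%N)%:R.
have d0 : forall n, d n = 0.
  apply: (@power_series_zero R d 2^-1) => [|t /andP[t0 t1]]; first by rewrite invr_gt0.
  pose x : R[i] := t%:C.
  have nx : nc x < 1 by rewrite nc_real gtr0_norm //; apply: le_lt_trans t1 _; lra.
  have x0 : x != 0 by rewrite -nc_gt0 nc_real gtr0_norm.
  have nx' : nc (- x) < 1 by rewrite ncN.
  have e1 := bern_series nx; have e2 := bern_series nx'.
  have p1 := cexp_phi x; have p2 := cexp_phi (- x).
  have a1 := asum_bern nx; have a2 := asum_bern nx'.
  pose S := cseries (fun n => ratr (bern n) * x ^+ n).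
  pose S' := cseries (fun n => ratr (bern n) * (- x) ^+ n).
  have p0 : phiexp x != 0.
    by apply/eqP => p0; move/eqP: e1; rewrite p0 mulr0 eq_sym oner_eq0.
  have p0' : phiexp (- x) != 0.
    by apply/eqP => p0'; move/eqP: e2; rewrite p0' mulr0 eq_sym oner_eq0.
  have inv_eq (a b : R[i]) : b != 0 -> a * b = 1 -> a = b^-1.
    by move=> b0 h; rewrite -[a]mulr1 -(mulfV b0) mulrA h mul1r.
  have eS : S' = S + x.
    have h := cexpN x; rewrite p1 p2 in h.
    have hS : S = (phiexp x)^-1 := inv_eq _ _ p0 e1.
    have hS' : S' = (phiexp (- x))^-1 := inv_eq _ _ p0' e2.
    rewrite hS hS'; move: (phiexp x) (phiexp (- x)) p0 p0' h => u v u0 v0 h.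
    have h' : u - v - x * u * v = 0.
      by apply: (mulfI x0); rewrite mulr0; move: h; move: (x) => y h; rewrite -(subrr 1) -{1}h; ring.
    apply/eqP; rewrite -subr_eq0; apply/eqP.
    have -> : v^-1 - (u^-1 + x) = (u - v - x * u * v) / (u * v) by field; rewrite u0 v0.
    by rewrite h' mul0r.
  have ax : asum (fun n => (n == 1%N)%:R * x ^+ n).
    apply: asum_le (rsum_geo (x := nc x) _) => [n|]; last by rewrite nc_ge0 nx.
    rewrite ncM ncX nc_nat; case: (n == 1%N); first by rewrite mul1r.
    by rewrite mul0r exprn_ge0 // nc_ge0.
  have ad : asum (fun n => d n * x ^+ n) /\ cseries (fun n => d n * x ^+ n) = 0.
    have e n : d n * x ^+ n = ratr (bern n) * (- x) ^+ n - ratr (bern n) * x ^+ n - (n == 1%N)%:R * x ^+ n.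
      rewrite /d [(- x) ^+ n]exprNn; move: ((-1) ^+ n) (x ^+ n) (ratr _) (_%:R) => a b f g; ring.
    split.
      apply: asum_le (rsumD (rsumD a2 a1) ax) => n; rewrite e.
      by apply: le_trans (ncB _ _) _; rewrite lerD2r; exact: ncB.
    rewrite (cseries_ext e) cseriesB //; last first.
      apply: asum_le (rsumD a2 a1) => n; exact: ncB.
    rewrite (cseriesB a2 a1) -/S -/S' eS (@cseries_fin _ _ 2); last first.
      by move=> [|[|n]] //= _; rewrite mul0r.
    rewrite !big_ord_recr big_ord0 /= mul0r mul1r expr1 !add0r.
    by move: (S) (x) => a b; ring.
  have eaW (W : R[i]) : x^-1 * (x * W) = W by rewrite mulrA mulVf ?mul1r.
  have hT := asum_cvg ad.1; rewrite ad.2 in hT.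
  have FFo : Filter (\oo : set_system nat) by typeclasses eauto.
  have hZ := @cvgCZ R nat \oo FFo (fun n => series (fun k => d k * x ^+ k : R[i]^o) n) _ hT x^-1.
  rewrite mulr0 in hZ.
  have e3 n : series (fun k : nat => d k * t%:C ^ (k%:Z - 1) : R[i]^o) n =
     x^-1 * series (fun k => d k * x ^+ k : R[i]^o) n; last first.
    by under eq_cvg do rewrite e3; exact: hZ.
  rewrite !seriesEord /= mulr_sumr; apply: eq_bigr => j _.
  by rewrite expfzDr // -exprnP exprN1 -/x; move: (d _) (x ^+ _) (x^-1) => u v r; ring.
have := d0 k.*2.+3; rewrite /d -signr_odd /= odd_double /= expr1 subr0 -opprD mulNr => /eqP.
rewrite oppr_eq0 mulf_eq0 -(natrD _ 1 1) pnatr_eq0 /= fmorph_eq0 => /eqP //.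
Qed.

Section TwoAdic.

(** x is a 2-adic integer whose residue modulo 2 is e. *)
Definition par2 (e : bool) (x : rat) := exists (u : int) (v : nat),
  [/\ odd v, x * v%:R = u%:~R & odd `|u| = e].

Lemma par2D e e' x y : par2 e x -> par2 e' y -> par2 (e (+) e') (x + y).
Proof.
move=> [u [v [ov h p]]] [u' [v' [ov' h' p']]].
exists (u * v'%:Z + u' * v%:Z), (v * v')%N; split; first by rewrite oddM ov ov'.
  rewrite natrM mulrDl mulrA h [v%:R * _]mulrC mulrA h' intrD !intrM.
  by rewrite -!pmulrn.
have odd_abszD (A B : int) : odd `|(A + B)%R|%N = odd `|A|%N (+) odd `|B|%N by lia.
by rewrite odd_abszD !abszM !absz_nat !oddM ov ov' p p' !andbT.
Qed.

Lemma par2Mn e x n : par2 e x -> par2 (odd n && e) (n%:R * x).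
Proof.
move=> [u [v [ov h p]]]; exists (n%:Z * u), v; split => //.
  by rewrite -mulrA h intrM -pmulrn.
by rewrite abszM absz_nat oddM p.
Qed.

Lemma par2N e x : par2 e x -> par2 e (- x).
Proof. by move=> [u [v [ov h p]]]; exists (- u), v; rewrite mulNr h mulrNz abszN. Qed.

Lemma par2_sum n (F : nat -> rat) (e : nat -> bool) : (forall i, (i < n)%N -> par2 (e i) (F i)) ->
  par2 (odd (\sum_(i < n) e i)) (\sum_(i < n) F i).
Proof.
elim: n => [|n IH] h; first by rewrite !big_ord0; exists 0, 1%N.
rewrite !big_ord_recr /= oddD oddb; apply: par2D; last exact: h.
by apply: IH => i hi; apply: h; rewrite ltnS ltnW.
Qed.

Lemma sum_bin_even n : ((\sum_(i < n.+2) (~~ odd i) * 'C(n.+1, i)) = 2 ^ n)%N.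
Proof.
apply/eqP; rewrite -(eqn_pmul2l (isT : 0 < 2)%N) -expnS -(eqr_nat rat).
have h1 : \sum_(i < n.+2) 'C(n.+1, i)%:R = 2 ^+ n.+1 :> rat.
  rewrite -[2]/(1 + 1 : rat) exprDn; apply: eq_bigr => i _.
  by rewrite !expr1n mulr1.
have h2 : \sum_(i < n.+2) (-1) ^+ i * 'C(n.+1, i)%:R = 0 :> rat.
  have := exprDn (1 : rat) (-1) n.+1; rewrite subrr expr0n /= => e; rewrite [RHS]e.
  by apply: eq_bigr => i _; rewrite expr1n mul1r mulr_natr.
apply/eqP; rewrite natrM natr_sum natrX -h1.
transitivity (\sum_(i < n.+2) 'C(n.+1, i)%:R + \sum_(i < n.+2) (-1) ^+ i * 'C(n.+1, i)%:R : rat).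
  rewrite -big_split mulr_sumr /=; apply: eq_bigr => i _; rewrite natrM -signr_odd.
  by case: (odd i); rewrite ?expr1 ?expr0 /=; ring.
by rewrite h2 addr0.
Qed.

(** The case p = 2 of von Staudt's theorem: 2 B_n is a 2-adic unit for n = 1 and for even n > 0. By
    induction, the recursion multiplied by 2 (n+3)! is reduced modulo 2. *)
Lemma bern_par (R : realType) n : par2 ((n == 1)%N || (~~ odd n && (0 < n)%N)) (2 * (n`!%:R * bern n)).
Proof.
elim/ltn_ind: n => n IH.
case: n IH => [|[|n]] IH.
- by rewrite bern0 !mulr1; exists 2, 1%N; rewrite mulr1.
- by rewrite bern1; exists (-1), 1%N.
rewrite /=; have [on|en] := boolP (odd n).
  have -> : n.+2 = (n./2).*2.+3 by have := odd_double_half n; rewrite on; lia.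
  by rewrite (bern_odd R) !mulr0; exists 0, 1%N.
have rec : \sum_(i < n.+3) 'C(n.+3, i)%:R * (2 * (i`!%:R * bern i)) = 0.
  have := bern_rec n.+2; rewrite /= => /(congr1 (fun y => 2 * (n.+3`!%:R * y))).
  rewrite !mulr0 mulr_sumr mulr_sumr => e; rewrite -[RHS]e; apply: eq_bigr => i _.
  have hi : (i <= n.+3)%N by rewrite ltnW.
  rewrite -(bin_fact hi) !natrM; have : (n.+3 - i)`!%:R != 0 :> rat by rewrite pnatr_eq0 -lt0n fact_gt0.
  by move: ((n.+3 - i)`!%:R) ('C(_, _)%:R) (i`!%:R) (bern i) => a b f g a0; field.
rewrite big_ord_recr /= in rec.
pose e (i : nat) := odd 'C(n.+3, i) && ((i == 1)%N || (~~ odd i && (0 < i)%N)).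
have hsum : par2 (odd (\sum_(i < n.+2) e i)) (\sum_(i < n.+2) 'C(n.+3, i)%:R * (2 * (i`!%:R * bern i))).
  apply: (@par2_sum _ (fun i => 'C(n.+3, i)%:R * (2 * (i`!%:R * bern i))) e) => i hi.
  by apply: par2Mn; exact: IH.
(* The binomials of even index add up to a power of 2. Removing the top one, n+3, leaves an odd sum;
   index 1 then takes the place of index 0, both binomials being odd. *)
have par : odd (\sum_(i < n.+2) e i).
  have h := sum_bin_even n.+2; rewrite 2!big_ord_recr /= in h.
  rewrite binn binSn in h.
  have o : odd n = false by apply/negbTE.
  rewrite o /= mul1n mul0n addn0 in h.
  have e1 : odd (\sum_(i < n.+2) (~~ odd i) * 'C(n.+3, i)).
    move: h o; rewrite expnS; move: (\sum_(i < n.+2) _)%N (2 ^ n.+1)%N => A B; lia.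
  have e2 : odd (\sum_(i < n.+2) e i) = odd (\sum_(i < n.+2) (~~ odd i) * 'C(n.+3, i)).
    rewrite -!(big_mkord xpredT (fun i => (e i : nat))) -!(big_mkord xpredT (fun i => ((~~ odd i) * 'C(n.+3, i))%N)).
    rewrite !big_nat_recl // /e /= bin0 bin1 !oddD !oddM /= oddb !negbK /= en !andbT.
    have hk k : odd (\sum_(0 <= i < k) (odd 'C(n.+3, i.+2) && ((i.+2 == 1)%N || (~~ odd i.+2 && (0 < i.+2)%N))))
       = odd (\sum_(0 <= i < k) (~~ odd i.+2) * 'C(n.+3, i.+2)).
      elim: k => [|k IHk]; first by rewrite !big_nil.
      rewrite !big_nat_recr // [LHS]oddD [RHS]oddD IHk; congr (_ (+) _).
      by move: 'C(n.+3, k.+2) => c; rewrite oddb oddM oddb /= andbT andbC.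
    rewrite hk.
    by move: (odd _) => b; case: b.
  by rewrite e2 e1.
move/eqP: rec; rewrite addr_eq0 binSn => /eqP rec.
rewrite par rec in hsum.
have [u [v [ov hu pu]]] := par2N hsum.
rewrite opprK in hu.
exists u, (n.+3 * v)%N; split => //; first by rewrite oddM ov /= en.
by rewrite -hu natrM; ring.
Qed.

Lemma bern_even_neq0 (R : realType) n : ~~ odd n -> bern n != 0.
Proof.
case: n => [|n] en; first by rewrite bern0 oner_eq0.
have [u [v [ov hu pu]]] := bern_par R n.+1.
apply/eqP => b0; move: hu pu; rewrite b0 !mulr0 mul0r en orbT => /esym/eqP.
by rewrite intr_eq0 => /eqP ->.
Qed.

End TwoAdic.

Section Faulhaber.
Variable R : realType.

Lemma exp_div_fact_diff (v u : rat) M :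
  (v + u) ^+ M / M`!%:R = \sum_(l < M.+1) u ^+ l / l`!%:R * (v ^+ (M - l) / (M - l)`!%:R).
Proof.
rewrite exprDn mulr_suml; apply: eq_bigr => l _; have hl : (l <= M)%N by rewrite -ltnS.
rewrite -(bin_fact hl) !natrM -mulr_natr.
have : l`!%:R != 0 :> rat by rewrite pnatr_eq0 -lt0n fact_gt0.
have : (M - l)`!%:R != 0 :> rat by rewrite pnatr_eq0 -lt0n fact_gt0.
have : 'C(M, l)%:R != 0 :> rat by rewrite pnatr_eq0 -lt0n bin_gt0.
move: (l`!%:R) ((M - l)`!%:R) ('C(M, l)%:R) => a b c c0 b0 a0.
by field; rewrite a0 b0 c0.
Qed.

(** The Bernoulli polynomial B_M in homogeneous form, u^M B_M(v/u) / M!; its difference equation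
    telescopes the power sums. *)
Definition Qtel (u v : rat) M := \sum_(i < M.+1) bern i * u ^+ i * (v ^+ (M - i) / (M - i)`!%:R).

Lemma Qtel_diff (u v : rat) D : Qtel u (v + u) D.+1 - Qtel u v D.+1 = u * (v ^+ D / D`!%:R).
Proof.
rewrite /Qtel -sumrB.
have -> : \sum_(i < D.+2) (bern i * u ^+ i * ((v + u) ^+ (D.+1 - i) / (D.+1 - i)`!%:R) -
     bern i * u ^+ i * (v ^+ (D.+1 - i) / (D.+1 - i)`!%:R)) =
   \sum_(i < D.+2) \sum_(t < D.+2 | (i < t)%N)
      bern i / (t - i)`!%:R * (u ^+ t * (v ^+ (D.+1 - t) / (D.+1 - t)`!%:R)).
  apply: eq_bigr => i _; rewrite exp_div_fact_diff big_ord_recl /= expr0 divr1 mul1r subn0.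
  rewrite mulrDr addrC addKr mulr_sumr.
  have hi : (i <= D.+1)%N by rewrite -ltnS.
  pose F t := bern i / (t - i)`!%:R * (u ^+ t * (v ^+ (D.+1 - t) / (D.+1 - t)`!%:R)).
  transitivity (\sum_(i.+1 <= t < D.+2) F t); last first.
    by rewrite big_geq_mkord; apply: eq_bigl => t.
  have -> : \sum_(i.+1 <= t < D.+2) F t = \sum_(0 <= k < D.+2 - i.+1) F (k + i.+1)%N.
    by rewrite -{1}[i.+1]add0n big_addn.
  rewrite subSS big_mkord; apply: eq_bigr => k _; rewrite /F /bump /= add1n.
  have -> : (k + i.+1 - i = k.+1)%N by lia.
  have -> : (D.+1 - (k + i.+1) = D.+1 - i - k.+1)%N by lia.
  have -> : (k + i.+1 = i + k.+1)%N by lia.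
  by rewrite exprD; move: (u ^+ i) (u ^+ k.+1) (v ^+ _) (_^-1) (_^-1) => a b c e f; ring.
rewrite (exchange_big_dep xpredT) //=.
pose H t := u ^+ t * (v ^+ (D.+1 - t) / (D.+1 - t)`!%:R).
have e (t : 'I_D.+2) : \sum_(i < D.+2 | (i < t)%N) bern i / (t - i)`!%:R * (u ^+ t * (v ^+ (D.+1 - t) / (D.+1 - t)`!%:R))
   = (t == 1 :> nat)%N%:R * H t.
  rewrite -mulr_suml -/(H t); congr (_ * _).
  rewrite -(big_ord_widen _ (fun i => bern i / (t - i)`!%:R)); last by rewrite ltnW.
  case: (t : nat) => [|t']; first by rewrite big_ord0.
  by rewrite bern_rec eqSS.
rewrite (eq_bigr _ (fun t _ => e t)) (bigD1 (Ordinal (isT : 1 < D.+2)%N)) //= big1 ?addr0.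
  by rewrite mul1r /H expr1 subSS subn0.
by move=> t; rewrite -val_eqE /= => /negPf ->; rewrite mul0r.
Qed.

Lemma faulhaber (u v : rat) D s :
  u * \sum_(i < s) (v + i%:R * u) ^+ D / D`!%:R = Qtel u (v + s%:R * u) D.+1 - Qtel u v D.+1.
Proof.
elim: s => [|s IH]; first by rewrite big_ord0 mulr0 mul0r addr0 subrr.
rewrite big_ord_recr /= mulrDr IH -natr1 mulrDl mul1r addrA.
by rewrite -[X in _ = X - _](subrK (Qtel u (v + s%:R * u) D.+1)) Qtel_diff; ring.
Qed.

Lemma sum_double (G : nat -> rat) n : \sum_(k < n.*2) G k = \sum_(j < n) (G j.*2 + G j.*2.+1).
Proof.
elim: n => [|n IH]; first by rewrite !big_ord0.
by rewrite doubleS !big_ord_recr /= IH addrA.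
Qed.

Definition convW (a b s : nat) : rat :=
  if a is a'.+1 then \sum_(i < s) i%:R ^+ a' * (s - i)%:R ^+ b.-1 / (a'`! * b.-1`!)%:R else 0.

(** The coefficient of Q^s in b_a L_b + L_a L_b - b_b L_a, where L_k is the sum of n^(k-1) Q^n /
    (k-1)! and L_0 = 0; [convW] is the part coming from L_a L_b. *)
Definition Wab (a b s : nat) : rat :=
  bern a * s%:R ^+ b.-1 / b.-1`!%:R + convW a b s -
  (if a is a'.+1 then bern b * s%:R ^+ a' / a'`!%:R else 0).

(** The source of the vectors [tvec]. For fixed N and s the convolutions are the coefficients of one
    polynomial [P1], a sum of D-th powers in arithmetic progression, which Faulhaber's formula
    evaluates. *)
Lemma WabE N a b s : odd N -> ~~ odd a -> (a + b = N)%N ->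
  Wab a b s = - \sum_(j < N.+1./2) bern (N - 1 - j.*2) / j.*2`!%:R * tvec N j.*2 a * s%:R ^+ j.*2.
Proof.
move=> oN ea e; have ob : odd b by move: oN; rewrite -e oddD (negPf ea).
have en : (N.+1./2 = (N./2).+1)%N by move: oN; lia.
have eN1 : ((N./2).*2 = N.-1)%N by move: oN; lia.
rewrite en big_ord_recr /= eN1 {2}/tvec eqxx -subn1 subnn bern0 subn1.
have -> : (-1) ^+ (N - a) = -1 :> rat by rewrite -e addKn -signr_odd ob expr1.
case: a ea e => [|a'] ea e.
  rewrite add0n in e; rewrite /Wab /convW subr0 addr0 bern0 big1 => [|j _].
    by rewrite e add0r; field; rewrite pnatr_eq0 -lt0n fact_gt0.
  rewrite /tvec ifF; last by have := ltn_ord j; lia.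
  by rewrite coefXM /= mulr0 mul0r.
have oa : odd a' by move: ea; rewrite /= negbK.
pose D := (N - 2)%N.
have eD : N = D.+2 by move: oN ob; rewrite /D; lia.
have eb : b = (D - a').+1 by lia.
have aD : (a' <= D)%N by move: ob; lia.
pose S : rat := s%:R.
pose P1 : {poly rat} := \sum_(i < s) (D`!%:R)^-1 *: (i%:R *: 'X + (s - i)%:R%:P) ^+ D.
(* Faulhaber with step u = x-1 and start v = s; one factor x-1 has been divided out. *)
pose g k : {poly rat} := ('X - 1) ^+ (D - k) * ('X^k - 1).
pose P2 : {poly rat} := \sum_(k < D.+1) (bern (D.+1 - k) * S ^+ k / k`!%:R) *: g k
   + (S ^+ D.+1 / D.+1`!%:R) *: \sum_(j < D.+1) 'X^j.
have eP : P1 = P2.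
  have x1 : ('X - 1 : {poly rat}) != 0 by rewrite -polyC1 polyXsubC_eq0.
  apply: (mulfI x1); apply: poly_pos_eq => x x0.
  have -> : (('X - 1) * P1).[x] = (x - 1) * \sum_(i < s) (S + i%:R * (x - 1)) ^+ D / D`!%:R.
    rewrite hornerM /P1 horner_sum; congr (_ * _); first by rewrite !hornerE.
    apply: eq_bigr => i _; rewrite hornerZ horner_exp hornerD hornerZ hornerX hornerC mulrC.
    congr (_ ^+ _ * _); rewrite natrB 1?ltnW // /S; ring.
  rewrite faulhaber; have -> : S + s%:R * (x - 1) = S * x by rewrite /S; ring.
  rewrite /Qtel -sumrB (reindex_inj rev_ord_inj) /= big_ord_recr /=.
  have -> : (('X - 1) * P2).[x] = \sum_(k < D.+1) bern (D.+1 - k) * S ^+ k / k`!%:R * ((x - 1) ^+ (D.+1 - k) * (x ^+ k - 1))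
     + S ^+ D.+1 / D.+1`!%:R * (x ^+ D.+1 - 1).
    have hx : ('X - 1 : {poly rat}).[x] = x - 1 by rewrite !hornerE.
    rewrite hornerM hx /P2 hornerD mulrDr hornerZ horner_sum mulr_sumr; congr (_ + _).
      apply: eq_bigr => k _; rewrite hornerZ /g hornerM horner_exp !hornerE /=.
      have -> : (D.+1 - k = (D - k).+1)%N by have := ltn_ord k; lia.
      rewrite [_ ^+ (D - k).+1]exprS.
      by move: (x ^+ k) ((x - 1) ^+ (D - k)) (bern _) (S ^+ k) (k`!%:R^-1) => a1 b1 c1 d1 f1; ring.
    rewrite mulrCA; congr (_ * _); rewrite subrX1 horner_sum; congr (_ * _).
    by apply: eq_bigr => j _; rewrite hornerXn.
  congr (_ + _).
    apply: eq_bigr => k _; rewrite subSS subKn; last by rewrite ltnW.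
    rewrite exprMn; move: (S ^+ k) (x ^+ k) ((x - 1) ^+ _) (bern _) (_^-1) => a1 b1 c1 d1 f1; ring.
  rewrite subnn subn0 bern0 expr0 exprMn.
  move: (S ^+ _) (x ^+ _) (_^-1) => a1 b1 c1; ring.
have cP1 : convW a'.+1 b s = P1`_a'.
  rewrite /convW /P1 coef_sum; apply: eq_bigr => i _; rewrite coefZ eb /=.
  have -> : ((i%:R *: 'X + (s - i)%:R%:P : {poly rat}) ^+ D)`_a' =
     'C(D, a')%:R * (i%:R ^+ a' * (s - i)%:R ^+ (D - a')).
    rewrite addrC exprDn coef_sum (bigD1 (Ordinal (aD : (a' < D.+1)%N))) //= big1 => [|k].
      rewrite addr0 coefMn -rmorphXn /= coefCM exprZn coefZ coefXn eqxx mulr1 -[_ *+ 'C(D, a')]mulr_natl.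
      by congr (_ * _); rewrite mulrC.
    rewrite -val_eqE /= => ne; rewrite coefMn -rmorphXn /= coefCM exprZn coefZ coefXn.
    by rewrite eq_sym (negPf ne) !mulr0 mul0rn.
  rewrite -(bin_fact aD) !natrM.
  have : a'`!%:R != 0 :> rat by rewrite pnatr_eq0 -lt0n fact_gt0.
  have : (D - a')`!%:R != 0 :> rat by rewrite pnatr_eq0 -lt0n fact_gt0.
  have : 'C(D, a')%:R != 0 :> rat by rewrite pnatr_eq0 -lt0n bin_gt0.
  move: (a'`!%:R) ((D - a')`!%:R) ('C(D, a')%:R) (_ ^+ _) (_ ^+ _) => a1 b1 c1 f1 h1 c0 b0 a0.
  by field; rewrite a0 b0 c0.
(* [fpoly] is [g k] at -X up to two monomials; at the odd index a' the substitution changes the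
   sign. *)
have gE k : ~~ odd k -> (k <= D)%N -> (g k)`_a' = - (fpoly N k)`_a' - (a' == (D - k)%N)%:R.
  move=> ek kD; have op : odd (D - k) by move: oN; rewrite eD; lia.
  have -> : fpoly N k = 'X^k - 'X^(D - k) + (g k \Po (- 'X)).
    rewrite /fpoly -/D /g rmorphM rmorphXn /= !rmorphB /= comp_polyX rmorph1 rmorphXn /= comp_polyX.
    rewrite [(- 'X) ^+ k]exprNn -[(-1) ^+ k]signr_odd (negPf ek) expr0 mul1r.
    have -> : - 'X - 1 = - 1 - 'X :> {poly rat} by rewrite addrC.
    by move: ('X^k : {poly rat}) ('X^(D - k) : {poly rat}) (_ ^+ (D - k)) => p q r; ring.
  rewrite coefD coefB !coefXn; have -> : (g k \Po (- 'X))`_a' = - (g k)`_a'.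
    rewrite comp_polyE coef_sum.
    have [lt|ge] := ltnP a' (size (g k)); last first.
      rewrite [in RHS]nth_default // oppr0 big1 // => i _.
      rewrite coefZ [(- 'X) ^+ _]exprNn -signr_odd.
      have ne : (a' == i) = false := gtn_eqF (leq_trans (ltn_ord i) ge).
      by case: (odd i); rewrite ?expr1 ?expr0 ?mulN1r ?mul1r ?coefN coefXn ne ?oppr0 mulr0.
    rewrite (bigD1 (Ordinal lt)) //= big1 => [|i].
      by rewrite addr0 coefZ [(- 'X) ^+ _]exprNn -signr_odd oa expr1 mulN1r coefN coefXn eqxx mulrN1.
    rewrite -val_eqE /= => ne.
    rewrite coefZ [(- 'X) ^+ _]exprNn -signr_odd.
    by case: (odd i); rewrite ?expr1 ?expr0 ?mulN1r ?mul1r ?coefN coefXn eq_sym (negPf ne) ?oppr0 mulr0.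
  rewrite (_ : (a' == k) = false); last by apply/negbTE; lia.
  by rewrite mulr0n; move: ((g k)`_a') ((a' == (D - k)%N)%:R) => p r; ring.
have hn : (D.+1 = (N./2).*2)%N by lia.
rewrite /Wab cP1 eP /P2 coefD coefZ coef_sum.
have -> : (\sum_(j < D.+1) 'X^j : {poly rat})`_a' = 1.
  rewrite coef_sum (bigD1 (Ordinal (aD : (a' < D.+1)%N))) //= coefXn eqxx big1 ?addr0 // => k.
  by rewrite -val_eqE /= coefXn eq_sym => /negPf ->.
rewrite (eq_bigr (fun k : 'I_D.+1 => bern (D.+1 - k) * S ^+ k / k`!%:R * (g k)`_a')); last first.
  by move=> k _; rewrite coefZ.
rewrite hn (sum_double (fun k => bern ((N./2).*2 - k) * S ^+ k / k`!%:R * (g k)`_a')) big_split /=.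
(* For odd powers of S the Bernoulli index is odd, so only b_1 = -1/2, at power D, survives; it
   cancels the last term of [Wab]. *)
have -> : \sum_(j < N./2) bern ((N./2).*2 - j.*2.+1) * S ^+ j.*2.+1 / j.*2.+1`!%:R * (g j.*2.+1)`_a' =
    - 2^-1 * S ^+ D / D`!%:R * (a' == D)%:R.
  have l0 : ((N./2).-1 < N./2)%N by lia.
  rewrite (bigD1 (Ordinal l0)) //= big1 ?addr0 => [|j ne].
    have -> : (((N./2).-1).*2.+1 = D)%N by lia.
    rewrite -hn subSnn bern1; congr (_ * _).
    rewrite /g subnn expr0 mul1r coefB coefXn coef1 (_ : (a' == 0)%N = false) ?subr0 //.
    by apply/negbTE; lia.
  have -> : ((N./2).*2 - j.*2.+1 = ((N./2) - j - 2).*2.+3)%N.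
    by have := ltn_ord j; move: ne; rewrite -val_eqE /=; lia.
  by rewrite (bern_odd R) !mul0r.
rewrite (eq_bigr (fun j : 'I_(N./2) => - (bern (N - 1 - j.*2) / j.*2`!%:R * tvec N j.*2 a'.+1 * S ^+ j.*2)
    - (a' == (D - j.*2)%N)%:R * (bern (N - 1 - j.*2) * S ^+ j.*2 / j.*2`!%:R))); last first.
  move=> j _; have hj := ltn_ord j.
  rewrite gE ?odd_double //; last by lia.
  rewrite /tvec ifF; last by apply/negbTE; lia.
  rewrite coefXM /=; have -> : ((N./2).*2 - j.*2 = N - 1 - j.*2)%N by lia.
  by move: (bern _) (S ^+ _) (j.*2`!%:R^-1) ((fpoly N j.*2)`_a') ((a' == _)%:R) => a1 b1 c1 d1 f1; ring.
rewrite sumrB sumrN.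
have -> : \sum_(j < N./2) (a' == (D - j.*2)%N)%:R * (bern (N - 1 - j.*2) * S ^+ j.*2 / j.*2`!%:R) =
   bern a'.+1 * S ^+ b.-1 / b.-1`!%:R.
  have l0 : ((D - a')./2 < N./2)%N by lia.
  rewrite (bigD1 (Ordinal l0)) //= big1 ?addr0 => [|j].
    have -> : (((D - a')./2).*2 = D - a')%N by move: ob; rewrite eb /=; lia.
    by rewrite subKn // eqxx mul1r eb /=; congr (bern _ * _ / _); lia.
  rewrite -val_eqE /= => ne; rewrite (_ : (a' == _) = false) ?mul0r //; apply/negbTE.
  by have := ltn_ord j; move: ne ob; rewrite eb /=; lia.
have -> : bern b * s%:R ^+ a' / a'`!%:R = - 2^-1 * S ^+ D / D`!%:R * (a' == D)%:R.
  have [e1|ne] := eqVneq a' D.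
    by rewrite eb e1 subnn bern1 mulr1.
  rewrite mulr0; have -> : b = ((b./2).-1).*2.+3 by move: ob ne; rewrite eb /=; lia.
  by rewrite (bern_odd R) !mul0r.
rewrite -hn eD /= -/S.
move: (\sum_(j < _) _) (bern _ * _ / _) (_ * _%:R) (S ^+ D.+1) (D.+1`!%:R) => a1 b1 c1 d1 f1; ring.
Qed.
End Faulhaber.
End BernoulliConvolution.
Import BernoulliConvolution.

(** * Calculus of complex-valued integrals over (t, 1-t) *)

Module IteratedIntegrals.
Section ComplexIntegral.
Context {R : realType}.
Local Notation C := R[i].
Local Notation mu := (@lebesgue_measure R).

Lemma ReM (z w : C) : complex.Re (z * w) = complex.Re z * complex.Re w - complex.Im z * complex.Im w.
Proof. by case: z; case: w. Qed.
Lemma ImM (z w : C) : complex.Im (z * w) = complex.Re z * complex.Im w + complex.Im z * complex.Re w.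
Proof. by case: z => a b; case: w => c d /=. Qed.

Definition ccont (h : R -> C) (x : R) := (h y : C^o) @[y --> x] --> (h x : C^o).

Lemma ccontM f g x : ccont f x -> ccont g x -> ccont (fun y => f y * g y) x.
Proof. by move=> a b; exact: (@cvgCM R R (nbhs x) (nbhs_filter x) f g _ _ a b). Qed.
Lemma ccontD f g x : ccont f x -> ccont g x -> ccont (fun y => f y + g y) x.
Proof. by move=> a b; exact: (@cvgCD R R (nbhs x) (nbhs_filter x) f g _ _ a b). Qed.
Lemma ccontB f g x : ccont f x -> ccont g x -> ccont (fun y => f y - g y) x.
Proof. by move=> a b; exact: (@cvgCB R R (nbhs x) (nbhs_filter x) f g _ _ a b). Qed.
Lemma ccont_cst (c : C) x : ccont (fun=> c) x.
Proof. exact: (@cvgC_cst R R (nbhs x) (nbhs_filter x) c). Qed.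

Lemma ccont_refl f x : ccont f (1 - x) -> ccont (fun y => f (1 - y)) x.
Proof.
move=> c; have cx : 1 - y @[y --> x] --> 1 - x.
  by apply: cvgB; [exact: cvg_cst|exact: cvg_id].
exact: (@cvg_comp _ _ _ (fun y => 1 - y) f _ _ _ cx c).
Qed.

Lemma ccont_affine (h : R -> C) (a b x : R) : ccont h (a + b * x) -> ccont (fun y => h (a + b * y)) x.
Proof.
move=> ch; have cx : a + b * y @[y --> x] --> a + b * x.
  by apply: cvgD; [exact: cvg_cst|apply: cvgM; [exact: cvg_cst|exact: cvg_id]].
exact: (@cvg_comp _ _ _ (fun y => a + b * y) h _ _ _ cx ch).
Qed.

Lemma ccont_Re h x : ccont h x -> {for x, continuous (fun y => complex.Re (h y))}.
Proof. by move=> c; refine (cvgC_Re (nbhs_filter x) c). Qed.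
Lemma ccont_Im h x : ccont h x -> {for x, continuous (fun y => complex.Im (h y))}.
Proof. by move=> c; refine (cvgC_Im (nbhs_filter x) c). Qed.

Definition cder (H : R -> C) (x : R) (v : C) :=
  is_derive x 1 (fun y => complex.Re (H y)) (complex.Re v) /\
  is_derive x 1 (fun y => complex.Im (H y)) (complex.Im v).

Lemma is_derive_continuous (f : R -> R) (x df : R) : is_derive x 1 f df -> {for x, continuous f}.
Proof. by move=> h; apply/differentiable_continuous/derivable1_diffP; exact: ex_derive. Qed.

Lemma cder_ccont H x v : cder H x v -> ccont H x.
Proof.
by move=> [h1 h2]; apply: cvgC_ReIm; exact: (is_derive_continuous (f := fun y => _ (H y))).
Qed.

#[local] Opaque ccont.

Lemma cderD F G x f g : cder F x f -> cder G x g -> cder (fun y => F y + G y) x (f + g).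
Proof.
move=> [a b] [a' b']; split.
  have -> : (fun y => complex.Re (F y + G y)) = (fun y => complex.Re (F y)) + (fun y => complex.Re (G y)).
    by apply/funext => y; rewrite ReD.
  by rewrite ReD; exact: is_deriveD.
have -> : (fun y => complex.Im (F y + G y)) = (fun y => complex.Im (F y)) + (fun y => complex.Im (G y)).
  by apply/funext => y; rewrite ImD.
by rewrite ImD; exact: is_deriveD.
Qed.

Lemma cderM F G x f g : cder F x f -> cder G x g -> cder (fun y => F y * G y) x (f * G x + F x * g).
Proof.
move=> [a b] [a' b']; split.
  have -> : (fun y => complex.Re (F y * G y)) = (fun y => complex.Re (F y)) * (fun y => complex.Re (G y)) -
     (fun y => complex.Im (F y)) * (fun y => complex.Im (G y)).
    by apply/funext => y; rewrite ReM.
  have := is_deriveB (is_deriveM a a') (is_deriveM b b').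
  by congr is_derive; rewrite ReD !ReM /GRing.scale /=; move: (complex.Re f) (complex.Re g)
    (complex.Im f) (complex.Im g) (complex.Re (F x)) (complex.Im (F x)) (complex.Re (G x))
    (complex.Im (G x)) => p1 p2 p3 p4 p5 p6 p7 p8; ring.
have -> : (fun y => complex.Im (F y * G y)) = (fun y => complex.Re (F y)) * (fun y => complex.Im (G y)) +
     (fun y => complex.Im (F y)) * (fun y => complex.Re (G y)).
  by apply/funext => y; rewrite ImM.
have := is_deriveD (is_deriveM a b') (is_deriveM b a').
by congr is_derive; rewrite ImD !ImM /GRing.scale /=; move: (complex.Re f) (complex.Re g)
  (complex.Im f) (complex.Im g) (complex.Re (F x)) (complex.Im (F x)) (complex.Re (G x))
  (complex.Im (G x)) => p1 p2 p3 p4 p5 p6 p7 p8; ring.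
Qed.

Lemma cder_cst (c : C) x : cder (fun=> c) x 0.
Proof. by split; exact: is_derive_cst. Qed.

Lemma cderZ (c : C) F x f : cder F x f -> cder (fun y => c * F y) x (c * f).
Proof. by move=> h; have := cderM (cder_cst c x) h; rewrite mul0r add0r. Qed.

Lemma cderN F x f : cder F x f -> cder (fun y => - F y) x (- f).
Proof.
move=> h; rewrite -mulN1r (_ : (fun y => - F y) = (fun y => -1 * F y)); first exact: cderZ.
by apply/funext => y; rewrite mulN1r.
Qed.

Lemma cderB F G x f g : cder F x f -> cder G x g -> cder (fun y => F y - G y) x (f - g).
Proof. by move=> h h'; apply: cderD h (cderN h'). Qed.

Lemma cder_real (f : R -> R) (x df : R) : is_derive x 1 f df -> cder (fun y => (f y)%:C) x df%:C.
Proof. by move=> h; split => //; exact: is_derive_cst. Qed.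

Lemma cder_affine (F : R -> C) (a b x : R) f : cder F (a + b * x) f ->
  cder (fun y => F (a + b * y)) x (f * b%:C).
Proof.
have h : is_derive x 1 (fun y => a + b * y) b.
  have := is_deriveD (is_derive_cst a x (1 : R)) (is_deriveZ b (is_derive_id x (1 : R))).
  by rewrite add0r -[b *: 1]/(b * 1) mulr1.
have e1 : complex.Re (f * b%:C) = complex.Re f * b by rewrite ReM /= mulr0 subr0.
have e2 : complex.Im (f * b%:C) = complex.Im f * b by rewrite ImM /= mulr0 add0r.
move=> [h1 h2]; split.
  rewrite e1; exact: (@is_derive1_comp R (fun y => complex.Re (F y)) (fun y => a + b * y) x _ b h1 h).
rewrite e2; exact: (@is_derive1_comp R (fun y => complex.Im (F y)) (fun y => a + b * y) x _ b h2 h).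
Qed.

Lemma within_cont (f : R -> R) (a b : R) : (forall x, a <= x <= b -> {for x, continuous f}) ->
  {within `[a, b], continuous f}.
Proof.
by move=> h; apply: continuous_in_subspaceT => x; rewrite inE /= in_itv /= => hx; exact: h.
Qed.

Lemma integrable_cont (f : R -> R) (a b : R) : (forall x, a <= x <= b -> {for x, continuous f}) ->
  mu.-integrable `[a, b] (EFin \o f).
Proof.
move=> h; apply: continuous_compact_integrable; first exact: segment_compact.
exact: within_cont.
Qed.

Lemma rint_FTC (f F : R -> R) (a b : R) : a < b ->
  (forall x, a <= x <= b -> is_derive x 1 F (f x)) ->
  (forall x, a <= x <= b -> {for x, continuous f}) ->
  \int[mu]_(t in `]a, b[) f t = F b - F a.
Proof.
move=> ab dF cf; rewrite /Rintegral.
have iab := integrable_cont cf.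
have ioo : mu.-integrable `]a, b[ (EFin \o f).
  apply: integrableS iab => //; exact: subset_itv_oo_cc.
rewrite -(@integral_itv_bndoo _ a b (EFin \o f) true false); last exact: measurable_int ioo.
rewrite (@continuous_FTC2 _ f F a b ab) //.
- exact: within_cont.
- split.
  + move=> x; rewrite in_itv /= => /andP[x1 x2].
    by have hx : a <= x <= b; [rewrite !ltW|have := dF x hx => d; exact: ex_derive].
  + apply: cvg_at_right_filter; apply: (is_derive_continuous (dF a _)).
    by rewrite lexx ltW.
  + apply: cvg_at_left_filter; apply: (is_derive_continuous (dF b _)).
    by rewrite lexx ltW.
- move=> x; rewrite in_itv /= => /andP[x1 x2]; rewrite derive1E.
  by have hx : a <= x <= b; [rewrite !ltW|have := dF x hx => d; exact: derive_val].
Qed.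

Lemma rint_antider (f : R -> R) (a b : R) :
  (forall x, a <= x <= b -> {for x, continuous f}) ->
  exists F : R -> R, forall x, a < x < b -> is_derive x 1 F (f x).
Proof.
move=> cf; pose F x := (\int[mu]_(t in [set` Interval (BLeft a) (BRight x)]) (f t))%R.
exists F => x /andP[x1 x2].
have hx : a <= x <= b by rewrite !ltW.
have [d e] := @continuous_FTC1 R f (BLeft a) x b x2 (integrable_cont cf) x1 (cf x hx).
exact: (DeriveDef d (etrans (esym (derive1E F x)) e)).
Qed.

Lemma cantider (h : R -> C) (a b : R) : (forall x, a <= x <= b -> ccont h x) ->
  exists H : R -> C, forall x, a < x < b -> cder H x (h x).
Proof.
move=> ch.
have [F1 h1] := @rint_antider (fun x => complex.Re (h x)) a b (fun x hx => ccont_Re (ch x hx)).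
have [F2 h2] := @rint_antider (fun x => complex.Im (h x)) a b (fun x hx => ccont_Im (ch x hx)).
by exists (fun x => F1 x +i* F2 x) => x hx; split; [exact: h1|exact: h2].
Qed.

Lemma cint_ext (a b : R) (g g' : R -> C) : (forall x, a < x < b -> g x = g' x) -> cint a b g = cint a b g'.
Proof.
move=> h; rewrite /cint.
by congr (_ +i* _); apply: eq_Rintegral => x; rewrite inE /= in_itv /= => hx; rewrite h.
Qed.

Lemma cint_FTC (g G : R -> C) (a b : R) : a < b ->
  (forall x, a <= x <= b -> cder G x (g x)) ->
  (forall x, a <= x <= b -> ccont g x) ->
  cint a b g = G b - G a.
Proof.
move=> ab dG cg; rewrite /cint.
have d1 x : a <= x <= b -> is_derive x 1 (fun x => complex.Re (G x)) (complex.Re (g x)).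
  by move=> /dG[].
have d2 x : a <= x <= b -> is_derive x 1 (fun x => complex.Im (G x)) (complex.Im (g x)).
  by move=> /dG[].
rewrite (rint_FTC ab d1 (fun x hx => ccont_Re (cg x hx))).
rewrite (rint_FTC ab d2 (fun x hx => ccont_Im (cg x hx))).
by apply: complex_ext; rewrite /= ?ReD ?ImD; case: (G a).
Qed.

(** The factor 2 comes from applying the real mean value theorem to the real and imaginary parts
    separately. *)
Lemma cder_bound (H h : R -> C) (a b M : R) : a < b -> (forall x, a <= x <= b -> cder H x (h x)) ->
  (forall x, a <= x <= b -> nc (h x) <= M) -> nc (H b - H a) <= 2 * M * (b - a).
Proof.
move=> ab dH hM; apply: le_trans (nc_ReIm _) _.
have ba : 0 < b - a by rewrite subr_gt0.
have step (F f : R -> R) : (forall x, a <= x <= b -> is_derive x 1 F (f x)) ->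
    (forall x, a <= x <= b -> `|f x| <= M) -> `|F b - F a| <= M * (b - a).
  move=> dF hf; have [c hc ->] := @MVT _ F f a b ab
    (fun x hx => dF x (subset_itv_oo_cc hx)) (within_cont (fun x hx => is_derive_continuous (dF x hx))).
  rewrite normrM (gtr0_norm ba) ler_pM2r //; apply: hf.
  by move: hc; rewrite in_itv /= => /andP[? ?]; rewrite !ltW.
have -> : 2 * M * (b - a) = M * (b - a) + M * (b - a) by ring.
apply: lerD.
  rewrite (_ : complex.Re (H b - H a) = complex.Re (H b) - complex.Re (H a)); last by case: (H b); case: (H a).
  apply: (step (fun x => complex.Re (H x)) (fun x => complex.Re (h x))) => x hx; first by have [] := dH x hx.
  exact: le_trans (nc_Re _) (hM x hx).
rewrite (_ : complex.Im (H b - H a) = complex.Im (H b) - complex.Im (H a)); last by case: (H b); case: (H a).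
apply: (step (fun x => complex.Im (H x)) (fun x => complex.Im (h x))) => x hx; first by have [] := dH x hx.
exact: le_trans (nc_Im _) (hM x hx).
Qed.

Definition xu (t u : R) : R := t + (1 - 2 * t) * u.

(** The integral of h over (t, 1-t), kept in the parameter u of (0,1) so that it has the shape of
    the iterated integral along the straight path. *)
Definition Lt (t : R) (h : R -> C) : C := cint 0 1 (fun u => h (xu t u) * (1 - 2 * t)%:C).

(** The trailing factor 1 is the empty tail of [simplex_int]. *)
Definition Lt2 (t : R) (f g : R -> C) : C :=
  cint 0 1 (fun u => f (xu t u) * (1 - 2 * t)%:C * cint u 1 (fun v => g (xu t v) * (1 - 2 * t)%:C * 1)).

Definition on01 (P : R -> Prop) := forall x, 0 < x < 1 -> P x.
Definition adm (t : R) (h H : R -> C) := forall x, t <= x <= 1 - t -> cder H x (h x) /\ ccont h x.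

Section FixT.
Local Ltac tlra t1 t2 := have ? := t1; have ? := t2; lra.
Variable t : R.
Hypotheses (t1 : 0 < t) (t2 : t < 2^-1).

Let c0 : 0 < 1 - 2 * t. Proof. by rewrite subr_gt0; tlra t1 t2. Qed.

Lemma xu_itv (u : R) : 0 <= u <= 1 -> t <= xu t u <= 1 - t.
Proof.
move=> /andP[u0 u1]; rewrite /xu; have a := mulr_ge0 (ltW c0) u0.
have b : (1 - 2 * t) * u <= 1 - 2 * t by rewrite -[leRHS]mulr1 ler_pM2l.
by apply/andP; split; tlra t1 t2.
Qed.

Lemma ccont_xu (h : R -> C) u : ccont h (xu t u) -> ccont (fun v => h (xu t v) * (1 - 2 * t)%:C) u.
Proof.
by move=> ch; exact: ccontM (ccont_affine ch) (@ccont_cst _ _).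
Qed.

Lemma cint_xu (h H : R -> C) a : 0 <= a < 1 -> adm t h H ->
  cint a 1 (fun u => h (xu t u) * (1 - 2 * t)%:C) = H (1 - t) - H (xu t a).
Proof.
move=> /andP[a0 a1] ad.
have hx x : a <= x <= 1 -> t <= xu t x <= 1 - t.
  by move=> /andP[x0 x1]; apply: xu_itv; rewrite x1 (le_trans a0).
rewrite (@cint_FTC _ (fun u => H (xu t u)) a 1 a1); first last.
- by move=> x /hx /ad[_ c]; exact: ccont_xu.
- by move=> x /hx /ad[d _]; exact: cder_affine.
by congr (H _ - _); rewrite /xu; ring.
Qed.

Lemma LtE h H : adm t h H -> Lt t h = H (1 - t) - H t.
Proof.
move=> ad; rewrite /Lt (cint_xu _ ad) ?lexx ?ltr01 //.
by congr (_ - H _); rewrite /xu; ring.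
Qed.

Lemma Lt_ext h h' : (forall x, t <= x <= 1 - t -> h x = h' x) -> Lt t h = Lt t h'.
Proof.
by move=> e; apply: cint_ext => u /andP[u0 u1]; rewrite e //; apply: xu_itv; rewrite !ltW.
Qed.

Lemma Lt2E f g G : adm t g G -> Lt2 t f g = Lt t (fun x => f x * (G (1 - t) - G x)).
Proof.
move=> ad; apply: cint_ext => u /andP[u0 u1].
rewrite (@cint_ext u 1 _ (fun v => g (xu t v) * (1 - 2 * t)%:C)) => [|v _]; last by rewrite mulr1.
by rewrite (cint_xu _ ad) ?u1 ?ltW // mulrAC.
Qed.

(** Continuity on a slightly larger interval gives an antiderivative with two-sided derivatives also
    at t and 1-t. *)
Definition ctn (h : R -> C) := forall x, t / 3 <= x <= 1 - t / 3 -> ccont h x.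

Lemma ctn_adm h : ctn h -> exists H, adm t h H.
Proof.
move=> c; have [H hH] := cantider c; exists H => x /andP[x0 x1]; split.
  by apply: hH; apply/andP; split; tlra t1 t2.
by apply: c; apply/andP; split; tlra t1 t2.
Qed.

Lemma on01_ctn f : on01 (ccont f) -> ctn f.
Proof. by move=> c x /andP[x0 x1]; apply: c; apply/andP; split; tlra t1 t2. Qed.

Lemma on01_adm f : on01 (ccont f) ->
  exists F, adm t f F /\ forall x, t / 3 <= x <= 1 - t / 3 -> cder F x (f x).
Proof.
move=> c; have [F hF] : exists H : R -> C, forall x, t / 4 < x < 1 - t / 4 -> cder H x (f x).
  by apply: cantider => x /andP[x0 x1]; apply: c; apply/andP; split; tlra t1 t2.
exists F; split=> x /andP[x0 x1]; last by apply: hF; apply/andP; split; tlra t1 t2.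
by split; [apply: hF|apply: c]; apply/andP; split; tlra t1 t2.
Qed.

Lemma LtD f g : ctn f -> ctn g -> Lt t (fun x => f x + g x) = Lt t f + Lt t g.
Proof.
move=> /ctn_adm[F hF] /ctn_adm[G hG].
rewrite (LtE hF) (LtE hG) (@LtE _ (fun x => F x + G x)).
  by move: (F _) (F _) (G _) (G _) => a b c d; ring.
by move=> x hx; have [[a b] [a' b']] := (hF x hx, hG x hx); split; [exact: cderD|exact: ccontD].
Qed.

Lemma LtZ (c : C) f : ctn f -> Lt t (fun x => c * f x) = c * Lt t f.
Proof.
move=> /ctn_adm[F hF]; rewrite (LtE hF) (@LtE _ (fun x => c * F x)); first by rewrite mulrBr.
move=> x hx; have [a b] := hF x hx; split; first exact: cderZ.
exact: ccontM (@ccont_cst _ _) b.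
Qed.

Lemma LtB f g : ctn f -> ctn g -> Lt t (fun x => f x - g x) = Lt t f - Lt t g.
Proof.
move=> cf cg; have cg' : ctn (fun x => -1 * g x).
  by move=> x hx; apply: ccontM; [exact: ccont_cst|exact: cg].
rewrite -[- Lt t g]mulN1r -(LtZ _ cg) -(LtD cf cg').
by apply: Lt_ext => x _; rewrite mulN1r.
Qed.

Lemma Lt_bound f M : ctn f -> (forall x, t <= x <= 1 - t -> nc (f x) <= M) -> nc (Lt t f) <= 2 * M.
Proof.
move=> /ctn_adm[F hF] hM; rewrite (LtE hF).
have tt : t < 1 - t by tlra t1 t2.
have M0 : 0 <= M by apply: le_trans (nc_ge0 (f t)) (hM t _); rewrite lexx ltW.
apply: le_trans (cder_bound tt (fun x hx => (hF x hx).1) hM) _.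
rewrite -[leRHS]mulr1; apply: ler_wpM2l; [by rewrite mulr_ge0|tlra t1 t2].
Qed.

(** With antiderivatives F and G, the sum of the two integrands is the derivative of G(1-t) F +
    F(1-t) G - F G. *)
Lemma shuffle2 f g : on01 (ccont f) -> on01 (ccont g) ->
  Lt2 t f g + Lt2 t g f = Lt t f * Lt t g.
Proof.
move=> cf cg; have [F [aF dF]] := on01_adm cf; have [G [aG dG]] := on01_adm cg.
rewrite (Lt2E f aG) (Lt2E g aF) (LtE aF) (LtE aG) -LtD; first last.
- by move=> x hx; apply: ccontM (on01_ctn cg hx) (ccontB (@ccont_cst _ _) (cder_ccont (dF x hx))).
- by move=> x hx; apply: ccontM (on01_ctn cf hx) (ccontB (@ccont_cst _ _) (cder_ccont (dG x hx))).
rewrite (@LtE _ (fun x => G (1 - t) * F x + F (1 - t) * G x - F x * G x)).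
  by move: (F _) (F _) (G _) (G _) => a b c d; ring.
move=> x hx; have [[a b] [a' b']] := (aF x hx, aG x hx); split.
  have := cderB (cderD (cderZ (G (1 - t)) a) (cderZ (F (1 - t)) a')) (cderM a a').
  by congr cder; move: (F _) (F _) (G _) (G _) (f x) (g x) => u v w z p q; ring.
exact: ccontD (ccontM b (ccontB (@ccont_cst _ _) (cder_ccont a')))
  (ccontM b' (ccontB (@ccont_cst _ _) (cder_ccont a))).
Qed.

Lemma refl_itv (a b x : R) : a <= x <= b -> 1 - b <= 1 - x <= 1 - a.
Proof. by move=> /andP[x0 x1]; apply/andP; split; tlra t1 t2. Qed.

Lemma cder_refl F x v : cder F (1 - x) v -> cder (fun y => F (1 - y)) x (- v).
Proof.
move=> d; have := @cder_affine F 1 (-1) x v; rewrite mulN1r => /(_ d).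
have -> : v * (-1)%:C = - v by rewrite rmorphN mulrN mulr1.
by congr cder; apply/funext => y; rewrite mulN1r.
Qed.

Lemma adm_refl h H : adm t h H -> adm t (fun x => h (1 - x)) (fun x => - H (1 - x)).
Proof.
move=> ad x hx; have [|d c] := ad (1 - x); first by have := refl_itv hx; rewrite opprB addrC subrK.
by split; [have := cderN (cder_refl d); rewrite opprK|exact: ccont_refl].
Qed.

Lemma Lt_refl h : ctn h -> Lt t (fun x => h (1 - x)) = Lt t h.
Proof.
move=> /ctn_adm[H ad]; rewrite (LtE ad) (LtE (adm_refl ad)) opprK.
have -> : 1 - (1 - t) = t by ring.
by rewrite addrC.
Qed.

(** Reversing the path reverses the word; after substitution this is integration by parts with (G -
    G(t)) (F(1-t) - F), which vanishes at both ends. *)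
Lemma Lt2_refl f g : on01 (ccont f) -> on01 (ccont g) ->
  Lt2 t (fun x => f (1 - x)) (fun x => g (1 - x)) = Lt2 t g f.
Proof.
move=> cf cg; have [F [aF dF]] := on01_adm cf; have [G [aG dG]] := on01_adm cg.
rewrite (Lt2E _ (adm_refl aG)) (Lt2E g aF).
have -> : 1 - (1 - t) = t by ring.
pose h x := f x * (G x - G t).
have ch : ctn h.
  by move=> x hx; apply: ccontM (on01_ctn cf hx) (ccontB (cder_ccont (dG x hx)) (@ccont_cst _ _)).
have -> : Lt t (fun x => f (1 - x) * (- G t - - G (1 - x))) = Lt t (fun x => h (1 - x)).
  by apply: Lt_ext => x _; rewrite /h opprK [- G t + _]addrC.
have cgF : ctn (fun x => g x * (F (1 - t) - F x)).
  by move=> x hx; apply: ccontM (on01_ctn cg hx) (ccontB (@ccont_cst _ _) (cder_ccont (dF x hx))).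
rewrite (Lt_refl ch); apply/eqP; rewrite eq_sym -subr_eq0 -(LtB cgF ch); apply/eqP.
rewrite (@LtE _ (fun x => (G x - G t) * (F (1 - t) - F x))).
  by rewrite !subrr mulr0 mul0r subrr.
move=> x hx; have [[a b] [a' b']] := (aF x hx, aG x hx); split.
  have := cderM (cderB a' (cder_cst (G t) x)) (cderB (cder_cst (F (1 - t)) x) a).
  by congr cder; rewrite /h; move: (F _) (F _) (G _) (G _) (f x) (g x) => u v w z p q; ring.
exact: ccontB (ccontM b' (ccontB (@ccont_cst _ _) (cder_ccont a)))
  (ccontM b (ccontB (cder_ccont a') (@ccont_cst _ _))).
Qed.

Lemma Lt2_ext f f' g g' : (forall x, t <= x <= 1 - t -> f x = f' x) ->
  (forall x, t <= x <= 1 - t -> g x = g' x) -> Lt2 t f g = Lt2 t f' g'.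
Proof.
move=> ef eg; apply: cint_ext => u /andP[u0 u1]; rewrite ef; last by apply: xu_itv; rewrite !ltW.
congr (_ * _); apply: cint_ext => v /andP[v0 v1]; rewrite eg //; apply: xu_itv.
by rewrite (ltW v1) andbT (le_trans (ltW u0)) // ltW.
Qed.

Lemma Lt_sum (I : Type) (r : seq I) (f : I -> R -> C) : (forall i, ctn (f i)) ->
  ctn (fun x => \sum_(i <- r) f i x) /\ Lt t (fun x => \sum_(i <- r) f i x) = \sum_(i <- r) Lt t (f i).
Proof.
move=> cf; elim: r => [|i r [c IH]].
  have e0 : (fun x : R => \sum_(i <- [::]) f i x) = (fun=> 0) by apply/funext => x; rewrite big_nil.
  rewrite e0 big_nil; split; first by move=> x _; exact: ccont_cst.
  rewrite (@LtE _ (fun=> 0)) ?subrr // => x _; split; [exact: cder_cst|exact: ccont_cst].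
have e0 : (fun x : R => \sum_(j <- i :: r) f j x) = (fun x => f i x + \sum_(j <- r) f j x).
  by apply/funext => x; rewrite big_cons.
rewrite e0 [X in _ = X]big_cons -IH; split; last exact: (LtD (cf i) c).
by move=> x hx; exact: ccontD (cf i x hx) (c x hx).
Qed.

Lemma rsum_tail (b : nat -> R) e : (forall i, 0 <= b i) -> rsum b -> 0 < e ->
  exists n0, forall n, (n0 <= n)%N -> forall m, \sum_(i < m) b (n + i)%N <= e.
Proof.
move=> b0 rb e0; have cb := rsum_cvg b0 rb.
have [n0 _ h] := (cvgrPdist_lt _ _).1 cb e e0.
exists n0 => n hn m; have := h n hn; rewrite /= => h1.
have le1 : series b (n + m)%N <= limn (series b).
  apply: nondecreasing_cvgn_le cb _; apply/nondecreasing_seqP => k.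
  by rewrite !seriesEord /= big_ord_recr /= lerDl.
have e1 : series b (n + m)%N = series b n + \sum_(i < m) b (n + i)%N.
  by rewrite !seriesEord /= big_split_ord /=.
have := le_lt_trans (ler_norm _) h1; rewrite e1 in le1; lra.
Qed.

Lemma cseries_tail (u : nat -> C) (b : nat -> R) e n : (forall i, nc (u i) <= b i) -> rsum b ->
  (forall m, \sum_(i < m) b (n + i)%N <= e) -> nc (cseries u - \sum_(i < n) u i) <= e.
Proof.
move=> ub rb hb; have au : asum u by exact: asum_le rb.
have -> : cseries u - \sum_(i < n) u i = cseries (fun i => u (n + i)%N).
  suff [_ e1] : asum (fun i => u (n + i)%N) /\
     cseries u = \sum_(i < n) u i + cseries (fun i => u (n + i)%N) by rewrite e1 addrC addKr.
  elim: n {hb} => [|n [a IH]].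
    by rewrite big_ord0 add0r; split; [exact: au|exact: cseries_ext].
  split; first by have := asum_shift a; under eq_fun do rewrite addnS -addSn.
  rewrite IH (cseries_shift a) big_ord_recr /= addn0 -addrA; congr (_ + (_ + _)).
  by apply: cseries_ext => i; rewrite addnS -addSn.
apply: nc_cseries_le => m; apply: le_trans (hb m); apply: ler_sum => i _; exact: ub.
Qed.

(** Termwise integration: the tail of the series is uniformly small on [t, 1-t] and h is bounded
    there. *)
Lemma Lt_series (h : R -> C) (s : nat -> R -> C) (b : nat -> R) (M : R) :
  ctn h -> (forall i, ctn (s i)) -> (forall i, 0 <= b i) -> rsum b -> 0 <= M ->
  (forall x, t <= x <= 1 - t -> nc (h x) <= M) ->
  (forall i x, t <= x <= 1 - t -> nc (s i x) <= b i) ->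
  ctn (fun x => cseries (s^~ x)) ->
  Lt t (fun x => h x * cseries (s^~ x)) = cseries (fun i => Lt t (fun x => h x * s i x)).
Proof.
move=> ch cs b0 rb M0 hM hs cS; apply/esym/cseriesP.
have FFo : Filter (\oo : set_system nat) by typeclasses eauto.
apply/(cvgCP FFo)/cvgrPdist_le => e e0.
have [n0 hn0] := rsum_tail b0 rb (e := e / (2 * M + 1)) (divr_gt0 e0 (ltr_wpDl (mulr_ge0 (ler0n _ 2) M0) ltr01)).
exists n0 => // n /= hn; rewrite sub0r normrN ger0_norm ?nc_ge0 //.
have chs i : ctn (fun x => h x * s i x) by move=> x hx; exact: ccontM (ch x hx) (cs i x hx).
have [c1 e1] := Lt_sum (index_enum 'I_n) (fun i : 'I_n => chs i).
have chS : ctn (fun x => h x * cseries (s^~ x)) by move=> x hx; exact: ccontM (ch x hx) (cS x hx).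
rewrite big_mkord -e1 nc_distC -(LtB chS c1).
apply: le_trans (Lt_bound (M := M * (e / (2 * M + 1))) _ _) _.
- by move=> x hx; exact: ccontB (chS x hx) (c1 x hx).
- move=> x hx; rewrite -mulr_sumr -mulrBr ncM; apply: ler_pM; rewrite ?nc_ge0 //; first exact: hM.
  by apply: cseries_tail rb _ => [i|m]; [exact: hs|exact: hn0].
have d0 : 0 < 2 * M + 1 by lra.
by rewrite mulrA mulrA ler_pdivrMr // mulrC ler_pM2l //; lra.
Qed.
End FixT.
End ComplexIntegral.
End IteratedIntegrals.
Import IteratedIntegrals.

(** * The kernels on (0,1): sine and cosine series, and the cotangent *)

Module KernelIntegrals.
Lemma two_pi_iE (R : realType) : two_pi_i R = (0 +i* 1) * (2 * pi)%:C.
Proof. by apply: complex_ext; rewrite ?ReM ?ImM /=; ring. Qed.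

#[local] Opaque cseries cexp two_pi_i ccont cint lam bern qtau.

Lemma Aseries1 (R : realType) (tau : R[i]) (t : R) k :
  Aseries_t tau t [:: k] = Jseries tau t [:: k].
Proof.
rewrite /Aseries_t /ncmul; do 3 rewrite /= ?big_ord_recl ?big_ord0.
rewrite /ncexp1 /=; move: (clog _) (Jseries tau t [:: k]) => l J.
have -> : Jseries tau t [::] = 1 by [].
by case: (k == 1%N); rewrite /= ?fact0 ?expr0 ?expr1 ?divr1; ring.
Qed.

(** For m = n = 1 the quadratic terms of the two exponentials cancel, l^2/2 - l^2 + l^2/2 = 0, so
    only linear logarithmic terms remain. *)
Lemma Aseries2 (R : realType) (tau : R[i]) (t : R) m n :
  Aseries_t tau t [:: m; n] = Jseries tau t [:: m; n]
   + (m == 1%N)%:R * clog (- two_pi_i R * t%:C) * Jseries tau t [:: n]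
   - (n == 1%N)%:R * clog (- two_pi_i R * t%:C) * Jseries tau t [:: m].
Proof.
rewrite /Aseries_t /ncmul; do 3 rewrite /= ?big_ord_recl ?big_ord0.
rewrite /ncexp1 /=; move: (clog _) (Jseries tau t [:: m; n]) (Jseries tau t [:: m]) (Jseries tau t [:: n]) => l J J1 J2.
have -> : Jseries tau t [::] = 1 by [].
have f2 : (2`!)%:R = 2 :> R[i] by [].
by case: (m == 1%N); case: (n == 1%N); rewrite /= ?fact0 ?expr0 ?expr1 ?divr1 ?f2; field.
Qed.

Section Kernel.
Context {R : realType}.
Local Notation C := R[i].
Local Notation X := (two_pi_i R).
Variable tau : C.
Hypothesis tau0 : 0 < complex.Im tau.
Local Notation q := (qtau tau).

Definition Fk (k : nat) (x : R) : C := fcoef tau k (ee x).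
Definition Co (n : nat) (x : R) : R := cos (2 * pi * n%:R * x).
Definition Si (n : nat) (x : R) : R := sin (2 * pi * n%:R * x).

(** Cosine coefficients, for kernels of even index, and below them sine coefficients, for odd
    index. *)
Definition alc (a m : nat) : C := if a is a'.+1 then - 2 * X ^+ a * lam a' (q ^+ m.+1) else 0.
Definition bec (b m : nat) : C := if b is b'.+1 then - 2 * (0 +i* 1) * X ^+ b * lam b' (q ^+ m.+1) else 0.

Lemma pullbackE (t u : R) k : 0 < t < 2^-1 -> 0 < u < 1 ->
  pullback tau t%:C (1 - t)%:C k u = Fk k (xu t u) * (1 - 2 * t)%:C.
Proof.
move=> /andP[t1 t2] /andP[u0 u1]; rewrite /pullback.
have e : (1 - t)%:C - t%:C = (1 - 2 * t)%:C by rewrite -rmorphB; congr (_ %:C); ring.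
rewrite e; congr (_ * _).
have -> : t%:C + u%:C * (1 - 2 * t)%:C = (xu t u)%:C.
  by rewrite -rmorphM -rmorphD /xu; congr (_ %:C); ring.
have hu : 0 <= u <= 1 by rewrite !ltW.
have /andP[h1 h2] := xu_itv t1 t2 hu.
by apply: fkerE => //; apply/andP; split; lra.
Qed.

Lemma Jseries1E (t : R) k : 0 < t < 2^-1 -> Jseries tau t [:: k] = Lt t (Fk k).
Proof.
move=> t0; rewrite /Jseries /iterated_int /=; apply: cint_ext => u hu.
by rewrite mulr1 pullbackE.
Qed.

Lemma Jseries2E (t : R) m n : 0 < t < 2^-1 -> Jseries tau t [:: m; n] = Lt2 t (Fk m) (Fk n).
Proof.
move=> t0; rewrite /Jseries /iterated_int /=; apply: cint_ext => u /andP[u0 u1].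
rewrite pullbackE ?u0 //; congr (_ * _); apply: cint_ext => v /andP[v0 v1].
by rewrite pullbackE // v1 (lt_trans u0).
Qed.

Lemma ee_pow (x : R) n : ee x ^+ n = Co n x +i* Si n x.
Proof. by rewrite -eeMn eeE /Co /Si !mulrA. Qed.

Lemma ee_powV (x : R) n : (ee x)^-1 ^+ n = Co n x -i* Si n x.
Proof.
rewrite -eeN -eeMn eeE /Co /Si; have -> : 2 * pi * (n%:R * - x) = - (2 * pi * n%:R * x) by ring.
by rewrite cosN sinN.
Qed.

Lemma lam_geo k : exists2 K : R, 0 <= K & forall m, nc (lam k (q ^+ m.+1)) <= K * nc q ^+ m.+1.
Proof.
have q1 := qtau_lt1 tau0; have [K K0 hK] := lam_bound (qtau_neq0 tau) q1 k; exists K => // m.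
by rewrite -ncX; apply: hK; exact: nc_qX.
Qed.

Lemma alc_geo a : exists2 K : R, 0 <= K & forall m, nc (alc a m) <= K * nc q ^+ m.+1.
Proof.
case: a => [|a]; first by exists 0 => // m; rewrite /alc mul0r -(nc0 (R := R)).
have [K K0 hK] := lam_geo a; exists (nc (- 2 * X ^+ a.+1) * K); first by rewrite mulr_ge0 ?nc_ge0.
by move=> m; rewrite /alc ncM -[leRHS]mulrA; apply: ler_wpM2l; [exact: nc_ge0|exact: hK].
Qed.

Lemma bec_geo a : exists2 K : R, 0 <= K & forall m, nc (bec a m) <= K * nc q ^+ m.+1.
Proof.
case: a => [|a]; first by exists 0 => // m; rewrite /bec mul0r -(nc0 (R := R)).
have [K K0 hK] := lam_geo a.
exists (nc (- 2 * (0 +i* 1) * X ^+ a.+1) * K); first by rewrite mulr_ge0 ?nc_ge0.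
by move=> m; rewrite /bec ncM -[leRHS]mulrA; apply: ler_wpM2l; [exact: nc_ge0|exact: hK].
Qed.

Lemma rsum_geoS (K : R) k : 0 <= K -> rsum (fun m => m.+1%:R ^+ k * (K * nc q ^+ m.+1)).
Proof.
move=> K0; have q01 : 0 <= nc q < 1 by rewrite nc_ge0 qtau_lt1.
have h := rsum_polygeo k q01.
have h2 := rsum_shift (fun n => mulr_ge0 (exprn_ge0 k (ler0n R n)) (exprn_ge0 n (nc_ge0 q))) h.
by apply: rsum_le (rsumZ K0 h2) => m; rewrite mulrCA.
Qed.

Lemma rsum_geo0 (K : R) : 0 <= K -> rsum (fun m => K * nc q ^+ m.+1).
Proof. by move=> K0; apply: rsum_le (rsum_geoS 0 K0) => m; rewrite expr0 mul1r. Qed.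

Lemma rsum_alc a k : rsum (fun m => m.+1%:R ^+ k * nc (alc a m)).
Proof.
have [K K0 hK] := alc_geo a; apply: rsum_le (rsum_geoS k K0) => m.
by rewrite ler_wpM2l ?exprn_ge0.
Qed.
Lemma rsum_bec b k : rsum (fun m => m.+1%:R ^+ k * nc (bec b m)).
Proof.
have [K K0 hK] := bec_geo b; apply: rsum_le (rsum_geoS k K0) => m.
by rewrite ler_wpM2l ?exprn_ge0.
Qed.

Lemma asum_alc a : asum (alc a).
Proof. by apply: asum_le (rsum_alc a 0) => m; rewrite expr0 mul1r. Qed.
Lemma asum_bec b : asum (bec b).
Proof. by apply: asum_le (rsum_bec b 0) => m; rewrite expr0 mul1r. Qed.

Lemma nc_Co n (x : R) : nc (Co n x)%:C <= 1.
Proof. by rewrite nc_real cos_max. Qed.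
Lemma nc_Si n (x : R) : nc (Si n x)%:C <= 1.
Proof. by rewrite nc_real ler_norml /Si sin_le1 sin_geN1. Qed.

Lemma gcoefE k (x : R) :
  gcoef q k (ee x) - (-1) ^+ k * gcoef q k (ee x)^-1 =
  cseries (fun m => lam k (q ^+ m.+1) * (ee x ^+ m.+1 - (-1) ^+ k * (ee x)^-1 ^+ m.+1)).
Proof.
have q1 := qtau_lt1 tau0.
have n1 := nc_ee x; have n2 : nc (ee x)^-1 = 1 by rewrite ncV n1 invr1.
have a1 := asum_gcoef (qtau_neq0 tau) q1 k n1; have a2 := asum_gcoef (qtau_neq0 tau) q1 k n2.
rewrite /gcoef -(cseriesZ _ a2) -(cseriesB a1 (asumZ _ a2)); apply: cseries_ext => m.
by move: (_ ^+ m.+1) (_ ^+ m.+1) ((-1) ^+ k) (lam _ _) => u v w z; ring.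
Qed.

Lemma FkE_even a (x : R) : ~~ odd a ->
  Fk a x = X ^+ a * ratr (bern a) + cseries (fun m => alc a m * (Co m.+1 x)%:C).
Proof.
case: a => [|a] ea.
  rewrite /Fk /fcoef /= subr0 addr0 [cseries _](@cseries_fin _ _ 0) ?big_ord0 ?addr0 // => n _.
  by rewrite /alc mul0r.
have oa : odd a by move: ea; rewrite /= negbK.
rewrite /Fk /fcoef ifF ?addr0; last by case: (a) oa.
rewrite gcoefE -signr_odd oa expr1; congr (_ + _).
have al : asum (fun m => lam a (q ^+ m.+1) * (ee x ^+ m.+1 - -1 * (ee x)^-1 ^+ m.+1)).
  have [K K0 hK] := lam_geo a; apply: asum_le (rsumZ (ler0n R 2) (rsum_geo0 K0)) => m.
  rewrite ncM mulrC; apply: ler_pM; rewrite ?nc_ge0 //.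
  apply: le_trans (ncB _ _) _; rewrite mulN1r ncN !ncX ncV nc_ee invr1 expr1n; lra.
rewrite -mulNr -(cseriesZ _ al); apply: cseries_ext => m; rewrite mulN1r opprK ee_pow ee_powV /alc.
have -> : Co m.+1 x +i* Si m.+1 x + (Co m.+1 x -i* Si m.+1 x) = 2 * (Co m.+1 x)%:C.
  by apply: complex_ext; rewrite ?ReD ?ImD ?ReM ?ImM /=; ring.
by move: (X ^+ _) (lam _ _) (_%:C) => u v w; ring.
Qed.

#[local] Opaque gcoef.

(** For k = 1 the Bernoulli term X b_1 = -X/2 and the polar term combine into pi cot(pi x), the only
    singular part of any kernel. *)
Lemma cot_ee (x : R) : 0 < x < 1 ->
  - (X / 2) - X * (ee x / (1 - ee x)) = (pi * (cos (pi * x) / sin (pi * x)))%:C.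
Proof.
move=> /andP[x0 x1]; have e1 : ee x != 1 by apply: ee_neq1; rewrite x0.
have s0 : 0 < sin (pi * x).
  by apply: sin_gt0_pi; rewrite mulr_gt0 ?pi_gt0 //= -[ltRHS]mulr1 ltr_pM2l ?pi_gt0.
have d0 : 1 - ee x != 0 by rewrite subr_eq0 eq_sym.
have eX := two_pi_iE R.
pose w : C := cos (pi * x) +i* sin (pi * x).
have ew : ee x = w * w.
  rewrite eeE /w; have -> : 2 * pi * x = pi * x + pi * x by ring.
  by rewrite cosD sinD; apply: complex_ext; rewrite ?ReM ?ImM /=; ring.
pose c := cos (pi * x); pose s := sin (pi * x).
have cs : c ^+ 2 + s ^+ 2 = 1 by exact: cos2Dsin2.
have e2 : 1 - ee x = - 2 * (0 +i* 1) * s%:C * w.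
  have -> : 1 - ee x = (c ^+ 2 + s ^+ 2)%:C - w * w by rewrite cs ew.
  by rewrite /w -/c -/s; apply: complex_ext; rewrite ?ReD ?ImD ?ReM ?ImM /=; ring.
have e3 : 1 + ee x = 2 * c%:C * w.
  have -> : 1 + ee x = (c ^+ 2 + s ^+ 2)%:C + w * w by rewrite cs ew.
  by rewrite /w -/c -/s; apply: complex_ext; rewrite ?ReD ?ImD ?ReM ?ImM /=; ring.
have w0 : w != 0.
  by apply/eqP => w0; move/eqP: e2; rewrite w0 mulr0 (negPf d0).
have sC : s%:C != 0 :> C by rewrite -nc_gt0 nc_real gtr0_norm.
have i2 : (0 +i* 1 : C) * (0 +i* 1) = -1 by apply: complex_ext; rewrite ?ReM ?ImM /=; ring.
have iC : (0 +i* 1 : C) != 0.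
  by apply/eqP => i0; move/eqP: i2; rewrite i0 mul0r eq_sym oppr_eq0 oner_eq0.
have -> : - (X / 2) - X * (ee x / (1 - ee x)) = - X / 2 * ((1 + ee x) / (1 - ee x)) by field.
rewrite e2 e3 eX !rmorphM fmorphV /= -/s -/c.
have -> : (2 : R)%:C = 2 :> C by rewrite rmorph_nat.
move: (pi%:C) (c%:C) (s%:C) (0 +i* 1) sC iC => p u v i v0 i0.
by field; rewrite v0 i0 w0.
Qed.

Lemma FkE_odd b (x : R) : odd b -> 0 < x < 1 ->
  Fk b x = (b == 1%N)%:R * (pi * (cos (pi * x) / sin (pi * x)))%:C
           + cseries (fun m => bec b m * (Si m.+1 x)%:C).
Proof.
case: b => // b ob hx.
have eb : ~~ odd b by [].
have al : asum (fun m => lam b (q ^+ m.+1) * (ee x ^+ m.+1 - 1 * (ee x)^-1 ^+ m.+1)).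
  have [K K0 hK] := lam_geo b; apply: asum_le (rsumZ (ler0n R 2) (rsum_geo0 K0)) => m.
  rewrite ncM mulrC; apply: ler_pM; rewrite ?nc_ge0 //.
  apply: le_trans (ncB _ _) _; rewrite mul1r !ncX ncV nc_ee invr1 expr1n; lra.
rewrite /Fk /fcoef gcoefE -signr_odd (negPf eb) expr0; congr (_ + _).
  rewrite eqSS; case: (eqVneq b 0%N) => [->|b0].
    rewrite expr1 bern1 mul1r -cot_ee // rmorphN fmorphV rmorph_nat mulrN /=.
    by move: (X / 2) => u.
  have -> : b = (b./2.-1).*2.+2 by move: eb b0; lia.
  by rewrite (bern_odd R) rmorph0 mulr0 addr0 mul0r.
rewrite -mulNr -(cseriesZ _ al); apply: cseries_ext => m; rewrite mul1r ee_pow ee_powV /bec.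
have -> : Co m.+1 x +i* Si m.+1 x - (Co m.+1 x -i* Si m.+1 x) = 2 * (0 +i* 1) * (Si m.+1 x)%:C.
  by apply: complex_ext; rewrite ?ReD ?ImD ?ReM ?ImM /=; ring.
by move: (X ^+ _) (lam _ _) (_%:C) (0 +i* 1) => u v w i; ring.
Qed.

Lemma Co_refl n (x : R) : Co n (1 - x) = Co n x.
Proof.
have := ee_pow (1 - x) n; rewrite eeD ee1 mul1r eeN => e.
by have := ee_powV x n; rewrite e => /(congr1 (@complex.Re R)) /=.
Qed.
Lemma Si_refl n (x : R) : Si n (1 - x) = - Si n x.
Proof.
have := ee_pow (1 - x) n; rewrite eeD ee1 mul1r eeN => e.
by have := ee_powV x n; rewrite e => /(congr1 (@complex.Im R)) /=.
Qed.

Lemma Fk_refl k (x : R) : 0 < x < 1 -> Fk k (1 - x) = (-1) ^+ k * Fk k x.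
Proof.
move=> hx; have hx' : 0 < 1 - x < 1 by case/andP: hx => ? ?; apply/andP; split; lra.
rewrite -signr_odd; have [ok|ek] := boolP (odd k).
  rewrite expr1 mulN1r !FkE_odd // opprD; congr (_ + _).
    rewrite -mulrN -rmorphN; congr (_ * _%:C).
    have -> : pi * (1 - x) = - (pi * x) + pi by ring.
    by rewrite cosDpi sinDpi cosN sinN opprK -mulrN -mulNr.
  have ab : asum (fun m => bec k m * (Si m.+1 x)%:C).
    apply: asum_le (rsum_bec k 0) => m; rewrite expr0 mul1r ncM ler_piMr ?nc_ge0 //; exact: nc_Si.
  by rewrite -(cseriesN ab); apply: cseries_ext => m; rewrite Si_refl rmorphN mulrN.
rewrite expr0 mul1r !FkE_even //; congr (_ + _).
by apply: cseries_ext => m; rewrite Co_refl.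
Qed.

Lemma is_derive_affine (f : R -> R) (c x df : R) : is_derive (c * x) 1 f df ->
  is_derive x 1 (fun y => f (c * y)) (df * c).
Proof.
move=> h; have h2 := is_deriveZ c (is_derive_id x (1 : R)).
have e : c *: (1 : R) = c by exact: mulr1.
rewrite e in h2.
exact: (@is_derive1_comp R f (fun y => c * y) x df c h h2).
Qed.

Lemma cder_Si n (x : R) : cder (fun y => (Si n y)%:C) x (2 * pi * n%:R * Co n x)%:C.
Proof. by apply: cder_real; rewrite mulrC; apply: is_derive_affine; exact: is_derive_sin. Qed.
Lemma cder_Co n (x : R) : cder (fun y => (Co n y)%:C) x (- (2 * pi * n%:R * Si n x))%:C.
Proof.
apply: cder_real; rewrite [_ * Si n x]mulrC -mulNr.
by apply: is_derive_affine; exact: is_derive_cos.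
Qed.
Lemma ccont_Si n (x : R) : ccont (fun y => (Si n y)%:C) x.
Proof. exact: cder_ccont (cder_Si n x). Qed.
Lemma ccont_Co n (x : R) : ccont (fun y => (Co n y)%:C) x.
Proof. exact: cder_ccont (cder_Co n x). Qed.

Transparent ccont.
Lemma ccont_series (c : nat -> C) (u : nat -> R -> R) (x : R) : asum c ->
  (forall m y, nc (u m y)%:C <= 1) -> (forall m, ccont (fun y => (u m y)%:C) x) ->
  ccont (fun y => cseries (fun m => c m * (u m y)%:C)) x.
Proof.
move=> ac hu cu.
have FFx : ProperFilter (nbhs x) by typeclasses eauto.
have dom : \forall y \near nbhs x, forall m, nc (c m * (u m y)%:C) <= nc (c m).
  by apply: nearW => y m; rewrite ncM ler_piMr ?nc_ge0.
have [_ h] := @tannery R R (nbhs x) FFx (fun y m => c m * (u m y)%:C) (fun m => c m * (u m x)%:C) _ ac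
   dom (fun m => @cvgCZ R R (nbhs x) (nbhs_filter x) _ _ (cu m) (c m)).
exact: h.
Qed.
#[local] Opaque ccont.

Lemma sin_pix_gt0 (x : R) : 0 < x < 1 -> 0 < sin (pi * x).
Proof.
move=> /andP[x0 x1].
by apply: sin_gt0_pi; rewrite mulr_gt0 ?pi_gt0 //= -[ltRHS]mulr1 ltr_pM2l ?pi_gt0.
Qed.

Lemma cder_lnsin (x : R) : 0 < x < 1 ->
  is_derive x 1 (fun y => ln (sin (pi * y))) (pi * (cos (pi * x) / sin (pi * x))).
Proof.
move=> hx; have s0 := sin_pix_gt0 hx.
have h1 : is_derive x 1 (fun y => sin (pi * y)) (cos (pi * x) * pi).
  by apply: is_derive_affine; exact: is_derive_sin.
have := @is_derive1_comp R (@ln R) (fun y => sin (pi * y)) x _ _ (is_derive1_ln s0) h1.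
rewrite [_^-1 * _](_ : _ = pi * (cos (pi * x) / sin (pi * x))) //.
by move: ((sin (pi * x))^-1) => u; ring.
Qed.

Lemma ccont_cot (x : R) : 0 < x < 1 -> ccont (fun y => (pi * (cos (pi * y) / sin (pi * y)))%:C) x.
Proof.
move=> hx; have s0 := sin_pix_gt0 hx.
have h1 : is_derive x 1 (fun y => sin (pi * y)) (cos (pi * x) * pi).
  by apply: is_derive_affine; exact: is_derive_sin.
have h2 : is_derive x 1 (fun y => cos (pi * y)) (- sin (pi * x) * pi).
  by apply: is_derive_affine; exact: is_derive_cos.
have c1 := is_derive_continuous h1; have c2 := is_derive_continuous h2.
apply: cvgC_ReIm; last exact: cvg_cst.
by apply: cvgM; [exact: cvg_cst|apply: cvgM => //; apply: cvgV => //; rewrite gt_eqF].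
Qed.

Lemma ccont_Fk k : on01 (ccont (Fk k)).
Proof.
Transparent ccont.
move=> x hx; have [ok|ek] := boolP (odd k).
  have h : ccont (fun y => (k == 1%N)%:R * (pi * (cos (pi * y) / sin (pi * y)))%:C
           + cseries (fun m => bec k m * (Si m.+1 y)%:C)) x.
    apply: ccontD; first exact: ccontM (@ccont_cst _ _ _) (ccont_cot hx).
    by apply: ccont_series; [exact: asum_bec|move=> m y; exact: nc_Si|move=> m; exact: ccont_Si].
  rewrite /ccont FkE_odd //; apply: cvg_trans h; apply: near_eq_cvg.
  have : \forall y \near x, 0 < y < 1.
    have : nbhs x `]0, 1[%classic by apply: near_in_itvoo; rewrite in_itv.
    by apply: filterS => y; rewrite /= in_itv.
  by apply: filterS => y hy; rewrite FkE_odd.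
have h : ccont (fun y => X ^+ k * ratr (bern k) + cseries (fun m => alc k m * (Co m.+1 y)%:C)) x.
  apply: ccontD; first exact: ccont_cst.
  by apply: ccont_series; [exact: asum_alc|move=> m y; exact: nc_Co|move=> m; exact: ccont_Co].
suff -> : Fk k = (fun y => X ^+ k * ratr (bern k) + cseries (fun m => alc k m * (Co m.+1 y)%:C)) by [].
by apply/funext => y; rewrite FkE_even.
Qed.
#[local] Opaque ccont.

(** H minus the linear term and n integrated terms has a derivative bounded by a tail, so
    [cder_bound] controls its increment; n then tends to infinity. *)
Lemma termwise (A : C) (u U : nat -> R -> C) (b B : nat -> R) (H h : R -> C) (x y : R) : x < y ->
  (forall z, x <= z <= y -> cder H z (h z)) ->
  (forall z, x <= z <= y -> h z = A + cseries (u^~ z)) ->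
  (forall m z, cder (U m) z (u m z)) ->
  (forall m, 0 <= b m) -> (forall m, 0 <= B m) -> rsum b -> rsum B ->
  (forall m z, nc (u m z) <= b m) -> (forall m z, nc (U m z) <= B m) ->
  H y - H x = A * (y - x)%:C + (cseries (U^~ y) - cseries (U^~ x)).
Proof.
move=> xy dH eh dU b0 B0 rb rB hu hU; apply/eqP; rewrite -subr_eq0 -nc_eq0; apply/eqP.
apply/eqP; rewrite eq_le nc_ge0 andbT; apply/ler_addgt0Pr => e e0; rewrite add0r.
have d0 : 0 < 2 * (y - x) + 2 by lra.
have e1 : 0 < e / (2 * (y - x) + 2) by rewrite divr_gt0.
set e' := e / _ in e1.
have [n1 hn1] := rsum_tail b0 rb e1; have [n2 hn2] := rsum_tail B0 rB e1.
pose n := maxn n1 n2.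
have t1 := hn1 n (leq_maxl _ _); have t2 := hn2 n (leq_maxr _ _).
pose D z := H z - (A * z%:C + \sum_(m < n) U m z).
have dD z : x <= z <= y -> cder D z (h z - (A * 1%:C + \sum_(m < n) u m z)).
  move=> hz; apply: cderB (dH z hz) _; apply: cderD.
    by apply: cderZ; apply: cder_real; exact: is_derive_id.
  elim: (n) => [|k IH].
    have -> : (fun z => \sum_(m < 0) U m z) = (fun=> 0) by apply/funext => w; rewrite big_ord0.
    by rewrite big_ord0; exact: cder_cst.
  have -> : (fun z => \sum_(m < k.+1) U m z) = (fun z => \sum_(m < k) U m z + U k z).
    by apply/funext => w; rewrite big_ord_recr.
  by rewrite big_ord_recr; exact: cderD.
have bD z : x <= z <= y -> nc (h z - (A * 1%:C + \sum_(m < n) u m z)) <= e'.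
  move=> hz; rewrite eh // mulr1 opprD addrACA subrr add0r.
  exact: cseries_tail (fun m => hu m z) rb t1.
have := cder_bound xy dD bD; rewrite /D => hD.
have s1 := cseries_tail (fun m => hU m y) rB t2.
have s2 := cseries_tail (fun m => hU m x) rB t2.
have -> : H y - H x - (A * (y - x)%:C + (cseries (U^~ y) - cseries (U^~ x))) =
  (H y - (A * y%:C + \sum_(m < n) U m y) - (H x - (A * x%:C + \sum_(m < n) U m x)))
  - (cseries (U^~ y) - \sum_(m < n) U m y) + (cseries (U^~ x) - \sum_(m < n) U m x).
  rewrite rmorphB /=.
  move: (\sum_(m < n) U m y) (\sum_(m < n) U m x) (cseries _) (cseries _) (H y) (H x) (y%:C) (x%:C) => a1 a2 a3 a4 a5 a6 a7 a8.
  by ring.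
apply: le_trans (ncD _ _) _; apply: le_trans (lerD (ncB _ _) (lexx _)) _.
apply: le_trans (lerD (lerD hD s1) s2) _.
have -> : 2 * e' * (y - x) + e' + e' = e' * (2 * (y - x) + 2) by ring.
by rewrite /e' divfK // gt_eqF.
Qed.
End Kernel.
End KernelIntegrals.
Import KernelIntegrals.

(** * The log-sine integral and the regularisation constant *)

Module LogSine.
Section LogSine.
Context {R : realType}.
Local Notation C := R[i].
Local Notation X := (two_pi_i R).

Lemma clogE (t : R) : 0 < t -> clog (- X * t%:C) = ln (2 * pi * t) +i* (- (pi / 2)).
Proof.
move=> t0; have p0 := pi_gt0 R; have pt : 0 < 2 * pi * t by rewrite !mulr_gt0.
have e0 : - X * t%:C = 0 +i* (- (2 * pi * t)).
  by rewrite /two_pi_i; apply: complex_ext; rewrite ?ReM ?ImM /=; ring.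
rewrite e0 /clog; apply: xget_unique => /=.
  split; last by apply/andP; split; lra.
  rewrite /cexp /= lnK ?posrE // cosN sinN cos_pihalf sin_pihalf mulr0 mulrN mulr1.
  by [].
move=> [u v] /= [e /andP[v1 v2]]; rewrite /cexp /= in e; case: e => ec es.
have eu := expR_gt0 u.
have c0 : cos v = 0 by move/eqP: ec; rewrite mulf_eq0 gt_eqF //= => /eqP.
have vneg : v < 0.
  rewrite ltNge; apply/negP => v0.
  have s0 : 0 <= sin v by apply: sin_ge0_pi; rewrite v0.
  have : 0 <= expR u * sin v by rewrite mulr_ge0 // ltW.
  by rewrite es oppr_ge0 leNgt pt.
have hv : - v = pi / 2.
  apply: cos_inj; rewrite ?in_itv /=; try (apply/andP; split; lra).
  by rewrite cosN c0 cos_pihalf.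
have ev : v = - (pi / 2) by rewrite -hv opprK.
rewrite ev; congr (_ +i* _).
move: es; rewrite ev sinN sin_pihalf mulrN1 => /eqP; rewrite eqr_opp => /eqP <-.
by rewrite expRK.
Qed.

Lemma tlnt_cvg : t * (`|ln (2 * pi * t)| + pi / 2) @[t --> (0 : R)^'+] --> (0 : R).
Proof.
have p0 := pi_gt0 R.
have FF0 : Filter ((0 : R)^'+) by typeclasses eauto.
pose K : R := `|ln (2 * pi)| + pi / 2 + 2.
have h : K * Num.sqrt t @[t --> (0 : R)^'+] --> (0 : R).
  have h0 : Num.sqrt t @[t --> (0 : R)^'+] --> (0 : R).
    apply: cvg_at_right_filter; have h : Num.sqrt t @[t --> (0 : R)] --> Num.sqrt (0 : R) := @sqrt_continuous R 0.
    by rewrite sqrtr0 in h.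
  have hM : K * Num.sqrt t @[t --> (0 : R)^'+] --> K * 0 by apply: cvgM; [exact: cvg_cst|exact: h0].
  by rewrite mulr0 in hM.
apply: (squeeze_cvgr (f := fun=> 0) (h := fun t => K * Num.sqrt t)); [|exact: cvg_cst|exact: h].
have : \forall t \near (0 : R)^'+, 0 < t < 1.
  by near=> t; apply/andP; split; near: t; [exact: nbhs_right_gt|exact: nbhs_right_lt].
apply: filterS => t /andP[t0 t1]; apply/andP; split.
  apply: mulr_ge0; [exact: ltW|apply: addr_ge0; [exact: normr_ge0|]].
  by apply: divr_ge0; [exact: ltW|].
have s0 : 0 < Num.sqrt t by rewrite sqrtr_gt0.
have st : Num.sqrt t * Num.sqrt t = t by rewrite -expr2 sqr_sqrtr // ltW.
have s1 : Num.sqrt t < 1 by rewrite -sqrtr1 ltr_sqrt.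
have l1 : - ln t <= 2 / Num.sqrt t.
  have := ln_sublinear (x := (Num.sqrt t)^-1); rewrite invr_gt0 => /(_ s0).
  rewrite lnV ?posrE // => h1.
  have -> : ln t = 2 * ln (Num.sqrt t) by rewrite -{1}st lnM ?posrE //; ring.
  by rewrite -mulrN ler_pM2l // ltW.
have ll : `|ln (2 * pi * t)| <= `|ln (2 * pi)| + 2 / Num.sqrt t.
  rewrite lnM ?posrE ?mulr_gt0 //; apply: le_trans (ler_normD _ _) _.
  by rewrite lerD2l ler0_norm // ln_le0 // ltW.
apply: le_trans (ler_wpM2l (ltW t0) (lerD ll (lexx (pi / 2)))) _.
have -> : t * (`|ln (2 * pi)| + 2 / Num.sqrt t + pi / 2) =
   Num.sqrt t * (Num.sqrt t * (`|ln (2 * pi)| + pi / 2) + 2).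
  rewrite -{1}st; move: s0; move: (Num.sqrt t) (`|_|) (pi / 2) => s n p s0.
  by field; rewrite gt_eqF.
rewrite mulrC ler_pM2r // /K lerD2r; apply: ler_piMl; last exact: ltW.
by apply: addr_ge0; [exact: normr_ge0|apply: divr_ge0; [exact: ltW|]].
Unshelve. all: by end_near.
Qed.

Lemma sin_ge (y : R) : 0 < y < pi / 2 -> exists2 c, 0 < c < y & sin y = y * cos c.
Proof.
move=> /andP[y0 y1].
have [c] := @MVT R (@sin R) (@cos R) 0 y y0 (fun x _ => is_derive_sin x)
  (within_cont (fun x _ => @continuous_sin R x)).
by rewrite in_itv /= sin0 !subr0 mulrC => hc e; exists c.
Qed.

Lemma cos_dec (u v : R) : 0 <= u <= v -> v <= pi -> cos v <= cos u.
Proof.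
move=> /andP[u0 uv] vp; rewrite leNgt; apply/negP => lt; move: lt.
rewrite (@ltr_cos R v u) ?in_itv /= ?(le_trans u0 uv) ?u0 ?(le_trans uv vp) //.
by rewrite ltNge uv.
Qed.

(** The mean value theorem gives sin(pi t) = pi t cos c with 0 < c < pi t, which squeezes the
    quotient. *)
Lemma lnsinc_cvg : ln (sin (pi * t)) - ln (2 * pi * t) @[t --> (0 : R)^'+] --> - ln (2 : R).
Proof.
have p0 := pi_gt0 R; have p2 := pihalf_ge1 R.
have FF0 : Filter ((0 : R)^'+) by typeclasses eauto.
have h : ln (cos (pi * t)) - ln 2 @[t --> (0 : R)^'+] --> - ln (2 : R).
  rewrite -[X in _ --> X]add0r; apply: cvgB; last exact: cvg_cst.
  apply: cvg_at_right_filter.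
  have c0 : cos (pi * t) @[t --> (0 : R)] --> (1 : R).
    have d : is_derive (0 : R) 1 (fun y => cos (pi * y)) (- sin (pi * 0) * pi).
      by apply: is_derive_affine; exact: is_derive_cos.
    have h : cos (pi * t) @[t --> (0 : R)] --> cos (pi * 0 : R) := is_derive_continuous d.
    by rewrite mulr0 cos0 in h.
  have cl : ln t @[t --> (1 : R)] --> ln (1 : R) := @continuous_ln R 1 ltr01.
  rewrite ln1 in cl.
  exact: (@cvg_comp _ _ _ (fun t => cos (pi * t)) (@ln R) _ _ _ c0 cl).
apply: (squeeze_cvgr (f := fun t => ln (cos (pi * t)) - ln 2) (h := fun=> - ln 2)); [|exact: h|exact: cvg_cst].
have : \forall t \near (0 : R)^'+, 0 < t < 4^-1.
  by near=> t; apply/andP; split; near: t; [exact: nbhs_right_gt|exact: nbhs_right_lt].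
apply: filterS => t /andP[t0 t1].
have y0 : 0 < pi * t by rewrite mulr_gt0.
have y1 : pi * t < pi / 2 by rewrite ltr_pM2l //; lra.
have [c /andP[c0 c1] e] : exists2 c, 0 < c < pi * t & sin (pi * t) = pi * t * cos c.
  by apply: sin_ge; rewrite y0.
have ct : cos (pi * t) <= cos c.
  by apply: cos_dec; [rewrite !ltW|rewrite (le_trans (ltW y1)) //; lra].
have cpt : 0 < cos (pi * t) by apply: cos_gt0_pihalf; apply/andP; split; lra.
have cc : 0 < cos c by exact: lt_le_trans ct.
have -> : ln (sin (pi * t)) - ln (2 * pi * t) = ln (cos c) - ln 2.
  rewrite e lnM ?posrE // -mulrA [ln (2 * _)]lnM ?posrE //; ring.
apply/andP; split; first by rewrite lerD2r ler_ln ?posrE.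
by have := ln_le0 (cos_le1 c); lra.
Unshelve. all: by end_near.
Qed.

Definition lnsin (x : R) : R := ln (sin (pi * x)).

Lemma lnsin_le0 (x : R) : lnsin x <= 0.
Proof. by rewrite /lnsin ln_le0 // sin_le1. Qed.

Lemma lnsin_refl (x : R) : lnsin (1 - x) = lnsin x.
Proof.
rewrite /lnsin; have -> : pi * (1 - x) = - (pi * x) + pi by ring.
by rewrite sinDpi sinN opprK.
Qed.

Lemma ccont_lnsin (x : R) : 0 < x < 1 -> ccont (fun y => (lnsin y)%:C) x.
Proof. by move=> hx; exact: cder_ccont (cder_real (cder_lnsin hx)). Qed.

Definition Mls (t : R) : R := complex.Re (Lt t (fun x => (lnsin x)%:C)).

Lemma lnsin_antider (t : R) : 0 < t < 2^-1 -> exists G : R -> R,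
  [/\ forall x, t <= x <= 1 - t -> is_derive x 1 G (lnsin x)
    & forall s, t <= s < 2^-1 -> Lt s (fun x => (lnsin x)%:C) = (G (1 - s) - G s)%:C].
Proof.
move=> /andP[t0 t1].
have [G hG] : exists F : R -> R, forall x, t / 2 < x < 1 - t / 2 -> is_derive x 1 F (lnsin x).
  apply: rint_antider => x /andP[x0 x1]; apply: (is_derive_continuous (cder_lnsin (x := x) _)).
  by apply/andP; split; lra.
exists G; split=> [x /andP[x0 x1]|s /andP[s0 s1]].
  by apply: hG; apply/andP; split; lra.
have s0' : 0 < s by lra.
rewrite (@LtE R s s0' s1 _ (fun x => (G x)%:C)) ?rmorphB // => x /andP[x0 x1]; split.
  by apply: cder_real; apply: hG; apply/andP; split; lra.
by apply: ccont_lnsin; apply/andP; split; lra.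
Qed.

Lemma MVT_le (G g : R -> R) (a b : R) : a <= b -> (forall x, a <= x <= b -> is_derive x 1 G (g x)) ->
  (forall x, a <= x <= b -> g x <= 0) -> G b <= G a.
Proof.
rewrite le_eqVlt => /orP[/eqP ->//|ab] dG g0.
have [c hc e] := @MVT R G g a b ab (fun x hx => dG x (subset_itv_oo_cc hx))
  (within_cont (fun x hx => is_derive_continuous (dG x hx))).
rewrite -subr_le0 e; move: hc; rewrite in_itv /= => /andP[c1 c2].
by apply: mulr_le0_ge0; [apply: g0; rewrite !ltW|rewrite subr_ge0 ltW].
Qed.

Lemma Mls_mono (t s : R) : 0 < t <= s -> s < 2^-1 -> Mls t <= Mls s.
Proof.
move=> /andP[t0 ts] s1; have t01 : 0 < t < 2^-1 by rewrite t0 (le_lt_trans ts).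
have [G [dG eG]] := lnsin_antider t01.
rewrite /Mls !eG ?ts ?lexx //=; last by case/andP: t01.
apply: lerB.
  apply: (MVT_le (g := lnsin)) => [|x /andP[x0 x1]|x _]; [lra| |exact: lnsin_le0].
  by apply: dG; apply/andP; split; lra.
apply: (MVT_le (g := lnsin)) => [|x /andP[x0 x1]|x _]; [lra| |exact: lnsin_le0].
by apply: dG; apply/andP; split; lra.
Qed.

(** On (0, 1/8], sin(pi x) is at least a constant times x, so log-sine is compared with ln x + [k],
    whose antiderivative [E] is explicit and bounded near 0. *)
Lemma lnsin_low : exists B : R, forall (t : R) (G : R -> R), 0 < t < 8^-1 ->
  (forall x, t <= x <= 8^-1 -> is_derive x 1 G (lnsin x)) -> B <= G 8^-1 - G t.
Proof.
have p0 := pi_gt0 R.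
have c0 : 0 < cos (pi * 8^-1 : R) by apply: cos_gt0_pihalf; apply/andP; split; lra.
pose k : R := ln (pi * cos (pi * 8^-1)).
pose E (x : R) : R := x * ln x - x + k * x.
exists (E 8^-1 - `|k|) => t G /andP[t0 t1] dG.
have dE (x : R) : 0 < x -> is_derive x 1 E (ln x + k).
  move=> x0; have := is_deriveD (is_deriveB (is_deriveM (is_derive_id x (1 : R)) (is_derive1_ln x0))
    (is_derive_id x (1 : R))) (is_deriveZ k (is_derive_id x (1 : R))).
  have -> : x *: x^-1 + ln x *: 1 - 1 + k *: 1 = ln x + k.
    rewrite /GRing.scale /= divff ?gt_eqF //; ring.
  exact.
have le : E 8^-1 - E t <= G 8^-1 - G t.
  have h : (E - G) 8^-1 <= (E - G) t.
    apply: (MVT_le (g := fun x => ln x + k - lnsin x)) => [|x /andP[x0 x1]|x /andP[x0 x1]]; first exact: ltW.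
      apply: is_deriveB; first by apply: dE; exact: lt_le_trans x0.
      by apply: dG; rewrite x0.
    have x0' : 0 < x by exact: lt_le_trans x0.
    have y0 : 0 < pi * x by rewrite mulr_gt0.
    have y1 : pi * x < pi / 2 by rewrite ltr_pM2l //; lra.
    have [c /andP[c1 c2] e] : exists2 c, 0 < c < pi * x & sin (pi * x) = pi * x * cos c.
      by apply: sin_ge; rewrite y0.
    have px : pi * x <= pi * 8^-1 by rewrite ler_pM2l.
    have cc : cos (pi * 8^-1) <= cos c.
      by apply: cos_dec; [rewrite (ltW c1) (le_trans (ltW c2))|lra].
    have cc0 : 0 < cos c by exact: lt_le_trans c0 cc.
    rewrite subr_le0 /lnsin e /k -lnM ?posrE ?mulr_gt0 //.
    rewrite ler_ln ?posrE ?mulr_gt0 //.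
    by rewrite mulrA [x * pi]mulrC ler_pM2l.
  rewrite -[(E - G) 8^-1]/(E 8^-1 - G 8^-1) -[(E - G) t]/(E t - G t) in h; lra.
apply: le_trans le; rewrite lerD2l lerN2 /E.
have tl : t * ln t <= 0 by apply: mulr_ge0_le0; [exact: ltW|apply: ln_le0; lra].
have kt : k * t <= `|k|.
  apply: le_trans (ler_norm _) _; rewrite normrM (gtr0_norm t0) ler_piMr //; lra.
lra.
Qed.

(** As log-sine is nonpositive, shrinking t decreases the integral; [lnsin_low] at both ends, by
    reflection, bounds it from below. *)
Lemma Mls_cvg : exists l : R, Mls t @[t --> (0 : R)^'+] --> l.
Proof.
have [B hB] := lnsin_low.
eexists; apply: (@nondecreasing_at_right_cvgr R Mls 0 (BLeft 8^-1)).
- by rewrite bnd_simp; lra.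
- by move=> x y; rewrite !in_itv /= => /andP[x0 x1] /andP[y0 y1] xy; apply: Mls_mono; [rewrite x0|lra].
exists (Mls 8^-1 + B + B) => _ [t /= + <-]; rewrite in_itv /= => /andP[t0 t1].
have t01 : 0 < t < 2^-1 by apply/andP; split; lra.
have [G [dG eG]] := lnsin_antider t01.
have h1 : t <= t < 2^-1 by apply/andP; split; lra.
have h8 : (8^-1 : R) < 2^-1 by rewrite ltf_pV2 ?posrE // ltr_nat.
have h2 : t <= (8^-1 : R) < 2^-1 by rewrite (ltW t1) h8.
rewrite /Mls (eG _ h1) (eG _ h2) /=.
have b1 : B <= G 8^-1 - G t.
  by apply: hB => [|x /andP[x0 x1]]; [rewrite t0|apply: dG; apply/andP; split; lra].
have b2 : B <= - G (1 - 8^-1) - - G (1 - t).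
  apply: (hB t (fun x => - G (1 - x))) => [|x /andP[x0 x1]]; first by rewrite t0.
  have hx : t <= 1 - x <= 1 - t by apply/andP; split; lra.
  have d : is_derive x 1 (fun y => - G (1 - y)) (- - lnsin (1 - x)).
    exact: (cderN (cder_refl (cder_real (dG _ hx)))).1.
  by rewrite opprK lnsin_refl in d.
lra.
Qed.

Definition cotw (x : R) : R := pi * (cos (pi * x) / sin (pi * x)).

(** Integration by parts, since pi cot(pi x) is the derivative of log-sine. *)
Lemma Lt_cot (t : R) : 0 < t < 2^-1 ->
  Lt t (fun x => (cotw x)%:C * (x - 2^-1)%:C) = ((1 - 2 * t) * lnsin t - Mls t)%:C.
Proof.
move=> /andP[t0 t1]; have t01 : 0 < t < 2^-1 by rewrite t0.
have in01 x : t / 3 <= x <= 1 - t / 3 -> 0 < x < 1.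
  by move=> /andP[x0 x1]; apply/andP; split; lra.
have c1 : ctn t (fun x => (lnsin x)%:C) by move=> x /in01; exact: ccont_lnsin.
have dl (x : R) : is_derive x 1 (fun y => y - 2^-1) 1.
  by have := is_deriveB (is_derive_id x (1 : R)) (is_derive_cst (2^-1 : R) x 1); rewrite subr0.
have c2 : ctn t (fun x => (cotw x)%:C * (x - 2^-1)%:C).
  by move=> x /in01 hx; exact: ccontM (ccont_cot hx) (cder_ccont (cder_real (dl x))).
have [G [dG eG]] := lnsin_antider t01.
have eM : Lt t (fun x => (lnsin x)%:C) = (Mls t)%:C by rewrite /Mls eG ?lexx.
have e : Lt t (fun x => (lnsin x)%:C + (cotw x)%:C * (x - 2^-1)%:C) = ((1 - 2 * t) * lnsin t)%:C.
  rewrite (@LtE R t t0 t1 _ (fun x => (lnsin x)%:C * (x - 2^-1)%:C)).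
    rewrite lnsin_refl -!rmorphM -rmorphB; by congr (_%:C); move: (lnsin t) => l; field.
  move=> x /andP[x0 x1]; have hx : 0 < x < 1 by apply/andP; split; lra.
  split; last exact: ccontD (ccont_lnsin hx) (ccontM (ccont_cot hx) (cder_ccont (cder_real (dl x)))).
  have := cderM (cder_real (cder_lnsin hx)) (cder_real (dl x)).
  by rewrite mulr1 addrC.
have := @LtD R t t0 t1 _ _ c1 c2; rewrite e eM => e2.
by rewrite rmorphB /= e2 addrC addKr.
Qed.

(** The boundary term (1-2t) ln sin(pi t) diverges like ln(2 pi t), which is exactly the real part
    of the regularising logarithm. *)
Lemma kappa_cvg : exists kappa : C,
  (Lt t (fun x => (cotw x)%:C * (x - 2^-1)%:C) - clog (- X * t%:C) * (1 - 2 * t)%:C : C^o)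
    @[t --> (0 : R)^'+] --> (kappa : C^o).
Proof.
have [l hl] := Mls_cvg.
have FF0 : Filter ((0 : R)^'+) by typeclasses eauto.
have c1 : 1 - 2 * t @[t --> (0 : R)^'+] --> (1 : R).
  apply: cvg_at_right_filter.
  have h : 1 - 2 * t @[t --> (0 : R)] --> 1 - 2 * (0 : R).
    by apply: cvgB; [exact: cvg_cst|apply: cvgM; [exact: cvg_cst|exact: cvg_id]].
  by rewrite mulr0 subr0 in h.
have h1 := cvgB (cvgM c1 lnsinc_cvg) hl.
have h2 := cvgM c1 (cvg_cst (pi / 2 : R)).
pose u t : R := (1 - 2 * t) * (ln (sin (pi * t)) - ln (2 * pi * t)) - Mls t.
pose v t : R := (1 - 2 * t) * (pi / 2).
exists ((1 * - ln 2 - l) +i* (1 * (pi / 2))).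
have h : (u t +i* v t : C^o) @[t --> (0 : R)^'+] --> ((1 * - ln 2 - l) +i* (1 * (pi / 2)) : C^o).
  by apply: cvgC_ReIm; [exact: h1|exact: h2].
apply: cvg_trans h; apply: near_eq_cvg.
have : \forall t \near (0 : R)^'+, 0 < t < 2^-1.
  by near=> t; apply/andP; split; near: t; [exact: nbhs_right_gt|exact: nbhs_right_lt].
apply: filterS => t ht; rewrite Lt_cot // clogE; last by case/andP: ht.
by apply: complex_ext; rewrite ?ReD ?ImD ?ReM ?ImM /= /u /v /lnsin; field.
Unshelve. all: by end_near.
Qed.

End LogSine.
End LogSine.
Import LogSine.

(** * Limits t -> 0: the values of length one and two *)

Module RegularizedValues.
Lemma ccont_bound {R : realType} (phi : R -> R[i]) (a b : R) : a <= b ->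
  (forall x, a <= x <= b -> ccont phi x) ->
  exists2 M, 0 <= M & forall x, a <= x <= b -> nc (phi x) <= M.
Proof.
move=> ab c; have cw : {within `[a, b], continuous (fun x => nc (phi x))}.
  by apply: within_cont => x hx; exact: (cvgC_norm _ (c x hx)).
have [x hx hM] := EVT_max ab cw.
by exists (nc (phi x)) => [|y hy]; [exact: nc_ge0|apply: hM; rewrite in_itv].
Qed.

Lemma ccont_right {R : realType} (h : R -> R[i]) (a : R) : ccont h a ->
  (h t : R[i]^o) @[t --> a^'+] --> (h a : R[i]^o).
Proof. by move=> c; exact: (@cvg_at_right_filter R R[i]^o h a (h a) c). Qed.

Lemma realCM {R : realType} (u v : R) : (u * v)%:C = u%:C * v%:C :> R[i].
Proof. exact: rmorphM. Qed.
Lemma realCD {R : realType} (u v : R) : (u + v)%:C = u%:C + v%:C :> R[i].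
Proof. exact: rmorphD. Qed.
Lemma realCN {R : realType} (u : R) : (- u)%:C = - u%:C :> R[i].
Proof. exact: rmorphN. Qed.
Lemma realC1 {R : realType} : (1 : R)%:C = 1 :> R[i]. Proof. by []. Qed.
Lemma realC2 {R : realType} : (2 : R)%:C = 2 :> R[i].
Proof. exact: (rmorph_nat (real_complex R) 2). Qed.
Lemma realCV2 {R : realType} : (2^-1 : R)%:C = 2^-1 :> R[i].
Proof. by rewrite (fmorphV (real_complex R)) (rmorph_nat (real_complex R)). Qed.
Lemma eq_opp0 {R : realType} (z : R[i]) : z = - z -> z = 0.
Proof. by move/eqP; rewrite -addr_eq0 -mulr2n mulrn_eq0 /= => /eqP. Qed.

#[local] Opaque cseries cexp two_pi_i ccont cint gcoef lam bern qtau clog Lt Lt2 Fk.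

Section Limits.
Context {R : realType}.
Local Notation C := R[i].
Local Notation X := (two_pi_i R).
Variable tau : C.
Hypothesis tau0 : 0 < complex.Im tau.
Local Notation q := (qtau tau).
Local Notation Fk := (Fk tau).
Local Notation alc := (alc tau).
Local Notation bec := (bec tau).

Let F0 := ((0 : R)^'+).
Let FF0 : ProperFilter ((0 : R)^'+). Proof. by typeclasses eauto. Qed.

Lemma near_half : \forall t \near (0 : R)^'+, 0 < t < 2^-1.
Proof.
by near=> t; apply/andP; split; near: t; [exact: nbhs_right_gt|exact: nbhs_right_lt].
Unshelve. all: by end_near.
Qed.

Lemma cvg_eq_near (f g : R -> C) (l : C) :
  (forall t, 0 < t < 2^-1 -> f t = g t) -> (f t : C^o) @[t --> (0 : R)^'+] --> (l : C^o) ->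
  (g t : C^o) @[t --> (0 : R)^'+] --> (l : C^o).
Proof.
move=> e h; apply: cvg_trans h; apply: near_eq_cvg.
by apply: filterS near_half => t ht; rewrite e.
Qed.

Lemma ctnF (t : R) k : 0 < t < 2^-1 -> ctn t (Fk k).
Proof. by move=> /andP[t0 t1]; apply: on01_ctn => //; exact: ccont_Fk. Qed.

Lemma in01 (t x : R) : 0 < t < 2^-1 -> t / 3 <= x <= 1 - t / 3 -> 0 < x < 1.
Proof. by move=> /andP[t0 t1] /andP[x0 x1]; apply/andP; split; lra. Qed.
Lemma in01' (t x : R) : 0 < t < 2^-1 -> t <= x <= 1 - t -> 0 < x < 1.
Proof. by move=> /andP[t0 t1] /andP[x0 x1]; apply/andP; split; lra. Qed.

Lemma Fk_refl_itv (t x : R) k : 0 < t < 2^-1 -> t <= x <= 1 - t -> Fk k (1 - x) = (-1) ^+ k * Fk k x.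
Proof. by move=> t01 hx; apply: Fk_refl (in01' t01 hx). Qed.

Lemma LtF_odd (t : R) k : odd k -> 0 < t < 2^-1 -> Lt t (Fk k) = 0.
Proof.
move=> ok t01; have /andP[t0 t1] := t01.
have e : Lt t (fun x => Fk k (1 - x)) = - Lt t (Fk k).
  rewrite -mulN1r -(LtZ t0 t1 _ (ctnF (k := k) t01)); apply: (Lt_ext t0 t1) => x hx.
  by rewrite (Fk_refl_itv _ t01 hx) -signr_odd ok expr1.
apply: eq_opp0; rewrite -e; symmetry; exact: (Lt_refl t0 t1 (ctnF (k := k) t01)).
Qed.

Lemma Lt2N (t : R) (f g : R -> C) : 0 < t < 2^-1 -> on01 (ccont g) ->
  Lt2 t (fun x => - f x) (fun x => - g x) = Lt2 t f g.
Proof.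
move=> t01 cg; have /andP[t0 t1] := t01; have [G [aG _]] := on01_adm t0 t1 cg.
have aN : adm t (fun x => - g x) (fun x => - G x).
  move=> x hx; have [d c] := aG x hx; split; first exact: cderN.
  have := ccontM (@ccont_cst R (-1) x) c; congr ccont; apply/funext => y; exact: mulN1r.
rewrite (Lt2E t0 t1 _ aN) (Lt2E t0 t1 _ aG); apply: (Lt_ext t0 t1) => x _.
by rewrite -opprD mulrNN.
Qed.

Lemma Lt2_parity (t : R) m n : odd m = odd n -> 0 < t < 2^-1 ->
  Lt2 t (Fk m) (Fk n) = 2^-1 * (Lt t (Fk m) * Lt t (Fk n)).
Proof.
move=> e t01; have /andP[t0 t1] := t01.
have cm := @ccont_Fk R tau tau0 m; have cn := @ccont_Fk R tau tau0 n.
have sh := shuffle2 t0 t1 cm cn.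
suff e2 : Lt2 t (Fk n) (Fk m) = Lt2 t (Fk m) (Fk n).
  by rewrite -sh e2; move: (Lt2 _ _ _) => u; field.
rewrite -(Lt2_refl t0 t1 cm cn).
have r k x : t <= x <= 1 - t -> Fk k (1 - x) = (-1) ^+ k * Fk k x by exact: Fk_refl_itv.
have [om|em] := boolP (odd m).
  transitivity (Lt2 t (fun x => - Fk m x) (fun x => - Fk n x)); last exact: Lt2N.
  apply: (Lt2_ext t0 t1) => x hx; rewrite (r _ _ hx).
    by rewrite -signr_odd om expr1 mulN1r.
  by rewrite -signr_odd -e om expr1 mulN1r.
apply: (Lt2_ext t0 t1) => x hx; rewrite (r _ _ hx).
  by rewrite -signr_odd (negPf em) expr0 mul1r.
by rewrite -signr_odd -e (negPf em) expr0 mul1r.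
Qed.

Definition A0 (a : nat) : C := X ^+ a * ratr (bern a).
Definition sgc (a m : nat) : C := alc a m / (2 * pi * m.+1%:R)%:C.
Definition Ssg (a : nat) (x : R) : C := cseries (fun m => sgc a m * (Si m.+1 x)%:C).
(** Antiderivative of the even kernel, normalised to be odd about 1/2. *)
Definition Psi (a : nat) (x : R) : C := A0 a * (x - 2^-1)%:C + Ssg a x.

Let p0 : 0 < pi :> R. Proof. exact: pi_gt0. Qed.

Lemma fr_gt0 (m : nat) : 0 < 2 * pi * m.+1%:R :> R.
Proof. by rewrite !mulr_gt0 // ltr0n. Qed.

Lemma fr_ge1 (m : nat) : 1 <= 2 * pi * m.+1%:R :> R.
Proof.
have h2 := pi_ge2 R; have h1 : (1 : R) <= m.+1%:R by rewrite ler1n.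
have : (4 : R) <= 2 * pi by lra.
by move=> h4; rewrite -[leLHS]mulr1; apply: ler_pM => //; lra.
Qed.

Lemma nc_fr (m : nat) : nc (2 * pi * m.+1%:R : R)%:C = 2 * pi * m.+1%:R.
Proof. by rewrite nc_real gtr0_norm // fr_gt0. Qed.

Lemma nc_sgc_le a m : nc (sgc a m) <= nc (alc a m).
Proof.
rewrite /sgc nc_div nc_fr ler_piMr ?nc_ge0 // invf_le1 ?fr_gt0 //; exact: fr_ge1.
Qed.

Lemma rsum_nalc a : rsum (fun m => nc (alc a m)).
Proof. by apply: rsum_le (rsum_alc tau0 a 0) => m; rewrite expr0 mul1r. Qed.

Lemma asum_sgc a : asum (sgc a).
Proof. by apply: asum_le (rsum_nalc a) => m; exact: nc_sgc_le. Qed.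

Lemma Psi_diff a (x y : R) (H : R -> C) : ~~ odd a -> x < y ->
  (forall z, x <= z <= y -> cder H z (Fk a z)) -> H y - H x = Psi a y - Psi a x.
Proof.
move=> ea xy dH.
rewrite (@termwise R (A0 a) (fun m z => alc a m * (Co m.+1 z)%:C) (fun m z => sgc a m * (Si m.+1 z)%:C)
  (fun m => nc (alc a m)) (fun m => nc (alc a m)) H (Fk a) x y xy dH).
- rewrite /Psi /Ssg !rmorphB /=; move: (cseries _) (cseries _) (x%:C) (y%:C) (2^-1%:C) (A0 a) => u v w z k l; ring.
- by move=> z _; rewrite FkE_even.
- move=> m z; have := cderZ (sgc a m) (cder_Si m.+1 z); congr cder.
  have w0 : (2 * pi * m.+1%:R : R)%:C != 0 by rewrite -nc_gt0 nc_fr fr_gt0.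
  rewrite /sgc (realCM (2 * pi * m.+1%:R)); move: w0; generalize ((2 * pi * m.+1%:R : R)%:C) => w w0.
  by rewrite /= mulrA divfK.
- by move=> m; exact: nc_ge0.
- by move=> m; exact: nc_ge0.
- exact: rsum_nalc.
- exact: rsum_nalc.
- by move=> m z; rewrite ncM ler_piMr ?nc_ge0 //; exact: nc_Co.
- move=> m z; rewrite ncM; apply: le_trans (nc_sgc_le a m).
  by rewrite ler_piMr ?nc_ge0 //; exact: nc_Si.
Qed.

Lemma Ssg_refl a (x : R) : Ssg a (1 - x) = - Ssg a x.
Proof.
rewrite /Ssg -cseriesN.
  by apply: cseries_ext => m; rewrite Si_refl rmorphN mulrN.
by apply: asum_le (asum_sgc a) => m; rewrite ncM ler_piMr ?nc_ge0 //; exact: nc_Si.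
Qed.

Lemma LtF_even (t : R) a : ~~ odd a -> 0 < t < 2^-1 ->
  Lt t (Fk a) = A0 a * (1 - 2 * t)%:C - 2 * Ssg a t.
Proof.
move=> ea t01; have /andP[t0 t1] := t01.
have [H [aH _]] := on01_adm t0 t1 (@ccont_Fk R tau tau0 a).
have tt : t < 1 - t by lra.
rewrite (LtE t0 t1 aH) (Psi_diff ea tt (fun z hz => (aH z hz).1)) /Psi Ssg_refl.
rewrite !rmorphB /= rmorphM rmorph_nat rmorph1 /=.
by move: (Ssg _ _) (A0 a) (t%:C) (2^-1%:C) => u v w z; ring.
Qed.

Lemma Si_cvg0 n : ((Si n t)%:C : C^o) @[t --> (0 : R)^'+] --> (0 : C^o).
Proof.
have h := ccont_right (@ccont_Si R n 0); have e : (Si n (0 : R))%:C = 0 by rewrite /Si mulr0 sin0.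
by rewrite e in h; exact: h.
Qed.

Lemma Co_cvg1 n : ((Co n t)%:C : C^o) @[t --> (0 : R)^'+] --> (1 : C^o).
Proof.
have h := ccont_right (@ccont_Co R n 0); have e : (Co n (0 : R))%:C = 1 by rewrite /Co mulr0 cos0.
by rewrite e in h; exact: h.
Qed.

Lemma cder_id (x : R) : cder (fun y => y%:C) x 1.
Proof. by have := cder_real (is_derive_id x (1 : R)); rewrite rmorph1. Qed.

Lemma cZ (c : C) (f : R -> C) (a : C) : ((f t : C^o) @[t --> (0 : R)^'+] --> (a : C^o)) ->
  (c * f t : C^o) @[t --> (0 : R)^'+] --> (c * a : C^o).
Proof. by move=> h; exact: (cvgCZ FF0 h). Qed.
Arguments cZ c [f a] _.

Lemma lin_cvg1 : ((1 - 2 * t)%:C : C^o) @[t --> (0 : R)^'+] --> (1 : C^o).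
Proof.
have d := cderB (cder_cst 1 0) (cderZ 2 (cder_id 0)).
have h := ccont_right (cder_ccont d); rewrite mulr0 subr0 in h.
apply: cvg_eq_near h => t _; by rewrite realCD realCN realCM realC2.
Qed.

Definition SS (c : nat -> C) (x : R) : C := cseries (fun m => c m * (Si m.+1 x)%:C).

Lemma nc_cSi (c : C) m (x : R) : nc (c * (Si m x)%:C) <= nc c.
Proof. by rewrite ncM ler_piMr ?nc_ge0 //; exact: nc_Si. Qed.

Lemma ccont_SS c (x : R) : asum c -> ccont (SS c) x.
Proof.
move=> ac; apply: (@ccont_series R c (fun m => Si m.+1) x ac) => [m y|m]; first exact: nc_Si.
exact: ccont_Si.
Qed.

Lemma nc_SS c : asum c -> exists2 M, 0 <= M & forall x, nc (SS c x) <= M.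
Proof.
move=> [M hM]; exists M => [|x]; first by have := hM 0%N; rewrite big_ord0.
apply: nc_cseries_le => n; apply: le_trans (hM n); apply: ler_sum => i _; exact: nc_cSi.
Qed.

Lemma LtSS (t : R) (phi : R -> C) (c : nat -> C) : 0 < t < 2^-1 -> on01 (ccont phi) -> asum c ->
  Lt t (fun x => phi x * SS c x) = cseries (fun m => c m * Lt t (fun x => phi x * (Si m.+1 x)%:C)).
Proof.
move=> t01 cp ac; have /andP[t0 t1] := t01.
have tt : t <= 1 - t by lra.
have [M M0 hM] := ccont_bound tt (fun x hx => cp x (in01' t01 hx)).
have cS m : ctn t (fun x => c m * (Si m.+1 x)%:C).
  by move=> x _; apply: ccontM; [exact: ccont_cst|exact: ccont_Si].
have cf : ctn t phi by move=> x hx; exact: cp (in01 t01 hx).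
have cc : ctn t (SS c) by move=> x _; exact: ccont_SS.
have := @Lt_series R t t0 t1 phi (fun m x => c m * (Si m.+1 x)%:C) (fun m => nc (c m)) M cf cS
  (fun m => nc_ge0 _) ac M0 hM (fun m x _ => nc_cSi (c m) m.+1 x) cc.
rewrite /SS => ->; apply: cseries_ext => m; rewrite -(LtZ t0 t1).
  by apply: (Lt_ext t0 t1) => x _; rewrite mulrCA.
by move=> x hx; apply: ccontM; [exact: cf|exact: ccont_Si].
Qed.

(** The weight m+1 in the domination is needed for the cotangent, whose integrals against sin(2 pi m
    x) are only bounded linearly in m here. *)
Lemma LtSS_cvg (phi : R -> C) (c l : nat -> C) (K : R) : on01 (ccont phi) ->
  rsum (fun m => m.+1%:R ^+ 1 * nc (c m)) -> 0 <= K ->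
  (forall (t : R) m, 0 < t < 2^-1 -> nc (Lt t (fun x => phi x * (Si m.+1 x)%:C)) <= K * m.+1%:R) ->
  (forall m, (Lt t (fun x => phi x * (Si m.+1 x)%:C) : C^o) @[t --> (0 : R)^'+] --> (l m : C^o)) ->
  asum (fun m => c m * l m) /\
  ((Lt t (fun x => phi x * SS c x) : C^o) @[t --> (0 : R)^'+] --> (cseries (fun m => c m * l m) : C^o)).
Proof.
move=> cp rc K0 hK hl.
have ac : asum c.
  by apply: asum_le rc => m; rewrite expr1 ler_peMl ?nc_ge0 // ler1n.
suff [? h] : asum (fun m => c m * l m) /\
  ((cseries (fun m => c m * Lt t (fun x => phi x * (Si m.+1 x)%:C)) : C^o) @[t --> (0 : R)^'+] -->
   (cseries (fun m => c m * l m) : C^o)).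
  by split; [|apply: cvg_eq_near h => t t01; rewrite LtSS].
apply: (@tannery R R _ FF0 (fun t m => c m * Lt t (fun x => phi x * (Si m.+1 x)%:C)) (fun m => c m * l m)
   (fun m => K * (m.+1%:R ^+ 1 * nc (c m)))).
- exact: rsumZ.
- apply: filterS near_half => t t01 m; rewrite ncM expr1 [leRHS]mulrA mulrC.
  by apply: ler_wpM2r; [exact: nc_ge0|exact: hK].
- by move=> m; exact: (@cvgCZ R R _ FF0 _ _ (hl m)).
Qed.

Lemma frC_neq0 m : (2 * pi * m.+1%:R : R)%:C != 0 :> C.
Proof. by rewrite -nc_gt0 nc_fr fr_gt0. Qed.

Lemma ccont_lin (x : R) : ccont (fun y => (y - 2^-1)%:C) x.
Proof.
apply: (cder_ccont (v := 1 - 0)).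
have := cderB (cder_id x) (cder_cst (2^-1)%:C x); congr cder.
by apply/funext => y; rewrite realCD realCN.
Qed.

Lemma Lt_linSi m : (Lt t (fun x => (x - 2^-1)%:C * (Si m.+1 x)%:C) : C^o) @[t --> (0 : R)^'+] -->
  (- ((2 * pi * m.+1%:R : R)%:C)^-1 : C^o).
Proof.
have w0 := frC_neq0 m; set w := (2 * pi * m.+1%:R : R)%:C in w0 *.
apply: (@cvg_eq_near (fun t : R => - w^-1 * ((1 - 2 * t)%:C * (Co m.+1 t)%:C) + - 2 * w^-1 ^+ 2 * (Si m.+1 t)%:C)).
  move=> t t01; have /andP[t0 t1] := t01; symmetry.
  rewrite (@LtE R t t0 t1 _ (fun x => (- w^-1) * ((x - 2^-1)%:C * (Co m.+1 x)%:C) + w^-1 ^+ 2 * (Si m.+1 x)%:C)).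
    rewrite Co_refl Si_refl !realCD !realCN !realCM realC2 realC1 realCV2.
    by move: w^-1 ((Co _ _)%:C) ((Si _ _)%:C) (t%:C) => u v y z; field.
  move=> x _; split; last by apply: ccontM; [exact: ccont_lin|exact: ccont_Si].
  have d1 : cder (fun y => (y - 2^-1)%:C) x 1.
    have := cderB (cder_id x) (cder_cst (2^-1)%:C x); rewrite subr0; congr cder.
    by apply/funext => y; rewrite realCD realCN.
  have := cderD (cderZ (- w^-1) (cderM d1 (cder_Co m.+1 x))) (cderZ (w^-1 ^+ 2) (cder_Si m.+1 x)).
  congr cder; rewrite realCN (realCM (2 * pi * m.+1%:R) (Si m.+1 x)).
  rewrite (realCM (2 * pi * m.+1%:R) (Co m.+1 x)) -/w.
  by move: w0 ((Co _ _)%:C) ((Si _ _)%:C) ((x - 2^-1)%:C); clearbody w => w0 v y z; field.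
have h := cvgCD FF0 (cZ (- w^-1) (cvgCM FF0 lin_cvg1 (@Co_cvg1 m.+1)))
  (cZ (- 2 * w^-1 ^+ 2) (@Si_cvg0 m.+1)).
by rewrite !mulr1 mulr0 addr0 in h; exact: h.
Qed.

Lemma Lt_SiSi j m : (Lt t (fun x => (Si j.+1 x)%:C * (Si m.+1 x)%:C) : C^o) @[t --> (0 : R)^'+] -->
  ((j == m)%:R / 2 : C^o).
Proof.
have [->|njm] := eqVneq j m.
  have w0 := frC_neq0 m; set w := (2 * pi * m.+1%:R : R)%:C in w0 *.
  apply: (@cvg_eq_near (fun t : R => 2^-1 * (1 - 2 * t)%:C + w^-1 * ((Co m.+1 t)%:C * (Si m.+1 t)%:C))).
    move=> t t01; have /andP[t0 t1] := t01; symmetry.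
    rewrite (@LtE R t t0 t1 _ (fun x => 2^-1 * x%:C + (- (2 * w)^-1) * ((Co m.+1 x)%:C * (Si m.+1 x)%:C))).
      rewrite Co_refl Si_refl !realCD !realCN !realCM realC2 realC1.
      by move: w0 ((Co _ _)%:C) ((Si _ _)%:C) (t%:C); clearbody w => w0 v y z; field.
    move=> x _; split; last by apply: ccontM; exact: ccont_Si.
    have := cderD (cderZ 2^-1 (cder_id x)) (cderZ (- (2 * w)^-1) (cderM (cder_Co m.+1 x) (cder_Si m.+1 x))).
    congr cder; rewrite realCN (realCM (2 * pi * m.+1%:R) (Si m.+1 x)).
    rewrite (realCM (2 * pi * m.+1%:R) (Co m.+1 x)) -/w.
    have e : (Co m.+1 x)%:C * (Co m.+1 x)%:C = 1 - (Si m.+1 x)%:C * (Si m.+1 x)%:C :> C.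
      by rewrite -!realCM -realC1 -realCN -realCD; congr (_ %:C); rewrite -!expr2 /Co cos2sin2.
    have e2 (u v : C) : u * u = 1 - v * v -> 2^-1 * 1 + - (2 * w)^-1 * (- (w * v) * v + u * (w * u)) = v * v.
      move=> h; rewrite mulrCA h; clearbody w; by field.
    exact: e2.
  have h := cvgCD FF0 (cZ 2^-1 lin_cvg1) (cZ w^-1 (cvgCM FF0 (@Co_cvg1 m.+1) (@Si_cvg0 m.+1))).
  have e : 2^-1 * 1 + w^-1 * (1 * 0) = true%:R / 2 :> C by rewrite !mulr0 addr0 mulr1 mul1r.
  by rewrite e in h; exact: h.
pose wj := (2 * pi * j.+1%:R : R)%:C : C; pose w := (2 * pi * m.+1%:R : R)%:C : C.
have d0 : w ^+ 2 - wj ^+ 2 != 0.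
  rewrite -!rmorphXn -rmorphB -nc_gt0 nc_real normr_gt0 subr_eq0 eqrXn2 ?ltW ?fr_gt0 //.
  have h2p : 2 * pi != 0 :> R by rewrite mulf_neq0 // gt_eqF.
  by apply: contraNneq njm => /(mulfI h2p)/eqP; rewrite eqr_nat eqSS eq_sym.
rewrite mul0r.
apply: (@cvg_eq_near (fun t : R => - 2 / (w ^+ 2 - wj ^+ 2) * (wj * ((Co j.+1 t)%:C * (Si m.+1 t)%:C)
    - w * ((Si j.+1 t)%:C * (Co m.+1 t)%:C)))).
  move=> t t01; have /andP[t0 t1] := t01; symmetry.
  rewrite (@LtE R t t0 t1 _ (fun x => (w ^+ 2 - wj ^+ 2)^-1 * (wj * ((Co j.+1 x)%:C * (Si m.+1 x)%:C)
    - w * ((Si j.+1 x)%:C * (Co m.+1 x)%:C)))).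
    rewrite !Co_refl !Si_refl !realCN; move: (_^-1) => k.
    by move: w wj {d0} (Co j.+1 t)%:C (Si m.+1 t)%:C (Co m.+1 t)%:C (Si j.+1 t)%:C => *; ring.
  move=> x _; split; last by apply: ccontM; exact: ccont_Si.
  have := cderZ ((w ^+ 2 - wj ^+ 2)^-1) (cderB (cderZ wj (cderM (cder_Co j.+1 x) (cder_Si m.+1 x)))
    (cderZ w (cderM (cder_Si j.+1 x) (cder_Co m.+1 x)))).
  congr cder; rewrite !realCN (realCM (2 * pi * m.+1%:R) (Si m.+1 x)).
  rewrite (realCM (2 * pi * m.+1%:R) (Co m.+1 x)) -/w.
  rewrite (realCM (2 * pi * j.+1%:R) (Si j.+1 x)).
  rewrite (realCM (2 * pi * j.+1%:R) (Co j.+1 x)) -/wj.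
  move: d0 (Co j.+1 x)%:C (Si m.+1 x)%:C (Co m.+1 x)%:C (Si j.+1 x)%:C; clearbody w wj => d0 u v y z.
  by field.
have h := cZ (- 2 / (w ^+ 2 - wj ^+ 2)) (cvgCB FF0 (cZ wj (cvgCM FF0 (@Co_cvg1 j.+1) (@Si_cvg0 m.+1)))
  (cZ w (cvgCM FF0 (@Si_cvg0 j.+1) (@Co_cvg1 m.+1)))).
by rewrite !mul0r !mulr0 subr0 mulr0 in h; exact: h.
Qed.

Lemma Lt_Co k : (Lt t (fun x => (Co k x)%:C) : C^o) @[t --> (0 : R)^'+] --> ((k == 0%N)%:R : C^o).
Proof.
case: k => [|k].
  apply: (@cvg_eq_near (fun t : R => (1 - 2 * t)%:C)); last exact: lin_cvg1.
  move=> t t01; have /andP[t0 t1] := t01; symmetry.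
  rewrite (@LtE R t t0 t1 _ (fun x => x%:C)); first by rewrite -realCN -realCD; congr (_ %:C); ring.
  move=> x _; split; last exact: ccont_Co.
  by have := cder_id x; congr cder; rewrite /Co mulr0 mul0r cos0.
have w0 := frC_neq0 k; set w := (2 * pi * k.+1%:R : R)%:C in w0 *.
apply: (@cvg_eq_near (fun t : R => - 2 / w * (Si k.+1 t)%:C)).
  move=> t t01; have /andP[t0 t1] := t01; symmetry.
  rewrite (@LtE R t t0 t1 _ (fun x => w^-1 * (Si k.+1 x)%:C)).
    by rewrite Si_refl realCN; move: (Si _ _)%:C w^-1 => u v; ring.
  move=> x _; split; last exact: ccont_Co.
  have := cderZ w^-1 (cder_Si k.+1 x); congr cder.
  by rewrite (realCM (2 * pi * k.+1%:R) (Co k.+1 x)) -/w /= mulrA mulVf // mul1r.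
by have h := cZ (- 2 / w) (@Si_cvg0 k.+1); rewrite mulr0 in h; exact: h.
Qed.

(** Multiplication by a sine removes the poles of the cotangent and leaves a trigonometric
    polynomial, integrable in closed form. *)
Lemma cot_Si n (x : R) : 0 < x < 1 -> cotw x * Si n x = pi * \sum_(k < n) (Co k x + Co k.+1 x).
Proof.
move=> hx; have s0 := sin_pix_gt0 hx.
rewrite /cotw -!mulrA; congr (_ * _); rewrite mulrCA; apply: (canLR (mulKf (lt0r_neq0 s0))).
elim: n => [|n IH]; first by rewrite big_ord0 /Si mulr0 mul0r sin0 !mulr0.
rewrite big_ord_recr /= mulrDr -IH /Si /Co.
have -> : 2 * pi * n.+1%:R * x = 2 * pi * n%:R * x + (pi * x) *+ 2.
  by rewrite -natr1; ring.
move: (2 * pi * n%:R * x) (pi * x) => u v; rewrite (sinD u) (cosD u) cos_mulr2n sin_mulr2n.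
have := cos2Dsin2 v; move: (cos v) (sin v) (cos u) (sin u) => a b c d e.
apply/eqP; rewrite -subr_eq0; apply/eqP; transitivity (2 * a * d * (a ^+ 2 + b ^+ 2 - 1)); first by ring.
by rewrite e subrr mulr0.
Qed.

Lemma ccont_cotw : on01 (ccont (fun x : R => (cotw x)%:C)).
Proof. by move=> x hx; exact: ccont_cot. Qed.

Lemma Lt_cotSiE (t : R) n : 0 < t < 2^-1 -> Lt t (fun x => (cotw x)%:C * (Si n x)%:C) =
  pi%:C * \sum_(k < n) (Lt t (fun x => (Co k x)%:C) + Lt t (fun x => (Co k.+1 x)%:C)).
Proof.
move=> t01; have /andP[t0 t1] := t01.
have c1 k : ctn t (fun x => (Co k x)%:C + (Co k.+1 x)%:C).
  by move=> x _; apply: ccontD; exact: ccont_Co.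
have [c2 e2] := @Lt_sum R t t0 t1 _ (index_enum 'I_n) (fun (k : 'I_n) x => (Co k x)%:C + (Co k.+1 x)%:C) (fun k => c1 k).
rewrite (@Lt_ext R t t0 t1 _ (fun x => pi%:C * \sum_(k < n) ((Co k x)%:C + (Co k.+1 x)%:C))).
  rewrite (LtZ t0 t1 _ c2) e2; congr (_ * _); apply: eq_bigr => k _.
  exact: (LtD t0 t1 (fun x _ => @ccont_Co R k x) (fun x _ => @ccont_Co R k.+1 x)).
move=> x hx; rewrite -realCM cot_Si ?(in01' t01 hx) // realCM (rmorph_sum (real_complex R)); congr (_ * _).
by apply: eq_bigr => k _; rewrite /= realCD.
Qed.

Lemma Lt_cotSi n : (Lt t (fun x => (cotw x)%:C * (Si n.+1 x)%:C) : C^o) @[t --> (0 : R)^'+] --> (pi%:C : C^o).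
Proof.
apply: (@cvg_eq_near (fun t : R => pi%:C * \sum_(k < n.+1) (Lt t (fun x => (Co k x)%:C) + Lt t (fun x => (Co k.+1 x)%:C)))).
  by move=> t t01; rewrite Lt_cotSiE.
have h := cZ pi%:C (@cvgC_sum R R _ FF0 _ (index_enum 'I_n.+1) _ _ (fun k : 'I_n.+1 => cvgCD FF0 (@Lt_Co k) (@Lt_Co k.+1))).
have e : pi%:C * (\sum_(k < n.+1) ((k == 0%N :> nat)%:R + (k.+1 == 0%N)%:R)) = pi%:C :> C.
  rewrite big_ord_recl /= addr0 big1 ?addr0 ?mulr1 // => i _; by rewrite addr0.
by rewrite e in h; exact: h.
Qed.

Lemma Lt_cotSi_le (t : R) n : 0 < t < 2^-1 -> nc (Lt t (fun x => (cotw x)%:C * (Si n x)%:C)) <= (4 * pi) * n%:R.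
Proof.
move=> t01; have /andP[t0 t1] := t01; rewrite Lt_cotSiE // ncM nc_real gtr0_norm //.
have hk k : nc (Lt t (fun x => (Co k x)%:C)) <= 2 * 1.
  by apply: (Lt_bound t0 t1) => [x _|x _]; [exact: ccont_Co|exact: nc_Co].
have -> : 4 * pi * n%:R = pi * (\sum_(k < n) 4) :> R by rewrite sumr_const card_ord -mulr_natr; ring.
apply: ler_wpM2l; first exact: ltW.
apply: le_trans (nc_sum _ _ _) _; apply: ler_sum => k _; apply: le_trans (ncD _ _) _.
have := hk k; have := hk k.+1; lra.
Qed.

(** The sine series is O(t) at 0 and t ln t tends to 0. *)
Lemma lSsg_cvg a : (clog (- X * t%:C) * Ssg a t : C^o) @[t --> (0 : R)^'+] --> (0 : C^o).
Proof.
have [M hM] := rsum_nalc a.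
have M0 : 0 <= M by have := hM 0%N; rewrite big_ord0.
have hS (t : R) : 0 < t -> nc (Ssg a t) <= 2 * t * M.
  move=> t0; apply: nc_cseries_le => n; apply: le_trans (_ : \sum_(i < n) 2 * t * nc (alc a i) <= _).
    apply: ler_sum => i _; rewrite ncM /sgc nc_div nc_fr.
    have sb : nc (Si i.+1 t)%:C <= 2 * (2 * pi * i.+1%:R) * t.
      have := @cder_bound R (fun x => (Si i.+1 x)%:C) (fun x => (2 * pi * i.+1%:R * Co i.+1 x)%:C) 0 t
        (2 * pi * i.+1%:R) t0 (fun x _ => cder_Si i.+1 x).
      have -> : (Si i.+1 (0 : R))%:C = 0 by rewrite /Si mulr0 sin0.
      rewrite !subr0; apply=> x _; rewrite realCM ncM nc_fr.
      by apply: ler_piMr; [exact: ltW (fr_gt0 i)|exact: nc_Co].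
    rewrite mulrAC ler_pdivrMr ?fr_gt0 //; apply: le_trans (ler_wpM2l (nc_ge0 _) sb) _.
    by rewrite le_eqVlt; apply/orP; left; apply/eqP; move: (nc _) (2 * pi * _) => u v; ring.
  rewrite -mulr_sumr; apply: ler_wpM2l => //; lra.
have h : 2 * M * (t * (`|ln (2 * pi * t)| + pi / 2)) @[t --> (0 : R)^'+] --> 2 * M * 0.
  by apply: cvgM; [exact: cvg_cst|exact: tlnt_cvg].
rewrite mulr0 in h; apply: (cvgC_squeeze FF0 _ h).
apply: filterS near_half => t /andP[t0 _]; rewrite subr0 ncM clogE //.
have nl : nc (ln (2 * pi * t) +i* (- (pi / 2))) <= `|ln (2 * pi * t)| + pi / 2.
  have hp : `|pi / 2 : R| = pi / 2 by rewrite gtr0_norm // divr_gt0.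
  by apply: le_trans (nc_ReIm _) _; rewrite /= normrN hp.
apply: le_trans (ler_pM (nc_ge0 _) (nc_ge0 _) nl (hS t t0)) _.
by rewrite le_eqVlt; apply/orP; left; apply/eqP; ring.
Qed.

Lemma Ssg_cvg0 a : (Ssg a t : C^o) @[t --> (0 : R)^'+] --> (0 : C^o).
Proof.
have h := ccont_right (@ccont_SS (sgc a) 0 (asum_sgc a)).
have e : SS (sgc a) 0 = 0.
  by rewrite /SS (@cseries_fin _ _ 0) ?big_ord0 // => n _; rewrite /Si mulr0 sin0 mulr0.
by rewrite e in h; exact: h.
Qed.

Definition A1v (k : nat) : C := if odd k then 0 else A0 k.

Lemma A1_cvg k : (Aseries_t tau t [:: k] : C^o) @[t --> (0 : R)^'+] --> (A1v k : C^o).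
Proof.
rewrite /A1v; have [ok|ek] := boolP (odd k).
  apply: (@cvg_eq_near (fun t : R => 0)); last exact: (@cvgC_cst R R _ FF0 0).
  by move=> t t01; rewrite Aseries1 (Jseries1E tau0 _ t01) LtF_odd.
apply: (@cvg_eq_near (fun t : R => A0 k * (1 - 2 * t)%:C - 2 * Ssg k t)).
  by move=> t t01; rewrite Aseries1 (Jseries1E tau0 _ t01) LtF_even.
have h := cvgCB FF0 (cZ (A0 k) lin_cvg1) (cZ 2 (@Ssg_cvg0 k)).
by rewrite mulr1 mulr0 subr0 in h; exact: h.
Qed.

Lemma A2_parity_cvg m n : odd m = odd n ->
  (Aseries_t tau t [:: m; n] : C^o) @[t --> (0 : R)^'+] --> (2^-1 * (A1v m * A1v n) : C^o).
Proof.
move=> e; apply: cvg_eq_near (cZ 2^-1 (cvgCM FF0 (@A1_cvg m) (@A1_cvg n))) => t t01.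
rewrite Aseries2 !Aseries1 !(Jseries1E tau0 _ t01) (Jseries2E tau0 _ _ t01) Lt2_parity //.
have z k l : odd k = odd l -> (k == 1%N)%:R * clog (- X * t%:C) * Lt t (Fk l) = 0.
  by case: eqP => [-> ol|_ _]; [rewrite LtF_odd -?ol ?mulr0|rewrite !mul0r].
by rewrite !z // subr0 addr0.
Qed.

Lemma ctZ (t : R) (c : C) f : ctn t f -> ctn t (fun x => c * f x).
Proof. by move=> cf x hx; exact: ccontM (@ccont_cst _ _ _) (cf x hx). Qed.
Lemma ctD (t : R) (f g : R -> C) : ctn t f -> ctn t g -> ctn t (fun x => f x + g x).
Proof. by move=> cf cg x hx; exact: ccontD (cf x hx) (cg x hx). Qed.

(** The odd kernel integrates to 0, so the shuffle product makes the double integral antisymmetric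
    and the boundary value of [Psi] drops out. *)
Lemma Lt2_mixed (t : R) a b : ~~ odd a -> odd b -> 0 < t < 2^-1 ->
  Lt2 t (Fk a) (Fk b) = Lt t (fun x => Fk b x * Psi a x).
Proof.
move=> ea ob t01; have /andP[t0 t1] := t01.
have ca := @ccont_Fk R tau tau0 a; have cb := @ccont_Fk R tau tau0 b.
have sh := shuffle2 t0 t1 ca cb; rewrite (LtF_odd ob t01) mulr0 in sh.
have -> : Lt2 t (Fk a) (Fk b) = - Lt2 t (Fk b) (Fk a).
  by apply/eqP; rewrite -addr_eq0 sh.
have [H [aH _]] := on01_adm t0 t1 ca.
rewrite (Lt2E t0 t1 _ aH).
have hP x : t <= x <= 1 - t -> H (1 - t) - H x = Psi a (1 - t) - Psi a x.
  move=> /andP[x0]; rewrite le_eqVlt => /orP[/eqP->|x1]; first by rewrite !subrr.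
  by apply: (Psi_diff ea x1) => z /andP[z0 z1]; apply: (aH z _).1; rewrite (le_trans x0 z0).
have cP : ctn t (Psi a).
  move=> x hx; apply: (@ccontD R (fun x => A0 a * (x - 2^-1)%:C) (Ssg a)).
    exact: ccontM (@ccont_cst _ _ _) (@ccont_lin x).
  exact: (@ccont_SS (sgc a) x (asum_sgc a)).
have cF := ctnF (k := b) t01.
have cFP : ctn t (fun x => Fk b x * Psi a x) by move=> x hx; exact: ccontM (cF x hx) (cP x hx).
rewrite (@Lt_ext R t t0 t1 _ (fun x => Psi a (1 - t) * Fk b x - Fk b x * Psi a x)).
  by rewrite (LtB t0 t1 (@ctZ t _ _ cF) cFP) (LtZ t0 t1 _ cF) (LtF_odd ob t01) mulr0 sub0r opprK.
by move=> x hx; rewrite (hP x hx) mulrBr [_ * Fk b x]mulrC.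
Qed.

(** Isolates the only divergent combination, cotangent against x - 1/2 minus the logarithm; the
    other pieces converge separately. *)
Lemma At_mixed (t : R) a b : ~~ odd a -> odd b -> 0 < t < 2^-1 ->
  Aseries_t tau t [:: a; b] = (b == 1%N)%:R * A0 a *
    (Lt t (fun x => (cotw x)%:C * (x - 2^-1)%:C) - clog (- X * t%:C) * (1 - 2 * t)%:C)
  + (A0 a * Lt t (fun x => (x - 2^-1)%:C * SS (bec b) x)
  + ((b == 1%N)%:R * Lt t (fun x => (cotw x)%:C * SS (sgc a) x)
  + Lt t (fun x => SS (bec b) x * SS (sgc a) x))) + 2 * (b == 1%N)%:R * (clog (- X * t%:C) * Ssg a t).
Proof.
move=> ea ob t01; have /andP[t0 t1] := t01.
rewrite Aseries2 !(Jseries1E tau0 _ t01) (Jseries2E tau0 _ _ t01) (Lt2_mixed ea ob t01).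
have -> : (a == 1%N) = false by apply: contraNF ea => /eqP ->.
rewrite !mul0r addr0 (LtF_even ea t01); set be := (b == 1%N)%:R.
have cc x : t / 3 <= x <= 1 - t / 3 -> ccont (fun x => (cotw x)%:C) x.
  by move=> hx; exact: (@ccont_cotw x (in01 t01 hx)).
have cB x := @ccont_SS (bec b) x (asum_bec tau0 b); have cG x := @ccont_SS (sgc a) x (asum_sgc a).
have c1 : ctn t (fun x => (cotw x)%:C * (x - 2^-1)%:C) by move=> x hx; exact: ccontM (cc x hx) (@ccont_lin x).
have c2 : ctn t (fun x => (x - 2^-1)%:C * SS (bec b) x) by move=> x hx; exact: ccontM (@ccont_lin x) (cB x).
have c3 : ctn t (fun x => (cotw x)%:C * SS (sgc a) x) by move=> x hx; exact: ccontM (cc x hx) (cG x).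
have c4 : ctn t (fun x => SS (bec b) x * SS (sgc a) x) by move=> x hx; exact: ccontM (cB x) (cG x).
rewrite (@Lt_ext R t t0 t1 _ (fun x => be * A0 a * ((cotw x)%:C * (x - 2^-1)%:C) +
   (A0 a * ((x - 2^-1)%:C * SS (bec b) x) + (be * ((cotw x)%:C * SS (sgc a) x) + SS (bec b) x * SS (sgc a) x)))).
  rewrite (LtD t0 t1 (@ctZ t _ _ c1) (@ctD t _ _ (@ctZ t _ _ c2) (@ctD t _ _ (@ctZ t _ _ c3) c4))) (LtD t0 t1 (@ctZ t _ _ c2) (@ctD t _ _ (@ctZ t _ _ c3) c4)).
  rewrite (LtD t0 t1 (@ctZ t _ _ c3) c4) !(LtZ t0 t1).
  - have rr (A B D E l S z a0 b0 : C) : b0 * a0 * A + (a0 * B + (b0 * D + E)) - b0 * l * (a0 * z - 2 * S) =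
        b0 * a0 * (A - l * z) + (a0 * B + (b0 * D + E)) + 2 * b0 * (l * S) by ring.
    exact: rr.
  - exact: c3.
  - exact: c2.
  - exact: c1.
move=> x hx; rewrite FkE_odd ?(in01' t01 hx) // -/(SS (bec b) x) -/(cotw x) -/be /Psi -/(SS (sgc a) x).
by rewrite /Ssg -/(SS (sgc a) x); move: (SS _ _) (SS _ _) (_%:C) (_%:C) (A0 a) be => *; ring.
Qed.

Lemma cseries_delta (u : nat -> C) m : cseries (fun j => u j * ((m == j)%:R / 2)) = u m / 2.
Proof.
rewrite (@cseries_fin _ _ m.+1) => [|n mn]; last by rewrite ltn_eqF // mul0r mulr0.
rewrite big_ord_recr /= eqxx mul1r big1 ?add0r // => i _.
by rewrite gtn_eqF ?ltn_ord // mul0r mulr0.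
Qed.

Definition lamS (a : nat) (Q : C) : C := if a is a'.+1 then lam a' Q else 0.

Lemma becE b m : bec b.+1 m = 2 * (2 * pi)%:C * X ^+ b * lam b (q ^+ m.+1).
Proof.
rewrite /bec exprS {1}two_pi_iE; have i2 : (0 +i* 1) * (0 +i* 1) = -1 :> C.
  by apply: complex_ext; rewrite ?ReM ?ImM /=; ring.
move: ((2 * pi)%:C) (lam _ _) (X ^+ b) (0 +i* 1) i2 => p l x I i2.
by transitivity (- 2 * (I * I) * p * x * l); [ring|rewrite i2; ring].
Qed.

Lemma alcE a m : alc a m = - 2 * X ^+ a * lamS a (q ^+ m.+1).
Proof. by case: a => [|a] //=; rewrite mulr0. Qed.

(** The contribution of the m-th Fourier mode; its bracket is the power series whose coefficients
    are [Wab]. *)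
Definition mixed_term a b m : C := - 2 * X ^+ (a + b).-1 / m.+1%:R *
  (ratr (bern a) * lamS b (q ^+ m.+1) + lamS a (q ^+ m.+1) * lamS b (q ^+ m.+1)
   - ratr (bern b) * lamS a (q ^+ m.+1)).

Lemma lin_le (t x : R) : 0 < t < 2^-1 -> t <= x <= 1 - t -> nc (x - 2^-1)%:C <= 1.
Proof. by move=> /andP[t0 t1] /andP[x0 x1]; rewrite nc_real ler_norml; apply/andP; split; lra. Qed.

(** The linear part of [Psi] against the sine series gives b_a L_b, sine against sine gives L_a L_b
    by orthogonality, and the cotangent against the sine part gives -b_1 L_a. *)
Lemma A2_mixed_cvg (kappa : C) a b : ~~ odd a -> odd b ->
  ((Lt t (fun x => (cotw x)%:C * (x - 2^-1)%:C) - clog (- X * t%:C) * (1 - 2 * t)%:C : C^o)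
    @[t --> (0 : R)^'+] --> (kappa : C^o)) ->
  (Aseries_t tau t [:: a; b] : C^o) @[t --> (0 : R)^'+] -->
    ((b == 1%N)%:R * A0 a * kappa + cseries (mixed_term a b) : C^o).
Proof.
move=> ea ob hk.
have bd (M : R) m : 0 <= M -> M <= M * m.+1%:R by move=> M0; rewrite ler_peMr // ler1n.
have Sle (t : R) (f : R -> C) (M : R) m : 0 < t < 2^-1 -> 0 <= M -> (forall x, t / 3 <= x <= 1 - t / 3 -> ccont f x) ->
  (forall x, t <= x <= 1 - t -> nc (f x) <= M) ->
  nc (Lt t (fun x => f x * (Si m.+1 x)%:C)) <= 2 * M * m.+1%:R.
  move=> t01 M0 cf hM; have /andP[t0 t1] := t01; apply: le_trans (bd (2 * M) m _); last by rewrite mulr_ge0.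
  apply: (Lt_bound t0 t1) => x hx; first exact: ccontM (cf x hx) (@ccont_Si R _ _).
  by rewrite ncM -[M]mulr1; apply: ler_pM; rewrite ?nc_ge0 ?nc_Si //; exact: hM.
have rb := rsum_bec tau0 b 1; have i2 : 0 <= 2 * 1 :> R by lra.
have rs : rsum (fun m => m.+1%:R ^+ 1 * nc (sgc a m)).
  by apply: rsum_le (rsum_alc tau0 a 1) => m; apply: ler_wpM2l; [exact: exprn_ge0|exact: nc_sgc_le].
have [s2 h2] := @LtSS_cvg (fun x => (x - 2^-1)%:C) (bec b) _ (2 * 1) (fun x _ => @ccont_lin x) rb i2
  (fun t m t01 => Sle t _ 1 m t01 ler01 (fun x _ => @ccont_lin x) (fun x hx => lin_le t01 hx)) Lt_linSi.
have p4 : 0 <= 4 * pi :> R by rewrite mulr_ge0 // ltW.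
have [s3 h3] := @LtSS_cvg (fun x => (cotw x)%:C) (sgc a) _ (4 * pi) ccont_cotw rs p4
  (fun t m t01 => Lt_cotSi_le m.+1 t01) Lt_cotSi.
have [M M0 hM] := nc_SS (asum_bec tau0 b).
have l4 m : (Lt t (fun x => SS (bec b) x * (Si m.+1 x)%:C) : C^o) @[t --> (0 : R)^'+] --> (bec b m / 2 : C^o).
  have [_ h] := @LtSS_cvg (fun x => (Si m.+1 x)%:C) (bec b) _ (2 * 1) (fun x _ => @ccont_Si R m.+1 x) rb i2
    (fun t j t01 => Sle t _ 1 j t01 ler01 (fun x _ => @ccont_Si R m.+1 x) (fun x _ => nc_Si m.+1 x)) (@Lt_SiSi m).
  rewrite cseries_delta in h; apply: cvg_eq_near h => t t01; have /andP[t0 t1] := t01.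
  by apply: (Lt_ext t0 t1) => x _; rewrite mulrC.
have M2 : 0 <= 2 * M by rewrite mulr_ge0.
have cB x := @ccont_SS (bec b) x (asum_bec tau0 b).
have [s4 h4] := @LtSS_cvg (SS (bec b)) (sgc a) _ (2 * M) (fun x _ => cB x) rs M2
  (fun t m t01 => Sle t _ M m t01 M0 (fun x _ => cB x) (fun x _ => hM x)) l4.
have hh := cvgCD FF0 (cvgCD FF0 (cZ ((b == 1%N)%:R * A0 a) hk) (cvgCD FF0 (cZ (A0 a) h2)
   (cvgCD FF0 (cZ (b == 1%N)%:R h3) h4))) (cZ (2 * (b == 1%N)%:R) (@lSsg_cvg a)).
suff e : A0 a * cseries (fun m => bec b m * - ((2 * pi * m.+1%:R : R)%:C)^-1) +
    ((b == 1%N)%:R * cseries (fun m => sgc a m * pi%:C) + cseries (fun m => sgc a m * (bec b m / 2)))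
    = cseries (mixed_term a b).
  rewrite mulr0 addr0 e in hh; apply: cvg_eq_near hh => t t01; symmetry; exact: At_mixed.
rewrite -(cseriesZ _ s2) -(cseriesZ _ s3) -(cseriesD (asumZ _ s3) s4).
rewrite -(cseriesD (asumZ _ s2) (asumD (asumZ _ s3) s4)).
apply: cseries_ext => m; rewrite /sgc /mixed_term alcE /A0.
case: b ob {rb s2 h2 h3 s3 M hM l4 s4 h4 hh M0 M2 cB} => // b ob; rewrite becE addnS exprD /=.
have p1 : (2 * pi : R)%:C != 0 by rewrite -nc_gt0 nc_real normr_gt0 mulf_neq0 // gt_eqF.
have m0 : m.+1%:R != 0 :> C by rewrite pnatr_eq0.
have -> : (2 * pi * m.+1%:R : R)%:C = (2 * pi)%:C * m.+1%:R.
  by rewrite realCM; congr (_ * _); exact: (rmorph_nat (real_complex R)).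
have -> : pi%:C = (2 * pi)%:C / 2 :> C by rewrite [in RHS]realCM realC2 mulrAC divff ?mul1r // pnatr_eq0.
have f1 (p n B x la lb : C) : p != 0 -> n != 0 -> x * B * (2 * p * 1 * lb * - (p * n)^-1) +
  (1 * (- 2 * x * la / (p * n) * (p / 2)) + - 2 * x * la / (p * n) * (2 * p * 1 * lb / 2)) =
  - 2 * (x * 1) / n * (B * lb + la * lb - - 2^-1 * la) by move=> p0' n0; field; rewrite p0' n0.
have f2 (p n B x la lb y : C) : p != 0 -> n != 0 -> x * B * (2 * p * y * lb * - (p * n)^-1) +
  (0 * (- 2 * x * la / (p * n) * (p / 2)) + - 2 * x * la / (p * n) * (2 * p * y * lb / 2)) =
  - 2 * (x * y) / n * (B * lb + la * lb - 0 * la) by move=> p0' n0; field; rewrite p0' n0.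
(* Here [b] is the predecessor of the index. Index 1 has b_1 = -1/2, which absorbs the cotangent
   term; for larger odd indices both vanish, so one formula covers all cases. *)
have [->|nb] := eqVneq b 0%N.
  have -> : ratr (bern 1) = - 2^-1 :> C by rewrite bern1 rmorphN /= fmorphV rmorph_nat.
  by rewrite expr0 eqxx; exact: f1.
have -> : bern b.+1 = 0.
  case: b ob nb => [|[|b]] // /= ob _; rewrite -(odd_double_half b); rewrite negbK in ob; rewrite (negPf ob).
  exact: (bern_odd R).
have -> : ratr 0 = 0 :> C by exact: (rmorph0 (@ratr C)).
by rewrite eqSS (negPf nb); exact: f2.
Qed.

Lemma At_antisym (t : R) a b : ~~ odd a -> odd b -> 0 < t < 2^-1 ->
  Aseries_t tau t [:: b; a] = - Aseries_t tau t [:: a; b].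
Proof.
move=> ea ob t01; have /andP[t0 t1] := t01.
rewrite !Aseries2 !(Jseries1E tau0 _ t01) !(Jseries2E tau0 _ _ t01).
have sh := shuffle2 t0 t1 (@ccont_Fk R tau tau0 a) (@ccont_Fk R tau tau0 b).
rewrite (LtF_odd ob t01) mulr0 in sh; rewrite (LtF_odd ob t01) !mulr0.
have -> : Lt2 t (Fk b) (Fk a) = - Lt2 t (Fk a) (Fk b) by apply/eqP; rewrite -addr_eq0 addrC sh.
by move: (Lt2 _ _ _) (_ * Lt _ _) => *; ring.
Qed.
End Limits.

Section EllipticZeta.
Context {R : realType}.
Local Notation C := R[i].
Let FF0 : ProperFilter ((0 : R)^'+). Proof. by typeclasses eauto. Qed.

Lemma IA0E (tau : UHP R) : IA [::] tau = 1.
Proof.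
rewrite /IA; apply: (@limC R _ _ FF0); apply: (@cvg_eq_near R (fun=> 1)); last exact: (@cvgC_cst R R _ FF0 1).
move=> t t01; rewrite /Aseries_t /ncmul /= !big_ord_recl !big_ord0 /= /ncexp1 /Jseries /iterated_int /=.
by rewrite !expr0 !addr0 !divr1 !mulr1.
Qed.

Lemma IA1E (tau : UHP R) k : IA [:: k] tau = A1v k.
Proof. by apply: (@limC R _ _ FF0); exact: (A1_cvg (valP tau)). Qed.

Lemma IA2_parity (tau : UHP R) m n : odd m = odd n -> IA [:: m; n] tau = 2^-1 * (A1v m * A1v n).
Proof. by move=> e; apply: (@limC R _ _ FF0); exact: (A2_parity_cvg (valP tau) e). Qed.

Lemma IA2_mixed : exists kappa : C, forall (tau : UHP R) a b, ~~ odd a -> odd b ->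
  IA [:: a; b] tau = (b == 1%N)%:R * A0 a * kappa + cseries (mixed_term (val tau) a b) /\
  IA [:: b; a] tau = - IA [:: a; b] tau.
Proof.
have [kappa hk] := @kappa_cvg R; exists kappa => tau a b ea ob.
have h := A2_mixed_cvg (valP tau) ea ob hk.
have e1 : IA [:: a; b] tau = (b == 1%N)%:R * A0 a * kappa + cseries (mixed_term (val tau) a b).
  exact: (@limC R _ _ FF0 _ _ h).
split=> //; rewrite e1; apply: (@limC R _ _ FF0).
by apply: cvg_eq_near (cvgCN FF0 h) => t t01; rewrite (At_antisym (valP tau) ea ob t01).
Qed.
End EllipticZeta.
End RegularizedValues.
Import RegularizedValues.

(** * Reduction to the series E_k and their independence *)

Module ModularExpansion.
Lemma qtau_surj (R : realType) (r : R) : 0 < r < 1 -> exists tau : UHP R, qtau (val tau) = r%:C.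
Proof.
move=> /andP[r0 r1]; have p0 := pi_gt0 R; have p2 : 0 < 2 * pi :> R by rewrite mulr_gt0.
have y0 : 0 < complex.Im (0 +i* (- ln r / (2 * pi)) : R[i]).
  by rewrite /= divr_gt0 // oppr_gt0 ln_lt0 // r0.
exists (exist (fun z : R[i] => is_true (0 < complex.Im z)) _ y0); rewrite /qtau /=.
have -> : two_pi_i R * (0 +i* (- ln r / (2 * pi))) = ln r +i* 0.
  have e : 2 * pi * (- ln r / (2 * pi)) = - ln r by rewrite mulrC divfK // gt_eqF.
  apply: complex_ext; rewrite ?ReM ?ImM /two_pi_i /=.
    by rewrite e mul0r sub0r opprK.
  by rewrite mul0r mulr0 addr0.
by rewrite /cexp /= cos0 sin0 mulr1 mulr0 lnK.
Qed.

#[local] Opaque cseries cexp two_pi_i lam bern qtau IA.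

Section Expansion.
Context {R : realType}.
Local Notation C := R[i].
Local Notation X := (two_pi_i R).

Lemma lamE k (Q : C) : lam k Q = cseries (fun n => n.+1%:R ^+ k * Q ^+ n.+1 / k`!%:R).
Proof. by []. Qed.

(** Cauchy product with indices shifted by one: the coefficient of Q is 0 and the term i = 0 of
    [convW] vanishes because a > 0. *)
Lemma lam_conv a b (Q : C) : nc Q < 1 -> (0 < a)%N ->
  lam a Q * lam b Q = cseries (fun n => ratr (convW a.+1 b.+1 n.+1) * Q ^+ n.+1) /\
  asum (fun n => ratr (convW a.+1 b.+1 n.+1) * Q ^+ n.+1).
Proof.
move=> Q1 a0; have [ac ec] := cauchy_product (asum_lam a Q1) (asum_lam b Q1).
have z0 : ratr (convW a.+1 b.+1 1) * Q ^+ 1 = 0.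
  by rewrite /convW big_ord_recl big_ord0 expr0n gtn_eqF // !mul0r addr0 rmorph0 mul0r.
have zS n : ratr (convW a.+1 b.+1 n.+2) * Q ^+ n.+2 =
    \sum_(i < n.+1) i.+1%:R ^+ a * Q ^+ i.+1 / a`!%:R * ((n - i).+1%:R ^+ b * Q ^+ (n - i).+1 / b`!%:R).
  rewrite /convW big_ord_recl expr0n gtn_eqF // !mul0r add0r rmorph_sum mulr_suml.
  apply: eq_bigr => i _; rewrite lift0 subSS /=; have hi : (i <= n)%N by rewrite -ltnS.
  rewrite (_ : (n.+1 - i)%N = (n - i).+1); last by rewrite subSn.
  rewrite (_ : n.+2 = (i.+1 + (n - i).+1)%N); last by lia.
  rewrite natrM invfM exprD !rmorphM !fmorphV /= !rmorphXn /= !rmorph_nat.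
  have rr (A B Fa Fb q1 q2 : C) : A * B * (Fa * Fb) * (q1 * q2) = A * q1 * Fa * (B * q2 * Fb) by ring.
  exact: rr.
have aS : asum (fun n => ratr (convW a.+1 b.+1 n.+1) * Q ^+ n.+1).
  by apply: rsum_unshift; apply: rsum_le ac => n; rewrite zS.
split=> //; rewrite (cseries_shift aS) z0 add0r !lamE ec.
by apply: cseries_ext => n; rewrite zS.
Qed.

Lemma ratr_bernM (x y : rat) (f s k : nat) (Q : C) :
  ratr (x / f%:R * y * s%:R ^+ k) * Q = ratr (x * y) * (s%:R ^+ k * Q / f%:R).
Proof.
rewrite !rmorphM /= fmorphV /= rmorphXn /= !rmorph_nat.
by move: (ratr x) (ratr y) (f%:R^-1) (s%:R ^+ k) => *; ring.
Qed.

Lemma ratr_term (x : rat) (f s k : nat) (Q : C) :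
  ratr (x * s%:R ^+ k / f%:R) * Q = ratr x * (s%:R ^+ k * Q / f%:R).
Proof.
rewrite !rmorphM /= fmorphV /= rmorphXn /= !rmorph_nat.
by move: (ratr x) (f%:R^-1) (s%:R ^+ k) => *; ring.
Qed.

Lemma lam_mixed N a b (Q : C) : nc Q < 1 -> odd N -> ~~ odd a -> (a + b = N)%N ->
  ratr (bern a) * lamS b Q + lamS a Q * lamS b Q - ratr (bern b) * lamS a Q =
  - \sum_(j < N.+1./2) ratr (bern (N - 1 - j.*2) * tvec N j.*2 a) * lam j.*2 Q.
Proof.
move=> Q1 oN ea e; have ob : odd b by move: oN; rewrite -e oddD (negPf ea).
have aL k := @asum_lam R k Q Q1.
have [eS aS] := @cseries_sum R _ (index_enum 'I_(N.+1./2)) (fun (j : 'I_(N.+1./2)) n =>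
   ratr (bern (N - 1 - j.*2) * tvec N j.*2 a) * (n.+1%:R ^+ j.*2 * Q ^+ n.+1 / j.*2`!%:R))
   (fun j => asumZ _ (aL j.*2)).
have -> : \sum_(j < N.+1./2) ratr (bern (N - 1 - j.*2) * tvec N j.*2 a) * lam j.*2 Q =
    - cseries (fun n => ratr (Wab a b n.+1) * Q ^+ n.+1).
  transitivity (cseries (fun n => \sum_(j < N.+1./2)
     ratr (bern (N - 1 - j.*2) * tvec N j.*2 a) * (n.+1%:R ^+ j.*2 * Q ^+ n.+1 / j.*2`!%:R))).
    by rewrite eS; apply: eq_bigr => j _; rewrite lamE (cseriesZ _ (aL j.*2)).
  rewrite -[LHS]opprK -(cseriesN aS); congr (- _); apply: cseries_ext => n.
  rewrite (WabE R n.+1 oN ea e) rmorphN rmorph_sum mulNr mulr_suml; congr (- _).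
  by apply: eq_bigr => j _; rewrite ratr_bernM.
rewrite opprK; case: b ob e {eS aS} => // b ob e /=.
case: a ea e => [|a] ea e /=.
  rewrite mul0r mulr0 subr0 addr0 lamE -(cseriesZ _ (aL b)); apply: cseries_ext => n.
  by rewrite /Wab /convW /= addr0 subr0 ratr_term.
have a0 : (0 < a)%N by case: a ea {e}.
have [ec ac] := lam_conv b Q1 a0.
rewrite ec !lamE -(cseriesZ _ (aL b)) -(cseriesZ _ (aL a)) -(cseriesD (asumZ _ (aL b)) ac).
rewrite -(cseriesB (asumD (asumZ _ (aL b)) ac) (asumZ _ (aL a))); apply: cseries_ext => n.
by rewrite -!ratr_term -mulrDl -mulrBl -rmorphD -rmorphB.
Qed.

(** E_k of the overview divided by k!, the factorial being part of [lam]. *)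
Definition Ecal (k : nat) (tau : UHP R) : C :=
  cseries (fun m => m.+1%:R^-1 * lam k (qtau (val tau) ^+ m.+1)).

Lemma nc_natV m : nc (m.+1%:R^-1 : C) <= 1.
Proof. by rewrite ncV nc_nat invf_le1 ?ltr0n // ler1n. Qed.

Lemma asum_Ecal k (tau : UHP R) : asum (fun m => m.+1%:R^-1 * lam k (qtau (val tau) ^+ m.+1)).
Proof.
have [K K0 hK] := lam_geo (valP tau) k; apply: asum_le (rsum_geo0 (valP tau) K0) => m.
rewrite ncM; apply: le_trans (hK m); rewrite ler_piMl ?nc_ge0 //; exact: nc_natV.
Qed.

Lemma nc_qX1 (tau : UHP R) m : nc (qtau (val tau) ^+ m.+1) < 1.
Proof. by apply: le_lt_trans (nc_qX (qtau_lt1 (valP tau)) m) (qtau_lt1 (valP tau)). Qed.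

(** The vector of index k = 0 is supported, among even a, on b = N-a = 1: exactly where [kappa]
    occurs. Hence [kappa] can be attached to E_0. *)
Lemma tvec0 N a : odd N -> ~~ odd a -> (a <= N)%N -> tvec N 0 a = - ((N - a)%N == 1%N)%:R.
Proof.
move=> oN ea aN; rewrite /tvec; case: eqP => [N1|N1].
  have eN : N = 1%N by move: oN; lia.
  have -> : a = 0%N by move: ea aN; lia.
  by rewrite eN expr1.
have -> : fpoly N 0 = 1 - 'X^(N - 2) by rewrite /fpoly expr0 subn0 mul1r opprD addrACA subrr addr0.
rewrite mulrBr mulr1 -exprS coefB coefX coefXn.
have -> : (a == 1%N) = false by move: ea; lia.
by rewrite sub0r; congr (- _%:R); congr nat_of_bool; move: oN ea aN N1; lia.
Qed.

Lemma mixed_series N a b (tau : UHP R) : odd N -> ~~ odd a -> (a + b = N)%N ->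
  cseries (mixed_term (val tau) a b) =
  \sum_(j < N.+1./2) 2 * X ^+ N.-1 * ratr (bern (N - 1 - j.*2) * tvec N j.*2 a) * Ecal j.*2 tau.
Proof.
move=> oN ea e.
have [eS aS] := @cseries_sum R _ (index_enum 'I_(N.+1./2)) (fun (j : 'I_(N.+1./2)) m =>
   2 * X ^+ N.-1 * ratr (bern (N - 1 - j.*2) * tvec N j.*2 a) * (m.+1%:R^-1 * lam j.*2 (qtau (val tau) ^+ m.+1)))
   (fun j => asumZ _ (asum_Ecal j.*2 tau)).
transitivity (\sum_(j < N.+1./2) cseries (fun m => 2 * X ^+ N.-1 * ratr (bern (N - 1 - j.*2) * tvec N j.*2 a) *
   (m.+1%:R^-1 * lam j.*2 (qtau (val tau) ^+ m.+1)))); last first.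
  by apply: eq_bigr => j _; rewrite (cseriesZ _ (asum_Ecal j.*2 tau)).
rewrite -eS; apply: cseries_ext => m; rewrite /mixed_term (lam_mixed (nc_qX1 tau m) oN ea e) e mulrN -mulNr mulr_sumr.
apply: eq_bigr => j _; move: (ratr _) (lam _ _) (X ^+ _) (m.+1%:R^-1) => *; ring.
Qed.

Lemma IA2_odd : exists kappa : C, forall N m (tau : UHP R), odd N -> (m <= N)%N ->
  IA [:: m; (N - m)%N] tau = \sum_(j < N.+1./2) 2 * X ^+ N.-1 * ratr (bern (N - 1 - j.*2) * tvec N j.*2 m) *
     (Ecal j.*2 tau + (j == 0%N :> nat)%:R * kappa).
Proof.
(* The factor -1/2 undoes the prefactor 2 and the value -1 from [tvec0]. *)
have [k0 hk] := @IA2_mixed R; exists (- k0 / 2) => N m tau oN mN.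
have ev a : ~~ odd a -> (a <= N)%N -> IA [:: a; (N - a)%N] tau =
   \sum_(j < N.+1./2) 2 * X ^+ N.-1 * ratr (bern (N - 1 - j.*2) * tvec N j.*2 a) *
     (Ecal j.*2 tau + (j == 0%N :> nat)%:R * (- k0 / 2)).
  move=> ea aN; have ob : odd (N - a) by rewrite oddB // oN (negPf ea).
  have eN : (a + (N - a) = N)%N by rewrite subnKC.
  rewrite (hk tau a _ ea ob).1 (mixed_series _ oN ea eN) addrC.
  under [RHS]eq_bigr do rewrite mulrDr.
  rewrite big_split /=; congr (_ + _).
  have n0 : uphalf N = N./2.+1 by rewrite uphalf_half oN.
  rewrite n0 big_ord_recl big1 ?addr0 => [|i _]; last by rewrite mul0r mulr0.
  rewrite /= subn0 tvec0 // mul1r; case: eqP => [b1|_]; last by rewrite !mul0r oppr0 mulr0 rmorph0 mulr0 mul0r.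
  have -> : (N - 1)%N = a by lia.
  have -> : N.-1 = a by lia.
  rewrite /A0 mulrN rmorphN mulr1; have fr (u v : C) : 1 * (v * u) * k0 = 2 * v * (- u) * (- k0 / 2) by field.
  exact: fr.
have [om|em] := boolP (odd m); last exact: ev.
have eb : ~~ odd (N - m) by rewrite oddB // oN om.
have := (hk tau (N - m)%N m eb om).2; have := ev _ eb (leq_subr _ _); rewrite subKn // => -> ->.
rewrite -sumrN; apply: eq_bigr => j _; rewrite tvec_antisym ?odd_double //.
  by rewrite [_ * - tvec _ _ _]mulrN rmorphN /= [_ * - ratr _]mulrN mulNr opprK.
by have := ltn_ord j; move: oN; lia.
Qed.

Lemma geo_half (r : R) n : 0 <= r <= 2^-1 -> \sum_(i < n) r ^+ i <= 2.
Proof.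
move=> /andP[r0 r1]; elim: n => [|n IH]; first by rewrite big_ord0.
rewrite big_ord_recl expr0; under eq_bigr do rewrite exprS.
rewrite -mulr_sumr; have : r * \sum_(i < n) r ^+ i <= 2^-1 * 2.
  by apply: ler_pM => //; apply: sumr_ge0 => i _; exact: exprn_ge0.
lra.
Qed.

Lemma linear_small (x K : R) : (forall r, 0 < r <= 2^-1 -> x <= K * r) -> x <= 0.
Proof.
move=> h; rewrite leNgt; apply/negP => x0.
pose k : R := `|K| + 1; have k0 : 0 < k by rewrite ltr_wpDl.
pose r : R := Num.min 2^-1 (x / (2 * k)).
have r0 : 0 < r by rewrite lt_min invr_gt0 ltr0n /= divr_gt0 // mulr_gt0.
have r1 : r <= 2^-1 by rewrite ge_min lexx.
have r2 : r <= x / (2 * k) by rewrite ge_min lexx orbT.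
have h1 : x <= K * r by apply: h; rewrite r0.
have h2 : K * r <= k * r by rewrite ler_pM2r // /k; have := ler_norm K; lra.
have h3 : k * r <= k * (x / (2 * k)) by rewrite ler_pM2l.
have h4 : k * (x / (2 * k)) = x / 2 by field; rewrite gt_eqF.
by move: h1 h2 h3; rewrite h4; lra.
Qed.

Lemma rsum_sum (I : Type) (s : seq I) (u : I -> nat -> R) :
  (forall i, rsum (u i)) -> rsum (fun n => \sum_(i <- s) u i n).
Proof.
move=> h; elim: s => [|i s IH].
  by exists 0 => n; rewrite big1 // => i _; rewrite big_nil.
by apply: rsum_le (rsumD (h i) IH) => n; rewrite big_cons.
Qed.

Section Independence.
Variables (n : nat) (P : 'I_n -> C) (c : C).
Hypothesis hc : forall tau, \sum_(j < n) P j * Ecal j.*2 tau = c.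

Let p (s : nat) : C := \sum_(j < n) P j * (s%:R ^+ j.*2 / j.*2`!%:R).
Let g (Q : C) : C := \sum_(j < n) P j * lam j.*2 Q.

Let gE (Q : C) : nc Q < 1 -> g Q = cseries (fun n => p n.+1 * Q ^+ n.+1) /\ asum (fun n => p n.+1 * Q ^+ n.+1).
Proof.
move=> Q1; have [eS aS] := @cseries_sum R _ (index_enum 'I_n) (fun (j : 'I_n) m =>
   P j * (m.+1%:R ^+ j.*2 * Q ^+ m.+1 / j.*2`!%:R)) (fun j => asumZ _ (@asum_lam R j.*2 Q Q1)).
have e : (fun m => \sum_(j < n) P j * (m.+1%:R ^+ j.*2 * Q ^+ m.+1 / j.*2`!%:R)) =
   (fun m => p m.+1 * Q ^+ m.+1).
  apply/funext => m; rewrite /p mulr_suml; apply: eq_bigr => j _.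
  by rewrite mulrAC !mulrA.
split; last by rewrite -e.
by rewrite -e eS; apply: eq_bigr => j _; rewrite lamE (cseriesZ _ (@asum_lam R j.*2 Q Q1)).
Qed.

Let FE (tau : UHP R) : cseries (fun m => m.+1%:R^-1 * g (qtau (val tau) ^+ m.+1)) = c.
Proof.
rewrite -(hc tau).
have [eS aS] := @cseries_sum R _ (index_enum 'I_n) (fun (j : 'I_n) m =>
   P j * (m.+1%:R^-1 * lam j.*2 (qtau (val tau) ^+ m.+1))) (fun j => asumZ _ (asum_Ecal j.*2 tau)).
transitivity (\sum_(j < n) cseries (fun m => P j * (m.+1%:R^-1 * lam j.*2 (qtau (val tau) ^+ m.+1)))); last first.
  by apply: eq_bigr => j _; rewrite (cseriesZ _ (asum_Ecal j.*2 tau)).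
rewrite -eS; apply: cseries_ext => m; rewrite /g mulr_sumr; apply: eq_bigr => j _; exact: mulrCA.
Qed.

Let p_sum : rsum (fun s => nc (p s) * 2^-1 ^+ s).
Proof.
have ha : 0 <= 2^-1 :> R by lra.
have hb : 2^-1 < 1 :> R by lra.
apply: rsum_le (_ : rsum (fun s => \sum_(j < n) nc (P j) * (s%:R ^+ j.*2 * 2^-1 ^+ s))).
  move=> s; apply: le_trans (_ : (\sum_(j < n) nc (P j) * s%:R ^+ j.*2) * 2^-1 ^+ s <= _); last first.
    by rewrite mulr_suml; apply: ler_sum => j _; rewrite mulrA.
  apply: ler_wpM2r; first by rewrite exprn_ge0 // invr_ge0.
  apply: le_trans (nc_sum _ _ _) _; apply: ler_sum => j _; rewrite ncM nc_div ncX !nc_nat.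
  apply: ler_wpM2l; first exact: nc_ge0.
  by rewrite ler_piMr ?exprn_ge0 // invf_le1 ?ltr0n ?fact_gt0 // ler1n fact_gt0.
by apply: rsum_sum => j; apply: rsumZ; [exact: nc_ge0|apply: rsum_polygeo; rewrite ha hb].
Qed.

(** If the first s coefficients vanish, g(Q) equals its leading term up to O(Q^(s+2)), uniformly for
    |Q| <= 1/2. *)
Let g_tail s : (forall i, (i < s)%N -> p i.+1 = 0) -> exists2 K : R, 0 <= K & forall Q, nc Q <= 2^-1 ->
  nc (g Q) <= K * nc Q ^+ s.+1 /\ nc (g Q - p s.+1 * Q ^+ s.+1) <= K * nc Q ^+ s.+2.
Proof.
move=> hs; have [M hM] := p_sum.
have pos (i : nat) : 0 <= nc (p i) * 2^-1 ^+ i by rewrite mulr_ge0 ?nc_ge0 // exprn_ge0 // invr_ge0.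
pose K1 : R := 2 ^+ s.+2 * M.
have M0 : 0 <= M by have := hM 0%N; rewrite big_ord0.
have K10 : 0 <= K1 by rewrite mulr_ge0 // exprn_ge0.
exists (nc (p s.+1) + K1); first by rewrite addr_ge0 ?nc_ge0.
move=> Q Q1; have Q1' : nc Q < 1 by lra.
have Q0 := nc_ge0 Q.
have [eg ag] := gE Q1'.
have tl : nc (g Q - p s.+1 * Q ^+ s.+1) <= K1 * nc Q ^+ s.+2.
  have -> : p s.+1 * Q ^+ s.+1 = \sum_(i < s.+1) p i.+1 * Q ^+ i.+1.
    by rewrite big_ord_recr /= big1 ?add0r // => i _; rewrite hs ?mul0r.
  rewrite eg; apply: (@cseries_tail R _ (fun i => nc (p i.+1 * Q ^+ i.+1))) => // m.
  apply: le_trans (_ : \sum_(i < m) (2 ^+ s.+2 * nc Q ^+ s.+2) * (nc (p (s.+2 + i)%N) * 2^-1 ^+ (s.+2 + i)) <= _).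
    apply: ler_sum => i _; rewrite ncM ncX -addSn.
    have -> : 2 ^+ s.+2 * nc Q ^+ s.+2 * (nc (p (s.+2 + i)%N) * 2^-1 ^+ (s.+2 + i)) =
       nc (p (s.+2 + i)%N) * (nc Q ^+ s.+2 * 2^-1 ^+ i).
      have a0 : (2 : R) ^+ s.+2 != 0 by rewrite expf_neq0.
      rewrite exprD (_ : 2^-1 ^+ s.+2 = (2 ^+ s.+2)^-1); last by rewrite exprVn.
      have ff (x y z w : R) : x != 0 -> x * y * (z * (x^-1 * w)) = z * (y * w) by move=> x0; field.
      exact: ff.
    rewrite exprD; apply: ler_wpM2l; first exact: nc_ge0.
    apply: ler_wpM2l; first exact: exprn_ge0.
    by rewrite lerXn2r // nnegrE // invr_ge0.
  rewrite -mulr_sumr mulrAC /K1; apply: ler_wpM2r; first exact: exprn_ge0.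
  apply: ler_wpM2l; first exact: exprn_ge0.
  apply: le_trans (hM (s.+2 + m)%N); rewrite big_split_ord /= lerDr; apply: sumr_ge0 => i _; exact: pos.
split; last by apply: le_trans tl _; apply: ler_wpM2r; [exact: exprn_ge0|rewrite lerDr nc_ge0].
have -> : g Q = p s.+1 * Q ^+ s.+1 + (g Q - p s.+1 * Q ^+ s.+1) by rewrite addrC subrK.
apply: le_trans (ncD _ _) _; rewrite mulrDl; apply: lerD; first by rewrite ncM ncX.
apply: le_trans tl _; apply: ler_wpM2l => //; rewrite exprS ler_piMl ?exprn_ge0 //; lra.
Qed.

Let term_le (tau : UHP R) (r : R) s K m : 0 < r <= 2^-1 -> qtau (val tau) = r%:C -> 0 <= K ->
  (forall Q, nc Q <= 2^-1 -> nc (g Q) <= K * nc Q ^+ s.+1) ->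
  nc (m.+1%:R^-1 * g (qtau (val tau) ^+ m.+1)) <= K * r ^+ s.+1 * r ^+ m.
Proof.
move=> /andP[r0 r1] eq K0 hg; have nq : nc (qtau (val tau) ^+ m.+1) = r ^+ m.+1.
  by rewrite eq ncX nc_real gtr0_norm.
have r1' : r <= 1 by lra.
rewrite ncM; apply: le_trans (_ : 1 * (K * (r ^+ m.+1) ^+ s.+1) <= _).
  apply: ler_pM; rewrite ?nc_ge0 //; first exact: nc_natV.
  rewrite -nq; apply: hg; rewrite nq exprS; apply: le_trans r1.
  by rewrite ler_piMr ?(ltW r0) // exprn_ile1 // ltW.
rewrite mul1r -mulrA -exprD -exprM; apply: ler_wpM2l => //.
by apply: ler_wiXn2l => //; [exact: ltW|nia].
Qed.

(** Let q tend to 0 along the reals: every q-series is O(q), so the constant must vanish. *)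
Let c0 : c = 0.
Proof.
have [K K0 hK] := @g_tail 0 (fun i (h : (i < 0)%N) => match (notF h) with end).
apply/eqP; rewrite -nc_eq0; apply/eqP/le_anti; rewrite nc_ge0 andbT.
apply: (@linear_small _ (2 * K)) => r r01; have /andP[r0 r1] := r01.
have [tau et] : exists tau : UHP R, qtau (val tau) = r%:C by apply: qtau_surj; rewrite r0 /=; lra.
rewrite -(FE tau); apply: nc_cseries_le => k.
apply: le_trans (_ : \sum_(m < k) K * r ^+ 1 * r ^+ m <= _).
  by apply: ler_sum => m _; apply: (term_le _ r01 et K0) => Q /hK[].
rewrite -mulr_sumr (_ : 2 * K * r = K * r ^+ 1 * 2); last by ring.
apply: ler_wpM2l; first by rewrite mulr_ge0 // ltW.
by apply: geo_half; rewrite ltW.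
Qed.

(** The lowest surviving power of q arises only from the summand m = 1, since the others involve
    g(q^m) with m >= 2. *)
Let p0 s : p s.+1 = 0.
Proof.
elim/ltn_ind: s => s IH; have [K K0 hK] := g_tail IH.
apply/eqP; rewrite -nc_eq0; apply/eqP/le_anti; rewrite nc_ge0 andbT.
apply: (@linear_small _ (3 * K)) => r r01; have /andP[r0 r1] := r01.
have [tau et] : exists tau : UHP R, qtau (val tau) = r%:C by apply: qtau_surj; rewrite r0 /=; lra.
have r00 := ltW r0.
have tb m : nc (m.+1%:R^-1 * g (qtau (val tau) ^+ m.+1)) <= K * r ^+ s.+1 * r ^+ m.
  by apply: (term_le _ r01 et K0) => Q /hK[].
have tl : nc (cseries (fun m => m.+1%:R^-1 * g (qtau (val tau) ^+ m.+1)) -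
    \sum_(m < 1) m.+1%:R^-1 * g (qtau (val tau) ^+ m.+1)) <= 2 * K * r ^+ s.+2.
  apply: (@cseries_tail R _ _ _ _ tb).
    by apply: rsumZ; [rewrite mulr_ge0 // exprn_ge0|apply: rsum_geo; rewrite r00 /=; lra].
  move=> m; rewrite -mulr_sumr.
  have -> : \sum_(i < m) r ^+ (1 + i) = r * \sum_(i < m) r ^+ i by rewrite mulr_sumr; apply: eq_bigr => i _; rewrite exprS.
  have -> : 2 * K * r ^+ s.+2 = K * r ^+ s.+1 * r * 2 by rewrite [r ^+ s.+2]exprSr; ring.
  rewrite mulrA; apply: ler_wpM2l; last by apply: geo_half; rewrite r00.
  by rewrite !mulr_ge0 ?exprn_ge0.
rewrite FE c0 sub0r ncN big_ord1 invr1 mul1r expr1 in tl.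
have nq : nc (qtau (val tau)) = r by rewrite et nc_real gtr0_norm.
have := (hK (qtau (val tau)) _).2; rewrite nq => /(_ r1) h2.
have h3 : nc (p s.+1) * r ^+ s.+1 <= 3 * K * r * r ^+ s.+1.
  have -> : nc (p s.+1) * r ^+ s.+1 = nc (p s.+1 * qtau (val tau) ^+ s.+1) by rewrite ncM ncX nq.
  have -> : p s.+1 * qtau (val tau) ^+ s.+1 = g (qtau (val tau)) - (g (qtau (val tau)) - p s.+1 * qtau (val tau) ^+ s.+1).
    by rewrite opprB addrC subrK.
  apply: le_trans (ncB _ _) _; move: tl h2; rewrite [r ^+ s.+2]exprS; lra.
by rewrite ler_pM2r ?exprn_gt0 // in h3.
Qed.

(** The q-expansion forces the sum of P_j s^(2j) / (2j)! to vanish at every positive integer s, so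
    this polynomial in s is zero. *)
Lemma Ecal_independent j : P j = 0.
Proof.
pose pp : {poly C} := \sum_(j < n) (P j / j.*2`!%:R) *: 'X^(j.*2).
have hp s : pp.[s.+1%:R] = 0.
  rewrite horner_sum -[RHS](p0 s); apply: eq_bigr => i _; rewrite hornerZ hornerXn.
  by rewrite mulrAC -mulrA.
have pp0 : pp = 0.
  apply/eqP; apply/negP => /negP ppn.
  pose rs := [seq s.+1%:R : C | s <- iota 0 (size pp)].
  have := @max_poly_roots C pp rs ppn; rewrite size_map size_iota ltnn => h.
  suff : false by []. apply: h.
    by apply/allP => x /mapP[s _ ->]; rewrite rootE hp.
  rewrite map_inj_uniq ?iota_uniq // => s1 s2 /eqP; rewrite eqr_nat eqSS => /eqP //.
have : pp`_(j.*2) = 0 by rewrite pp0 coef0.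
rewrite coef_sum (bigD1 j) //= coefZ coefXn eqxx mulr1 big1 ?addr0 => [/eqP|i ij].
  by rewrite mulf_eq0 invr_eq0 pnatr_eq0 gtn_eqF ?fact_gt0 // orbF => /eqP.
rewrite coefZ coefXn (_ : (j.*2 == i.*2) = false) ?mulr0 //.
by apply: contraNF ij => /eqP/double_inj e; exact/eqP/val_inj.
Qed.
End Independence.

Lemma two_pi_i_free M (c : nat -> rat) : \sum_(i < M) ratr (c i) * X ^+ i = 0 -> forall i, (i < M)%N -> c i = 0.
Proof.
move=> h i iM; pose P := \poly_(i < M) c i.
have [Q [a a0 e]] := rat_poly_scale P.
have aQ : (a%:~R : rat) != 0 by rewrite intr_eq0.
have eQ : map_poly intr Q = a%:~R *: P :> {poly rat} by rewrite e scalerA divff // scale1r.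
have z : (map_poly intr Q).[X] = 0 :> C.
  have -> : map_poly intr Q = map_poly ratr (map_poly intr Q : {poly rat}) :> {poly C}.
    rewrite -map_poly_comp; apply: eq_map_poly => k /=; by rewrite ratr_int.
  rewrite eQ linearZ /= hornerZ.
  have -> : (map_poly ratr P).[X] = 0 :> C.
    rewrite (@horner_coef_wide _ M) => [|]; last by rewrite size_map_poly size_poly.
    rewrite -[RHS]h; apply: eq_bigr => k _; by rewrite coef_map coef_poly ltn_ord.
  by rewrite mulr0.
have Q0 : Q = 0 by apply/eqP; apply/negP => /negP/(two_pi_i_transcendental R)/eqP; rewrite z.
have : P`_i = 0 by rewrite e Q0 rmorph0 scaler0 coef0.
by rewrite coef_poly iM.
Qed.
End Expansion.
End ModularExpansion.
Import ModularExpansion.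

#[local] Opaque cseries cexp two_pi_i lam bern qtau IA Ecal.

(** * Dimension of the graded pieces and generation of all relations *)

Section Assembly.
Context {R : realType}.
Local Notation C := R[i].
Local Notation X := (two_pi_i R).

Definition yco N (v : nat -> rat) (j : nat) : rat := \sum_(i < N.+1) v i * tvec N j.*2 i.

Definition wsum N (v : nat -> rat) (tau : UHP R) : C :=
  \sum_(i < N.+1) ratr (v i) * IA [:: i : nat; (N - i)%N] tau.

Definition wcoef N (v : nat -> rat) (j : nat) : C :=
  2 * X ^+ N.-1 * ratr (bern (N - 1 - j.*2) * yco N v j).

Lemma wsum_odd : exists kappa : C, forall N v (tau : UHP R), odd N ->
  wsum N v tau = \sum_(j < N.+1./2) wcoef N v j * (Ecal j.*2 tau + (j == 0%N :> nat)%:R * kappa).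
Proof.
have [k hk] := @IA2_odd R; exists k => N v tau oN; rewrite /wsum /wcoef /yco.
transitivity (\sum_(i < N.+1) \sum_(j < N.+1./2) ratr (v i) * (2 * X ^+ N.-1 *
    ratr (bern (N - 1 - j.*2) * tvec N j.*2 i) * (Ecal j.*2 tau + (j == 0%N :> nat)%:R * k))).
  by apply: eq_bigr => i _; rewrite hk // -1?ltnS // mulr_sumr.
rewrite exchange_big; apply: eq_bigr => j _ /=.
rewrite rmorphM rmorph_sum /= !mulr_sumr mulr_suml; apply: eq_bigr => i _; rewrite !rmorphM /=.
by move: (ratr (v i)) (ratr (bern _)) (ratr (tvec _ _ _)) (X ^+ _) (_ + _) => *; ring.
Qed.

Lemma wsum_odd0 N v tau : odd N -> (forall j, (j < N.+1./2)%N -> yco N v j = 0) -> wsum N v tau = 0.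
Proof.
have [k hk] := wsum_odd; move=> oN h; rewrite hk // big1 // => j _.
by rewrite /wcoef h // mulr0 rmorph0 mulr0 mul0r.
Qed.

Lemma wsum_even N v tau : ~~ odd N ->
  wsum N v tau = \sum_(i < N.+1) ratr (v i) * (2^-1 * (A1v i * A1v (N - i))).
Proof.
move=> eN; apply: eq_bigr => i _; rewrite IA2_parity // oddB ?(negPf eN) // -ltnS; exact: ltn_ord.
Qed.

(** The coefficient of each E_(2j) is a combination of the powers X^(N-1) with rational coefficients
    b_(N-1-2j) times [yco]. Transcendence separates the weights, and the Bernoulli factor, of even
    index, is nonzero. *)
Lemma weights_independent M (v : nat -> nat -> rat) :
  (forall tau : UHP R, \sum_(N < M.+1) wsum N (v N) tau = 0) ->
  forall N j, (N <= M)%N -> odd N -> (j < N.+1./2)%N -> yco N (v N) j = 0.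
Proof.
move=> h N0 j0 hN oN hj; have [k hk] := wsum_odd.
pose P (j : 'I_M.+1) : C := \sum_(N < M.+1) if odd N && (j < N.+1./2)%N then wcoef N (v N) j else 0.
(* Everything constant in tau, that is even weights and the [kappa] terms, goes to the right-hand
   side. *)
pose e N : C := if odd N then \sum_(j < N.+1./2) wcoef N (v N) j * ((j == 0%N :> nat)%:R * k)
  else \sum_(i < N.+1) ratr (v N i) * (2^-1 * (A1v i * A1v (N - i))).
have hP : forall tau, \sum_(j < M.+1) P j * Ecal j.*2 tau = - \sum_(N < M.+1) e N.
  move=> tau; apply/eqP; rewrite -addr_eq0 -[X in _ == X](h tau) ; apply/eqP.
  have -> : \sum_(j < M.+1) P j * Ecal j.*2 tau =
     \sum_(N < M.+1) if odd N then \sum_(j < N.+1./2) wcoef N (v N) j * Ecal j.*2 tau else 0.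
    transitivity (\sum_(j < M.+1) \sum_(N < M.+1) (if odd N && (j < N.+1./2)%N then wcoef N (v N) j else 0) * Ecal j.*2 tau).
      by apply: eq_bigr => j _; rewrite mulr_suml.
    rewrite exchange_big; apply: eq_bigr => N _; case: ifP => oN' /=; last by rewrite big1 // => j _; rewrite mul0r.
    rewrite (@big_ord_widen _ _ _ _ M.+1 (fun j => wcoef N (v N) j * Ecal j.*2 tau)); last by have := ltn_ord N; lia.
    by rewrite [RHS]big_mkcond; apply: eq_bigr => j _; case: ifP => _ //; rewrite mul0r.
  rewrite -big_split /=; apply: eq_bigr => N _; rewrite /e; case: ifP => oN'.
    by rewrite hk // -big_split; apply: eq_bigr => j _; rewrite mulrDr.
  by rewrite add0r wsum_even ?oN'.
have jM : (j0 < M.+1)%N by move: hj hN; lia.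
have := Ecal_independent hP (Ordinal jM); rewrite /P /= => z.
(* Multiplying by X/2 turns the prefactor 2 X^(N-1) into X^N, giving a polynomial relation for X
   indexed by the weight. *)
pose co N : rat := if odd N && (j0 < N.+1./2)%N then bern (N - 1 - j0.*2) * yco N (v N) j0 else 0.
have z2 : \sum_(N < M.+1) ratr (co N) * X ^+ N = 0.
  transitivity (X / 2 * \sum_(N < M.+1) if odd N && (j0 < N.+1./2)%N then wcoef N (v N) j0 else 0); last by rewrite z mulr0.
  rewrite mulr_sumr; apply: eq_bigr => -[N hN'] _ /=; rewrite /co.
  case: ifP => [/andP[oN' _]|_]; last by rewrite rmorph0 mul0r mulr0.
  rewrite /wcoef; case: N oN' {hN'} => // N _; rewrite [X ^+ N.+1]exprS /=.
  by move: (ratr _) (X ^+ N) X => u y x; field.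
have := two_pi_i_free z2 (i := N0); rewrite ltnS => /(_ hN); rewrite /co oN hj /= => /eqP.
rewrite mulf_eq0 (negPf (bern_even_neq0 R _)) /=; first by move/eqP.
by rewrite -subnDA oddB ?oddD ?odd_double ?oN //; move: hj oN; lia.
Qed.

Lemma weight_independent N v : odd N -> (forall tau : UHP R, wsum N v tau = 0) ->
  forall j, (j < N.+1./2)%N -> yco N v j = 0.
Proof.
move=> oN h j hj.
have := @weights_independent N (fun N' => if N' == N then v else (fun=> 0)) _ N j (leqnn _) oN hj.
rewrite eqxx; apply=> tau; rewrite big_ord_recr /= eqxx h addr0 big1 // => i _.
by rewrite ltn_eqF ?ltn_ord // /wsum big1 // => k _; rewrite rmorph0 mul0r.
Qed.

Lemma select_sum (L : comPzRingType) n m (f : 'I_n -> 'I_m) (c : 'I_n -> L) (F : nat -> L) :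
  \sum_(i < m) (\sum_(k < n) c k * (f k == i :> nat)%:R) * F i = \sum_(k < n) c k * F (f k).
Proof.
transitivity (\sum_(i < m) \sum_(k < n) c k * (f k == i :> nat)%:R * F i).
  by apply: eq_bigr => i _; rewrite mulr_suml.
rewrite exchange_big; apply: eq_bigr => k _ /=.
rewrite (bigD1 (f k)) //= eqxx mulr1 big1 ?addr0 // => i ik.
by rewrite eq_sym (inj_eq val_inj) (negPf ik) mulr0 mul0r.
Qed.

Lemma wsum_select N n (f : 'I_n -> 'I_N.+1) (c : 'I_n -> rat) tau :
  wsum N (fun i => \sum_(k < n) c k * (f k == i :> nat)%:R) tau =
  \sum_(k < n) ratr (c k) * IA [:: f k : nat; (N - f k)%N] tau.
Proof.
rewrite -(select_sum f (fun k => ratr (c k)) (fun i => IA [:: i; (N - i)%N] tau)).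
apply: eq_bigr => i _; rewrite rmorph_sum; congr (_ * _); apply: eq_bigr => k _.
by rewrite rmorphM /= rmorph_nat.
Qed.

Lemma wsumB N v w tau : wsum N (fun i => v i - w i) tau = wsum N v tau - wsum N w tau.
Proof. by rewrite /wsum -sumrB; apply: eq_bigr => i _; rewrite rmorphB mulrBl. Qed.

(** Length-one values of odd weight are 0 and the empty word has weight 0, so in odd weight the
    quotient is the span of the double values itself. *)
Lemma LEZ1_odd N f : odd N -> @LEZ R 1 N f -> forall tau, f tau = 0.
Proof.
move=> oN [n [c [g [hg hf]]]] tau; rewrite hf big1 // => i _; have [w [sw ew ->]] := hg i.
case: w sw ew => [|k [|? ?]] //= _ ew; first by rewrite -ew in oN.
by rewrite addn0 in ew; rewrite IA1E /A1v ew oN mulr0.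
Qed.

Lemma LEZ2_odd N f : odd N -> @LEZ R 2 N f -> exists v : nat -> rat, forall tau, f tau = wsum N v tau.
Proof.
move=> oN [n [c [g [hg hf]]]].
have [v hv] : exists v : 'I_n -> nat -> rat, forall i, forall tau, g i tau = wsum N (v i) tau.
  apply: (@fin_all_exists _ (fun=> nat -> rat) (fun i v => forall tau, g i tau = wsum N v tau)) => i.
  have [w [sw ew ->]] := hg i; case: w sw ew => [|k [|l [|? ?]]] //= _ ew; first by rewrite -ew in oN.
    exists (fun=> 0) => tau; rewrite addn0 in ew; rewrite IA1E /A1v ew oN.
    by rewrite /wsum big1 // => j _; rewrite rmorph0 mul0r.
  rewrite addn0 in ew; exists (fun i => (k == i)%:R) => tau.
  have kN : (k < N.+1)%N by rewrite -ew ltnS leq_addr.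
  have eN : (N - k)%N = l by rewrite -ew addKn.
  rewrite /wsum (bigD1 (Ordinal kN)) //= eqxx rmorph1 mul1r eN big1 ?addr0 // => j jk.
  rewrite (_ : (k == j) = false) ?rmorph0 ?mul0r //; apply: contraNF jk => /eqP e; exact/eqP/val_inj.
exists (fun j => \sum_(i < n) c i * v i j) => tau; rewrite hf /wsum.
transitivity (\sum_(i < n) \sum_(j < N.+1) ratr (c i) * ratr (v i j) * IA [:: j : nat; (N - j)%N] tau).
  by apply: eq_bigr => i _; rewrite hv /wsum mulr_sumr; apply: eq_bigr => j _; rewrite mulrA.
rewrite exchange_big; apply: eq_bigr => j _; rewrite rmorph_sum mulr_suml.
by apply: eq_bigr => i _; rewrite rmorphM.
Qed.

Lemma yco_mx N (v : nat -> rat) (j : 'I_(N.+1./2)) :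
  ((\row_(i < N.+1) v i) *m (Tmx N)^T) 0 j = yco N v j.
Proof. by rewrite !mxE; apply: eq_bigr => i _; rewrite !mxE. Qed.

Lemma gr_dim_odd N : odd N -> gr_dim R 2 N (N %/ 3 + 1)%N.
Proof.
move=> oN; have [rk _] := rank_T_Rel R oN; rewrite -rk -mxrank_tr.
(* Rows of [A] correspond to the values I(m, N-m); a maximal independent set of rows selects the
   basis. *)
set A := (Tmx N)^T; pose f := maxrankfun A.
exists (fun k => IA [:: f k : nat; (N - f k)%N]); split.
- move=> k; exists 1%N, (fun=> 1), (fun=> IA [:: f k : nat; (N - f k)%N]); split.
    by move=> _; exists [:: f k : nat; (N - f k)%N]; split=> //=; rewrite addn0 subnKC // -ltnS.
  by move=> tau; rewrite big_ord1 rmorph1 mul1r.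
- move=> c hU; pose v (i : nat) := \sum_k c k * (f k == i :> nat)%:R.
  have z tau : wsum N v tau = 0 by rewrite wsum_select; exact: (LEZ1_odd oN hU tau).
  have z2 : (\row_k c k) *m rowsub f A = 0 *m rowsub f A.
    apply/rowP => j; rewrite mul0mx [RHS]mxE mxE.
    have y := weight_independent oN z (ltn_ord j); rewrite /yco select_sum in y.
    by rewrite -[RHS]y; apply: eq_bigr => k _; rewrite !mxE.
  move=> i; have := row_free_inj (maxrowsub_free A) z2 => /rowP/(_ i); by rewrite !mxE.
- move=> g hg; have [v hv] := LEZ2_odd oN hg.
  have sub : ((\row_(i < N.+1) v i) *m A <= rowsub f A)%MS by rewrite (eq_maxrowsub A) submxMl.
  have [D hD] := submxP sub.
  exists (fun k => D 0 k); exists 0%N, (fun=> 0), (fun _ _ => 0); split; first by case.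
  move=> tau; rewrite big_ord0 hv -wsum_select -wsumB; apply: wsum_odd0 => // j hj.
  have e1 := yco_mx v (Ordinal hj); rewrite hD in e1.
  have -> : yco N (fun i => v i - \sum_k D 0 k * (f k == i :> nat)%:R) j =
     yco N v j - \sum_k D 0 k * tvec N j.*2 (f k).
    rewrite -(select_sum f (fun k => D 0 k) (tvec N j.*2)) /yco -sumrB.
    by apply: eq_bigr => i _; rewrite mulrBl.
  rewrite -[yco N v j]e1 mxE; apply/eqP; rewrite subr_eq0; apply/eqP; apply: eq_bigr => k _.
  by rewrite !mxE.
Qed.

(** In even weight every double value is 0 or a rational multiple of X^N, hence of I(N), because b_N
    is nonzero. *)
Lemma gr_dim_even N : ~~ odd N -> gr_dim R 2 N 0.
Proof.
move=> eN; exists (fun _ _ => 0); split=> [[]//|c _ []//|f [n [c [g [hg hf]]]]].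
have [r hr] : exists r : 'I_n -> rat, forall i, forall tau, g i tau = ratr (r i) * IA [:: N] tau.
  apply: (@fin_all_exists _ (fun=> rat) (fun i r => forall tau, g i tau = ratr r * IA [:: N] tau)) => i.
  have bN := bern_even_neq0 R eN.
  have [w [sw ew ->]] := hg i; case: w sw ew => [|k [|l [|? ?]]] //= _ ew.
  - by exists 1 => tau; rewrite -ew IA0E IA1E /A1v /A0 expr0 bern0 !rmorph1 !mulr1.
  - by exists 1 => tau; rewrite -ew addn0 rmorph1 mul1r.
  rewrite addn0 in ew; have kl : odd k = odd l by move: eN; rewrite -ew oddD; case: (odd k); case: (odd l).
  exists (if odd k then 0 else bern k * bern l / (2 * bern N)) => tau.
  rewrite IA2_parity // IA1E /A1v -kl (negPf eN); case: ifP => _; first by rewrite rmorph0 !mul0r mulr0.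
  rewrite /A0 -{2}ew exprD !rmorphM fmorphV rmorphM /= rmorph_nat.
  have b0 : ratr (bern N) != 0 :> C by rewrite fmorph_eq0.
  by move: (X ^+ k) (X ^+ l) (ratr (bern k)) (ratr (bern l)) (ratr (bern N)) b0 => *; field.
exists (fun=> 0); exists 1%N, (fun=> \sum_i c i * r i), (fun=> IA [:: N]); split.
  by move=> _; exists [:: N]; split=> //=; rewrite addn0.
move=> tau; rewrite big_ord0 subr0 big_ord1 hf rmorph_sum mulr_suml; apply: eq_bigr => i _.
by rewrite hr rmorphM mulrA.
Qed.

Notation conseq := (@fay_shuffle_consequence R).

Lemma conseq_ext (c c' : nat * nat -> rat) (r r' : UHP R -> C) :
  c =1 c' -> r =1 r' -> conseq (c, r) -> conseq (c', r').
Proof. by move=> ec er [n [a [g [h1 h2 h3]]]]; exists n, a, g; split=> // x /=; rewrite -?ec -?er. Qed.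

Lemma conseq_rel rho : fay_or_shuffle rho -> conseq rho.
Proof.
by move=> h; exists 1%N, (fun=> 1), (fun=> rho); split=> // x; rewrite big_ord1 ?rmorph1 mul1r.
Qed.

Lemma conseq0 : conseq (fun=> 0, fun=> 0).
Proof. by exists 0%N, (fun=> 0), (fun=> shuffle_rel R 0 0); split=> [[]//|x|x]; rewrite big_ord0. Qed.

Lemma conseqZ k c r : conseq (c, r) -> conseq (fun p => k * c p, fun tau => ratr k * r tau).
Proof.
move=> [n [a [g [h1 h2 h3]]]]; exists n, (fun i => k * a i), g; split=> // x /=.
  by rewrite [c x]h2 mulr_sumr; apply: eq_bigr => i _; rewrite mulrA.
by rewrite [r x]h3 mulr_sumr; apply: eq_bigr => i _; rewrite rmorphM mulrA.
Qed.

Lemma conseqD c r c' r' : conseq (c, r) -> conseq (c', r') ->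
  conseq (fun p => c p + c' p, fun tau => r tau + r' tau).
Proof.
move=> [n [a [g [h1 h2 h3]]]] [n' [a' [g' [h1' h2' h3']]]].
exists (n + n')%N, (fun i => match fintype.split i with inl k => a k | inr k => a' k end),
  (fun i => match fintype.split i with inl k => g k | inr k => g' k end).
have sl i : fintype.split (lshift n' i) = inl i by exact: (unsplitK (inl i)).
have sr i : fintype.split (rshift n i) = inr i by exact: (unsplitK (inr i)).
split=> [i|p|tau] /=; first by case: (fintype.split i).
  rewrite big_split_ord /=; congr (_ + _); [rewrite [LHS]h2|rewrite [LHS]h2'];
  by apply: eq_bigr => i _; rewrite ?sl ?sr.
rewrite big_split_ord /=; congr (_ + _); [rewrite [LHS]h3|rewrite [LHS]h3'];
by apply: eq_bigr => i _; rewrite ?sl ?sr.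
Qed.

Lemma conseq_sum n (c : 'I_n -> nat * nat -> rat) (r : 'I_n -> UHP R -> C) :
  (forall i, conseq (c i, r i)) -> conseq (fun p => \sum_i c i p, fun tau => \sum_i r i tau).
Proof.
elim: n c r => [|n IH] c r h.
  by apply: conseq_ext conseq0 => x; rewrite big_ord0.
have := conseqD (h ord0) (IH (fun i => c (lift ord0 i)) (fun i => r (lift ord0 i)) (fun i => h _)).
by apply: conseq_ext => x; rewrite [RHS]big_ord_recl.
Qed.

(* For even weight, Fay(m,n) and Fay(n,m) have the same right-hand side, so they antisymmetrise to I(m,n) = I(n,m). *)
Lemma conseq_even m n : odd m = odd n -> conseq (sym2 m n, IA [:: m; n]).
Proof.
move=> e; have sh : conseq (shuffle_rel R m n) by apply: conseq_rel; exists m, n; left.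
have f1 : conseq (fay_rel R m n) by apply: conseq_rel; exists m, n; right.
have f2 : conseq (fay_rel R n m) by apply: conseq_rel; exists n, m; right.
(* Half of shuffle + Fay(m,n) - Fay(n,m): after matching signs by parity the Fay sums and the
   zeta(2) constants cancel. *)
have := conseqD (conseqZ 2^-1 sh) (conseqD (conseqZ 2^-1 f1) (conseqZ (- 2^-1) f2)).
apply: conseq_ext => [p|tau] /=.
  have s1 : (-1) ^+ n = (-1) ^+ m :> rat by rewrite -signr_odd -e signr_odd.
  rewrite (addnC n m) s1.
  have -> : \sum_(r < n.+1) (-1) ^+ (n - r) * (fay_binom m r)%:R * sym2 (m + r) (n - r) p =
     \sum_(r < n.+1) (-1) ^+ (m + r) * (fay_binom m r)%:R * sym2 (m + r) (n - r) p.
    by apply: eq_bigr => r _; rewrite -signr_odd oddB -1?ltnS // -e -oddD signr_odd.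
  have -> : \sum_(r < m.+1) (-1) ^+ (m - r) * (fay_binom n r)%:R * sym2 (n + r) (m - r) p =
     \sum_(r < m.+1) (-1) ^+ (n + r) * (fay_binom n r)%:R * sym2 (n + r) (m - r) p.
    by apply: eq_bigr => r _; rewrite -signr_odd oddB -1?ltnS // e -oddD signr_odd.
  by move: (\sum_(r < n.+1) _) (\sum_(r < m.+1) _) (sym2 _ _ _) (sym2 _ _ _) (sym2 _ _ _) => *; field.
have r2 : ratr 2^-1 = 2^-1 :> C by rewrite fmorphV rmorph_nat.
rewrite IA2_parity // !IA1E [(n == _) && _]andbC rmorphN /= r2.
have rr (x d : C) : 2^-1 * x + (2^-1 * - d + - 2^-1 * - d) = 2^-1 * x by ring.
exact: rr.
Qed.

Lemma sym2_supp a b p : (p.1 + p.2)%N != (a + b)%N -> sym2 a b p = 0.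
Proof. by move=> h; rewrite /sym2; case: eqP => // e; rewrite e eqxx in h. Qed.

Lemma shuffle_supp m n p : (p.1 + p.2)%N != (m + n)%N -> (shuffle_rel R m n).1 p = 0.
Proof. by move=> h; rewrite /= (sym2_supp h) sym2_supp ?addr0 // [(n + m)%N]addnC. Qed.

Lemma fay_supp m n p : (p.1 + p.2)%N != (m + n)%N -> (fay_rel R m n).1 p = 0.
Proof.
move=> h; rewrite /= !sym2_supp // !big1 ?mulr0 ?addr0 ?subr0 // => r _; rewrite sym2_supp ?mulr0 //.
  by have := ltn_ord r; move: h; lia.
by have := ltn_ord r; move: h; lia.
Qed.

(** [rank_T_Rel] writes the vector through the relation rows. All right-hand sides vanish: in odd
    weight one factor of I(m) I(n) has odd index, and m = n = 1 cannot occur. *)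
Lemma conseq_odd N (v : nat -> rat) : odd N -> (forall j, (j < N.+1./2)%N -> yco N v j = 0) ->
  conseq (fun p => if (p.1 + p.2)%N == N then v p.1 else 0, fun=> 0).
Proof.
move=> oN hv; have [_ ker] := rank_T_Rel R oN.
have /ker/submxP[D hD] : (\row_(i < N.+1) v i) *m (Tmx N)^T = 0.
  by apply/rowP => j; rewrite yco_mx hv // mxE.
exists (N.+1 + N.+1)%N, (fun k => D 0 k), (fun k => match fintype.split k with
  inl m => shuffle_rel R m (N - m) | inr m => fay_rel R m (N - m) end); split=> [k|p|tau] /=.
- by case: (fintype.split k) => m; exists m, (N - m)%N; [left|right].
(* Outside weight N both sides vanish, as the weight-N relations involve only pairs of sum N. *)
- case: ifP => [/eqP e|/negbT ne].
    have pN : (p.1 < N.+1)%N by rewrite -e ltnS leq_addr.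
    have := congr1 (fun M : 'rV_N.+1 => M 0 (Ordinal pN)) hD; rewrite mxE /= => ->.
    rewrite mxE; apply: eq_bigr => k _; rewrite /Relmx mxE; congr (_ * _).
    have ep : p = (p.1, (N - p.1)%N) by rewrite -e addKn; case: (p).
    by case: (fintype.split k) => m; rewrite mxE [in RHS]ep.
  rewrite big1 // => k _; case: (fintype.split k) => m; have hm : (m <= N)%N by rewrite -ltnS.
    by rewrite shuffle_supp ?mulr0 // subnKC.
  by rewrite fay_supp ?mulr0 // subnKC.
rewrite big1 // => k _; case: (fintype.split k) => m /=; have hm : (m <= N)%N by rewrite -ltnS.
  rewrite !IA1E /A1v oddB // oN; by case: (odd m); rewrite /= ?mul0r ?mulr0 ?mulr0.
have -> : ((m == 1%N :> nat) && ((N - m)%N == 1%N)) = false by move: oN hm; lia.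
by rewrite !mul0r oppr0 mulr0.
Qed.

Lemma sum_by_weight (s : seq (nat * nat)) (F : nat * nat -> C) M : uniq s ->
  (forall p, p \in s -> (p.1 + p.2 <= M)%N) -> (forall p, p \notin s -> F p = 0) ->
  \sum_(p <- s) F p = \sum_(N < M.+1) \sum_(i < N.+1) F (i : nat, (N - i)%N).
Proof.
move=> us hM h0.
transitivity (\sum_(p <- s) \sum_(N < M.+1) \sum_(i < N.+1) if p == (i : nat, (N - i)%N) then F p else 0).
  rewrite big_seq [RHS]big_seq; apply: eq_bigr => p ps; have := hM p ps; rewrite -ltnS => pM.
  have p1 : (p.1 < (p.1 + p.2).+1)%N by rewrite ltnS leq_addr.
  rewrite (bigD1 (Ordinal pM)) //= (bigD1 (Ordinal p1)) //= addKn -surjective_pairing eqxx.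
  rewrite big1 => [|i ne]; last first.
    case: eqP => // e; case/eqP: ne; apply: val_inj => /=; exact: (esym (congr1 fst e)).
  rewrite big1 ?addr0 // => N ne; rewrite big1 // => i _; case: eqP => // e.
  by case/eqP: ne; apply: val_inj => /=; rewrite (congr1 fst e) (congr1 snd e) /= subnKC // -ltnS.
rewrite exchange_big; apply: eq_bigr => N _ /=; rewrite exchange_big; apply: eq_bigr => i _ /=.
set x := (_, _); have [xs|xs] := boolP (x \in s); last first.
  by rewrite h0 // big1 // => p _; case: eqP => // ->; exact: h0.
rewrite (bigD1_seq x) //= eqxx big1 ?addr0 // => p px; by rewrite (negPf px).
Qed.

(** Odd weights separate and are treated by [conseq_odd]. In even weight each I(m,n) alone is
    expressed by the relations, so any combination is a consequence with its own value as right-hand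
    side; the right-hand sides add up to 0 by hypothesis. *)
Lemma relations_conseq (s : seq (nat * nat)) (c : nat * nat -> rat) : uniq s ->
  (forall p, p \notin s -> c p = 0) ->
  (forall tau : UHP R, \sum_(p <- s) ratr (c p) * IA [:: p.1; p.2] tau = 0) ->
  conseq (c, fun=> 0).
Proof.
move=> us h0 h; pose M := (\max_(p <- s) (p.1 + p.2))%N.
have hM p : p \in s -> (p.1 + p.2 <= M)%N by move=> ps; rewrite /M (big_rem p ps) /= leq_maxl.
pose v N i := c (i, (N - i)%N).
have tot (tau : UHP R) : \sum_(N < M.+1) wsum N (v N) tau = 0.
  rewrite -[RHS](h tau) (@sum_by_weight s (fun p => ratr (c p) * IA [:: p.1; p.2] tau) M) // => p ps.
  by rewrite h0 // rmorph0 mul0r.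
have hN (N : 'I_M.+1) : conseq (fun p => if (p.1 + p.2)%N == N then c p else 0, wsum N (v N)).
  have [oN|eN] := boolP (odd N).
    have y0 j : (j < N.+1./2)%N -> yco N (v N) j = 0.
      by move=> hj; apply: (weights_independent tot _ oN hj); rewrite -ltnS.
    apply: conseq_ext (conseq_odd oN y0) => [p|tau]; last by rewrite wsum_odd0.
    by case: eqP => // <-; rewrite /v addKn -surjective_pairing.
  have hp (i : 'I_N.+1) : odd i = odd (N - i) by rewrite oddB -1?ltnS // (negPf eN).
  have := conseq_sum (fun i : 'I_N.+1 => conseqZ (c (i : nat, (N - i)%N)) (conseq_even (hp i))).
  apply: conseq_ext => [p|tau] //; case: eqP => [e|ne].
    have pN : (p.1 < N.+1)%N by rewrite -e ltnS leq_addr.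
    have ep : p = (p.1, (N - p.1)%N) by rewrite -e addKn; case: (p).
    have s1 : sym2 p.1 (N - p.1) p = 1 by rewrite /sym2 -ep eqxx.
    rewrite (bigD1 (Ordinal pN)) //= s1 mulr1 -ep big1 ?addr0 // => i ne.
    rewrite /sym2; case: eqP => [e'|]; last by rewrite mulr0.
    by case/eqP: ne; apply: val_inj => /=; exact: (esym (congr1 fst e')).
  rewrite big1 // => i _; rewrite sym2_supp ?mulr0 // subnKC; last by rewrite -ltnS.
  exact/eqP.
apply: conseq_ext (conseq_sum hN) => [p|tau]; last exact: tot.
have [ps|ps] := boolP (p \in s); last by rewrite h0 // big1 // => N _; case: ifP.
have := hM p ps; rewrite -ltnS => pM; rewrite (bigD1 (Ordinal pM)) //= eqxx big1 ?addr0 // => N ne.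
by rewrite ifN //; apply: contraNneq ne => e; exact/eqP/val_inj.
Qed.
End Assembly.

Theorem mainTheorem1 (R : realType) :
  (forall N : nat, gr_dim R 2 N (if odd N then (N %/ 3 + 1)%N else 0%N)) /\
  (forall (s : seq (nat * nat)) (c : nat * nat -> rat),
     uniq s ->
     (forall p, p \notin s -> c p = 0) ->
     (forall tau : UHP R,
        \sum_(p <- s) ratr (c p) * IA [:: p.1; p.2] tau = 0) ->
     fay_shuffle_consequence (c, (fun _ : UHP R => 0 : R[i]))).
Proof.
split=> [N|s c us hc h]; last exact: (relations_conseq us hc h).
by case: ifP => oN; [exact: gr_dim_odd|apply: gr_dim_even; rewrite oN].
Qed.
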